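(* Let $B$ be a two-sided Brownian motion, $R$ a two-sided Bessel-3 process and $\mathcal L$ a directed landscape, all three independent. Almost surely the random function $$(x,y)\mapsto B(x)-R(x)+\mathcal L(x,0;y,1)-B(y)-R(y),\qquad (x,y)\in\mathbb R^2,$$ attains its maximum at some finite $(x,y)$. Moreover, there are constants $c>0$ and $a>1$ such that for any measurably chosen maximizer $(X,Y)$ of this function, $$\mathbb P(|X|>t)=\mathbb P(|Y|>t)<c\,\frac{\log t}{\sqrt t}\quad\text{for all }t\ge2,$$ $$\mathbb E\,a^{|Y-X|^3}<\infty,\qquad \mathbb E\,a^{|\mathcal L(X,0;Y,1)|^{3/2}}<\infty.$$
   Context: Directed landscape. Let $\mathbb R^4_\uparrow=\{(x,s;y,t)\in\mathbb R^4:s<t\}$. Let $(W_j)_{j\in\mathbb Z}$ be independent standard two-sided Brownian motions and $$\mathcal L_n(x,s;y,t)=n^{1/6}\Big(\sup\sum_{j=\lfloor ns\rfloor+1}^{\lfloor nt\rfloor}\big(W_j(z_j)-W_j(z_{j-1})\big)-2(t-s)\sqrt n-2(y-x)n^{1/6}\Big),$$ the sup over nondecreasing sequences $z_{\lfloor ns\rfloor}\le\dots\le z_{\lfloor nt\rfloor}$ with $z_{\lfloor ns\rfloor}=s+2xn^{-1/3}$, $z_{\lfloor nt\rfloor}=t+2yn^{-1/3}$. The directed landscape $\mathcal L:\mathbb R^4_\uparrow\to\mathbb R$ is the random continuous function which is the limit in distribution of $\mathcal L_n$ as $n\to\infty$ with respect to uniform convergence on compact subsets of $\mathbb R^4_\uparrow$.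 Two-sided Brownian motion $B$ has $B(0)=0$ and diffusion parameter (variance per unit time) $1$. The two-sided Bessel-3 process is $R(t)=|W(t)|$, $t\in\mathbb R$, with $W$ a two-sided standard 3-dimensional Brownian motion, $W(0)=0$. *)

(* Defs.v *)
From HB Require Import structures.
From mathcomp Require Import all_boot all_order all_algebra finmap.
From mathcomp Require Import all_classical all_reals all_analysis.

Set Implicit Arguments.
Unset Strict Implicit.
Unset Printing Implicit Defensive.

Import Order.TTheory GRing.Theory Num.Theory.
Import numFieldNormedType.Exports.

Local Open Scope classical_set_scope.
Local Open Scope ring_scope.

Section independence.
Context {R : realType} {d : measure_display} {T : measurableType d}.
Variable P : probability T R.

Definition mutual_indep (I : choiceType) (F : I -> set (set T)) : Prop :=
  forall (J : {fset I}) (E : I -> set T), (forall i, i \in J -> F i (E i)) ->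
    P (\bigcap_(i in [set` J]) E i) = (\prod_(i <- J) P (E i))%E.

(* Only used for sigma-algebras; as these contain setT, the product rule for
   triples entails the one for pairs. *)
Definition indep3 (F G H : set (set T)) : Prop :=
  forall A B C, F A -> G B -> H C ->
    P (A `&` B `&` C) = (P A * P B * P C)%E.

End independence.

(* sigma-algebra generated by the coordinates X i, i in D *)
Definition process_sigma {R : realType} {d : measure_display}
    {T : measurableType d} (I : Type) (D : set I) (X : I -> T -> R) :
    set (set T) :=
  <<s \bigcup_(i in D) preimage_set_system setT (X i) measurable >>.

Section brownian.
Context {R : realType} {d : measure_display} {T : measurableType d}.
Variable P : probability T R.

(* The second parameter of normal_prob is the standard deviation. *)
Record two_sided_brownian (B : R -> T -> R) : Prop := TwoSidedBrownian {
  brownian_measurable : forall t, measurable_fun setT (B t) ;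
  brownian_continuous : forall w, continuous (fun t => B t w) ;
  brownian_zero : forall w, B 0 w = 0 ;
  brownian_gaussian : forall (s t : R), s < t ->
    forall A : set R, measurable A ->
    P ((fun w => B t w - B s w) @^-1` A) = normal_prob 0 (Num.sqrt (t - s)) A ;
  brownian_indep_increments : forall t : nat -> R,
    {homo t : i j / (i <= j)%N >-> i <= j} ->
    mutual_indep P (fun i : nat =>
      preimage_set_system setT (fun w => B (t i.+1) w - B (t i) w) measurable)
}.

Definition two_sided_brownian_family (I : choiceType) (W : I -> R -> T -> R) :
    Prop :=
  (forall i, two_sided_brownian (W i)) /\
  mutual_indep P (fun i => process_sigma setT (W i)).

Definition two_sided_bessel3 (Z : R -> T -> R) : Prop :=
  exists2 W : 'I_3 -> R -> T -> R, two_sided_brownian_family W &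
    forall t w, Z t w = Num.sqrt (\sum_(i < 3) W i t w ^+ 2).

End brownian.

Section landscape.
Context {R : realType}.

(* A point (x, s; y, t) is the tuple (x, s, y, t). Functions on R4up are
   represented by total functions, whose values off R4up are irrelevant. *)
Definition R4up : set (R * R * R * R) :=
  [set p | let: (x, s, y, t) := p in s < t].

(* Values of the sums over nondecreasing sequences z_m <= ... <= z_M
   with z_m = u and z_M = v; in the sum, j = m + 1 + i runs through m+1..M. *)
Definition lpp_values (W : int -> R -> R) (m M : int) (u v : R) : set R :=
  [set l | exists z : int -> R,
    [/\ z m = u, z M = v,
        forall j : int, m < j <= M -> z (j - 1) <= z j &
        l = \sum_(i < `|M - m|%N)
              (let j := m + 1 + i%:Z in W j (z j) - W j (z (j - 1)))]].

Definition prelandscape (W : int -> R -> R) (n : nat) (p : R * R * R * R) : R :=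
  let: (x, s, y, t) := p in
  let N : R := n%:R in
  N `^ (1 / 6) *
  (sup (lpp_values W (Num.floor (N * s)) (Num.floor (N * t))
          (s + 2 * x * N `^ (- (1 / 3))) (t + 2 * y * N `^ (- (1 / 3))))
   - 2 * (t - s) * Num.sqrt N - 2 * (y - x) * N `^ (1 / 6)).

(* Functions R^4 -> R with uniform convergence on the compact subsets of
   R4up. *)
Definition landscape_space : topologicalType :=
  {family compactly_in R4up, (R * R * R * R)%type -> R}.

Context {d : measure_display} {T : measurableType d}.
Variable P : probability T R.

(* Convergence in distribution is tested on bounded continuous functionals of
   landscape_space. For fixed n, prelandscape W n is piecewise continuous
   with deterministic pieces, so it takes values in a separable subspace and
   the functionals of it are measurable: no outer expectation is needed. *)
Record directed_landscape (L : T -> R * R * R * R -> R) : Prop :=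
    DirectedLandscape {
  landscape_measurable :
    forall p, R4up p -> measurable_fun setT (fun w => L w p) ;
  landscape_continuous : forall w, {within R4up, continuous (L w)} ;
  landscape_limit :
    exists (d' : measure_display) (T' : measurableType d')
      (P' : probability T' R) (W : int -> R -> T' -> R),
      two_sided_brownian_family P' W /\
      forall f : landscape_space -> R,
        continuous f -> (exists K : R, forall g, `|f g| <= K) ->
        ('E_P'[fun w => f (prelandscape (fun j u => W j u w) n)]
           @[n --> \oo] --> 'E_P[fun w => f (L w)])%E
}.

End landscape.

Definition is_maximizer {R : realType} (F : R -> R -> R) (x y : R) : Prop :=
  forall x' y', F x' y' <= F x y.

Definition bessel_landscape_sum {R : realType} {T : Type} (B Z : R -> T -> R)
    (L : T -> R * R * R * R -> R) (w : T) (x y : R) : R :=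
  B x w - Z x w + L w (x, 0, y, 1) - B y w - Z y w.

(* Main.v *)
Require Import Defs.
From HB Require Import structures.
From mathcomp Require Import all_boot all_order all_algebra finmap.
From mathcomp Require Import all_classical all_reals all_analysis.
From mathcomp Require Import measurable_realfun gauss_integral ring lra zify.

(* Upper tails of last passage values: Brownian increments are replaced by steps of
   a simple random walk, one at a time and at a bounded cost; by Burke's theorem the
   queues of a tandem fed by such steps have independent geometric lengths, which
   gives explicit exponential moments. Lower tails follow from superadditivity over
   independent blocks. Both bounds pass to [L], which thus has tails of exponent 3/2
   around a parabola.

   Let [x] lie in [[k, k + 1]] and let the function be at least its value at the
   origin at [(x, y)]. Outside an event of probability [exp (- c r^3)] that depends on
   [B] and [L] only, this forces [Z x <= r^2], [|y - x| = O(r)] and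
   [|L (x, 0, y, 1)| = O(r^2)]. Independently, [Z] comes below [r^2] in [[k, k + 1]]
   with probability [O((r^2 / sqrt k)^3)], since each of the three coordinates has to
   be small. Summing over [r] and then over [k >= t] gives [O(1 / sqrt t)], and
   localizing [x] to [|x| <= exp (c r^3 / 2)] gives the exponential moments.

   Two maximizers cannot coexist: if they differ, some increment of [B], independent
   of everything else, enters their values with different weights, unless both lie on
   the diagonal; then an increment of a coordinate of the Bessel process does so
   monotonically. As [(x, y) -> (- y, - x)] preserves the law of the function, the
   maximizer [(X, Y)] has the same law as [(- Y, - X)]. *)

Set Implicit Arguments.
Unset Strict Implicit.
Unset Printing Implicit Defensive.
Import Order.TTheory GRing.Theory Num.Theory.
Import numFieldNormedType.Exports.
Local Open Scope classical_set_scope.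
Local Open Scope ring_scope.

(** * Independence and laws of processes *)

(** All tail estimates are derived from the definition of the landscape as a limit. This limit is
    tested on bounded continuous functionals only, so each event is first reduced to finitely many
    points, transferred with a margin by [clipped_excess], and extended to boxes by continuity. The
    lower tail starts softly: a continuous limit is bounded below on compact strips with probability
    close to one. This goes back to the prelimits as a bound that fails with probability at most
    2^-16, and the scaling of time by 8 and of fluctuations by 2 amplifies it to the right exponent.
    The same strips turn a bound for one passage of duration 3 into one for all passages of duration
    1 between two unit intervals. As [c] and [a] precede the probability space, tightness is stated
    for all Brownian families at once, and the constants found with one landscape serve for all.
    Suprema and maximizers must be events of product sigma-algebras; hence the dense sequence
    [unit_grid] and the countable encodings [same_sup] and [far_reached]. *)

Definition cylinders (R : realType) (I : Type) : set (set (I -> R)) :=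
  \bigcup_i preimage_set_system setT (fun f : I -> R => f i) measurable.

(** An event of the product sigma-algebra depends on countably many coordinates; functionals of
    whole paths are therefore written with countable grids before they are used here. *)
Definition path_space (R : realType) (I : Type) :=
  g_sigma_algebraType (@cylinders R I).

Section independence_pi_lambda.
Context {R : realType} {d : measure_display} {T : measurableType d}.
Variable P : probability T R.

Definition indep2 (G H : set (set T)) : Prop :=
  forall A B, G A -> H B -> P (A `&` B) = (P A * P B)%E.

Lemma indep2C G H : indep2 G H -> indep2 H G.
Proof. by move=> GH A B HA GB; rewrite setIC GH// muleC. Qed.

Lemma g_sigma_measurable (G : set (set T)) :
  G `<=` measurable -> <<s G >> `<=` measurable.
Proof. by move=> Gm; apply: smallest_sub => //; exact: sigma_algebra_measurable. Qed.

Lemma g_sigma_mono (G H : set (set T)) : G `<=` <<s H >> -> <<s G >> `<=` <<s H >>.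
Proof. by move=> GH; apply: smallest_sub => //; exact: smallest_sigma_algebra. Qed.

(** For fixed [B], both sides of the product rule are finite measures of [A]: the restriction
    [mrestr P mB] and [P] scaled by [P B]. They agree on the pi-system [G]; [setT] is added to it to
    provide the exhausting sequence of the uniqueness theorem. *)
Lemma indep2_sigmal (G H : set (set T)) : setI_closed G ->
  G `<=` measurable -> H `<=` measurable -> indep2 G H -> indep2 <<s G >> H.
Proof.
move=> GI Gm Hm GH A B sA HB.
have mB := Hm _ HB.
pose m1 : {measure set T -> \bar R} := mrestr P mB.
have PBf : P B = (fine (P B))%:E by rewrite fineK// fin_num_measure.
pose b : {nonneg R} := NngNum (fine_ge0 (measure_ge0 P B)).
pose m2 : {measure set T -> \bar R} := mscale b P.
pose G' := G `|` [set setT].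
have : m1 A = m2 A.
  apply: (g_sigma_algebra_measure_unique G' _ (fun=> setT)) => //.
  - by move=> X [/Gm//|->]; exact: measurableT.
  - by move=> _; right.
  - by rewrite bigcup_const.
  - move=> X Y [GX|->] [GY|->]; rewrite ?setIT ?setTI.
    + by left; exact: GI.
    + by left.
    + by left.
    + by right.
  - move=> X [GX|->]; rewrite /m1 /m2/= /mrestr /mscale/=.
      by rewrite GH// -PBf muleC.
    by rewrite setTI -PBf probability_setT mule1.
  - move=> k; rewrite /m1/= /mrestr setTI PBf ltry//.
  - by apply: g_sigma_mono sA => X GX; apply: sub_sigma_algebra; left.
by rewrite /m1 /m2/= /mrestr /mscale/= -PBf muleC.
Qed.

Lemma indep2_sigma (G H : set (set T)) : setI_closed G -> setI_closed H ->
  G `<=` measurable -> H `<=` measurable -> indep2 G H ->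
  indep2 <<s G >> <<s H >>.
Proof.
move=> GI HI Gm Hm GH; apply: indep2_sigmal => //; first exact: g_sigma_measurable.
by apply: indep2C; apply: indep2_sigmal => //; exact: indep2C.
Qed.

Lemma indep2_sub (G H G' H' : set (set T)) :
  G' `<=` G -> H' `<=` H -> indep2 G H -> indep2 G' H'.
Proof. by move=> sG sH GH A B /sG GA /sH HB; exact: GH. Qed.

Definition fin_inter (I : choiceType) (K : set I) (F : I -> set (set T)) :
    set (set T) :=
  [set A | exists (J : {fset I}) (E : I -> set T),
    [/\ forall i, i \in J -> K i, forall i, F i (E i) &
        A = \bigcap_(i in [set` J]) E i]].

Lemma fin_interI (I : choiceType) (K : set I) (F : I -> set (set T)) :
  (forall i, F i setT) -> (forall i, setI_closed (F i)) ->
  setI_closed (fin_inter K F).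
Proof.
move=> FT FI _ _ [J1 [E1 [JK1 FE1 ->]]] [J2 [E2 [JK2 FE2 ->]]].
pose E' (J : {fset I}) (E : I -> set T) i := if i \in J then E i else setT.
exists (J1 `|` J2)%fset, (fun i => E' J1 E1 i `&` E' J2 E2 i); split.
- by move=> i; rewrite inE => /orP[/JK1|/JK2].
- by move=> i; apply: FI; rewrite /E'; case: ifPn.
- rewrite predeqE => x; split.
    move=> [h1 h2] i /= _; rewrite /E'; split; case: ifPn => // iJ.
      exact: h1.
    exact: h2.
  move=> h; split => i /= iJ.
    by have := h i; rewrite /= inE iJ /= /E' iJ => /(_ isT)[].
  by have := h i; rewrite /= inE iJ orbT /= /E' iJ => /(_ isT)[].
Qed.

(** Finite intersections of events from each group form pi-systems. As [K1] and [K2] are disjoint,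
    two such intersections glue into one finite family, to which mutual independence applies. *)
Lemma mutual_indep_group (I : choiceType) (F : I -> set (set T)) (K1 K2 : set I) :
  (forall i, F i setT) -> (forall i, setI_closed (F i)) ->
  (forall i, F i `<=` measurable) -> mutual_indep P F -> K1 `&` K2 = set0 ->
  indep2 <<s \bigcup_(i in K1) F i >> <<s \bigcup_(i in K2) F i >>.
Proof.
move=> FT FI Fm Find K12.
have mfin K : fin_inter K F `<=` measurable.
  move=> _ [J [E [_ FE ->]]]; apply: fin_bigcap_measurable => //.
  by move=> i _; exact: Fm (FE i).
have sub K : <<s \bigcup_(i in K) F i >> `<=` <<s fin_inter K F >>.
  apply: g_sigma_mono => A [i Ki FA]; apply: sub_sigma_algebra.
  exists [fset i]%fset, (fun j => if j == i then A else setT); split.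
  - by move=> j; rewrite inE => /eqP ->.
  - by move=> j; case: eqP => [->|].
  - rewrite predeqE => x; split.
      by move=> Ax j /=; rewrite inE => /eqP->; rewrite eqxx.
    by move=> /(_ i); rewrite /= inE eqxx; exact.
apply: (indep2_sub (sub K1) (sub K2)); apply: indep2_sigma.
- exact: fin_interI.
- exact: fin_interI.
- exact: mfin.
- exact: mfin.
move=> _ _ [J1 [E1 [JK1 FE1 ->]]] [J2 [E2 [JK2 FE2 ->]]].
have dis : [disjoint J1 & J2]%fset.
  apply/fdisjointP => i iJ1; apply/negP => iJ2.
  have : (K1 `&` K2) i by split; [exact: JK1|exact: JK2].
  by rewrite K12.
pose E i := if i \in J1 then E1 i else E2 i.
have -> : \bigcap_(i in [set` J1]) E1 i `&` \bigcap_(i in [set` J2]) E2 i =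
          \bigcap_(i in [set` (J1 `|` J2)%fset]) E i.
  rewrite predeqE => x; split.
    move=> [h1 h2] i /=; rewrite inE /E; case: ifPn => [i1 _|_ /= i2].
      exact: h1.
    exact: h2.
  move=> h; split => i /= iJ.
    by have := h i; rewrite /= inE iJ /E iJ; exact.
  have := h i; rewrite /= inE iJ orbT /E; case: ifPn => [i1|_]; last exact.
  by have := fdisjointP dis _ i1; rewrite iJ.
rewrite !Find//; last by move=> i _; rewrite /E; case: ifPn.
have -> : (\prod_(i <- (J1 `|` J2)%fset) P (E i) =
    \prod_(i <- (J1 : seq I) ++ (J2 : seq I)) P (E i))%E.
  apply: perm_big; apply: uniq_perm => [||i]; rewrite ?fset_uniq//.
    rewrite cat_uniq !fset_uniq andbT/=; apply/hasPn => i i2; apply/negP => i1.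
    by have := fdisjointP dis _ i1; rewrite i2.
  by rewrite inE mem_cat.
rewrite big_cat/=; congr (_ * _)%E; apply: eq_big_seq => i iJ.
  by rewrite /E iJ.
by rewrite /E; case: ifPn => // i1; have := fdisjointP dis _ i1; rewrite iJ.
Qed.

End independence_pi_lambda.

Section process_laws.
Context {R : realType}.

Section law.
Context d d1 (T : measurableType d) (T1 : measurableType d1).
Variables (P : probability T R) (X : T -> T1) (mX : measurable_fun setT X).

Let X' : {mfun T >-> T1} :=
  HB.pack_for {mfun T >-> T1} X (isMeasurableFun.Build _ _ _ _ _ mX).

Definition law : probability T1 R := distribution P X'.

Lemma ge0_integral_law (f : T1 -> \bar R) :
  measurable_fun setT f -> (forall y, 0 <= f y)%E ->
  (\int[law]_y f y = \int[P]_w f (X w))%E.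
Proof. by move=> mf f0; rewrite /law ge0_integral_distribution. Qed.

End law.

Lemma measurable_path d (T : measurableType d) (I : Type) (X : I -> T -> R) :
  (forall i, measurable_fun setT (X i)) ->
  measurable_fun setT ((fun w i => X i w) : T -> path_space R I).
Proof.
move=> mX; apply: (@measurability _ _ T (path_space R I) setT _ (@cylinders R I)) => //.
move=> _ [_ [i _ [A mA <-]] <-].
by rewrite setTI setTI -[X in measurable X]setTI; exact: mX.
Qed.

Lemma measurable_coord (I : Type) (i : I) :
  measurable_fun setT ((fun f => f i) : path_space R I -> R).
Proof.
move=> _ A mA; rewrite setTI; apply: sub_sigma_algebra.
by exists i => //; exists A => //; rewrite setTI.
Qed.

Lemma measurable_reindex (I J : Type) (g : I -> J) :
  measurable_fun setT ((fun f i => f (g i)) : path_space R J -> path_space R I).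
Proof. by apply: measurable_path => i; exact: measurable_coord. Qed.

Definition same_law d d' (T : measurableType d) (T' : measurableType d')
    (P : probability T R) (P' : probability T' R) (I : Type)
    (X : I -> T -> R) (X' : I -> T' -> R) : Prop :=
  forall E : set (path_space R I), measurable E ->
    P [set w | E (fun i => X i w)] = P' [set w | E (fun i => X' i w)].

Section same_law.
Context d d' (T : measurableType d) (T' : measurableType d').
Variables (P : probability T R) (P' : probability T' R).

Lemma same_law_fdd (I : choiceType) (X : I -> T -> R) (X' : I -> T' -> R) :
  (forall i, measurable_fun setT (X i)) ->
  (forall i, measurable_fun setT (X' i)) ->
  (forall (J : {fset I}) (A : I -> set R), (forall i, measurable (A i)) ->
    P (\bigcap_(i in [set` J]) (X i @^-1` A i)) =
    P' (\bigcap_(i in [set` J]) (X' i @^-1` A i))) ->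
  same_law P P' X X'.
Proof.
move=> mX mX' XX' E mE.
pose f := (fun w i => X i w) : T -> path_space R I.
pose f' := (fun w i => X' i w) : T' -> path_space R I.
have mf : measurable_fun setT f := measurable_path mX.
have mf' : measurable_fun setT f' := measurable_path mX'.
pose G : set (set (path_space R I)) :=
  [set B | exists (J : {fset I}) (A : I -> set R),
    (forall i, measurable (A i)) /\
    B = \bigcap_(i in [set` J]) ((fun f : I -> R => f i) @^-1` A i)].
have Gm : G `<=` measurable.
  move=> _ [J [A [mA ->]]]; apply: fin_bigcap_measurable => // i _.
  by rewrite -[X in measurable X]setTI; exact: measurable_coord.
have GT : G setT.
  exists fset0, (fun=> setT); split => //.
  by rewrite set_fset0 bigcap_set0.
have GI : setI_closed G.
  move=> _ _ [J1 [A1 [mA1 ->]]] [J2 [A2 [mA2 ->]]].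
  pose E' (J : {fset I}) (A : I -> set R) i := if i \in J then A i else setT.
  exists (J1 `|` J2)%fset, (fun i => E' J1 A1 i `&` E' J2 A2 i); split.
    move=> i; rewrite /E'.
    by case: ifPn => _; case: ifPn => _; apply: measurableI => //;
      exact: measurableT.
  rewrite predeqE => x; split.
    move=> [h1 h2] i /= _; rewrite /E'; split; case: ifPn => // iJ.
      exact: h1.
    exact: h2.
  move=> h; split => i /= iJ.
    by have := h i; rewrite /= inE iJ /= /E' iJ => /(_ isT)[].
  by have := h i; rewrite /= inE iJ orbT /= /E' iJ => /(_ isT)[].
change (law P mf E = law P' mf' E).
apply: (g_sigma_algebra_measure_unique G _ (fun=> setT)) => //.
- by rewrite bigcup_const.
- by move=> _ [J [A [mA ->]]]; exact: XX'.
- by move=> k; apply: (le_lt_trans (probability_le1 _ _)); rewrite ?ltry.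
- have : @measurable _ (path_space R I) `<=` <<s G >>.
    apply: g_sigma_mono => _ [i _ [A mA <-]]; apply: sub_sigma_algebra.
    exists [fset i]%fset, (fun j => if j == i then A else setT); split.
      by move=> j; case: eqP => // _; exact: measurableT.
    rewrite setTI predeqE => x; split.
      by move=> Ax j /=; rewrite inE => /eqP->; rewrite eqxx.
    by move=> /(_ i); rewrite /= inE eqxx; exact.
  exact.
Qed.

Lemma same_law_integral (I : Type) (X : I -> T -> R) (X' : I -> T' -> R)
    (F : path_space R I -> \bar R) :
  (forall i, measurable_fun setT (X i)) ->
  (forall i, measurable_fun setT (X' i)) ->
  same_law P P' X X' ->
  measurable_fun setT F -> (forall x, 0 <= F x)%E ->
  (\int[P]_w F (fun i => X i w) = \int[P']_w F (fun i => X' i w))%E.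
Proof.
move=> mX mX' XX' mF F0.
have mf := measurable_path mX; have mf' := measurable_path mX'.
rewrite -(ge0_integral_law P mf)// -(ge0_integral_law P' mf')//.
by apply: eq_measure_integral => A mA _; exact: XX'.
Qed.

Lemma same_law_comp (I J : Type) (X : I -> T -> R) (X' : I -> T' -> R)
    (g : path_space R I -> path_space R J) :
  measurable_fun setT g -> same_law P P' X X' ->
  same_law P P' (fun j w => g (fun i => X i w) j)
                (fun j w => g (fun i => X' i w) j).
Proof.
move=> mg XX' E mE.
have mgE : measurable (g @^-1` E) by rewrite -[X in measurable X]setTI; exact: mg.
exact: (XX' _ mgE).
Qed.

End same_law.

(** The product rule on rectangles identifies the joint law of [X] and [Y] with the product of their
    laws, and Tonelli unfolds the product integral. This is how one source of randomness is frozen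
    while another is integrated. *)
Lemma decoupling d d1 d2 (T : measurableType d) (T1 : measurableType d1)
    (T2 : measurableType d2) (P : probability T R)
    (X : T -> T1) (Y : T -> T2) (f : T1 * T2 -> \bar R) :
  measurable_fun setT X -> measurable_fun setT Y ->
  (forall A B, measurable A -> measurable B ->
    P (X @^-1` A `&` Y @^-1` B) = P (X @^-1` A) * P (Y @^-1` B))%E ->
  measurable_fun setT f -> (forall z, 0 <= f z)%E ->
  (\int[P]_w f (X w, Y w) = \int[P]_w \int[P]_w' f (X w, Y w'))%E.
Proof.
move=> mX mY XY mf f0.
have mXY : measurable_fun setT (fun w => (X w, Y w)).
  by apply/measurable_fun_pairP; split.
rewrite -(ge0_integral_law P mXY)//.
transitivity (\int[law P mX \x law P mY]_z f z)%E.
  apply: eq_measure_integral => A mA _; apply/esym.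
  apply: (@product_measure_unique _ _ _ _ _ (law P mX) (law P mY)) => //.
rewrite fubini_tonelli1// ge0_integral_law//=.
- apply: eq_integral => w _; rewrite /fubini_F ge0_integral_law//.
  exact: measurableT_comp.
- exact: measurable_fun_fubini_tonelli_F.
- by move=> x; apply: integral_ge0 => y _.
Qed.

End process_laws.

(** * Gaussian estimates and Brownian families *)

Section density.
Context d {R : realType} (T : measurableType d).
Variables (mu nu : {measure set T -> \bar R}) (p : T -> R).
Hypotheses (mp : measurable_fun setT p) (p0 : forall x, 0 <= p x).
Hypothesis nuE : forall A, measurable A -> nu A = (\int[mu]_(x in A) (p x)%:E)%E.

Import HBNNSimple.

Let ge0_integral_density_nnsfun (f : {nnsfun T >-> R}) :
  (\int[nu]_x (f x)%:E = \int[mu]_x ((f x)%:E * (p x)%:E))%E.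
Proof.
under [LHS]eq_integral do rewrite fimfunE -fsumEFin//.
rewrite [LHS]ge0_integral_fsum//; last 2 first.
  - by move=> r; exact/measurable_EFinP/measurableT_comp.
  - by move=> n x _; rewrite EFinM nnfun_muleindic_ge0.
under [RHS]eq_integral.
  move=> x xD; rewrite fimfunE -fsumEFin// ge0_mule_fsuml; last first.
    by move=> r; rewrite EFinM nnfun_muleindic_ge0.
  over.
rewrite [RHS]ge0_integral_fsum//; last 2 first.
  - move=> r; apply/measurable_EFinP; apply: measurable_funM => //.
    exact: measurableT_comp.
  - move=> n x _; rewrite mule_ge0// ?lee_fin//.
    by have := nnfun_muleindic_ge0 f n x; rewrite -EFinM lee_fin.
apply: eq_fsbigr => r; rewrite inE => -[x _ <-] {r}.
have fx0 : 0 <= f x by [].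
have mfx : measurable (f @^-1` [set f x]) by [].
rewrite integralZl_indic_nnsfun//= integral_indic// setIT nuE//.
under [RHS]eq_integral do rewrite EFinM -muleA.
rewrite [RHS]ge0_integralZl//.
- rewrite integral_mkcond; congr (_ * _)%E.
  by apply: eq_integral => y _; rewrite epatch_indic muleC.
- apply/measurable_EFinP; apply: measurable_funM => //.
- by move=> y _; rewrite -EFinM lee_fin mulr_ge0.
Qed.

Lemma ge0_integral_density (f : T -> \bar R) :
  measurable_fun setT f -> (forall x, 0 <= f x)%E ->
  (\int[nu]_x f x = \int[mu]_x (f x * (p x)%:E))%E.
Proof.
move=> mf f0.
pose f_ := nnsfun_approx measurableT mf.
transitivity (lim (\int[nu]_x (f_ n x)%:E @[n --> \oo])%E).
  rewrite -monotone_convergence//=.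
  - apply: eq_integral => ? /[!inE] xD; apply/esym/cvg_lim => //=.
    exact: cvg_nnsfun_approx.
  - by move=> n; exact/measurable_EFinP/measurable_funTS.
  - by move=> n ? _; rewrite lee_fin.
  - by move=> ? _ ? ? mn; rewrite lee_fin; exact/lefP/nd_nnsfun_approx.
under eq_fun do rewrite ge0_integral_density_nnsfun.
rewrite -monotone_convergence//=.
- apply: eq_integral => x /[!inE] xD; apply/cvg_lim => //.
  apply: cvgeZr => //; exact: cvg_nnsfun_approx.
- move=> n; apply/measurable_EFinP/measurable_funM => //.
- by move=> n x _; rewrite -EFinM lee_fin mulr_ge0.
- move=> x _ m n mn; rewrite -!EFinM lee_fin ler_wpM2r//.
  exact/lefP/nd_nnsfun_approx.
Qed.

End density.

Section normal_facts.
Context {R : realType}.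
Implicit Types (s r x c : R).
Local Notation mu := (@lebesgue_measure R).

Lemma normal_pdf0E s x : 0 < s ->
  normal_pdf 0 s x = normal_peak s * expR (- x ^+ 2 / (s ^+ 2 *+ 2)).
Proof.
by move=> s0; rewrite normal_pdfE ?gt_eqF// /normal_fun subr0.
Qed.

Lemma normal_peakZ c s : 0 < c -> 0 < s -> normal_peak (c * s) = c^-1 * normal_peak s.
Proof.
move=> c0 s0; rewrite /normal_peak.
rewrite (_ : (c * s) ^+ 2 * pi *+ 2 = c ^+ 2 * (s ^+ 2 * pi *+ 2)); last first.
  by rewrite exprMn !mulrnAr !mulrA.
by rewrite sqrtrM ?sqr_ge0// sqrtr_sqr gtr0_norm// invfM.
Qed.

Lemma normal_pdfZ c s x : 0 < c -> 0 < s ->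
  c * normal_pdf 0 (c * s) (c * x) = normal_pdf 0 s x.
Proof.
move=> c0 s0; rewrite !normal_pdf0E ?mulr_gt0// normal_peakZ//.
rewrite mulrA mulrA divff ?gt_eqF// mul1r; congr (_ * expR _).
rewrite !exprMn -mulNr -mulrnAr; field.
by rewrite !gt_eqF.
Qed.

(** Comparison with the density of standard deviation [sqrt 2 * s]: the quotient of the two
    densities is [sqrt 2 * expR (- x ^+ 2 / (4 * s ^+ 2))], and the wider one has mass at most 1.
    This spares any Gaussian integral, at the price of the constants. *)
Lemma normal_prob_bound s (A : set R) : 0 < s -> measurable A ->
  forall r, (forall x, A x -> r <= x ^+ 2) ->
  (normal_prob 0 s A <= (Num.sqrt 2 * expR (- r / (s ^+ 2 *+ 4)))%:E)%E.
Proof.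
move=> s0 mA r Ar.
have t0 : 0 < Num.sqrt (2 : R) by rewrite sqrtr_gt0.
set K := _ * _.
apply: (@le_trans _ _ (\int[mu]_(x in A) (K%:E * (normal_pdf 0 (Num.sqrt 2 * s) x)%:E))%E).
  apply: ge0_le_integral => //=.
  - by move=> x _; rewrite lee_fin normal_pdf_ge0.
  - by apply/measurable_EFinP; apply: measurable_funTS; exact: measurable_normal_pdf.
  - apply/measurable_EFinP/measurable_funM => //.
    by apply: measurable_funTS; exact: measurable_normal_pdf.
  move=> x Ax; rewrite lee_fin !normal_pdf0E ?mulr_gt0//.
  rewrite normal_peakZ// /K.
  have -> : Num.sqrt 2 * expR (- r / (s ^+ 2 *+ 4)) *
    ((Num.sqrt 2)^-1 * normal_peak s * expR (- x ^+ 2 / ((Num.sqrt 2 * s) ^+ 2 *+ 2))) =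
    normal_peak s * (expR (- r / (s ^+ 2 *+ 4)) *
     expR (- x ^+ 2 / ((Num.sqrt 2 * s) ^+ 2 *+ 2))).
    by field; rewrite gt_eqF.
  rewrite ler_wpM2l ?normal_peak_ge0// -expRD ler_expR exprMn sqr_sqrtr//.
  rewrite -subr_ge0.
  have -> : - r / (s ^+ 2 *+ 4) + - x ^+ 2 / (2 * s ^+ 2 *+ 2) -
    - x ^+ 2 / (s ^+ 2 *+ 2) = (x ^+ 2 - r) / (s ^+ 2 *+ 4).
    by field; rewrite gt_eqF.
  by rewrite mulr_ge0 ?subr_ge0 ?Ar// invr_ge0 mulrn_wge0// sqr_ge0.
have K0 : 0 <= K by rewrite mulr_ge0 ?expR_ge0// ltW.
rewrite ge0_integralZl//=; last 2 first.
- by apply/measurable_EFinP; apply: measurable_funTS; exact: measurable_normal_pdf.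
- by move=> x _; rewrite lee_fin normal_pdf_ge0.
rewrite -[leRHS]mule1 lee_wpmul2l ?lee_fin//.
exact: (@probability_le1 _ _ R (normal_prob 0 (Num.sqrt 2 * s))).
Qed.

Lemma ge0_integral_normal s (f : R -> \bar R) :
  measurable_fun setT f -> (forall x, 0 <= f x)%E ->
  (\int[normal_prob 0 s]_x f x = \int[mu]_x (f x * (normal_pdf 0 s x)%:E))%E.
Proof.
move=> mf f0; apply: ge0_integral_density => //.
- exact: measurable_normal_pdf.
- exact: normal_pdf_ge0.
Qed.

(** The same comparison with the wider density: the exponents differ by the square of
    [r * s - x / (2 * s)]. *)
Lemma normal_mgf_bound s r : 0 < s ->
  (\int[normal_prob 0 s]_x (expR (r * x))%:E <=
   (Num.sqrt 2 * expR (r ^+ 2 * s ^+ 2))%:E)%E.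
Proof.
move=> s0.
have t0 : 0 < Num.sqrt (2 : R) by rewrite sqrtr_gt0.
have mexp : measurable_fun setT (fun x => expR (r * x)).
  by apply: measurableT_comp => //; exact: measurable_funM.
rewrite ge0_integral_normal//; last exact/measurable_EFinP.
set K := Num.sqrt 2 * _.
have K0 : 0 <= K by rewrite mulr_ge0 ?expR_ge0// ltW.
apply: (@le_trans _ _ (\int[mu]_x (K%:E * (normal_pdf 0 (Num.sqrt 2 * s) x)%:E))%E).
  apply: ge0_le_integral => //=.
  - by move=> x _; rewrite mule_ge0// lee_fin ?expR_ge0 ?normal_pdf_ge0.
  - apply/measurable_EFinP/measurable_funM => //; exact: measurable_normal_pdf.
  - apply/measurable_EFinP/measurable_funM => //; exact: measurable_normal_pdf.
  move=> x _; rewrite -!EFinM lee_fin !normal_pdf0E ?mulr_gt0// normal_peakZ// /K.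
  have -> : Num.sqrt 2 * expR (r ^+ 2 * s ^+ 2) *
    ((Num.sqrt 2)^-1 * normal_peak s * expR (- x ^+ 2 / ((Num.sqrt 2 * s) ^+ 2 *+ 2))) =
    normal_peak s * (expR (r ^+ 2 * s ^+ 2) *
     expR (- x ^+ 2 / ((Num.sqrt 2 * s) ^+ 2 *+ 2))).
    by field; rewrite gt_eqF.
  rewrite mulrCA ler_wpM2l ?normal_peak_ge0// -!expRD ler_expR exprMn sqr_sqrtr//.
  rewrite -subr_ge0.
  have -> : r ^+ 2 * s ^+ 2 + - x ^+ 2 / (2 * s ^+ 2 *+ 2) -
    (r * x + - x ^+ 2 / (s ^+ 2 *+ 2)) = (r * s - x / (s *+ 2)) ^+ 2.
    by field; rewrite gt_eqF.
  exact: sqr_ge0.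
rewrite ge0_integralZl//=; last 2 first.
- by apply/measurable_EFinP; exact: measurable_normal_pdf.
- by move=> x _; rewrite lee_fin normal_pdf_ge0.
rewrite -[leRHS]mule1 lee_wpmul2l ?lee_fin//.
exact: (@probability_le1 _ _ R (normal_prob 0 (Num.sqrt 2 * s))).
Qed.

(** The density is at most its peak [1 / (s * sqrt (2 * pi))], the interval has length [2 * r], and
    [pi >= 2]. *)
Lemma normal_small_ball s r : 0 < s -> 0 <= r ->
  (normal_prob 0 s [set x : R | (`|x| <= r)%R] <= (r / s)%:E)%E.
Proof.
move=> s0 r0.
have -> : [set x : R | (`|x| <= r)%R] = `[- r, r]%classic.
  by apply/seteqP; split => x /=; rewrite in_itv/= ler_norml.
apply: (@le_trans _ _ (\int[mu]_(x in `[(- r)%R, r]) (normal_peak s)%:E)%E).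
  apply: ge0_le_integral => //=.
  - by move=> x _; rewrite lee_fin normal_pdf_ge0.
  - by apply/measurable_EFinP; apply: measurable_funTS; exact: measurable_normal_pdf.
  - by move=> x _; rewrite lee_fin normal_pdf_ub// gt_eqF.
rewrite integral_cst//= lebesgue_measure_itv/= lte_fin.
case: ifPn => [rr|_]; last by rewrite mule0 lee_fin divr_ge0// ltW.
rewrite -EFinD -EFinM lee_fin /normal_peak opprK -mulr2n.
rewrite -[r *+ 2]mulr_natl mulrA mulrC ler_wpM2l//.
rewrite ler_pdivrMl ?sqrtr_gt0; last first.
  by rewrite mulrn_wgt0// mulr_gt0 ?pi_gt0// exprn_even_gt0 ?gt_eqF.
rewrite ler_pdivlMr//.
have -> : 2 * s = Num.sqrt ((2 * s) ^+ 2) by rewrite sqrtr_sqr gtr0_norm ?mulr_gt0.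
rewrite ler_sqrt; last by rewrite mulrn_wge0// mulr_ge0 ?sqr_ge0 ?pi_ge0.
rewrite exprMn mulrC -mulrnAr ler_wpM2l ?sqr_ge0//.
have := pi_ge2 R; lra.
Qed.

Lemma normal_probZ c s (A : set R) : 0 < c -> 0 < s -> measurable A ->
  normal_prob 0 (c * s) ((fun x => c^-1 * x) @^-1` A) = normal_prob 0 s A.
Proof.
move=> c0 s0 mA.
have cs0 : 0 < c * s by rewrite mulr_gt0.
have mf : measurable_fun setT (fun x : measurableTypeR R => c^-1 * x : measurableTypeR R) by exact: measurable_funM.
pose oc : set (set R) := [set `]x.1, x.2]%classic | x in setT].
pose g (k : nat) := `](- k%:R : R), k%:R]%classic.
rewrite -[LHS]/(law (normal_prob 0 (c * s)) mf A).
have mG : @measurable _ (measurableTypeR R) = <<s oc >> by [].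
apply: (@measure_unique _ R (measurableTypeR R) oc g mG _ _ _ (law (normal_prob 0 (c * s)) mf) (normal_prob 0 s)).
- exact: (@ocitvI R).
- by move=> k; exists (- k%:R, k%:R).
- rewrite -subTset => x _; exists (Num.truncn `|x|).+1 => //=.
  rewrite /g /= in_itv/=.
  have : `|x| < (Num.truncn `|x|).+1%:R by exact: truncnS_gt.
  by rewrite ltr_norml => /andP[-> /ltW].
- move=> _ [[a b] _ <-]; rewrite /law /distribution /pushforward/=.
  have [ba|ab] := leP b a.
    have ab0 : `]a, b]%classic = set0 by rewrite set_itv_ge// bnd_simp -leNgt.
    rewrite ab0 preimage_set0.
    by rewrite /normal_prob !integral_set0.
  have -> : (fun x => c^-1 * x) @^-1` `]a, b]%classic = `](c * a), (c * b)]%classic.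
    apply/seteqP; split => x /=; rewrite !in_itv/=.
      by rewrite ltr_pdivlMl// ler_pdivrMl.
    by rewrite ltr_pdivlMl// ler_pdivrMl.
  rewrite /normal_prob.
  rewrite !integral_itv_obnd_cbnd; last 2 first.
  + apply/measurable_EFinP; apply: measurable_funTS; exact: measurable_normal_pdf.
  + apply/measurable_EFinP; apply: measurable_funTS; exact: measurable_normal_pdf.
  have dF : forall x, derivable ( *%R c : R -> R) x 1 by move=> x; exact: derivableM.
  have dFE : ( *%R c : R -> R)^`()%classic = cst c.
    by apply/funext => x; rewrite derive1E deriveM// derive_id derive_cst scaler0 addr0/= /GRing.scale/= mulr1.
  rewrite (@integration_by_substitution_increasing _ ( *%R c) _ a b) ?(ltW ab)//.
  + apply: eq_integral => x _ /=.
    by rewrite fctE dFE /= mulrC normal_pdfZ.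
  + by move=> x y _ _ xy; rewrite ltr_pM2l.
  + by rewrite dFE => x _; exact: cst_continuous.
  + by rewrite dFE; apply: is_cvg_cst.
  + by rewrite dFE; apply: is_cvg_cst.
  + split => //.
    * apply: cvg_at_right_filter; exact: mulrl_continuous.
    * apply: cvg_at_left_filter; exact: mulrl_continuous.
  + apply: continuous_subspaceT; apply: continuous_normal_pdf; rewrite gt_eqF//.
- move=> k; apply: (@le_lt_trans _ _ 1%E); last exact: ltry.
  by apply: probability_le1; exact: measurable_itv.
- exact: mA.
Qed.

End normal_facts.

Section brownian_families.
Context {R : realType}.

(** Independence of increments is stated along one nondecreasing sequence; a finite set of times is
    sorted, and the sequence then stays at the largest one. *)
Lemma time_grid (s : seq R) : exists2 t : nat -> R,
  {homo t : i j / (i <= j)%N >-> i <= j} & forall u, u \in s -> exists k, t k = u.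
Proof.
pose s' := sort <=%R s.
have sorted_s' : sorted <=%R s' by exact: sort_le_sorted.
case: (posnP (size s)) => [/size0nil ->|s0]; first by exists (fun=> 0).
exists (fun i => nth 0 s' (minn i (size s').-1)); last first.
  move=> u us; have us' : u \in s' by rewrite mem_sort.
  exists (index u s'); have := us'; rewrite -index_mem => h.
  have -> : minn (index u s') (size s').-1 = index u s'.
    by apply/minn_idPl; rewrite -ltnS (ltn_predK h).
  exact: nth_index.
move=> i j ij.
have h : (0 < size s')%N by rewrite size_sort.
apply: (sorted_leq_nth le_trans lexx 0 sorted_s'); rewrite ?inE.
- by rewrite (leq_ltn_trans (geq_minr _ _))// prednK.
- by rewrite (leq_ltn_trans (geq_minr _ _))// prednK.
- by rewrite leq_min geq_minr andbT (leq_trans (geq_minl _ _)).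
Qed.

Definition increment (I T : Type) (W : I -> R -> T -> R) (t : nat -> R)
  (p : I * nat) (w : T) : R := W p.1 (t p.2.+1) w - W p.1 (t p.2) w.

Section one_space.
Context d (T : measurableType d) (P : probability T R).

Definition preimage_sigma (X : T -> R) : set (set T) :=
  preimage_set_system setT X measurable.

Lemma preimage_sigmaT X : preimage_sigma X setT.
Proof. by exists setT => //; rewrite setTI preimage_setT. Qed.

Lemma preimage_sigmaI X : setI_closed (preimage_sigma X).
Proof.
move=> _ _ [A mA <-] [B mB <-]; exists (A `&` B); first exact: measurableI.
by rewrite !setTI preimage_setI.
Qed.

Lemma preimage_sigma_measurable X : measurable_fun setT X ->
  preimage_sigma X `<=` measurable.
Proof. by move=> mX _ [A mA <-]; exact: mX. Qed.

Lemma process_sigma_preimage (I : Type) (D : set I) (X : I -> T -> R) i A :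
  D i -> measurable A -> process_sigma D X (X i @^-1` A).
Proof.
move=> Di mA; apply: sub_sigma_algebra; exists i => //.
by exists A => //; rewrite setTI.
Qed.

Lemma process_sigma_measurable (I : Type) (D : set I) (X : I -> T -> R) :
  (forall i, D i -> measurable_fun setT (X i)) -> process_sigma D X `<=` measurable.
Proof.
by move=> mX; apply: g_sigma_measurable => A [i Di]; apply: preimage_sigma_measurable; exact: mX.
Qed.

(* Membership in a process sigma-algebra is measurability on the alias below. *)
Definition process_type (I : Type) (D : set I) (X : I -> T -> R) :=
  g_sigma_algebraType (\bigcup_(i in D) preimage_set_system setT (X i) measurable).

Lemma measurable_process_type (I : Type) (D : set I) (X : I -> T -> R) i :
  D i -> measurable_fun setT (X i : process_type D X -> R).
Proof. by move=> Di _ A mA; rewrite setTI; exact: process_sigma_preimage. Qed.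

Lemma increment_measurable (I : choiceType) (W : I -> R -> T -> R) t p :
  two_sided_brownian_family P W -> measurable_fun setT (increment W t p).
Proof.
move=> [bW _]; apply: measurable_funB; exact: (brownian_measurable (bW _)).
Qed.

Lemma process_sigmaT (I : Type) (D : set I) (X : I -> T -> R) : process_sigma D X setT.
Proof. exact: (@measurableT _ (process_type D X)). Qed.

Lemma process_sigmaI (I : Type) (D : set I) (X : I -> T -> R) :
  setI_closed (process_sigma D X).
Proof. by move=> A B; exact: (@measurableI _ (process_type D X)). Qed.

(** Two levels of independence: different lines are independent, and so are the increments within a
    line. The product over pairs is partitioned according to the line. *)
Lemma increment_indep (I : choiceType) (W : I -> R -> T -> R) (t : nat -> R) :
  two_sided_brownian_family P W -> {homo t : i j / (i <= j)%N >-> i <= j} ->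
  mutual_indep P (fun p => preimage_sigma (increment W t p)).
Proof.
move=> [bW iW] ht J E FE.
pose J1 : {fset I} := [fset p.1 | p in J]%fset.
pose Jj (j : I) : {fset nat} := [fset p.2 | p in [fset p in J | p.1 == j]]%fset.
pose A j := \bigcap_(i in [set` Jj j]) E (j, i).
have JjP j i : (i \in Jj j) = ((j, i) \in J).
  apply/imfsetP/idP => [[[j' i'] /=]|ji]; last first.
    by exists (j, i) => //=; rewrite !inE ji eqxx.
  by rewrite !inE/= => /andP[+ /eqP <-] ->.
have FA j i : i \in Jj j -> preimage_sigma (fun w => W j (t i.+1) w - W j (t i) w) (E (j, i)).
  by rewrite JjP => /FE.
have -> : \bigcap_(p in [set` J]) E p = \bigcap_(j in [set` J1]) A j.
  rewrite predeqE => x; split.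
    by move=> h j _ i /=; rewrite JjP => jiJ; exact: h.
  move=> h [j i] /= jiJ; apply: (h j) => /=.
    by apply/imfsetP; exists (j, i).
  by rewrite JjP.
rewrite iW; last first.
  move=> j _; rewrite -[_ (A j)]/(@measurable _ (process_type setT (W j)) (A j)).
  apply: fin_bigcap_measurable => // i /FA[B mB <-].
  apply: (measurable_funB (T := process_type setT (W j))) => //; exact: measurable_process_type.
rewrite (partition_big_imfset _ fst)/= -/J1.
apply: eq_big_seq => j _.
rewrite (brownian_indep_increments (bW j) ht); last by move=> i /FA.
have injJ : {in [fset p in J | p.1 == j]%fset &, injective snd}.
  move=> [a b] [a' b']; rewrite !inE/= => /andP[_ /eqP ->] /andP[_ /eqP ->] -> //.
rewrite /Jj big_imfset//=.
rewrite [RHS]big_fset_condE/=; apply: eq_big_seq => -[a b].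
by rewrite !inE/= => /andP[_ /eqP ->].
Qed.

Lemma brownian_incrementE (B : R -> T -> R) (t : nat -> R) (k0 k : nat) w :
  two_sided_brownian P B -> t k0 = 0 ->
  B (t k) w = \sum_(i < k) (B (t i.+1) w - B (t i) w) -
              \sum_(i < k0) (B (t i.+1) w - B (t i) w).
Proof.
move=> bB t0; have tele n : \sum_(i < n) (B (t i.+1) w - B (t i) w) = B (t n) w - B (t 0%N) w.
  by rewrite -(big_mkord xpredT (fun i => B (t i.+1) w - B (t i) w)) telescope_sumr.
by rewrite !tele t0 (brownian_zero bB); ring.
Qed.

Lemma brownian_family_measurable (I : choiceType) (W : I -> R -> T -> R) (p : I * R) :
  two_sided_brownian_family P W -> measurable_fun setT (W p.1 p.2).
Proof. by move=> [bW _]; exact: (brownian_measurable (bW _)). Qed.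

Lemma brownian_family_indep (I : choiceType) (W : I -> R -> T -> R) (K1 K2 : set I) :
  two_sided_brownian_family P W -> K1 `&` K2 = set0 ->
  indep2 P (process_sigma [set p : I * R | K1 p.1] (fun p => W p.1 p.2))
           (process_sigma [set p : I * R | K2 p.1] (fun p => W p.1 p.2)).
Proof.
move=> WW K12; have [bW iW] := WW.
have sub K : process_sigma [set p : I * R | K p.1] (fun p => W p.1 p.2) `<=`
   <<s \bigcup_(j in K) process_sigma setT (W j) >>.
  apply: g_sigma_mono => A [[j u] /= Kj [B mB <-]]; apply: sub_sigma_algebra.
  by exists j => //; rewrite setTI; exact: process_sigma_preimage.
apply: (indep2_sub (sub K1) (sub K2)); apply: mutual_indep_group => //.
- by move=> i; exact: process_sigmaT.
- by move=> i; exact: process_sigmaI.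
- by move=> i; apply: process_sigma_measurable => u _; exact: (brownian_measurable (bW _)).
Qed.

Lemma single_brownian_family (B : R -> T -> R) :
  two_sided_brownian P B -> two_sided_brownian_family P (fun _ : unit => B).
Proof.
move=> bB; split => // J E FE.
have [->|->] : J = fset0 \/ J = [fset tt]%fset.
  case: (boolP (tt \in J)) => ttJ; [right|left].
    by apply/fsetP => -[]; rewrite !inE ttJ.
  by apply/fsetP => -[]; rewrite !inE (negbTE ttJ).
- by rewrite set_fset0 bigcap_set0 big_nil probability_setT.
- by rewrite set_fset1 bigcap_set1 big_seq_fset1.
Qed.

End one_space.

(** Along a grid of times the values are fixed linear combinations [g] of increments, which are
    independent with prescribed laws. Time 0 belongs to the grid because the paths are anchored
    there, in the midst of negative and positive times. *)
Lemma brownian_family_law (I : choiceType)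
    d (T : measurableType d) (P : probability T R) (W : I -> R -> T -> R)
    d' (T' : measurableType d') (P' : probability T' R) (W' : I -> R -> T' -> R) :
  two_sided_brownian_family P W -> two_sided_brownian_family P' W' ->
  same_law P P' (fun p : I * R => W p.1 p.2) (fun p : I * R => W' p.1 p.2).
Proof.
move=> WW WW'; apply: same_law_fdd.
- by move=> p; exact: brownian_family_measurable WW.
- by move=> p; exact: brownian_family_measurable WW'.
move=> J A mA.
have [t ht tE] := time_grid (0 :: [seq p.2 | p <- (J : seq (I * R))]).
have [k0 tk0] := tE 0 (mem_head _ _).
have /choice[k kE] : forall u, exists k, u \in 0 :: [seq p.2 | p <- (J : seq (I * R))] -> t k = u.
  move=> u; case: (boolP (u \in 0 :: [seq p.2 | p <- (J : seq (I * R))])) => [/tE[k tk]|_].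
    by exists k.
  by exists 0%N.
pose g (x : path_space R (I * nat)) (p : I * R) : R :=
  \sum_(i < k p.2) x (p.1, i : nat) - \sum_(i < k0) x (p.1, i : nat).
have gE d1 (T1 : measurableType d1) (P1 : probability T1 R) (W1 : I -> R -> T1 -> R) :
    two_sided_brownian_family P1 W1 ->
    forall p w, p \in J -> W1 p.1 p.2 w = g (fun q => increment W1 t q w) p.
  move=> [bW1 _] p w pJ.
  have tk : t (k p.2) = p.2 by rewrite kE// inE map_f ?orbT.
  by rewrite -[in LHS]tk (brownian_incrementE (k p.2) w (bW1 p.1) tk0).
pose E : set (path_space R (I * nat)) := \bigcap_(p in [set` J]) ((fun x => g x p) @^-1` A p).
have mE : measurable E.
  apply: fin_bigcap_measurable => // p _; rewrite -[X in measurable X]setTI.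
  have : measurable_fun setT (fun x : path_space R (I * nat) => g x p).
    by apply: measurable_funB; apply: measurable_sum => i; exact: measurable_coord.
  exact.
have PE d1 (T1 : measurableType d1) (P1 : probability T1 R) (W1 : I -> R -> T1 -> R) :
    two_sided_brownian_family P1 W1 ->
    \bigcap_(p in [set` J]) ((W1 p.1 p.2) @^-1` A p) =
    [set w | E (fun q => increment W1 t q w)].
  move=> WW1; rewrite predeqE => w; split => h p pJ.
    by have := h p pJ; rewrite /= (gE _ _ _ _ WW1).
  by have := h p pJ; rewrite /= -(gE _ _ _ _ WW1).
rewrite (PE _ _ _ _ WW) (PE _ _ _ _ WW'); move: E mE {PE}.
apply: same_law_fdd.
- by move=> p; exact: increment_measurable WW.
- by move=> p; exact: increment_measurable WW'.
move=> J2 A2 mA2.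
(* When two consecutive grid times coincide the increment vanishes; its law is then the point mass
   at 0 and not a normal law. *)
have inc d1 (T1 : measurableType d1) (P1 : probability T1 R) (W1 : I -> R -> T1 -> R) :
  two_sided_brownian_family P1 W1 ->
  P1 (\bigcap_(p in [set` J2]) (increment W1 t p @^-1` A2 p)) =
  (\prod_(p <- J2) if (t p.2.+1 == t p.2) then (\1_(A2 p) 0)%:E else
     normal_prob 0 (Num.sqrt (t p.2.+1 - t p.2)) (A2 p))%E.
  move=> WW1; rewrite (increment_indep WW1 ht); last first.
    by move=> p _; exists (A2 p) => //; rewrite setTI.
  apply: eq_bigr => p _; case: ifPn => [/eqP tt|tt].
    have -> : increment W1 t p @^-1` A2 p = if pselect (A2 p 0) then setT else set0.
      rewrite predeqE => w; rewrite /= /increment tt subrr.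
      by case: pselect.
    case: pselect => a0; first by rewrite probability_setT indicE mem_set.
    by rewrite measure0 indicE memNset.
  by have [bW1 _] := WW1; rewrite (brownian_gaussian (bW1 p.1))// lt_neqAle eq_sym tt ht.
by rewrite !inc.
Qed.

Lemma brownian_law d (T : measurableType d) (P : probability T R) (B : R -> T -> R)
    d' (T' : measurableType d') (P' : probability T' R) (B' : R -> T' -> R) :
  two_sided_brownian P B -> two_sided_brownian P' B' -> same_law P P' B B'.
Proof.
move=> bB bB'.
have := brownian_family_law (single_brownian_family bB) (single_brownian_family bB').
move=> /(same_law_comp (g := fun (x : path_space R (unit * R)) (u : R) => x (tt, u))).
by apply; exact: measurable_reindex.
Qed.

End brownian_families.

Section brownian_transformations.
Context {R : realType} d (T : measurableType d) (P : probability T R).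

Lemma two_sided_brownian_affine (B : R -> T -> R) (al be : R) :
  0 < al -> two_sided_brownian P B ->
  two_sided_brownian P
    (fun t w => (Num.sqrt al)^-1 * (B (al * t + be) w - B be w)).
Proof.
move=> al0 bB; have sal0 : 0 < Num.sqrt al by rewrite sqrtr_gt0.
have incE s t w : (Num.sqrt al)^-1 * (B (al * t + be) w - B be w) -
    (Num.sqrt al)^-1 * (B (al * s + be) w - B be w) =
    (Num.sqrt al)^-1 * (B (al * t + be) w - B (al * s + be) w).
  by rewrite -mulrBr; congr (_ * _); ring.
have mB t : measurable_fun setT (B t) := brownian_measurable bB t.
split.
- by move=> t; apply: measurable_funM => //; exact: measurable_funB.
- move=> w t; apply: cvgM; first exact: cvg_cst.
  apply: cvgB; last exact: cvg_cst.
  apply: (@continuous_comp _ _ _ (fun t : R => al * t + be) (B ^~ w)).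
    apply: cvgD; last exact: cvg_cst.
    by apply: cvgM; [exact: cvg_cst|exact: cvg_id].
  exact: brownian_continuous bB w _.
- by move=> w; rewrite mulr0 add0r subrr mulr0.
- move=> s t st A mA.
  have alst : al * s + be < al * t + be by rewrite ltrD2r ltr_pM2l.
  under eq_fun do rewrite incE.
  rewrite (_ : _ @^-1` A = (fun w => B (al * t + be) w - B (al * s + be) w) @^-1`
     ((fun x => (Num.sqrt al)^-1 * x) @^-1` A)); last by [].
  rewrite (brownian_gaussian bB alst); last first.
    by rewrite -[X in measurable X]setTI; exact: measurable_funM.
  have -> : al * t + be - (al * s + be) = al * (t - s) by ring.
  have st0 : 0 < Num.sqrt (t - s) by rewrite sqrtr_gt0 subr_gt0.
  have -> : Num.sqrt (al * (t - s)) = Num.sqrt al * Num.sqrt (t - s).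
    by rewrite sqrtrM// ltW.
  exact: normal_probZ sal0 st0 mA.
- move=> t ht J E FE.
  have ht' : {homo (fun i => al * t i + be) : i j / (i <= j)%N >-> i <= j}.
    by move=> i j ij; rewrite lerD2r ler_pM2l// ht.
  rewrite (brownian_indep_increments bB ht')// => i /FE[A mA <-].
  exists ((fun x => (Num.sqrt al)^-1 * x) @^-1` A).
    by rewrite -[X in measurable X]setTI; exact: measurable_funM.
  by under [in RHS]eq_fun do rewrite incE.
Qed.

Lemma two_sided_brownian_reflect (B : R -> T -> R) (be : R) :
  two_sided_brownian P B ->
  two_sided_brownian P (fun t w => B be w - B (be - t) w).
Proof.
move=> bB.
have incE s t w : B be w - B (be - t) w - (B be w - B (be - s) w) =
    B (be - s) w - B (be - t) w by ring.
have mB t : measurable_fun setT (B t) := brownian_measurable bB t.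
split.
- by move=> t; exact: measurable_funB.
- move=> w t; apply: cvgB; first exact: cvg_cst.
  apply: (@continuous_comp _ _ _ (fun t : R => be - t) (B ^~ w)).
    by apply: cvgB; [exact: cvg_cst|exact: cvg_id].
  exact: brownian_continuous bB w _.
- by move=> w; rewrite subr0 subrr.
- move=> s t st A mA; under eq_fun do rewrite incE.
  have st' : be - t < be - s by rewrite ltrD2l ltrN2.
  have := brownian_gaussian bB st' mA.
  by rewrite (_ : be - s - (be - t) = t - s); last ring.
- move=> t ht J E FE.
  (* Reflection reverses the order of the times. With [m] the largest index in use, the index [i]
     becomes [m - i] and the reflected times [t'] are nondecreasing again. *)
  pose m := (\max_(i <- (J : seq nat)) i)%N.
  have mJ i : i \in J -> (i <= m)%N.
    by move=> iJ; exact: (@leq_bigmax_seq _ (J : seq nat) xpredT id i iJ isT).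
  pose t' i := be - t (m.+1 - i)%N.
  have ht' : {homo t' : i j / (i <= j)%N >-> i <= j}.
    by move=> i j ij; rewrite lerD2l lerN2 ht// leq_sub2l.
  pose J' : {fset nat} := [fset (m - i)%N | i in J]%fset.
  have injJ : {in J &, injective (fun i => m - i)%N}.
    by move=> i j /mJ im /mJ jm /(congr1 (fun x => m - x)%N); rewrite !subKn.
  have EJ : \bigcap_(i in [set` J]) E i = \bigcap_(i in [set` J']) E (m - i)%N.
    rewrite predeqE => w; split => h i /=.
      by move=> /imfsetP[j /= jJ ->]; rewrite subKn ?mJ//; exact: h.
    move=> iJ; have := h (m - i)%N; rewrite /= subKn ?mJ//; apply.
    by apply/imfsetP; exists i.
  rewrite EJ (brownian_indep_increments bB ht'); last first.
    move=> _ /imfsetP[j /= jJ ->]; rewrite subKn ?mJ//.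
    have [A mA <-] := FE _ jJ; exists A => //.
    under [in RHS]eq_fun do rewrite incE.
    have e1 : t' (m - j).+1 = be - t j by rewrite /t' subSS subKn ?mJ.
    have e2 : t' (m - j)%N = be - t j.+1.
      by rewrite /t' subSn ?leq_subr// subKn ?mJ.
    rewrite e1 e2; reflexivity.
  rewrite /J' big_imfset//=; apply: eq_big_seq => i iJ.
  by rewrite subKn// mJ.
Qed.

(** The line [W' j] is a function of [W (f j)] alone, and by injectivity of [f] no two new lines
    share a source. *)
Lemma two_sided_brownian_family_reindex (I J : choiceType) (f : J -> I)
    (W : I -> R -> T -> R) (W' : J -> R -> T -> R) :
  injective f -> two_sided_brownian_family P W ->
  (forall j, two_sided_brownian P (W' j)) ->
  (forall j u, measurable_fun setT (W' j u : process_type setT (W (f j)) -> R)) ->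
  two_sided_brownian_family P W'.
Proof.
move=> injf [bW iW] bW' mW'; split => // K E FE.
have FE' j : j \in K -> process_sigma setT (W (f j)) (E j).
  move=> /FE; apply: g_sigma_mono => A [u _ [B mB <-]]; exact: mW'.
pose E' i := \bigcap_(j in [set j | j \in K /\ f j = i]) E j.
have E'E j : j \in K -> E' (f j) = E j.
  move=> jK; rewrite /E' (_ : [set _ | _] = [set j]) ?bigcap_set1//.
  by apply/seteqP; split => [k /= [_ /injf]|k /= ->].
have -> : \bigcap_(i in [set` K]) E i = \bigcap_(i in [set` [fset f j | j in K]%fset]) E' i.
  rewrite predeqE => w; split => h i /=.
    by move=> _ j /= [jK _]; exact: h.
  move=> iK; rewrite -(E'E _ iK); apply: h => /=.
  by apply/imfsetP; exists i.
rewrite iW; last first.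
  by move=> _ /imfsetP[j /= jK ->]; rewrite E'E//; exact: FE'.
rewrite big_imfset//=; last by move=> i j _ _ /injf.
by apply: eq_big_seq => j jK; rewrite E'E.
Qed.

Lemma brownian_family_affine (I J : choiceType) (f : J -> I) (W : I -> R -> T -> R)
    (al be : R) : injective f -> 0 < al -> two_sided_brownian_family P W ->
  two_sided_brownian_family P
    (fun j t w => (Num.sqrt al)^-1 * (W (f j) (al * t + be) w - W (f j) be w)).
Proof.
move=> injf al0 WW; apply: (two_sided_brownian_family_reindex injf WW).
  by move=> j; apply: two_sided_brownian_affine => //; exact: WW.1.
move=> j u; apply: measurable_funM => //.
by apply: (measurable_funB (T := process_type setT (W (f j))));
  exact: measurable_process_type.
Qed.

Lemma brownian_family_reflect (I J : choiceType) (f : J -> I) (W : I -> R -> T -> R)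
    (be : R) : injective f -> two_sided_brownian_family P W ->
  two_sided_brownian_family P (fun j t w => W (f j) be w - W (f j) (be - t) w).
Proof.
move=> injf WW; apply: (two_sided_brownian_family_reindex injf WW).
  by move=> j; apply: two_sided_brownian_reflect; exact: WW.1.
move=> j u; apply: (measurable_funB (T := process_type setT (W (f j))));
  exact: measurable_process_type.
Qed.

End brownian_transformations.

(** * Last passage percolation *)

Section last_passage.
Context {R : realType}.
Implicit Types (W : int -> R -> R) (m : int) (N : nat) (u v w : R) (p : nat -> R).

(** There are [N.+1] lines, never zero: a path then exists whenever [u <= v], so that the supremum
    is over a nonempty set. *)
Definition lpp W m N u v : R := sup (lpp_values W m (m + N.+1%:Z) u v).

Lemma lpp_values_line W m u v : u <= v ->
  lpp_values W m (m + 1) u v (W (m + 1) v - W (m + 1) u).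
Proof.
move=> uv; exists (fun j => if j <= m then u else v); split.
- by rewrite lexx.
- by rewrite ifN// -ltNge ltrDl.
- move=> j /andP[mj jM]; have -> : j = m + 1 by lia.
  by rewrite addrK lexx ifN// -ltNge ltrDl.
- rewrite addrAC subrr add0r/= big_ord1/= addr0 addrK lexx ifN//.
  by rewrite -ltNge ltrDl.
Qed.

Lemma lpp_values_cat W m (N1 N2 : nat) u w v l1 l2 :
  lpp_values W m (m + N1%:Z) u w l1 ->
  lpp_values W (m + N1%:Z) (m + (N1 + N2)%:Z) w v l2 ->
  lpp_values W m (m + (N1 + N2)%:Z) u v (l1 + l2).
Proof.
move=> [z1 [z1m z1M z1le ->]] [z2 [z2m z2M z2le ->]].
pose z j := if j <= m + N1%:Z then z1 j else z2 j.
have z_1 j : j <= m + N1%:Z -> z j = z1 j by rewrite /z => ->.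
have z_2 j : m + N1%:Z <= j -> z j = z2 j.
  by rewrite /z le_eqVlt => /predU1P[<-|h]; rewrite ?lexx ?z1M ?z2m// leNgt h.
exists z; split.
- by rewrite z_1// lerDl.
- by rewrite z_2// lerD2l lez_nat leq_addr.
- move=> j /andP[mj jM]; have [h|h] := leP j (m + N1%:Z).
    by rewrite !z_1//; [apply: z1le; rewrite mj h|lia].
  by rewrite !z_2//; [apply: z2le; rewrite h jM|lia|lia].
have -> : (m + (N1 + N2)%:Z - m)%R = (N1 + N2)%:Z by lia.
have -> : (m + N1%:Z - m)%R = N1%:Z by lia.
have -> : (m + (N1 + N2)%:Z - (m + N1%:Z))%R = N2%:Z by lia.
rewrite !absz_nat big_split_ord/=; congr (_ + _).
  apply: eq_bigr => i _; have iN := ltn_ord i.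
  by rewrite !z_1//; lia.
apply: eq_bigr => i _.
have e : m + 1 + (N1 + i)%:Z = m + N1%:Z + 1 + i%:Z by lia.
by rewrite e !z_2//; lia.
Qed.

Lemma lpp_values_n0 W m N u v : u <= v -> lpp_values W m (m + N.+1%:Z) u v !=set0.
Proof.
move=> uv; elim: N => [|N [l hl]].
  by exists (W (m + 1) v - W (m + 1) u); exact: lpp_values_line.
exists (l + (W (m + N.+1%:Z + 1) v - W (m + N.+1%:Z + 1) v)).
have := @lpp_values_cat W m N.+1 1 u v v _ _ hl; rewrite addn1; apply.
have -> : m + N.+2%:Z = m + N.+1%:Z + 1 by lia.
exact: lpp_values_line.
Qed.

Lemma lpp_path_bounds m (M : int) u v (z : int -> R) : z m = u -> z M = v ->
  (forall j : int, m < j <= M -> z (j - 1) <= z j) ->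
  forall j, m <= j <= M -> u <= z j <= v.
Proof.
move=> zm zM zle.
have le1 (k : nat) (j : int) : m <= j -> j + k%:Z <= M -> z j <= z (j + k%:Z).
  elim: k => [|k ih] mj jkM; first by rewrite addr0.
  have jk : j + k%:Z <= M by lia.
  rewrite (le_trans (ih mj jk))//.
  have := zle (j + k.+1%:Z); rewrite (_ : j + k.+1%:Z - 1 = j + k%:Z); last by lia.
  by apply; apply/andP; split => //; lia.
move=> j /andP[mj jM]; apply/andP; split.
  rewrite -zm; have := le1 `|j - m|%N m (lexx _).
  have -> : m + `|j - m|%N%:Z = j by lia.
  exact.
rewrite -zM; have := le1 `|M - j|%N j mj.
have -> : j + `|M - j|%N%:Z = M by lia.
exact.
Qed.

Lemma lpp_values_ub W m (M : int) u v : (forall j, continuous (W j)) -> m <= M -> u <= v ->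
  has_ubound (lpp_values W m M u v).
Proof.
move=> cW mM uv.
have bnd j : exists C, forall t, u <= t <= v -> `|W j t| <= C.
  have cont : {within `[u, v], continuous (fun t => `|W j t|)}.
    apply: continuous_subspaceT => t; apply: continuous_comp; first exact: cW.
    exact: norm_continuous.
  have [c _ hc] := EVT_max uv cont; exists `|W j c| => t tuv; apply: hc.
  by rewrite in_itv.
have /(@choice int R)[C hC] := bnd.
exists (\sum_(i < `|M - m|%N) (C (m + 1 + i%:Z) *+ 2)).
move=> _ [z [zm zM zle ->]]; apply: ler_sum => i _.
have zb := lpp_path_bounds zm zM zle; have iM := ltn_ord i.
rewrite /= (le_trans (ler_norm _))// (le_trans (ler_normB _ _))// mulr2n.
by apply: lerD; apply: hC; apply: zb; lia.
Qed.

Lemma lpp_ub W m N u v l : (forall j, continuous (W j)) -> u <= v ->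
  lpp_values W m (m + N.+1%:Z) u v l -> l <= lpp W m N u v.
Proof. by move=> cW uv; apply: ub_le_sup; apply: lpp_values_ub => //; lia. Qed.

Lemma lpp_lub W m N u v x : u <= v ->
  (forall l, lpp_values W m (m + N.+1%:Z) u v l -> l <= x) -> lpp W m N u v <= x.
Proof. by move=> uv h; apply: ge_sup => //; exact: lpp_values_n0. Qed.

Lemma lpp_superadditive W m (N1 N2 : nat) u w v : (forall j, continuous (W j)) ->
  u <= w -> w <= v ->
  lpp W m N1 u w + lpp W (m + N1.+1%:Z) N2 w v <= lpp W m (N1.+1 + N2) u v.
Proof.
move=> cW uw wv; rewrite -lerBrDr; apply: lpp_lub => // l1 hl1.
rewrite lerBrDr -lerBrDl; apply: lpp_lub => // l2 hl2; rewrite lerBrDl.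
apply: lpp_ub => //; first exact: le_trans wv.
have := @lpp_values_cat W m N1.+1 N2.+1 u w v _ _ hl1.
rewrite -addnS; apply.
by rewrite (_ : m + (N1.+1 + N2.+1)%:Z = m + N1.+1%:Z + N2.+1%:Z)//; lia.
Qed.

(** The path that waits at [u] on all lines but the last. *)
Lemma lpp_ge_last W m N u v : (forall j, continuous (W j)) -> u <= v ->
  W (m + N.+1%:Z) v - W (m + N.+1%:Z) u <= lpp W m N u v.
Proof.
move=> cW uv; apply: lpp_ub => //.
case: N => [|N]; first exact: lpp_values_line.
have hl : lpp_values W m (m + N.+1%:Z) u u 0.
  elim: N => [|N ih].
    by have := @lpp_values_line W m u u (lexx _); rewrite subrr.
  have := @lpp_values_cat W m N.+1 1 u u u _ _ ih; rewrite addn1 => /(_ 0).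
  rewrite addr0; apply.
  rewrite (_ : m + N.+2%:Z = m + N.+1%:Z + 1); last by lia.
  by have := @lpp_values_line W (m + N.+1%:Z) u u (lexx _); rewrite subrr.
have := @lpp_values_cat W m N.+1 1 u u v 0 (W (m + N.+2%:Z) v - W (m + N.+2%:Z) u) hl.
rewrite addn1 add0r; apply.
rewrite (_ : m + N.+2%:Z = m + N.+1%:Z + 1); last by lia.
exact: lpp_values_line.
Qed.

(* [grid_lpp x m p N i] is the last passage value from [p 0] to [p i] through the
   lines [m + 1, ..., m + N + 1] when the jumps are restricted to the grid [p]. *)
Fixpoint grid_lpp (x : int * R -> R) m p (N i : nat) : R :=
  if N is N'.+1 then
    \big[Num.max/grid_lpp x m p N' i]_(k < i.+1)
      (grid_lpp x m p N' k + (x (m + N.+1%:Z, p i) - x (m + N.+1%:Z, p k)))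
  else x (m + 1, p i) - x (m + 1, p 0%N).

Lemma bigmax_attained (n : nat) (x0 : R) (F : 'I_n -> R) (Q : R -> Prop) :
  Q x0 -> (forall i, Q (F i)) -> Q (\big[Num.max/x0]_(i < n) F i).
Proof.
move=> Q0 QF; apply: big_ind => // x y Qx Qy.
by rewrite /Num.max; case: ifP.
Qed.

Lemma grid_lpp_values W m p N i : {homo p : i j / (i <= j)%N >-> i <= j} ->
  lpp_values W m (m + N.+1%:Z) (p 0%N) (p i) (grid_lpp (fun q => W q.1 q.2) m p N i).
Proof.
move=> hp; elim: N i => [|N ih] i; first exact/lpp_values_line/hp.
have step k : (k <= i)%N -> lpp_values W m (m + N.+2%:Z) (p 0%N) (p i)
    (grid_lpp (fun q => W q.1 q.2) m p N k + (W (m + N.+2%:Z) (p i) - W (m + N.+2%:Z) (p k))).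
  move=> ki; have := @lpp_values_cat W m N.+1 1 _ _ _ _ _ (ih k); rewrite addn1; apply.
  rewrite (_ : m + N.+2%:Z = m + N.+1%:Z + 1); last by lia.
  exact/lpp_values_line/hp.
rewrite [grid_lpp _ _ _ _ _]/=; apply: bigmax_attained.
  by have := step i (leqnn _); rewrite subrr addr0.
by move=> k; apply: step; rewrite -ltnS.
Qed.

Lemma grid_lpp_ge (x : int * R -> R) m p N (a : nat -> nat) : a 0%N = 0%N ->
  {homo a : i j / (i <= j)%N} ->
  \sum_(j < N.+1) (x (m + 1 + j%:Z, p (a j.+1)) - x (m + 1 + j%:Z, p (a j))) <=
  grid_lpp x m p N (a N.+1).
Proof.
move=> a0 ha; elim: N => [|N ih].
  by rewrite big_ord1/= addr0 a0.
rewrite big_ord_recr/=.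
have h : (a N.+1 < (a N.+2).+1)%N by rewrite ltnS ha.
apply: (@le_trans _ _ (grid_lpp x m p N (a N.+1) +
    (x (m + N.+2%:Z, p (a N.+2)) - x (m + N.+2%:Z, p (a N.+1))))).
  by rewrite lerD// (_ : m + 1 + N.+1%:Z = m + N.+2%:Z)//; lia.
exact: (le_bigmax _ _ (Ordinal h)).
Qed.

End last_passage.

Section last_passage_approximation.
Context {R : realType}.
Implicit Types (W : int -> R -> R) (m : int) (N : nat) (u v w : R) (p : nat -> R).

Definition uniform_grid u v (k i : nat) : R := u + (v - u) * (i%:R / k.+1%:R).

Lemma uniform_grid0 u v k : uniform_grid u v k 0 = u.
Proof. by rewrite /uniform_grid mul0r mulr0 addr0. Qed.

Lemma uniform_grid_last u v k : uniform_grid u v k k.+1 = v.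
Proof. by rewrite /uniform_grid divff ?pnatr_eq0// mulr1 addrC subrK. Qed.

Lemma uniform_grid_homo u v k : u <= v ->
  {homo uniform_grid u v k : i j / (i <= j)%N >-> i <= j}.
Proof.
move=> uv i j ij; rewrite lerD2l ler_wpM2l ?subr_ge0// ler_wpM2r ?invr_ge0//.
by rewrite ler_nat.
Qed.

Lemma truncn_grid_cvg (x : R) : 0 <= x ->
  (Num.truncn (x * k.+1%:R))%:R / k.+1%:R @[k --> \oo] --> x.
Proof.
move=> x0; apply: (@squeeze_cvgr _ _ _ _ (fun k => x - (k.+1%:R)^-1) (fun=> x)).
- near=> k; have k0 : 0 < k.+1%:R :> R by rewrite ltr0n.
  have xk0 : 0 <= x * k.+1%:R by rewrite mulr_ge0.
  apply/andP; split.
    rewrite ler_pdivlMr// mulrBl mulVf ?gt_eqF// lerBlDr.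
    by rewrite natr1; exact: ltW (truncnS_gt _).
  by rewrite ler_pdivrMr// truncn_le.
- rewrite -[X in _ --> X]subr0; apply: cvgB; first exact: cvg_cst.
  exact: cvg_harmonic.
- exact: cvg_cst.
Unshelve. all: by end_near. Qed.

(** The jump times of a nearly optimal path are rounded down to the grid. Rounding keeps them
    ordered, and the value of the rounded path converges by continuity of the lines. *)
Lemma grid_lpp_cvg W m N u v : (forall j, continuous (W j)) -> u < v ->
  grid_lpp (fun q => W q.1 q.2) m (uniform_grid u v k) N k.+1 @[k --> \oo] -->
  lpp W m N u v.
Proof.
move=> cW uv; have uv' := ltW uv.
have vu0 : 0 < v - u by rewrite subr_gt0.
apply/cvgrPdist_le => e e0.
have le_lpp k : grid_lpp (fun q => W q.1 q.2) m (uniform_grid u v k) N k.+1 <= lpp W m N u v.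
  apply: lpp_ub => //.
  have := @grid_lpp_values _ W m _ N k.+1 (uniform_grid_homo k uv').
  by rewrite uniform_grid0 uniform_grid_last.
have e20 : 0 < e / 2 by rewrite divr_gt0.
have [l [z [zm zM zle lE]] hl] : exists2 l, lpp_values W m (m + N.+1%:Z) u v l &
    lpp W m N u v - e / 2 < l.
  apply: sup_adherent => //; split; first exact: lpp_values_n0.
  by apply: lpp_values_ub => //; lia.
(* [minn] freezes the jump times beyond the last line, so that [zn] is nondecreasing on all of
   [nat]. *)
pose zn (j : nat) := z (m + (minn j N.+1)%:Z).
pose a k (j : nat) := Num.truncn ((zn j - u) / (v - u) * k.+1%:R).
have zb := lpp_path_bounds zm zM zle.
have znb j : u <= zn j <= v by apply: zb; lia.
have zn_le i j : (i <= j)%N -> zn i <= zn j.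
  move=> ij; rewrite /zn.
  have zle' (k : int) : m + (minn i N.+1)%:Z < k <= m + N.+1%:Z -> z (k - 1) <= z k.
    by move=> hk; apply: zle; lia.
  have := lpp_path_bounds erefl zM zle' (j := m + (minn j N.+1)%:Z).
  by case/(_ _)/andP => //; lia.
have a0 k : a k 0%N = 0%N.
  by rewrite /a /zn min0n addr0 zm subrr mul0r mul0r truncn0.
have aN k : a k N.+1 = k.+1.
  by rewrite /a /zn minnn zM divff ?gt_eqF// mul1r natrK.
have ha k : {homo a k : i j / (i <= j)%N}.
  move=> i j ij; apply: le_truncn.
  by rewrite ler_wpM2r// ler_wpM2r ?invr_ge0 ?(ltW vu0)// lerB// zn_le.
have pa j : uniform_grid u v k (a k j) @[k --> \oo] --> zn j.
  have -> : zn j = u + (v - u) * ((zn j - u) / (v - u)).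
    by rewrite mulrC divfK ?gt_eqF// addrC subrK.
  apply: cvgD; first exact: cvg_cst.
  apply: cvgM; first exact: cvg_cst.
  apply: truncn_grid_cvg; rewrite divr_ge0 ?(ltW vu0)// subr_ge0.
  by have /andP[] := znb j.
have lim : (\sum_(j < N.+1) (W (m + 1 + j%:Z) (uniform_grid u v k (a k j.+1)) -
                             W (m + 1 + j%:Z) (uniform_grid u v k (a k j))))
           @[k --> \oo] --> l.
  have -> : l = \sum_(j < N.+1) (W (m + 1 + j%:Z) (zn j.+1) - W (m + 1 + j%:Z) (zn j)).
    rewrite lE (_ : `|(m + N.+1%:Z - m)%R|%N = N.+1); last by lia.
    apply: eq_bigr => j _ /=; have jN := ltn_ord j; rewrite /zn.
    rewrite (minn_idPl _)// (minn_idPl _) 1?ltnW//.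
    by congr (W _ (z _) - W _ (z _)); lia.
  apply: (@cvg_big _ _ +%R) => [|j _]; first exact: add_continuous.
  apply: cvgB.
    by apply: (cvg_comp _ (W _)) (pa _) _; exact: cW.
  by apply: (cvg_comp _ (W _)) (pa _) _; exact: cW.
move/cvgrPdist_le/(_ _ e20) : lim; apply: filterS => k hk.
have ge : \sum_(j < N.+1) (W (m + 1 + j%:Z) (uniform_grid u v k (a k j.+1)) -
       W (m + 1 + j%:Z) (uniform_grid u v k (a k j))) <=
   grid_lpp (fun q => W q.1 q.2) m (uniform_grid u v k) N k.+1.
  by rewrite -[X in grid_lpp _ _ _ _ X](aN k); exact: grid_lpp_ge (a0 k) (ha k).
have := le_lpp k; move: hk hl ge; rewrite ler_norml ger0_norm ?subr_ge0//.
by move=> /andP[_ h1] h2 h3 h4; lra.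
Qed.

Lemma measurable_bigmax d (T : measurableType d) (I : Type) (s : seq I)
    (g : T -> R) (f : I -> T -> R) : measurable_fun setT g ->
  (forall i, measurable_fun setT (f i)) ->
  measurable_fun setT (fun x => \big[Num.max/g x]_(i <- s) f i x).
Proof.
move=> mg mf; elim: s => [|i s ih].
  by under eq_fun do rewrite big_nil.
by under eq_fun do rewrite big_cons; exact: measurable_maxr.
Qed.

Lemma measurable_grid_lpp m p N i :
  measurable_fun setT (fun x : path_space R (int * R) => grid_lpp x m p N i).
Proof.
elim: N i => [|N ih] i /=.
  by apply: measurable_funB; exact: measurable_coord.
apply: measurable_bigmax => // k.
by apply: measurable_funD => //; apply: measurable_funB; exact: measurable_coord.
Qed.

(* On continuous environments this is the last passage value; it is measurable on
   the whole path space. *)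
Definition lpp_hat m N u v (x : path_space R (int * R)) : R :=
  fine (limn_esup (fun k => (grid_lpp x m (uniform_grid u v k) N k.+1)%:E)).

Lemma measurable_lpp_hat m N u v : measurable_fun setT (lpp_hat m N u v).
Proof.
apply: measurableT_comp => //; apply: measurable_fun_limn_esup => k.
by apply/measurable_EFinP; exact: measurable_grid_lpp.
Qed.

Lemma lpp_hatE W m N u v : (forall j, continuous (W j)) -> u < v ->
  lpp_hat m N u v (fun q => W q.1 q.2) = lpp W m N u v.
Proof.
move=> cW uv; rewrite /lpp_hat.
suff -> : limn_esup (fun k => (grid_lpp (fun q => W q.1 q.2) m
    (uniform_grid u v k) N k.+1)%:E) = (lpp W m N u v)%:E by [].
have cv : (grid_lpp (fun q => W q.1 q.2) m (uniform_grid u v k) N k.+1)%:E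
    @[k --> \oo] --> (lpp W m N u v)%:E.
  by apply: cvg_EFin; [exact: nearW|exact: grid_lpp_cvg].
rewrite is_cvg_limn_esupE; last by apply/cvg_ex; exists (lpp W m N u v)%:E.
exact/cvg_lim.
Qed.

End last_passage_approximation.

Section last_passage_laws.
Context {R : realType}.
Implicit Types (m : int) (N : nat) (u v be : R).

Lemma lpp_affine (W : int -> R -> R) (a : int) (ka al be : R) m N u v :
  (forall j, continuous (W j)) -> 0 < ka -> 0 < al -> u <= v ->
  lpp (fun j t => ka * (W (j + a) (al * t + be) - W (j + a) be)) m N u v =
  ka * lpp W (m + a) N (al * u + be) (al * v + be).
Proof.
move=> cW ka0 al0 uv.
have uv' : al * u + be <= al * v + be by rewrite lerD2r ler_pM2l.
set W' := fun j t => _.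
have cW' j : continuous (W' j).
  move=> t; apply: cvgM; first exact: cvg_cst.
  apply: cvgB; last exact: cvg_cst.
  apply: (@continuous_comp _ _ _ (fun t : R => al * t + be) (W (j + a))).
    apply: cvgD; last exact: cvg_cst.
    by apply: cvgM; [exact: cvg_cst|exact: cvg_id].
  exact: cW.
have mM : m + a + N.+1%:Z - (m + a) = m + N.+1%:Z - m by lia.
apply/eqP; rewrite eq_le; apply/andP; split.
  apply: lpp_lub => // _ [z [zm zM zle ->]].
  rewrite -ler_pdivrMl// mulr_sumr; apply: lpp_ub => //.
  exists (fun j => al * z (j - a) + be); split.
  - by rewrite addrK zm.
  - by rewrite (_ : m + a + N.+1%:Z - a = m + N.+1%:Z) ?zM//; lia.
  - move=> j hj; rewrite lerD2r ler_pM2l//.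
    by rewrite (_ : j - 1 - a = j - a - 1); [apply: zle; lia|lia].
  - rewrite mM; apply: eq_bigr => i _ /=.
    rewrite /W' -mulrBr mulrA mulVf ?gt_eqF// mul1r.
    have -> : m + a + 1 + i%:Z = m + 1 + i%:Z + a by lia.
    have -> : m + 1 + i%:Z + a - 1 - a = m + 1 + i%:Z - 1 by lia.
    by rewrite addrK; ring.
rewrite -ler_pdivlMl//; apply: lpp_lub => // _ [z [zm zM zle ->]].
rewrite ler_pdivlMl// mulr_sumr; apply: lpp_ub => //.
exists (fun j => (z (j + a) - be) / al); split.
- by rewrite zm addrK mulrC mulKf// gt_eqF.
- rewrite (_ : m + N.+1%:Z + a = m + a + N.+1%:Z); last by lia.
  by rewrite zM addrK mulrC mulKf// gt_eqF.
- move=> j hj; rewrite ler_pM2r ?invr_gt0// lerD2r.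
  by rewrite (_ : j - 1 + a = j + a - 1); [apply: zle; lia|lia].
- rewrite mM; apply: eq_bigr => i _ /=.
  rewrite /W' -mulrBr.
  have -> : m + a + 1 + i%:Z = m + 1 + i%:Z + a by lia.
  have -> : m + 1 + i%:Z - 1 + a = m + 1 + i%:Z + a - 1 by lia.
  have h x : al * ((x - be) / al) + be = x by rewrite mulrC divfK ?gt_eqF// subrK.
  by rewrite !h; congr (_ * _); ring.
Qed.

(** Time and the order of the lines are reversed together. As [z j] is the time of the jump from
    line [j] to line [j + 1], the corresponding jump of the reflected path has index [c - 1 - j]. *)
Lemma lpp_reflect (W : int -> R -> R) (c : int) (be : R) m N u v :
  (forall j, continuous (W j)) -> u <= v ->
  lpp (fun j t => W (c - j) be - W (c - j) (be - t)) m N u v =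
  lpp W (c - m - N.+2%:Z) N (be - v) (be - u).
Proof.
move=> cW uv.
have uv' : be - v <= be - u by rewrite lerD2l lerN2.
set W' := fun j t => _.
have cW' j : continuous (W' j).
  move=> t; apply: cvgB; first exact: cvg_cst.
  apply: (@continuous_comp _ _ _ (fun t : R => be - t) (W (c - j))).
    by apply: cvgB; [exact: cvg_cst|exact: cvg_id].
  exact: cW.
have e1 : `|(c - m - N.+2%:Z + N.+1%:Z - (c - m - N.+2%:Z))%R|%N = N.+1 by lia.
have e2 : `|(m + N.+1%:Z - m)%R|%N = N.+1 by lia.
apply/eqP; rewrite eq_le; apply/andP; split.
  apply: lpp_lub => // _ [z [zm zM zle ->]]; apply: lpp_ub => //.
  exists (fun j => be - z (c - 1 - j)); split.
  - by rewrite (_ : c - 1 - (c - m - N.+2%:Z) = m + N.+1%:Z) ?zM//; lia.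
  - by rewrite (_ : c - 1 - (c - m - N.+2%:Z + N.+1%:Z) = m) ?zm//; lia.
  - move=> j hj; rewrite lerD2l lerN2.
    by rewrite (_ : c - 1 - j = c - 1 - (j - 1) - 1); [apply: zle; lia|lia].
  - rewrite e1 e2 (reindex_inj rev_ord_inj)/=; apply: eq_bigr => i _ /=.
    have iN := ltn_ord i; rewrite /W'.
    have -> : c - m - N.+2%:Z + 1 + i%:Z = c - (m + 1 + (N.+1 - i.+1)%N%:Z) by lia.
    have -> : c - 1 - (c - (m + 1 + (N.+1 - i.+1)%N%:Z)) = m + 1 + (N.+1 - i.+1)%N%:Z - 1 by lia.
    have -> : c - 1 - (c - (m + 1 + (N.+1 - i.+1)%N%:Z) - 1) = m + 1 + (N.+1 - i.+1)%N%:Z by lia.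
    by ring.
apply: lpp_lub => // _ [z [zm zM zle ->]]; apply: lpp_ub => //.
exists (fun j => be - z (c - 1 - j)); split.
- rewrite (_ : c - 1 - m = c - m - N.+2%:Z + N.+1%:Z) ?zM; [ring|lia].
- rewrite (_ : c - 1 - (m + N.+1%:Z) = c - m - N.+2%:Z) ?zm; [ring|lia].
- move=> j hj; rewrite lerD2l lerN2.
  by rewrite (_ : c - 1 - j = c - 1 - (j - 1) - 1); [apply: zle; lia|lia].
- rewrite e1 e2 (reindex_inj rev_ord_inj)/=; apply: eq_bigr => i _ /=.
  have iN := ltn_ord i; rewrite /W'.
  have -> : c - m - N.+2%:Z + 1 + (N.+1 - i.+1)%N%:Z = c - (m + 1 + i%:Z) by lia.
  have -> : c - 1 - (m + 1 + i%:Z) = c - (m + 1 + i%:Z) - 1 by lia.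
  have -> : c - 1 - (m + 1 + i%:Z - 1) = c - (m + 1 + i%:Z) by lia.
  have h x : be - (be - x) = x by ring.
  by rewrite !h; ring.
Qed.

(** The value is a limit of grid values that read the lines [m + 1, ..., m + N.+1] only. Taking for
    [T] the sigma-algebra generated by these lines shows later that blocks on disjoint lines are
    independent. *)
Lemma measurable_lpp_gen d (T : measurableType d) (W : int -> R -> T -> R) m N u v :
  (forall j w, continuous (fun t => W j t w)) -> u < v ->
  (forall j t, m < j <= m + N.+1%:Z -> measurable_fun setT (W j t)) ->
  measurable_fun setT (fun w => lpp (fun j t => W j t w) m N u v).
Proof.
move=> cW uv mW.
apply: (@measurable_fun_cvg _ _ _ _ (fun k w =>
  grid_lpp (fun q => W q.1 q.2 w) m (uniform_grid u v k) N k.+1)).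
- move=> k; set i := k.+1; clearbody i.
  have mN n : (n <= N)%N -> forall t, measurable_fun setT (W (m + n.+1%:Z) t).
    by move=> nN t; apply: mW; lia.
  suff h n : (n <= N)%N -> forall i, measurable_fun setT (fun w =>
      grid_lpp (fun q => W q.1 q.2 w) m (uniform_grid u v k) n i) by exact: h.
  elim: n => [|n ih] nN {}i /=.
    by apply: measurable_funB; exact: (mN 0%N).
  apply: measurable_bigmax => [|k']; first exact/ih/ltnW.
  apply: measurable_funD; first exact/ih/ltnW.
  by apply: measurable_funB; exact: (mN n.+1).
- move=> w _; exact: (grid_lpp_cvg (W := fun j t => W j t w)).
Qed.

Section families.
Context d (T : measurableType d) (P : probability T R) (W : int -> R -> T -> R).
Hypothesis WW : two_sided_brownian_family P W.

Lemma brownian_family_continuous j w : continuous (fun t => W j t w).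
Proof. exact: brownian_continuous (WW.1 j) w. Qed.

Definition lpp_of (b : int * nat * R * R) (w : T) : R :=
  lpp (fun j t => W j t w) b.1.1.1 b.1.1.2 b.1.2 b.2.

Lemma measurable_lpp b : b.1.2 < b.2 -> measurable_fun setT (lpp_of b).
Proof.
move=> uv; apply: measurable_lpp_gen => //.
  exact: brownian_family_continuous.
by move=> j t _; exact: (brownian_family_measurable (j, t) WW).
Qed.

Lemma measurable_lpp_lines (K : set int) b : b.1.2 < b.2 ->
  (forall j, b.1.1.1 < j <= b.1.1.1 + b.1.1.2.+1%:Z -> K j) ->
  measurable_fun setT
    (lpp_of b : process_type [set p : int * R | K p.1] (fun p => W p.1 p.2) -> R).
Proof.
move=> uv hK; apply: measurable_lpp_gen => //.
  exact: brownian_family_continuous.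
move=> j t hj.
exact: (measurable_process_type (X := fun p => W p.1 p.2) (i := (j, t)) (hK j hj)).
Qed.

Lemma lpp_indep (K1 K2 : set int) d1 d2 (T1 : measurableType d1) (T2 : measurableType d2)
    (X : T -> T1) (Y : T -> T2) (A : set T1) (B : set T2) : K1 `&` K2 = set0 ->
  measurable_fun setT
    (X : process_type [set p : int * R | K1 p.1] (fun p => W p.1 p.2) -> T1) ->
  measurable_fun setT
    (Y : process_type [set p : int * R | K2 p.1] (fun p => W p.1 p.2) -> T2) ->
  measurable A -> measurable B ->
  P (X @^-1` A `&` Y @^-1` B) = (P (X @^-1` A) * P (Y @^-1` B))%E.
Proof.
move=> K12 mX mY mA mB; apply: (brownian_family_indep WW K12).
  by have := mX measurableT A mA; rewrite setTI.
by have := mY measurableT B mB; rewrite setTI.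
Qed.

End families.

Lemma lpp_law d (T : measurableType d) (P : probability T R) (W : int -> R -> T -> R)
    d' (T' : measurableType d') (P' : probability T' R) (W' : int -> R -> T' -> R)
    (K : Type) (b : K -> int * nat * R * R) :
  two_sided_brownian_family P W -> two_sided_brownian_family P' W' ->
  (forall k, (b k).1.2 < (b k).2) ->
  same_law P P' (fun k => lpp_of W (b k)) (fun k => lpp_of W' (b k)).
Proof.
move=> WW WW' hb.
have := brownian_family_law WW WW'.
move=> /(same_law_comp (g := fun (x : path_space R (int * R)) k =>
  lpp_hat (b k).1.1.1 (b k).1.1.2 (b k).1.2 (b k).2 x)).
have -> : (fun k => lpp_of W (b k)) = (fun k w => lpp_hat (b k).1.1.1 (b k).1.1.2
    (b k).1.2 (b k).2 (fun i : int * R => W i.1 i.2 w)).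
  apply/funext => k; apply/funext => w.
  rewrite /lpp_of -(@lpp_hatE _ (fun j t => W j t w))// => j.
  exact: (brownian_family_continuous WW).
have -> : (fun k => lpp_of W' (b k)) = (fun k w => lpp_hat (b k).1.1.1 (b k).1.1.2
    (b k).1.2 (b k).2 (fun i : int * R => W' i.1 i.2 w)).
  apply/funext => k; apply/funext => w.
  rewrite /lpp_of -(@lpp_hatE _ (fun j t => W' j t w))// => j.
  exact: (brownian_family_continuous WW').
by apply; apply: measurable_path => k; exact: measurable_lpp_hat.
Qed.

End last_passage_laws.

(** * Tandem queues and exponential moments of last passage values *)

Section bits_mean.
Context {R : realType}.
Local Open Scope ereal_scope.
Implicit Types (F : seq bool -> \bar R) (hs ws d : seq bool).

(* Expectation over independent bits, each equal to [true] with probability [p]. *)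
Fixpoint bits_mean (p : R) (t : nat) F : \bar R :=
  if t is t'.+1 then p%:E * bits_mean p t' (fun s => F (true :: s)) +
                     (1 - p)%:E * bits_mean p t' (fun s => F (false :: s))
  else F [::].

Variable p : R.
Hypotheses (p0 : (0 <= p)%R) (p1 : (p <= 1)%R).
Let q0 : (0 <= 1 - p)%R. Proof. by rewrite subr_ge0. Qed.

Lemma bits_mean_ge0 t F : (forall s, 0 <= F s) -> 0 <= bits_mean p t F.
Proof.
elim: t F => [|t ih] F F0 //=.
by rewrite adde_ge0// mule_ge0 ?lee_fin// ih.
Qed.

Lemma le_bits_mean t F G : (forall s, size s = t -> F s <= G s) ->
  bits_mean p t F <= bits_mean p t G.
Proof.
elim: t F G => [|t ih] F G FG /=; first exact: FG.
by apply: leeD; apply: lee_wpmul2l; rewrite ?lee_fin//; apply: ih => s st; apply: FG; rewrite /= st.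
Qed.

Lemma eq_bits_mean t F G : (forall s, size s = t -> F s = G s) ->
  bits_mean p t F = bits_mean p t G.
Proof.
by move=> FG; apply/eqP; rewrite eq_le; apply/andP; split; apply: le_bits_mean => s /FG ->.
Qed.

Lemma bits_mean_cst t c : bits_mean p t (fun=> c%:E) = c%:E.
Proof.
elim: t => //= t ->; rewrite -!EFinM -EFinD; congr EFin; ring.
Qed.

Lemma bits_meanZ t c F : 0 <= c -> (forall s, 0 <= F s) ->
  bits_mean p t (fun s => c * F s) = c * bits_mean p t F.
Proof.
move=> c0; elim: t F => [|t ih] F F0 //=.
rewrite !ih// ge0_muleDr; last 2 first.
  by rewrite mule_ge0 ?lee_fin// bits_mean_ge0.
  by rewrite mule_ge0 ?lee_fin// bits_mean_ge0.
by rewrite !(muleCA c).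
Qed.

Lemma bits_meanD t F G : (forall s, 0 <= F s) -> (forall s, 0 <= G s) ->
  bits_mean p t (fun s => F s + G s) = bits_mean p t F + bits_mean p t G.
Proof.
elim: t F G => [|t ih] F G F0 G0 //=.
rewrite !ih// !ge0_muleDr ?bits_mean_ge0//.
by rewrite addeACA.
Qed.

Lemma bits_mean_lty t F : (forall s, 0 <= F s) -> (forall s, F s < +oo) ->
  bits_mean p t F < +oo.
Proof.
elim: t F => [|t ih] F F0 Foo //=.
by rewrite lte_add_pinfty// lte_mul_pinfty ?lee_fin ?ih.
Qed.

Lemma bits_mean_cat t1 t2 F :
  bits_mean p (t1 + t2) F = bits_mean p t1 (fun s => bits_mean p t2 (fun s' => F (s ++ s'))).
Proof. by elim: t1 F => [|t ih] F //=; rewrite !ih. Qed.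

Lemma bits_mean_series t (F : nat -> seq bool -> \bar R) :
  (forall k s, 0 <= F k s) ->
  bits_mean p t (fun s => \sum_(k <oo) F k s) = \sum_(k <oo) bits_mean p t (F k).
Proof.
elim: t F => [|t ih] F F0 //=.
rewrite !ih// -!nneseriesZl; try by move=> *; exact: bits_mean_ge0.
by rewrite -nneseriesD// => k _; rewrite mule_ge0 ?lee_fin// bits_mean_ge0.
Qed.

End bits_mean.

Section tandem_queues.
Context {R : realType}.
Local Open Scope ereal_scope.
Implicit Types (F : seq bool -> \bar R) (hs ws d : seq bool).

(* One time unit of a queue of length [k], fed by [h] and served by [w]: a served
   customer leaves, and an idle server lets the arriving step through. *)
Definition queue_step (k : nat) (h w : bool) : nat * bool :=
  match h, w with
  | true, false => if k is k'.+1 then (k', false) else (0%N, true)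
  | false, true => (k.+1, true)
  | _, _ => (k, w)
  end.

Fixpoint queue_run (k : nat) hs ws : seq bool * nat :=
  match hs, ws with
  | h :: hs', w :: ws' =>
      let: (k', e) := queue_step k h w in
      let: (d, kf) := queue_run k' hs' ws' in (e :: d, kf)
  | _, _ => ([::], k)
  end.

Variable p : R.
Hypotheses (p1 : (p <= 1)%R) (p_half : (2^-1 < p)%R).
Let pgt0 : (0 < p)%R. Proof. by apply: lt_trans p_half; rewrite invr_gt0. Qed.
Let p0 : (0 <= p)%R. Proof. exact: ltW. Qed.
Let q0 : (0 <= 1 - p)%R. Proof. by rewrite subr_ge0. Qed.
Let r : R := ((1 - p) / p)%R.
(** The stationary law of the queue: with a fair server the length goes up with probability
    [(1 - p) / 2] and, when positive, down with probability [p / 2]. *)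
Definition queue_law (k : nat) : R := ((1 - r) * r ^+ k)%R.

Let r0 : (0 <= r)%R. Proof. by rewrite divr_ge0// ltW. Qed.
Let r1 : (r < 1)%R.
Proof. by rewrite /r ltr_pdivrMr// mul1r; have := p_half; lra. Qed.

Lemma queue_law_ge0 k : (0 <= queue_law k)%R.
Proof. by rewrite mulr_ge0 ?exprn_ge0// subr_ge0 ltW. Qed.

(** Detailed balance between two neighbouring lengths. *)
Lemma queue_lawS k : (queue_law k.+1 * p = queue_law k * (1 - p))%R.
Proof.
rewrite /queue_law exprS /r; field; rewrite gt_eqF//.
Qed.

Lemma nneseries_shift (f : nat -> \bar R) : (forall k, 0 <= f k) ->
  \sum_(k <oo) f k = f 0%N + \sum_(k <oo) f k.+1.
Proof.
move=> f0; rewrite nneseries_recl//; congr (_ + _).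
by rewrite -(nneseries_addn 1 f0); apply: eq_eseriesr => k _; rewrite addn1.
Qed.

Lemma queue_law_gf c : (0 <= c)%R -> (r * c < 1)%R ->
  \sum_(k <oo) ((queue_law k)%:E * (c ^+ k)%:E) = ((1 - r) / (1 - r * c))%:E.
Proof.
move=> c0 rc1; apply/cvg_lim => //.
have -> : (fun n => \sum_(0 <= k < n) ((queue_law k)%:E * (c ^+ k)%:E)) =
    EFin \o series (geometric (1 - r)%R (r * c)%R).
  apply/funext => n /=; rewrite /series/= sumEFin; congr EFin.
  by apply: eq_bigr => k _; rewrite /queue_law -mulrA -exprMn.
apply: cvg_EFin; first exact: nearW.
apply: cvg_geometric_series.
by rewrite ger0_norm// mulr_ge0.
Qed.

Lemma queue_law_sum : \sum_(k <oo) (queue_law k)%:E = 1.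
Proof.
have := @queue_law_gf 1%R ler01; rewrite mulr1 => /(_ r1).
rewrite divff; last by rewrite subr_eq0 gt_eqF.
move=> <-; apply: eq_eseriesr => k _.
by rewrite expr1n mule1.
Qed.

Local Notation half := (2^-1 : R)%R.

(** One time unit of Burke's theorem: the new length and the output bit are independent, with the
    laws of the old length and of the input bit. The four series stand for the four pairs of input
    and service. By detailed balance [B] is a shift of [C] and [A] a shift of [D], each with the
    extra term [A 0]. *)
Lemma queue_step_stationary (G : nat * bool -> \bar R) : (forall z, 0 <= G z) ->
  \sum_(k <oo) ((queue_law k)%:E *
     (p%:E * (half%:E * G (queue_step k true true) + (1 - half)%:E * G (queue_step k true false)) +
      (1 - p)%:E * (half%:E * G (queue_step k false true) + (1 - half)%:E * G (queue_step k false false)))) =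
  \sum_(k <oo) ((queue_law k)%:E * (p%:E * G (k, true) + (1 - p)%:E * G (k, false))).
Proof.
move=> G0; pose a k := queue_law k; have a0 k : (0 <= a k)%R := queue_law_ge0 k.
pose A k := (a k * p * half)%:E * G (k, true).
pose C k := (a k * (1 - p) * half)%:E * G (k, false).
pose B k := (a k * p * half)%:E * G (queue_step k true false).
pose D k := (a k * (1 - p) * half)%:E * G (k.+1, true).
have h0 : (0 <= half)%R by rewrite invr_ge0.
have e1 : (1 - half = half :> R)%R by lra.
have c1 k : (0 <= a k * p * half)%R by rewrite mulr_ge0// mulr_ge0.
have c2 k : (0 <= a k * (1 - p) * half)%R by rewrite mulr_ge0// mulr_ge0.
have A0 k : 0 <= A k by rewrite mule_ge0 ?lee_fin.
have B0 k : 0 <= B k by rewrite mule_ge0 ?lee_fin.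
have C0 k : 0 <= C k by rewrite mule_ge0 ?lee_fin.
have D0 k : 0 <= D k by rewrite mule_ge0 ?lee_fin.
have sB : \sum_(k <oo) B k = A 0%N + \sum_(k <oo) C k.
  rewrite nneseries_shift//; congr (_ + _); apply: eq_eseriesr => k _.
  by rewrite /B /C /= /a queue_lawS.
have sA : \sum_(k <oo) A k = A 0%N + \sum_(k <oo) D k.
  rewrite nneseries_shift//; congr (_ + _); apply: eq_eseriesr => k _.
  by rewrite /A /D /= /a queue_lawS.
transitivity (\sum_(k <oo) ((A k + B k) + (D k + C k))).
  apply: eq_eseriesr => k _; rewrite e1.
  rewrite !ge0_muleDr ?mule_ge0 ?adde_ge0 ?mule_ge0 ?lee_fin ?(ltW pgt0)//.
  by rewrite !muleA -!EFinM /A /B /C /D /=.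
transitivity (\sum_(k <oo) ((A k + A k) + (C k + C k))); last first.
  apply: eq_eseriesr => k _.
  rewrite ge0_muleDr ?mule_ge0 ?lee_fin ?(ltW pgt0)//.
  rewrite /A /C -!ge0_muleDl ?lee_fin// -!EFinD !muleA -!EFinM.
  by congr (_%:E * _ + _%:E * _); rewrite -/(a k); field.
rewrite !nneseriesD//; try by move=> *; exact: adde_ge0.
rewrite sB [in RHS]sA {1}sA.
by rewrite -[LHS]addeA -[RHS]addeA [X in _ + X]addeACA.
Qed.

(** After one time unit the length is again stationary and independent of the bit just produced, so
    the run can be restarted from there. *)
Lemma queue_burke t (F : seq bool * nat -> \bar R) : (forall z, 0 <= F z) ->
  \sum_(k <oo) ((queue_law k)%:E * bits_mean p t (fun hs =>
     bits_mean half t (fun ws => F (queue_run k hs ws)))) =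
  \sum_(k <oo) ((queue_law k)%:E * bits_mean p t (fun d => F (d, k))).
Proof.
have half0 : (0 <= half)%R by rewrite invr_ge0.
have half1 : (half <= 1)%R by rewrite invf_le1// ler1n.
have halfC : (0 <= 1 - half)%R by rewrite subr_ge0.
elim: t F => [|t ih] F F0; first by [].
pose V (z : nat * bool) := bits_mean p t (fun hs => bits_mean half t (fun ws =>
  F (z.2 :: (queue_run z.1 hs ws).1, (queue_run z.1 hs ws).2))).
have V0 z : 0 <= V z by apply: bits_mean_ge0 => // hs; exact: bits_mean_ge0.
have VE k h w : bits_mean p t (fun hs => bits_mean half t (fun ws =>
    F (queue_run k (h :: hs) (w :: ws)))) = V (queue_step k h w).
  apply: eq_bits_mean => // hs _; congr bits_mean; apply/funext => ws /=.
  by case: queue_step => k' e /=; case: queue_run.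
have meanD h k : bits_mean p t (fun hs =>
    half%:E * bits_mean half t (fun ws => F (queue_run k (h :: hs) (true :: ws))) +
    (1 - half)%:E * bits_mean half t (fun ws => F (queue_run k (h :: hs) (false :: ws)))) =
    half%:E * V (queue_step k h true) + (1 - half)%:E * V (queue_step k h false).
  rewrite -!VE bits_meanD//; last 2 first.
  - by move=> s; rewrite mule_ge0// bits_mean_ge0.
  - by move=> s; rewrite mule_ge0// bits_mean_ge0.
  by rewrite !bits_meanZ// => s; exact: bits_mean_ge0.
transitivity (\sum_(k <oo) ((queue_law k)%:E *
   (p%:E * (half%:E * V (queue_step k true true) + (1 - half)%:E * V (queue_step k true false)) +
    (1 - p)%:E * (half%:E * V (queue_step k false true) + (1 - half)%:E * V (queue_step k false false))))).
  by apply: eq_eseriesr => k _; rewrite -!meanD.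
rewrite queue_step_stationary//.
pose F' e (z : seq bool * nat) := F (e :: z.1, z.2).
have VF e : \sum_(k <oo) ((queue_law k)%:E * V (k, e)) =
    \sum_(k <oo) ((queue_law k)%:E * bits_mean p t (fun d => F (e :: d, k))).
  by rewrite -(ih (F' e))// => z; exact: F0.
have law0 k : 0 <= (queue_law k)%:E by rewrite lee_fin queue_law_ge0.
have split (G : nat -> bool -> \bar R) : (forall k e, 0 <= G k e) ->
    \sum_(k <oo) ((queue_law k)%:E * (p%:E * G k true + (1 - p)%:E * G k false)) =
    p%:E * \sum_(k <oo) ((queue_law k)%:E * G k true) +
    (1 - p)%:E * \sum_(k <oo) ((queue_law k)%:E * G k false).
  move=> G0; rewrite -!nneseriesZl; try by move=> k _; exact: mule_ge0.
  rewrite -nneseriesD//; try by move=> k _; rewrite !mule_ge0.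
  apply: eq_eseriesr => k _; rewrite ge0_muleDr ?mule_ge0//.
  by rewrite !(muleCA (queue_law k)%:E).
rewrite (split (fun k e => V (k, e)))// !VF.
rewrite -(split (fun k e => bits_mean p t (fun d => F (e :: d, k))))//.
by move=> k e; exact: bits_mean_ge0.
Qed.

(* Mean of [c ^ (total final queue length)] for [n] fair servers in tandem fed by
   [hs] and started from stationary queues. *)
Fixpoint tandem_mean (c : R) (t n : nat) hs : \bar R :=
  if n is n'.+1 then
    \sum_(k <oo) ((queue_law k)%:E * bits_mean half t (fun ws =>
      (c ^+ (queue_run k hs ws).2)%:E * tandem_mean c t n' (queue_run k hs ws).1))
  else 1.

Lemma tandem_mean_ge0 c t n hs : (0 <= c)%R -> 0 <= tandem_mean c t n hs.
Proof.
move=> c0; elim: n hs => //= n ih hs; apply: nneseries_ge0 => k _ _.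
rewrite mule_ge0 ?lee_fin ?queue_law_ge0//; apply: bits_mean_ge0.
- by rewrite invr_ge0.
- by rewrite invf_le1// ler1n.
- by move=> s; rewrite mule_ge0// lee_fin exprn_ge0.
Qed.

(** By Burke's theorem the output of a queue is an input of the same law for the next one,
    independent of the final length. Each queue thus contributes one factor, the generating function
    of the geometric law at [c]. *)
Lemma tandem_meanE c t n : (0 <= c)%R -> (r * c < 1)%R ->
  bits_mean p t (tandem_mean c t n) = (((1 - r) / (1 - r * c)) ^+ n)%:E.
Proof.
move=> c0 rc1; elim: n => [|n ih].
  by rewrite bits_mean_cst.
have g0 hs := tandem_mean_ge0 t n hs c0.
pose F (z : seq bool * nat) := (c ^+ z.2)%:E * tandem_mean c t n z.1.
have F0 z : 0 <= F z by rewrite mule_ge0// lee_fin exprn_ge0.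
have half0 : (0 <= half)%R by rewrite invr_ge0.
have half1 : (half <= 1)%R by rewrite invf_le1// ler1n.
rewrite [tandem_mean c t n.+1]/= bits_mean_series//; last first.
  move=> k s; rewrite mule_ge0 ?lee_fin ?queue_law_ge0//; apply: bits_mean_ge0 => // s'.
  exact: (F0 (queue_run k s s')).
transitivity (\sum_(k <oo) ((queue_law k)%:E * bits_mean p t (fun hs =>
     bits_mean half t (fun ws => F (queue_run k hs ws))))).
  apply: eq_eseriesr => k _; rewrite bits_meanZ ?lee_fin ?queue_law_ge0// => s.
  by apply: bits_mean_ge0 => // s'; exact: (F0 (queue_run k s s')).
rewrite queue_burke//.
transitivity (\sum_(k <oo) ((((1 - r) / (1 - r * c)) ^+ n)%:E *
    ((queue_law k)%:E * (c ^+ k)%:E))).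
  apply: eq_eseriesr => k _; rewrite /F/= bits_meanZ ?lee_fin ?exprn_ge0//.
  by rewrite ih muleA muleC.
rewrite nneseriesZl; last by move=> k _; rewrite mule_ge0// lee_fin ?queue_law_ge0 ?exprn_ge0.
by rewrite queue_law_gf// -EFinM exprSr.
Qed.

Definition bit_step (b : bool) : R := (if b then 1 else -1)%R.
Definition bit_sum ws i : R := (\sum_(b <- take i ws) bit_step b)%R.

Lemma bit_sum0 ws : bit_sum ws 0 = 0%R.
Proof. by rewrite /bit_sum take0 big_nil. Qed.

Lemma bit_sumS b ws i : bit_sum (b :: ws) i.+1 = (bit_step b + bit_sum ws i)%R.
Proof. by rewrite /bit_sum /= big_cons. Qed.

Definition lpp_step (g : nat -> R) ws i : R :=
  (\big[Num.max/g i]_(k < i.+1) (g k + (bit_sum ws i - bit_sum ws k)))%R.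

Definition lpp_steps (g : nat -> R) (wss : seq (seq bool)) : nat -> R :=
  foldl lpp_step g wss.

Fixpoint lines_mean (t n : nat) (F : seq (seq bool) -> \bar R) : \bar R :=
  if n is n'.+1 then
    bits_mean half t (fun ws => lines_mean t n' (fun wss => F (ws :: wss)))
  else F [::].

Let half0 : (0 <= half)%R. Proof. by rewrite invr_ge0. Qed.
Let half1 : (half <= 1)%R. Proof. by rewrite invf_le1// ler1n. Qed.

Lemma le_lines_mean t n (Phi Psi : seq (seq bool) -> \bar R) :
  (forall wss, size wss = n -> (forall ws, ws \in wss -> size ws = t) -> Phi wss <= Psi wss) ->
  lines_mean t n Phi <= lines_mean t n Psi.
Proof.
elim: n Phi Psi => [|n ih] Phi Psi FG /=; first by apply: FG.
apply: le_bits_mean => // ws wst; apply: ih => wss wssn h; apply: FG; first by rewrite /= wssn.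
by move=> ws'; rewrite inE => /predU1P[->//|]; exact: h.
Qed.

Lemma lines_mean_ge0 t n (Phi : seq (seq bool) -> \bar R) :
  (forall s, 0 <= Phi s) -> 0 <= lines_mean t n Phi.
Proof.
by elim: n Phi => //= n ih Phi F0; apply: bits_mean_ge0 => // ws; apply: ih.
Qed.

Lemma lines_mean_lty t n (Phi : seq (seq bool) -> \bar R) :
  (forall s, 0 <= Phi s) -> (forall s, Phi s < +oo) -> lines_mean t n Phi < +oo.
Proof.
elim: n Phi => //= n ih Phi F0 Foo; apply: bits_mean_lty => // ws; last exact: ih.
exact: lines_mean_ge0.
Qed.

(** Conservation: each gain of 2 of the output over the input is stored as one more customer. *)
Lemma queue_stepE k h w :
  (bit_step (queue_step k h w).2 + k.*2%:R = bit_step h + (queue_step k h w).1.*2%:R)%R.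
Proof.
by case: h; case: w; case: k => [|k] //=; rewrite /bit_step ?doubleS -?natr1; ring.
Qed.

Lemma queue_step_ge k h w : (bit_step w <= bit_step (queue_step k h w).2)%R.
Proof. by case: h; case: w; case: k => [|k]; rewrite /bit_step//=; lra. Qed.

Lemma queue_run_final k hs ws : size hs = size ws ->
  (bit_sum (queue_run k hs ws).1 (size hs) + k.*2%:R =
   bit_sum hs (size hs) + (queue_run k hs ws).2.*2%:R)%R.
Proof.
elim: hs ws k => [|h hs ih] [|w ws] k //= [st].
have := queue_stepE k h w; case: queue_step => k' e /= ek.
have := ih ws k' st; case: queue_run => d kf /= dk.
rewrite !bit_sumS; lra.
Qed.

Lemma queue_run_ge_input k hs ws i : size hs = size ws -> (i <= size hs)%N ->
  (bit_sum hs i <= bit_sum (queue_run k hs ws).1 i + k.*2%:R)%R.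
Proof.
elim: hs ws k i => [|h hs ih] [|w ws] k [|i] //= st; rewrite ?bit_sum0 ?add0r//.
case: st => st ihs.
have := queue_stepE k h w; case: queue_step => k' e /= ek.
have := ih ws k' i st ihs; case: queue_run => d kf /= dk.
rewrite !bit_sumS; lra.
Qed.

Lemma queue_run_ge_service k hs ws i j : size hs = size ws -> (i <= j <= size hs)%N ->
  (bit_sum ws j - bit_sum ws i <=
   bit_sum (queue_run k hs ws).1 j - bit_sum (queue_run k hs ws).1 i)%R.
Proof.
elim: hs ws k i j => [|h hs ih] [|w ws] k [|i] [|j] //= st; rewrite ?bit_sum0 ?subrr//.
- case: st => st /= ihs.
  have := queue_step_ge k h w; case: queue_step => k' e /= ek.
  have := ih ws k' 0%N j st ihs; case: queue_run => d kf /= dk.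
  by rewrite !bit_sumS; move: dk; rewrite !bit_sum0; lra.
- case: st => st /= ihs.
  have := queue_step_ge k h w; case: queue_step => k' e /= ek.
  have := ih ws k' i j st ihs; case: queue_run => d kf /= dk.
  by rewrite !bit_sumS; lra.
Qed.

(** The output path, raised by twice the initial length, lies above the input path, and over every
    time interval it grows at least as much as the service. Hence, up to [a], it dominates the last
    passage profile through the new line. *)
Lemma queue_run_lpp_step k hs ws g (a : R) i : size hs = size ws -> (i <= size hs)%N ->
  (forall j, (j <= size hs)%N -> g j <= bit_sum hs j + a)%R ->
  (lpp_step g ws i <= bit_sum (queue_run k hs ws).1 i + (k.*2%:R + a))%R.
Proof.
move=> st ih gh; apply: bigmax_le.
  by have := gh i ih; have := queue_run_ge_input k st ih; lra.
move=> j _; have ji : (j <= i)%N by rewrite -ltnS.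
have jh := leq_trans ji ih.
have := gh j jh; have := queue_run_ge_input k st jh.
have := queue_run_ge_service k st (i := j) (j := i); rewrite ji ih => /(_ isT).
lra.
Qed.

Lemma size_queue_run k hs ws : size hs = size ws ->
  size (queue_run k hs ws).1 = size hs.
Proof.
elim: hs ws k => [|h hs ih] [|w ws] k //= [st].
by case: queue_step => k' e; have := ih ws k' st; case: queue_run => d kf /= ->.
Qed.

(** Each further line is the service of a queue whose output dominates the new profile. The
    comparison costs twice the initial length; conservation trades this for twice the final length,
    which [tandem_mean] weighs with [c = expR (2 * th)]. *)
Lemma tandem_lpp (th a : R) t n hs g : (0 <= th)%R -> size hs = t ->
  (forall j, (j <= t)%N -> g j <= bit_sum hs j + a)%R ->
  lines_mean t n (fun wss => (expR (th * lpp_steps g wss t))%:E) <=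
  (expR (th * (bit_sum hs t + a)))%:E * tandem_mean (expR (th *+ 2)) t n hs.
Proof.
move=> th0; elim: n a hs g => [|n ih] a hs g hst gh /=.
  by rewrite mule1 lee_fin ler_expR ler_wpM2l// gh.
set L := bits_mean _ _ _.
have L0 : 0 <= L.
  by apply: bits_mean_ge0 => // ws; apply: lines_mean_ge0 => wss; rewrite lee_fin expR_ge0.
have c0 : (0 <= expR (th *+ 2))%R by exact: expR_ge0.
(* No queue occurs in [L]; it is averaged over an auxiliary initial length of law [queue_law], each
   value of which gives a valid comparison. *)
have -> : L = \sum_(k <oo) ((queue_law k)%:E * L).
  have : L < +oo.
    apply: bits_mean_lty => // ws.
      by apply: lines_mean_ge0 => wss; rewrite lee_fin expR_ge0.
    apply: lines_mean_lty => wss; first by rewrite lee_fin expR_ge0.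
    by rewrite ltry.
  move: L L0 => [x||]// x0 _.
  transitivity (x%:E * \sum_(k <oo) (queue_law k)%:E).
    by rewrite queue_law_sum mule1.
  rewrite -nneseriesZl; last by move=> k _; rewrite lee_fin queue_law_ge0.
  by apply: eq_eseriesr => k _; rewrite muleC.
have tm0 k ws : 0 <= (expR (th *+ 2) ^+ (queue_run k hs ws).2)%:E *
    tandem_mean (expR (th *+ 2)) t n (queue_run k hs ws).1.
  by rewrite mule_ge0 ?lee_fin ?exprn_ge0// tandem_mean_ge0.
rewrite -nneseriesZl; last first.
  by move=> k _; rewrite mule_ge0 ?lee_fin ?queue_law_ge0// bits_mean_ge0.
apply: lee_nneseries => [k _ _|k _].
  by rewrite mule_ge0// lee_fin queue_law_ge0.
rewrite muleCA lee_wpmul2l ?lee_fin ?queue_law_ge0//.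
rewrite -bits_meanZ ?lee_fin ?expR_ge0//.
apply: le_bits_mean => // ws wst; rewrite muleA -EFinM -expRM_natl -expRD.
have hw : size hs = size ws by rewrite hst wst.
apply: le_trans (ih (k.*2%:R + a)%R (queue_run k hs ws).1 (lpp_step g ws) _ _) _.
- by rewrite size_queue_run.
- move=> j jt; apply: queue_run_lpp_step => //; rewrite hst//.
rewrite lee_wpmul2r ?tandem_mean_ge0// lee_fin ler_expR.
have := queue_run_final k hw; rewrite hst => e.
have dbl m : (m.*2%:R = 2 * m%:R :> R)%R by rewrite -mul2n natrM.
rewrite (_ : bit_sum (queue_run k hs ws).1 t + (k.*2%:R + a) =
  bit_sum hs t + 2 * (queue_run k hs ws).2%:R + a)%R; last first.
  by rewrite -dbl -e; ring.
by rewrite le_eqVlt; apply/orP; left; apply/eqP; ring.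
Qed.

Lemma bit_sum_ge ws i : (- i%:R <= bit_sum ws i)%R.
Proof.
elim: ws i => [|w ws ih] [|i]; rewrite ?bit_sum0 ?oppr0//.
  by rewrite /bit_sum big_nil oppr_le0.
rewrite bit_sumS; have := ih i; rewrite -natr1 /bit_step; case: w; lra.
Qed.

Lemma bits_mean_bit_sum (th : R) t :
  bits_mean p t (fun hs => (expR (- (th * bit_sum hs t)))%:E) =
  ((p * expR (- th) + (1 - p) * expR th) ^+ t)%:E.
Proof.
elim: t => [|t ih] /=; first by rewrite bit_sum0 mulr0 oppr0 expR0 expr0.
have eb b : bits_mean p t (fun s => (expR (- (th * bit_sum (b :: s) t.+1)))%:E) =
    (expR (- (th * bit_step b)))%:E * ((p * expR (- th) + (1 - p) * expR th) ^+ t)%:E.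
  rewrite -ih -bits_meanZ ?lee_fin ?expR_ge0//.
  by apply: eq_bits_mean => // s _; rewrite bit_sumS -EFinM -expRD; congr (expR _)%:E; ring.
rewrite !eb -!EFinM -EFinD; congr EFin.
by rewrite exprS /bit_step mulr1 mulrN1 opprK; ring.
Qed.

(* The initial profile allows only paths that start at [0]. *)
Definition narrow_wedge (t i : nat) : R := if i is 0%N then 0%R else (- t%:R)%R.

(** The narrow wedge lies below every input path [hs], so [tandem_lpp] holds for all of them with
    [a = 0]. The weight [expR (- (th * bit_sum hs t))] cancels the endpoint of the input, and the
    mean over [hs] is then given by Burke's theorem. *)
Lemma lines_mean_bound (th : R) t n :
  (0 <= th)%R -> (r * expR (th *+ 2) < 1)%R ->
  ((p * expR (- th) + (1 - p) * expR th) ^+ t)%:E *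
  lines_mean t n (fun wss => (expR (th * lpp_steps (narrow_wedge t) wss t))%:E) <=
  (((1 - r) / (1 - r * expR (th *+ 2))) ^+ n)%:E.
Proof.
move=> th0 rc1; rewrite -(tandem_meanE t n (expR_ge0 _) rc1) -bits_mean_bit_sum.
set L := lines_mean _ _ _.
have L0 : 0 <= L by apply: lines_mean_ge0 => wss; rewrite lee_fin expR_ge0.
rewrite muleC -bits_meanZ//.
apply: le_bits_mean => // hs hst.
have gh j : (j <= t)%N -> (narrow_wedge t j <= bit_sum hs j + 0)%R.
  rewrite addr0; case: j => [|j] jt /=; first by rewrite bit_sum0.
  by apply: le_trans (bit_sum_ge _ _); rewrite lerN2 ler_nat.
have := tandem_lpp n th0 hst gh; rewrite addr0 -/L => h.
apply: (@le_trans _ _ ((expR (th * bit_sum hs t))%:E *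
    tandem_mean (expR (th *+ 2)) t n hs * (expR (- (th * bit_sum hs t)))%:E)).
  by rewrite lee_wpmul2r// lee_fin expR_ge0.
rewrite muleAC -EFinM -expRD subrr expR0 mul1e//.
Qed.

End tandem_queues.

(** * Splitting a coin flip off a Gaussian variable *)

Section one_step.
Context {R : realType}.
Implicit Types x y t : R.
Local Notation mu := (@lebesgue_measure R).

Lemma expR_ge_quadratic x : 0 <= x -> 1 + x + x ^+ 2 / 2 <= expR x.
Proof.
move=> x0; have cv := is_cvg_series_exp_coeff x.
have nd : nondecreasing_seq (series (exp_coeff x)).
  apply: nondecreasing_series => n _ _.
  by rewrite /exp_coeff/= divr_ge0// exprn_ge0.
have := nondecreasing_cvgn_le nd cv 3.
rewrite /series/= /exp_coeff !big_nat_recr//= big_geq// add0r expr0 expr1.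
by rewrite (_ : 0`! = 1%N)// (_ : 1`! = 1%N)// (_ : 2`! = 2%N)// !divr1.
Qed.

(** The difference of [expR y + expR (- y)] and 2 is the square of [expR (y / 2) - expR (- y / 2)],
    whose absolute value is at least that of [y]. The latter is [half], from an upper bound of
    [expR (- z)] by the inverse of a Taylor polynomial. *)
Lemma cosh_ge y : 2 + y ^+ 2 <= expR y + expR (- y).
Proof.
have half (z : R) : 0 <= z -> 2 * z <= expR z - expR (- z).
  move=> z0; have h := expR_ge_quadratic z0.
  have q0 : 0 < 1 + z + z ^+ 2 / 2 by have := sqr_ge0 z; lra.
  have : expR (- z) <= (1 + z + z ^+ 2 / 2)^-1.
    by rewrite expRN lef_pV2// posrE expR_gt0.
  suff : (1 + z + z ^+ 2 / 2)^-1 <= 1 + z + z ^+ 2 / 2 - 2 * z by lra.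
  rewrite -[X in X <= _]mul1r ler_pdivrMr//.
  rewrite -subr_ge0 (_ : _ - 1 = z ^+ 4 / 4); last by field.
  by rewrite divr_ge0// exprn_even_ge0.
have e (z : R) : expR (z / 2) * expR (z / 2) = expR z by rewrite -expRD -splitr.
have e1 : expR (y / 2) * expR (- y / 2) = 1 by rewrite -expRD mulNr subrr expR0.
suff h : y ^+ 2 <= (expR (y / 2) - expR (- y / 2)) ^+ 2.
  rewrite -(e y) -(e (- y)).
  by move: h; rewrite sqrrB e1 !expr2; lra.
have [y0|y0] := leP 0 y.
  have y20 : 0 <= y / 2 by rewrite divr_ge0.
  by have := half _ y20; rewrite mulNr => h; rewrite ler_sqr ?nnegrE//; lra.
have y20 : 0 <= - y / 2 by rewrite divr_ge0// oppr_ge0 ltW.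
have := half _ y20; rewrite mulNr opprK => h.
rewrite -[X in X <= _]sqrrN -[X in _ <= X]sqrrN ler_sqr ?nnegrE; lra.
Qed.

(** Through [1 - t + t ^+ 2 <= expR (- (t - t ^+ 2))] and the identity
    [(1 + t) * (1 - t + t ^+ 2) = 1 + t ^+ 3]. *)
Lemma expR_le1D t : 0 <= t -> expR (t - t ^+ 2) <= 1 + t.
Proof.
move=> t0; have c : 0 < 1 - t + t ^+ 2 by have := sqr_ge0 (t - 2^-1); rewrite sqrrB; lra.
have h : 1 - t + t ^+ 2 <= expR (- (t - t ^+ 2)).
  by apply: le_trans (expR_ge1Dx _); lra.
rewrite -[t - _]opprK expRN; apply: (@le_trans _ _ (1 - t + t ^+ 2)^-1).
  by rewrite lef_pV2// posrE expR_gt0.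
rewrite -[X in X <= _]mul1r ler_pdivrMr// -subr_ge0.
rewrite (_ : _ - 1 = t ^+ 3); last by ring.
exact: exprn_ge0.
Qed.

Lemma cosh_ge_expR y : 2 * expR (y ^+ 2 / 2 - y ^+ 4 / 4) <= expR y + expR (- y).
Proof.
apply: le_trans (cosh_ge y).
have y0 : 0 <= y ^+ 2 / 2 by rewrite divr_ge0// sqr_ge0.
have := expR_le1D y0; rewrite (_ : (y ^+ 2 / 2) ^+ 2 = y ^+ 4 / 4); last by field.
lra.
Qed.

Lemma pow4_le_expR x : x ^+ 4 <= 24 * (expR x + expR (- x)).
Proof.
have h (z : R) : 0 <= z -> z ^+ 4 <= 24 * expR z.
  move=> z0; have := expR_ge1Dxn 3 z0; rewrite (_ : 4`! = 24%N)//; lra.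
have [x0|x0] := leP 0 x.
  by have := h _ x0; have := expR_ge0 (- x); lra.
have := h (- x); rewrite (_ : (- x) ^+ 4 = x ^+ 4); last by ring.
by have := expR_ge0 x; rewrite oppr_ge0 => ? /(_ (ltW x0)); lra.
Qed.

(** A flip of size [sqrt d] has the mean and the variance of the Gaussian part that it replaces. The
    terms of first order in [d / tau] therefore cancel and the relative error is quadratic. The
    peaks are compared by [expR_le1D], the sum of the two shifted densities by [cosh_ge_expR]. *)
Lemma normal_pdf_step (d tau x : R) : 0 < d -> 0 < tau ->
  normal_pdf 0 (Num.sqrt (tau + d)) x <=
  (normal_pdf 0 (Num.sqrt tau) (x - Num.sqrt d) +
   normal_pdf 0 (Num.sqrt tau) (x + Num.sqrt d)) / 2 +
  normal_pdf 0 (Num.sqrt (tau + d)) x *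
    ((d / tau) ^+ 2 * (2^-1 + (x / Num.sqrt tau) ^+ 4 / 4)).
Proof.
move=> d0 tau0; have td0 : 0 < tau + d by rewrite addr_gt0.
set s := Num.sqrt (tau + d); set t := Num.sqrt tau; set h := Num.sqrt d.
have s0 : 0 < s by rewrite sqrtr_gt0.
have t0 : 0 < t by rewrite sqrtr_gt0.
have h0 : 0 < h by rewrite sqrtr_gt0.
have s2 : s ^+ 2 = tau + d by rewrite sqr_sqrtr// ltW.
have t2 : t ^+ 2 = tau by rewrite sqr_sqrtr// ltW.
have h2 : h ^+ 2 = d by rewrite sqr_sqrtr// ltW.
set q := d / tau; have q0 : 0 < q by rewrite divr_gt0.
set E := q ^+ 2 * _.
set A := normal_pdf 0 s x; set Bm := normal_pdf 0 t (x - h); set Bp := normal_pdf 0 t (x + h).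
have A0 : 0 <= A by exact: normal_pdf_ge0.
suff main : A <= (Bm + Bp) / 2 * expR E.
  have : A * expR (- E) <= (Bm + Bp) / 2.
    by rewrite expRN ler_pdivrMr ?expR_gt0.
  have : A * (1 - E) <= A * expR (- E) by rewrite ler_wpM2l// expR_ge1Dx.
  by lra.
pose y := x * h / tau.
have y2 : y ^+ 2 = q * (x ^+ 2 / tau).
  by rewrite /y /q expr_div_n exprMn h2; field; rewrite gt_eqF.
have y4 : y ^+ 4 = q ^+ 2 * (x / t) ^+ 4.
  rewrite (_ : y ^+ 4 = (y ^+ 2) ^+ 2); last by rewrite -exprM.
  have t4 : t ^+ 4 = tau ^+ 2 by rewrite -t2 -exprM.
  rewrite y2 (expr_div_n x) t4.
  by field; rewrite gt_eqF.
have BE : (Bm + Bp) / 2 = normal_peak t * expR (- x ^+ 2 / (tau *+ 2) - q / 2) *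
    ((expR y + expR (- y)) / 2).
  rewrite /Bm /Bp !normal_pdf0E// t2.
  have -> : - (x - h) ^+ 2 / (tau *+ 2) = - x ^+ 2 / (tau *+ 2) - q / 2 + y.
    by rewrite sqrrB h2 /q /y; field; rewrite gt_eqF.
  have -> : - (x + h) ^+ 2 / (tau *+ 2) = - x ^+ 2 / (tau *+ 2) - q / 2 - y.
    by rewrite sqrrD h2 /q /y; field; rewrite gt_eqF.
  by rewrite !expRD; ring.
have peakE : normal_peak s <= normal_peak t * expR (- q / 2 + q ^+ 2 / 2).
  have sE : s = (s / t) * t by rewrite divfK// gt_eqF.
  rewrite [X in normal_peak X <= _]sE normal_peakZ ?divr_gt0// mulrC.
  rewrite ler_wpM2l ?normal_peak_ge0// -[leRHS]invrK -expRN lef_pV2 ?posrE ?divr_gt0 ?expR_gt0//.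
  rewrite -ler_sqr ?nnegrE ?expR_ge0 ?divr_ge0 ?(ltW s0) ?(ltW t0)//.
  rewrite (expr_div_n s) s2 t2 -expRM_natl (_ : _ * _ = q - q ^+ 2); last by field.
  rewrite (_ : (tau + d) / tau = 1 + q); last by rewrite /q; field; rewrite gt_eqF.
  by rewrite expR_le1D ?ltW.
have fE : - x ^+ 2 / ((tau + d) *+ 2) <= - x ^+ 2 / (tau *+ 2) + y ^+ 2 / 2.
  rewrite y2 /q -subr_ge0.
  rewrite (_ : _ - _ = x ^+ 2 * d ^+ 2 / (2 * tau ^+ 2 * (tau + d))).
    apply: divr_ge0; first by rewrite mulr_ge0 ?sqr_ge0.
    by rewrite mulr_ge0 ?(ltW td0)// mulr_ge0 ?sqr_ge0.
  by field; rewrite !gt_eqF.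
have EE : E = q ^+ 2 / 2 + y ^+ 4 / 4 by rewrite y4 /E; field; rewrite gt_eqF.
rewrite BE EE /A normal_pdf0E// s2.
apply: (@le_trans _ _ (normal_peak t * expR (- q / 2 + q ^+ 2 / 2) *
    expR (- x ^+ 2 / (tau *+ 2) + y ^+ 2 / 2))).
  by rewrite ler_pM ?expR_ge0 ?normal_peak_ge0 ?ler_expR.
have -> : normal_peak t * expR (- q / 2 + q ^+ 2 / 2) * expR (- x ^+ 2 / (tau *+ 2) + y ^+ 2 / 2) =
    normal_peak t * expR (- x ^+ 2 / (tau *+ 2) - q / 2) * expR (y ^+ 2 / 2 - y ^+ 4 / 4) *
    expR (q ^+ 2 / 2 + y ^+ 4 / 4).
  rewrite -(mulrA (normal_peak t)) -expRD -(mulrA (normal_peak t)) -expRD.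
  by rewrite -(mulrA (normal_peak t)) -expRD; congr (_ * expR _); lra.
rewrite ler_wpM2r ?expR_ge0// ler_wpM2l ?mulr_ge0 ?expR_ge0 ?normal_peak_ge0//.
by have := cosh_ge_expR y; lra.
Qed.
End one_step.

Section normal_split.
Context {R : realType}.
Local Notation mu := (@lebesgue_measure R).

Lemma ge0_integral_shift (h : R) (G : R -> R) : continuous G -> (forall x, 0 <= G x) ->
  (\int[mu]_x (G x)%:E = \int[mu]_x (G (x + h))%:E)%E.
Proof.
move=> cG G0.
have dF (x : R) : is_derive x 1 (fun y : R => y + h) 1.
  by rewrite -[X in is_derive _ _ _ X]addr0; apply: is_deriveD.
have F1 : ((fun y : R => y + h)^`())%classic = cst 1.
  by apply/funext => x; rewrite derive1E; exact: (@derive_val _ _ _ _ _ _ _ (dF x)).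
rewrite (@increasing_ge0_integration_by_substitutionT _ (fun y => y + h))//.
- by apply: eq_integral => x _; rewrite F1/= mulr1.
- by move=> x y; rewrite ltrD2r.
- by rewrite F1; exact: cst_continuous.
- by rewrite F1; exact: is_cvg_cst.
- by rewrite F1; exact: is_cvg_cst.
- apply/cvgrNyPle => A; near=> x; rewrite -lerBrDr; near: x; apply: nbhs_ninfty_le; exact: num_real.
- apply/cvgryPge => A; near=> x; rewrite -lerBlDr; near: x; apply: nbhs_pinfty_ge; exact: num_real.
Unshelve. all: by end_near. Qed.

(** Bounds the mean of [2^-1 + (x / sqrt tau) ^+ 4 / 4] under a normal law of variance at most
    [2 * tau]: by [pow4_le_expR] the second summand is at most 6 times a sum of two exponentials,
    each of mean at most [sqrt 2 * expR 2]. *)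
Definition split_error : R := 2^-1 + 12 * (Num.sqrt 2 * expR 2).

Lemma split_error_ge0 : 0 <= split_error.
Proof. by rewrite addr_ge0// mulr_ge0// mulr_ge0// expR_ge0. Qed.

Lemma normal_split (phi : R -> R) (C d tau : R) : continuous phi ->
  (forall x, 0 <= phi x <= C) -> 0 < d <= tau ->
  (\int[normal_prob 0 (Num.sqrt (tau + d))]_x (phi x)%:E <=
   2^-1%:E * (\int[normal_prob 0 (Num.sqrt tau)]_x (phi (x + Num.sqrt d))%:E +
              \int[normal_prob 0 (Num.sqrt tau)]_x (phi (x - Num.sqrt d))%:E) +
   (C * split_error * (d / tau) ^+ 2)%:E)%E.
Proof.
move=> cphi phiC /andP[d0 dt].
have phi0 x : 0 <= phi x by have /andP[] := phiC x.
have C0 : 0 <= C by have /andP[h1 h2] := phiC 0; exact: le_trans h2.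
have tau0 : 0 < tau := lt_le_trans d0 dt.
have td0 : 0 < tau + d by rewrite addr_gt0.
set s := Num.sqrt (tau + d); set t := Num.sqrt tau; set h := Num.sqrt d.
have s0 : 0 < s by rewrite sqrtr_gt0.
have t0 : 0 < t by rewrite sqrtr_gt0.
have s2 : s ^+ 2 = tau + d by rewrite sqr_sqrtr// ltW.
have t2 : t ^+ 2 = tau by rewrite sqr_sqrtr// ltW.
have st x := normal_pdf_step x d0 tau0.
rewrite -/s -/t -/h in st; clearbody s t h.
have mphi : measurable_fun setT phi by exact: continuous_measurable_fun.
have mphiD (c : R) : measurable_fun setT (fun x : R => phi (x + c)).
  by apply: measurableT_comp mphi _; exact: measurable_funD.
have cpdf : continuous (normal_pdf 0 t) by apply: continuous_normal_pdf; rewrite gt_eqF.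
have mpdf (c r : R) : measurable_fun setT (fun x : R => normal_pdf 0 c (x + r)).
  apply: measurableT_comp; first exact: measurable_normal_pdf.
  exact: measurable_funD.
have shift (c : R) : (\int[normal_prob 0 t]_x (phi (x + c))%:E =
    \int[mu]_x (phi x * normal_pdf 0 t (x - c))%:E)%E.
  rewrite ge0_integral_normal; last 2 first.
  - by apply/measurable_EFinP; exact: mphiD.
  - by move=> x; rewrite lee_fin.
  rewrite [RHS](ge0_integral_shift c).
  - by apply: eq_integral => x _; rewrite -EFinM addrK.
  - move=> x; apply: cvgM; first exact: cphi.
    apply: (@continuous_comp _ _ _ (fun x => x - c) (normal_pdf 0 t)); last exact: cpdf.
    by apply: cvgB => //; exact: cvg_cst.
  - by move=> x; rewrite mulr_ge0// normal_pdf_ge0.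
rewrite (shift h) (shift (- h)) ge0_integral_normal; last 2 first.
- exact/measurable_EFinP.
- by move=> x; rewrite lee_fin.
pose P4 (x : R) : R := 2^-1 + (x / t) ^+ 4 / 4.
have P40 x : 0 <= P4 x by rewrite addr_ge0// divr_ge0// exprn_even_ge0.
have mP4 : measurable_fun setT P4.
  apply: measurable_funD => //; apply: measurable_funM => //.
  by apply: measurable_funX; exact: measurable_funM.
have E4 : (\int[normal_prob 0 s]_x (P4 x)%:E <= split_error%:E)%E.
  have mexp (r : R) : measurable_fun setT (fun x : R => (expR (r * x))%:E).
    by apply/measurable_EFinP; apply: measurableT_comp => //; exact: measurable_funM.
  apply: (@le_trans _ _ (\int[normal_prob 0 s]_x
    (2^-1%:E + (6 : R)%R%:E * ((expR (t^-1 * x))%:E + (expR (- t^-1 * x))%:E)))%E).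
    apply: ge0_le_integral => //=.
    - by move=> x _; rewrite lee_fin.
    - by apply/measurable_EFinP; exact: mP4.
    - by apply: emeasurable_funD => //; apply: emeasurable_funM => //; apply: emeasurable_funD; exact: mexp.
    - move=> x _; suff : P4 x <= 2^-1 + 6 * (expR (t^-1 * x) + expR (- t^-1 * x)) by rewrite -lee_fin.
      rewrite /P4 mulNr ![t^-1 * x]mulrC.
      by have := pow4_le_expR (x / t); lra.
  rewrite ge0_integralD//=; last 2 first.
  - by move=> x _; rewrite mule_ge0 ?adde_ge0 ?lee_fin ?expR_ge0.
  - by apply: emeasurable_funM => //; apply: emeasurable_funD; exact: mexp.
  rewrite integral_cst//= ge0_integralZl//=; last 2 first.
  - by apply: emeasurable_funD; exact: mexp.
  - by move=> x _; rewrite adde_ge0 ?lee_fin ?expR_ge0.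
  rewrite ge0_integralD//=; last 2 first.
  - exact: mexp.
  - exact: mexp.
  have b (r : R) : r ^+ 2 = t^-1 ^+ 2 ->
     (\int[normal_prob 0 s]_x (expR (r * x))%:E <= (Num.sqrt 2 * expR 2)%:E)%E.
    move=> r2; apply: le_trans (normal_mgf_bound r s0) _.
    rewrite lee_fin ler_wpM2l// ler_expR r2 exprVn s2 t2.
    by rewrite mulrC ler_pdivrMr//; lra.
  set k := Num.sqrt 2 * expR 2 in b *.
  apply: (@le_trans _ _ (2^-1%:E + (6 : R)%R%:E * (k%:E + k%:E))%E).
    apply: leeD; last by rewrite lee_wpmul2l ?lee_fin// leeD// b// sqrrN.
    rewrite -[leRHS]mule1 lee_wpmul2l ?lee_fin//.
    exact: (@probability_le1 _ _ R (normal_prob 0 s)).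
  suff : 2^-1 + 6 * (k + k) <= split_error by rewrite -lee_fin.
  by rewrite /split_error -/k; lra.
have [e eE e0] : exists2 e, (d / tau) ^+ 2 = e & 0 <= e by exists ((d / tau) ^+ 2); rewrite ?sqr_ge0.
apply: (@le_trans _ _ (\int[mu]_x
   (2^-1%:E * ((phi x * normal_pdf 0 t (x - h))%:E + (phi x * normal_pdf 0 t (x - - h))%:E) +
    (C * e)%:E * ((P4 x)%:E * (normal_pdf 0 s x)%:E)))%E).
  apply: ge0_le_integral => //=.
  - by move=> x _; rewrite -EFinM lee_fin mulr_ge0// normal_pdf_ge0.
  - apply/measurable_EFinP/measurable_funM => //; exact: measurable_normal_pdf.
  - apply/measurable_EFinP; apply: measurable_funD.
      by apply: measurable_funM => //; apply: measurable_funD; apply: measurable_funM => //; exact: mpdf.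
    by do 2 apply: measurable_funM => //; exact: measurable_normal_pdf.
  - move=> x _;
    suff : phi x * normal_pdf 0 s x <=
      2^-1 * (phi x * normal_pdf 0 t (x - h) + phi x * normal_pdf 0 t (x - - h)) +
      C * e * (P4 x * normal_pdf 0 s x) by rewrite -lee_fin.
    rewrite opprK.
    apply: le_trans (ler_wpM2l (phi0 x) (st x)) _.
    rewrite -/(P4 x) eE mulrDr lerD//.
      by rewrite le_eqVlt; apply/orP; left; apply/eqP; field.
    rewrite [leRHS](_ : _ = C * (P4 x * normal_pdf 0 s x * e)); last by ring.
    rewrite [leLHS](_ : _ = phi x * (P4 x * normal_pdf 0 s x * e)); last by ring.
    rewrite ler_wpM2r ?mulr_ge0 ?normal_pdf_ge0//.
    by have /andP[] := phiC x.
have m1 (c : R) : measurable_fun setT (fun x => (phi x * normal_pdf 0 t (x - c))%:E).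
  by apply/measurable_EFinP; apply: measurable_funM => //; exact: mpdf.
have p1 (c x : R) : (0 <= (phi x * normal_pdf 0 t (x - c))%:E)%E.
  by rewrite lee_fin mulr_ge0// normal_pdf_ge0.
have m2 : measurable_fun setT (fun x => (P4 x)%:E * (normal_pdf 0 s x)%:E)%E.
  by apply/measurable_EFinP/measurable_funM => //; exact: measurable_normal_pdf.
rewrite ge0_integralD//=; last 4 first.
- by move=> x _; rewrite mule_ge0// adde_ge0.
- by apply: emeasurable_funM => //; apply: emeasurable_funD; exact: m1.
- by move=> x _; rewrite mule_ge0 ?lee_fin ?mulr_ge0 ?normal_pdf_ge0.
- exact: emeasurable_funM.
rewrite ge0_integralZl//=; last 2 first.
- by apply: emeasurable_funD; exact: m1.
- by move=> x _; rewrite adde_ge0.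
rewrite ge0_integralD//=; [|exact: m1|exact: m1].
rewrite leeD2l// ge0_integralZl ?lee_fin ?mulr_ge0//=; last first.
  by move=> x _; rewrite -EFinM lee_fin mulr_ge0// normal_pdf_ge0.
rewrite -ge0_integral_normal; last 2 first.
- exact/measurable_EFinP.
- by move=> x; rewrite lee_fin.
rewrite eE [C * _ * _]mulrAC [leRHS]EFinM lee_wpmul2l ?lee_fin ?mulr_ge0//.
Qed.
End normal_split.

Section normal_bits.
Context {R : realType}.
Local Notation half := (2^-1 : R).

(** A bound for the mean absolute value of a standard normal variable, from
    [|y| <= expR y + expR (- y)] and [normal_mgf_bound]. *)
Definition lipschitz_error : R := 2 * (Num.sqrt 2 * expR 1).

Lemma lipschitz_continuous (phi : R -> R) (L : R) :
  (forall x y, `|phi x - phi y| <= L * `|x - y|) -> continuous phi.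
Proof.
move=> lip x; have L0 : 0 <= L.
  by have := lip 1 0; rewrite subr0 normr1 mulr1; exact: le_trans.
apply/(@cvgrPdist_le _ R) => e e0; near=> y.
apply: le_trans (lip x y) _; apply: (@le_trans _ _ ((L + 1) * `|x - y|)).
  by rewrite ler_wpM2r// lerDl.
rewrite mulrC -ler_pdivlMr; last by rewrite ltr_wpDl.
near: y; apply/nbhs_ballP; exists (e / (L + 1)) => /=; last by move=> z /ltW.
by rewrite divr_gt0// ltr_wpDl.
Unshelve. all: by end_near. Qed.

Lemma normal_lipschitz (phi : R -> R) (L t : R) : 0 < t -> (forall x, 0 <= phi x) ->
  (forall x y, `|phi x - phi y| <= L * `|x - y|) ->
  (\int[normal_prob 0 t]_x (phi x)%:E <= (phi 0 + L * (lipschitz_error * t))%:E)%E.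
Proof.
move=> t0 phi0 lip; have L0 : 0 <= L.
  by have := lip 1 0; rewrite subr0 normr1 mulr1; exact: le_trans.
have mphi : measurable_fun setT phi.
  by apply: continuous_measurable_fun; exact: lipschitz_continuous lip.
have mexp (r : R) : measurable_fun setT (fun x : R => (expR (r * x))%:E).
  by apply/measurable_EFinP; apply: measurableT_comp => //; exact: measurable_funM.
have b (r : R) : r ^+ 2 = t^-1 ^+ 2 ->
   (\int[normal_prob 0 t]_x (expR (r * x))%:E <= (Num.sqrt 2 * expR 1)%:E)%E.
  move=> r2; apply: le_trans (normal_mgf_bound r t0) _.
  by rewrite lee_fin ler_wpM2l// ler_expR r2 exprVn mulVf// expf_neq0// gt_eqF.
set k := Num.sqrt 2 * expR 1 in b *.
have Lt0 : 0 <= L * t by rewrite mulr_ge0// ltW.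
apply: (@le_trans _ _ (\int[normal_prob 0 t]_x
    ((phi 0)%:E + (L * t)%:E * ((expR (t^-1 * x))%:E + (expR (- t^-1 * x))%:E)))%E).
  apply: ge0_le_integral => //=.
  - by move=> x _; rewrite lee_fin.
  - by apply/measurable_EFinP; exact: mphi.
  - by apply: emeasurable_funD => //; apply: emeasurable_funM => //; apply: emeasurable_funD; exact: mexp.
  - move=> x _; suff : phi x <= phi 0 + (L * t) * (expR (t^-1 * x) + expR (- t^-1 * x)) by rewrite -lee_fin.
    have : phi x <= phi 0 + L * `|x|.
      have := lip x 0; rewrite subr0 => /(le_trans (ler_norm _)); lra.
    move=> /le_trans; apply; rewrite lerD2l -mulrA ler_wpM2l//.
    rewrite -[leLHS]mul1r -(@divff _ t) ?gt_eqF// -mulrA ler_wpM2l ?(ltW t0)//.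
    rewrite -[t^-1 in leLHS]ger0_norm ?invr_ge0 ?(ltW t0)// -normrM mulNr.
    set y := t^-1 * x; have [y0|y0] := leP 0 y.
      by rewrite ger0_norm//; have := expR_ge1Dx y; have := expR_ge0 (- y); lra.
    by rewrite ltr0_norm//; have := expR_ge1Dx (- y); have := expR_ge0 y; lra.
rewrite ge0_integralD//=; last 3 first.
- by move=> x _; rewrite lee_fin.
- by move=> x _; rewrite mule_ge0 ?adde_ge0 ?lee_fin ?expR_ge0.
- by apply: emeasurable_funM => //; apply: emeasurable_funD; exact: mexp.
rewrite integral_cst//= ge0_integralZl//=; last 2 first.
- by apply: emeasurable_funD; exact: mexp.
- by move=> x _; rewrite adde_ge0 ?lee_fin ?expR_ge0.
rewrite ge0_integralD//=; last 2 first.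
- exact: mexp.
- exact: mexp.
apply: (@le_trans _ _ ((phi 0)%:E + (L * t)%:E * (k%:E + k%:E))%E).
  apply: leeD; last by rewrite lee_wpmul2l ?lee_fin// leeD// b// sqrrN.
  rewrite -[leRHS]mule1 lee_wpmul2l ?lee_fin//.
  exact: (@probability_le1 _ _ R (normal_prob 0 t)).
suff : phi 0 + L * t * (k + k) <= phi 0 + L * (lipschitz_error * t) by rewrite -lee_fin.
by rewrite /lipschitz_error -/k; lra.
Qed.

(** The flips are split off one at a time while a Gaussian part of variance at least [tau] is kept
    in reserve. It keeps the density smooth, so that every flip costs at most [(d / tau) ^+ 2] up to
    a constant. *)
Lemma normal_bits_reserve (C L d tau : R) (l : nat) (phi : R -> R) :
  (forall x y, `|phi x - phi y| <= L * `|x - y|) ->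
  (forall x, 0 <= phi x <= C) -> 0 < d <= tau ->
  (\int[normal_prob 0 (Num.sqrt (tau + l%:R * d))]_x (phi x)%:E <=
   bits_mean half l (fun b => \int[normal_prob 0 (Num.sqrt tau)]_x
      (phi (Num.sqrt d * bit_sum b l + x))%:E) +
   (l%:R * (C * split_error * (d / tau) ^+ 2))%:E)%E.
Proof.
move=> lip phiC dt; have /andP[d0 dtau] := dt.
have tau0 : 0 < tau := lt_le_trans d0 dtau.
have C0 : 0 <= C by have /andP[h1 h2] := phiC 0; exact: le_trans h2.
set err := C * split_error * (d / tau) ^+ 2.
have err0 : 0 <= err by rewrite !mulr_ge0 ?split_error_ge0 ?divr_ge0 ?invr_ge0 ?(ltW tau0) ?(ltW d0).
elim: l phi lip phiC => [|l ih] phi lip phiC.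
  rewrite /= !mul0r addr0 adde0 le_eqVlt; apply/orP; left; apply/eqP.
  by apply: eq_integral => x _; rewrite bit_sum0 mulr0 add0r.
rewrite (_ : tau + l.+1%:R * d = tau + l%:R * d + d); last by rewrite -natr1; ring.
have dtl : 0 < d <= tau + l%:R * d.
  by rewrite d0/= (le_trans dtau)// lerDl mulr_ge0// ltW.
apply: le_trans (normal_split (lipschitz_continuous lip) phiC dtl) _.
have sh (c : R) : (\int[normal_prob 0 (Num.sqrt (tau + l%:R * d))]_x (phi (x + c))%:E <=
   bits_mean half l (fun b => \int[normal_prob 0 (Num.sqrt tau)]_x
      (phi (Num.sqrt d * bit_sum b l + x + c))%:E) + (l%:R * err)%:E)%E.
  apply: (ih (fun x => phi (x + c))) => // x y.
  by apply: le_trans (lip _ _) _; rewrite opprD addrACA subrr addr0.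
have e0 : (0 <= (l%:R * err)%:E)%E by rewrite lee_fin mulr_ge0.
have i0 (c : R) b : (0 <= \int[normal_prob 0 (Num.sqrt tau)]_x
      (phi (Num.sqrt d * bit_sum b l + x + c))%:E)%E.
  by apply: integral_ge0 => x _; rewrite lee_fin; have /andP[] := phiC (Num.sqrt d * bit_sum b l + x + c).
have b0 (c : R) : (0 <= bits_mean half l (fun b => \int[normal_prob 0 (Num.sqrt tau)]_x
      (phi (Num.sqrt d * bit_sum b l + x + c))%:E))%E.
  by apply: bits_mean_ge0 => //; rewrite ?invr_ge0 ?invf_le1 ?ler1n.
apply: (@le_trans _ _ ((half%:E * (bits_mean half l (fun b => \int[normal_prob 0 (Num.sqrt tau)]_x
      (phi (Num.sqrt d * bit_sum b l + x + Num.sqrt d))%:E) + (l%:R * err)%:E) +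
   half%:E * (bits_mean half l (fun b => \int[normal_prob 0 (Num.sqrt tau)]_x
      (phi (Num.sqrt d * bit_sum b l + x - Num.sqrt d))%:E) + (l%:R * err)%:E) + err%:E))%E).
  have phi0 x : (0 <= (phi x)%:E)%E by rewrite lee_fin; have /andP[] := phiC x.
  rewrite ge0_muleDr; [|exact: integral_ge0|exact: integral_ge0].
  rewrite leeD ?leeD ?lee_wpmul2l ?lee_fin ?sh//.
  rewrite /err ler_wpM2l ?mulr_ge0 ?split_error_ge0// ler_sqr ?nnegrE ?divr_ge0 ?(ltW d0) ?(ltW tau0)//.
  - rewrite ler_wpM2l ?(ltW d0)// lef_pV2 ?posrE ?lerDl ?mulr_ge0 ?(ltW d0)//.
    by rewrite (lt_le_trans d0)// (andP dtl).2.
  - by rewrite (le_trans (ltW d0))// (andP dtl).2.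
have hh : 1 - half = half by field.
rewrite /= hh !ge0_muleDr//.
rewrite [leLHS](_ : _ = (half%:E * bits_mean half l (fun b => \int[normal_prob 0 (Num.sqrt tau)]_x
      (phi (Num.sqrt d * bit_sum b l + x + Num.sqrt d))%:E) +
   half%:E * bits_mean half l (fun b => \int[normal_prob 0 (Num.sqrt tau)]_x
      (phi (Num.sqrt d * bit_sum b l + x - Num.sqrt d))%:E) +
   ((half * (l%:R * err))%:E + (half * (l%:R * err))%:E + err%:E))%E); last first.
  by rewrite -!EFinM -!addeA; congr (_ + _)%E; rewrite addeCA.
rewrite leeD//; last first.
  suff : half * (l%:R * err) + half * (l%:R * err) + err <= l.+1%:R * err by rewrite -lee_fin.
  by rewrite -[l.+1%:R]natr1 mulrDl mul1r; move: (l%:R * err) (err) => z e; lra.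
rewrite le_eqVlt; apply/orP; left; apply/eqP; congr (_ * _ + _ * _)%E.
  apply: eq_bits_mean => [||b _]; rewrite ?invr_ge0 ?invf_le1 ?ler1n//.
  apply: eq_integral => x _; congr (phi _)%:E.
  by rewrite bit_sumS /bit_step; ring.
apply: eq_bits_mean => [||b _]; rewrite ?invr_ge0 ?invf_le1 ?ler1n//.
apply: eq_integral => x _; congr (phi _)%:E.
by rewrite bit_sumS /bit_step; ring.
Qed.

Definition cell_error (C L d tau : R) (l : nat) : R :=
  L * (lipschitz_error * Num.sqrt tau) + l%:R * (C * split_error * (d / tau) ^+ 2).

(** Finally the reserve is dropped, which a Lipschitz function feels by a multiple of [sqrt tau]. *)
Lemma normal_bits (C L d tau : R) (l : nat) (phi : R -> R) :
  (forall x y, `|phi x - phi y| <= L * `|x - y|) ->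
  (forall x, 0 <= phi x <= C) -> 0 < d <= tau ->
  (\int[normal_prob 0 (Num.sqrt (tau + l%:R * d))]_x (phi x)%:E <=
   bits_mean half l (fun b => (phi (Num.sqrt d * bit_sum b l))%:E) +
   (cell_error C L d tau l)%:E)%E.
Proof.
move=> lip phiC dt; have /andP[d0 dtau] := dt.
have tau0 : 0 < tau := lt_le_trans d0 dtau.
have half0 : 0 <= half by rewrite invr_ge0.
have half1 : half <= 1 by rewrite invf_le1 ?ler1n.
apply: le_trans (normal_bits_reserve l lip phiC dt) _.
rewrite /cell_error EFinD addeA leeD//.
rewrite -(bits_mean_cst half l (L * (lipschitz_error * Num.sqrt tau))).
have L0 : 0 <= L.
  by have := lip 1 0; rewrite subr0 normr1 mulr1; exact: le_trans.
rewrite -bits_meanD//; last 2 first.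
- by move=> b; rewrite lee_fin; have /andP[] := phiC (Num.sqrt d * bit_sum b l).
- by move=> b; rewrite lee_fin !mulr_ge0 ?expR_ge0.
apply: le_bits_mean => // b _.
rewrite -EFinD.
have lipb x y : `|phi (Num.sqrt d * bit_sum b l + x) - phi (Num.sqrt d * bit_sum b l + y)| <= L * `|x - y|.
  by apply: le_trans (lip _ _) _; rewrite opprD addrACA subrr add0r.
have t0 : 0 < Num.sqrt tau by rewrite sqrtr_gt0.
have := @normal_lipschitz (fun x => phi (Num.sqrt d * bit_sum b l + x)) L _ t0 _ lipb.
rewrite addr0; apply => x; by have /andP[] := phiC (Num.sqrt d * bit_sum b l + x).
Qed.
End normal_bits.

Lemma measurable_decoupled (R : realType) d d1 d2 (T : measurableType d)
    (T1 : measurableType d1) (T2 : measurableType d2) (P : probability T R)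
    (X : T -> T1) (Y : T -> T2) (f : T1 * T2 -> \bar R) :
  measurable_fun setT X -> measurable_fun setT Y ->
  measurable_fun setT f -> (forall z, 0 <= f z)%E ->
  measurable_fun setT (fun w => \int[P]_w' f (X w, Y w'))%E.
Proof.
move=> mX mY mf f0.
rewrite (_ : (fun w => _) = fubini_F (law P mY) f \o X).
  by apply: measurableT_comp mX; exact: measurable_fun_fubini_tonelli_F.
apply/funext => w; symmetry.
apply: (@ge0_integral_law _ _ _ _ _ P Y mY (fun y => f (X w, y))) => //.
exact: measurableT_comp.
Qed.

(** * Replacement of Gaussian cells, one at a time *)

Section replacement.
Context {R : realType}.
Local Notation half := (2^-1 : R).
Implicit Types (F : (nat -> R) -> R) (y : nat -> R).

Definition scons (x : R) y (q : nat) : R := if q is q'.+1 then y q' else x.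

Definition pad Q y (q : nat) : R := if (q < Q)%N then y q else 0.

Fixpoint cells_mean (h : R) (l Q : nat) F : \bar R :=
  if Q is Q'.+1 then
    bits_mean half l (fun b => cells_mean h l Q' (fun y => F (scons (h * bit_sum b l) y)))
  else (F (fun=> 0))%:E.

(** Measurability without a chosen sigma-algebra on sequences; in this form it passes to
    [F (scons x _)] by inserting a constant coordinate. *)
Definition measurable_functional F : Prop :=
  forall d (T : measurableType d) (X : nat -> T -> R),
    (forall q, measurable_fun setT (X q)) ->
    measurable_fun setT (fun w => F (fun q => X q w)).

Record test_functional (C L : R) F : Prop := TestFunctional {
  test_bounded : forall y, 0 <= F y <= C ;
  test_lipschitz : forall y y' h, (forall q, `|y q - y' q| <= h) -> `|F y - F y'| <= L * h ;
  test_measurable : measurable_functional F }.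

Lemma test_scons C L F x : test_functional C L F ->
  test_functional C L (fun y => F (scons x y)).
Proof.
case=> b lip mF; split => [y|y y' h yh|d T X mX]; first exact: b.
- apply: lip => -[|q] /=; last exact: yh.
  by rewrite subrr normr0; apply: le_trans (yh 0%N).
- rewrite (_ : (fun w => _) = fun w => F (fun q => (if q is q'.+1 then X q' else cst x) w)).
    by apply: mF => -[].
  by apply/funext => w; congr F; apply/funext => -[].
Qed.

Lemma integral_bits_mean d (T : measurableType d) (P : probability T R) (l : nat)
    (f : seq bool -> T -> \bar R) :
  (forall b, measurable_fun setT (f b)) -> (forall b w, (0 <= f b w)%E) ->
  measurable_fun setT (fun w => bits_mean half l (fun b => f b w)) /\
  (\int[P]_w bits_mean half l (fun b => f b w) =
   bits_mean half l (fun b => \int[P]_w f b w))%E.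
Proof.
have half0 : 0 <= half by rewrite invr_ge0.
have hh : 1 - half = half by field.
elim: l f => [|l ih] f mf f0 //=.
have [m1 e1] := ih (fun b => f (true :: b)) (fun b => mf _) (fun b w => f0 _ w).
have [m2 e2] := ih (fun b => f (false :: b)) (fun b => mf _) (fun b w => f0 _ w).
have b0 c w : (0 <= bits_mean half l (fun b => f (c :: b) w))%E.
  by apply: bits_mean_ge0 => //; rewrite invf_le1 ?ler1n.
rewrite hh; split.
  by apply: emeasurable_funD; apply: emeasurable_funM.
rewrite ge0_integralD//; last 4 first.
- by move=> w _; rewrite mule_ge0.
- exact: emeasurable_funM.
- by move=> w _; rewrite mule_ge0.
- exact: emeasurable_funM.
by rewrite !ge0_integralZl// e1 e2.
Qed.

Variables (d : measure_display) (T : measurableType d) (P : probability T R).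
Variables (X : nat -> T -> R) (C L c tau : R) (l : nat).
Hypothesis mX : forall q, measurable_fun setT (X q).
Hypothesis indX : forall q,
  indep2 P (preimage_sigma (X q)) (process_sigma [set k | (q < k)%N] X).
Hypothesis ctau : 0 < c <= tau.
Hypothesis lawX : forall q (A : set R), measurable A ->
  P (X q @^-1` A) = normal_prob 0 (Num.sqrt (tau + l%:R * c)) A.

Lemma ge0_integral_cell q (f : R -> \bar R) : measurable_fun setT f ->
  (forall x, 0 <= f x)%E ->
  (\int[P]_w f (X q w) = \int[normal_prob 0 (Num.sqrt (tau + l%:R * c))]_x f x)%E.
Proof.
move=> mf f0; have mX' : measurable_fun setT (X q : T -> measurableTypeR R) by exact: mX.
rewrite -(ge0_integral_law P mX')//.
by apply: eq_measure_integral => A mA _; exact: lawX mA.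
Qed.

(** Given the later cells, the integrand is a bounded Lipschitz function of cell [m], which is
    independent of them. [normal_bits] applies to it, the induction handles the rest, and the errors
    of the [Q] cells add up. *)
Lemma cells_replacement F m Q : test_functional C L F ->
  (\int[P]_w (F (pad Q (fun q => X (m + q) w)))%:E <=
   cells_mean (Num.sqrt c) l Q F + (Q%:R * cell_error C L c tau l)%:E)%E.
Proof.
have half0 : 0 <= half by rewrite invr_ge0.
have half1 : half <= 1 by rewrite invf_le1 ?ler1n.
have C0 G : test_functional C L G -> 0 <= C.
  by move=> tG; have /andP[h1 h2] := test_bounded tG (fun=> 0); exact: le_trans h2.
elim: Q m F => [|Q ih] m F tF.
  rewrite /= mul0r adde0 (_ : (fun w => _) = cst (F (fun=> 0))%:E).
    rewrite integral_cst// -[leRHS]mule1 lee_wpmul2l ?probability_le1// lee_fin.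
    by have /andP[] := test_bounded tF (fun=> 0).
  by apply/funext => w /=.
pose Y : T -> process_type [set k | (m < k)%N] X := id.
have mY : measurable_fun setT Y.
  move=> _ A mA; rewrite setTI; apply: process_sigma_measurable mA => k _; exact: mX.
pose f (z : process_type [set k | (m < k)%N] X * R) : \bar R :=
  (F (scons z.2 (pad Q (fun q => X (m.+1 + q) z.1))))%:E.
have mpad (d1 : measure_display) (T1 : measurableType d1) (V : nat -> T1 -> R) (v : T1 -> R) :
    measurable_fun setT v -> (forall q, (q < Q)%N -> measurable_fun setT (V q)) ->
    measurable_fun setT (fun z => F (scons (v z) (pad Q (fun q => V q z)))).
  move=> mv mV.
  rewrite (_ : (fun z => _) = fun z => F (fun q =>
    (if q is q'.+1 then if (q' < Q)%N then V q' else cst 0 else v) z)).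
    by apply: (test_measurable tF) => -[//|q]; case: ifPn => // qQ; exact: mV.
  by apply/funext => z; congr F; apply/funext => -[//|q] /=; rewrite /pad; case: ifP.
have mf : measurable_fun setT f.
  apply/measurable_EFinP; apply: mpad => [|q qQ]; first exact: measurable_snd.
  apply: (@measurableT_comp _ _ _ _ _ _ (X (m.+1 + q) : process_type [set k | (m < k)%N] X -> R)).
    by apply: measurable_process_type => /=; rewrite addSn ltnS leq_addr.
  exact: measurable_fst.
have f0 z : (0 <= f z)%E by rewrite lee_fin; have /andP[] := test_bounded tF (scons z.2 (pad Q (fun q => X (m.+1 + q) z.1))).
have ind A B : measurable A -> measurable B ->
    P (Y @^-1` A `&` X m @^-1` B) = (P (Y @^-1` A) * P (X m @^-1` B))%E.
  move=> mA mB; rewrite setIC muleC; apply: indX; last exact: mA.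
  by exists B => //; rewrite setTI.
have := decoupling mY (mX m) ind mf f0.
rewrite (_ : (fun w => f (Y w, X m w)) = fun w => (F (pad Q.+1 (fun q => X (m + q) w)))%:E); last first.
  apply/funext => w; congr (F _)%:E; apply/funext => -[|q]; rewrite /= /pad /= ?addn0//.
  by rewrite ltnS addnS addSn.
move=> ->.
set err := cell_error C L c tau l.
have err0 : 0 <= err.
  have L0 : 0 <= L.
    have := @test_lipschitz _ _ _ tF (fun=> 0) (fun=> 1) 1.
    by rewrite mulr1 => /(_ _)/(le_trans _); apply => // q; rewrite sub0r normrN normr1.
  have /andP[c0 ct] := ctau; have t0 : 0 <= tau by rewrite ltW// (lt_le_trans c0).
  by rewrite addr_ge0 ?mulr_ge0 ?expR_ge0 ?split_error_ge0 ?divr_ge0 ?invr_ge0 ?(ltW c0)// (C0 _ tF).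
pose g b (w : T) : \bar R := (F (scons (Num.sqrt c * bit_sum b l) (pad Q (fun q => X (m.+1 + q) w))))%:E.
have mg b : measurable_fun setT (g b).
  by apply/measurable_EFinP; apply: mpad => // q _; exact: mX.
have g0 b w : (0 <= g b w)%E.
  by rewrite lee_fin; have /andP[] := test_bounded tF (scons (Num.sqrt c * bit_sum b l) (pad Q (fun q => X (m.+1 + q) w))).
have [mb eb] := integral_bits_mean P l mg g0.
apply: (@le_trans _ _ (\int[P]_w (bits_mean half l (fun b => g b w) + err%:E))%E).
  apply: ge0_le_integral => //.
  - by move=> w _; exact: integral_ge0.
  - exact: (measurable_decoupled P mY (mX m) mf f0).
  - exact: emeasurable_funD.
  move=> w _; pose phi x := F (scons x (pad Q (fun q => X (m.+1 + q) w))).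
  have lip x x' : `|phi x - phi x'| <= L * `|x - x'|.
    by apply: (test_lipschitz tF) => -[|q] //=; rewrite subrr normr0.
  rewrite (@ge0_integral_cell m (fun x => (phi x)%:E)).
  - by apply: normal_bits => // x; exact: (test_bounded tF).
  - by apply/measurable_EFinP; apply: continuous_measurable_fun; exact: lipschitz_continuous lip.
  - by move=> x; rewrite lee_fin; have /andP[] := test_bounded tF (scons x (pad Q (fun q => X (m.+1 + q) w))).
rewrite ge0_integralD//; last by move=> w _; exact: bits_mean_ge0.
have -> : ((Q.+1%:R * err)%:E = (Q%:R * err)%:E + err%:E)%E.
  by rewrite -EFinD -[Q.+1%:R]natr1 mulrDl mul1r.
rewrite eb integral_cst// addeA leeD//; last first.
  by rewrite -[leRHS]mule1 lee_wpmul2l ?probability_le1// lee_fin.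
rewrite /= -(bits_mean_cst half l (Q%:R * err)).
rewrite -bits_meanD//; last 2 first.
- move=> b; rewrite (_ : cells_mean _ _ _ _ = cells_mean (Num.sqrt c) l Q (fun y => F (scons (Num.sqrt c * bit_sum b l) y)))//.
  have := test_scons (Num.sqrt c * bit_sum b l) tF.
  elim: Q {ih f mpad mf f0 ind g mg g0 mb eb} (fun y => F _) => [|Q ih'] G tG /=.
    by rewrite lee_fin; have /andP[] := test_bounded tG (fun=> 0).
  by apply: bits_mean_ge0 => // b'; apply: ih'; exact: test_scons.
- by move=> b; rewrite lee_fin mulr_ge0.
apply: le_bits_mean => // b _; apply: (ih m.+1 (fun y => F (scons (Num.sqrt c * bit_sum b l) y))).
exact: test_scons.
Qed.
End replacement.

(** * Last passage through an array of cells and through words of bits *)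

Section array_lpp.
Context {R : realType}.
Local Notation half := (2^-1 : R).
Implicit Types (F : (nat -> R) -> R) (y : nat -> R).

(* Last passage through the lines 0..N of an array of increments stored row by row. *)
Fixpoint array_lpp (K : nat) y (N i : nat) : R :=
  if N is N'.+1 then
    \big[Num.max/array_lpp K y N' i]_(k < i.+1)
      (array_lpp K y N' k + \sum_(k <= c < i) y (N * K + c)%N)
  else \sum_(0 <= c < i) y c.

(** Cell [q] holds the increment of line [q %/ K] over column [q %% K], so that sums over
    consecutive columns telescope. *)
Lemma array_lpp_grid (x : int * R -> R) m p K N i : (i <= K)%N ->
  array_lpp K (fun q => x (m + 1 + (q %/ K)%:Z, p (q %% K).+1) -
                        x (m + 1 + (q %/ K)%:Z, p (q %% K)%N)) N i =
  grid_lpp x m p N i.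
Proof.
have line a k j : (k <= j <= K)%N ->
   \sum_(k <= c < j) (x (m + 1 + ((a * K + c) %/ K)%:Z, p ((a * K + c) %% K).+1) -
     x (m + 1 + ((a * K + c) %/ K)%:Z, p ((a * K + c) %% K)%N)) =
   x (m + 1 + a%:Z, p j) - x (m + 1 + a%:Z, p k).
  move=> /andP[kj jK].
  rewrite -(telescope_sumr (fun c => x (m + 1 + a%:Z, p c)) kj).
  rewrite !big_nat; apply: eq_bigr => c /andP[_ cj].
  have cK : (c < K)%N by apply: leq_trans jK.
  have K0 : (0 < K)%N by apply: leq_ltn_trans cK.
  by rewrite divnMDl// divn_small// addn0 modnMDl modn_small.
elim: N i => [|N ih] i iK.
  by have := line 0%N 0%N i; rewrite leq0n iK mul0n addr0 /= => <-.
rewrite [array_lpp _ _ _ _]/= ih//=.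
apply: eq_bigr => k _; have ki : (k <= i)%N by rewrite -ltnS.
rewrite ih; last exact: leq_trans iK.
rewrite line; last by rewrite ki.
by rewrite (_ : m + 1 + N.+1%:Z = m + N.+2%:Z)//; lia.
Qed.

(** A path collects at most [K] cells in each of the [N.+1] lines. *)
Lemma array_lpp_lipschitz K y y' h N i : (i <= K)%N -> 0 <= h ->
  (forall q, `|y q - y' q| <= h) ->
  `|array_lpp K y N i - array_lpp K y' N i| <= (N.+1 * K)%:R * h.
Proof.
move=> iK h0 yh.
have sum_le (u v : nat -> R) k j : (k <= j)%N -> (j <= K)%N ->
    (forall q, `|u q - v q| <= h) ->
    \sum_(k <= c < j) u c <= \sum_(k <= c < j) v c + K%:R * h.
  move=> kj jK uv; apply: (@le_trans _ _ (\sum_(k <= c < j) (v c + h))).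
    apply: ler_sum => c _; rewrite -lerBlDl.
    exact: le_trans (ler_norm _) (uv c).
  rewrite big_split/= lerD2l sumr_const_nat.
  rewrite -[X in X <= _]mulr_natl ler_wpM2r// ler_nat.
  by rewrite leq_subLR (leq_trans jK)// leq_addl.
suff le y1 y2 j : (j <= K)%N -> (forall q, `|y1 q - y2 q| <= h) ->
    array_lpp K y1 N j <= array_lpp K y2 N j + (N.+1 * K)%:R * h.
  rewrite ler_norml lerBlDl le// andbT lerNl opprB lerBlDl le// => q.
  by rewrite distrC.
move=> jK yy; elim: N j jK => [|N ih] j jK /=.
  by rewrite mul1n; apply: sum_le.
apply: bigmax_le => [|k _].
  apply: le_trans (ih j jK) _; rewrite lerD//.
    exact: bigmax_ge_id.
  by rewrite ler_wpM2r// ler_nat leq_mul2r leqnSn orbT.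
have kj : (k <= j)%N by rewrite -ltnS.
apply: (@le_trans _ _ (array_lpp K y2 N k + \sum_(k <= c < j) y2 (N.+1 * K + c)%N + (N.+2 * K)%:R * h)).
  rewrite [(N.+2 * K)%N]mulSn addnC natrD mulrDl addrACA lerD//.
    by apply: ih; apply: leq_trans jK.
  by apply: (sum_le (fun c => y1 (N.+1 * K + c)%N) (fun c => y2 (N.+1 * K + c)%N)).
by rewrite lerD2r; apply: (le_bigmax _ (fun k : 'I_j.+1 => array_lpp K y2 N k + \sum_(k <= c < j) y2 (N.+1 * K + c)%N)).
Qed.

Lemma measurable_array_lpp d (T : measurableType d) (X : nat -> T -> R) K N i :
  (forall q, measurable_fun setT (X q)) ->
  measurable_fun setT (fun w => array_lpp K (fun q => X q w) N i).
Proof.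
move=> mX; have ms k j f : measurable_fun setT (fun w => \sum_(k <= c < j) X (f c) w).
  by apply: measurable_sum => c; exact: mX.
elim: N i => [|N ih] i /=; first exact: (ms 0%N i id).
apply: measurable_bigmax => // k.
by apply: measurable_funD => //; exact: ms.
Qed.

Definition fcat K (x y : nat -> R) (q : nat) : R := if (q < K)%N then x q else y (q - K)%N.

Definition bit_cells (h : R) (l : nat) (ws : seq bool) (c : nat) : R :=
  h * (bit_sum ws (c.+1 * l) - bit_sum ws (c * l)).

Lemma bit_sum_cat (b ws : seq bool) i :
  bit_sum (b ++ ws) (size b + i) = bit_sum b (size b) + bit_sum ws i :> R.
Proof. by rewrite /bit_sum takeD drop_size_cat// take_size_cat// take_size big_cat. Qed.

Lemma cells_mean_line h l K Q F :
  cells_mean h l (K + Q) F =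
  bits_mean half (K * l) (fun ws => cells_mean h l Q (fun y => F (fcat K (bit_cells h l ws) y))).
Proof.
have half0 : 0 <= half by rewrite invr_ge0.
have half1 : half <= 1 by rewrite invf_le1 ?ler1n.
elim: K F => [|K ih] F.
  rewrite mul0n add0n /=; congr (cells_mean _ _ _ _); apply/funext => y; congr F.
  by apply/funext => q; rewrite /fcat /= subn0.
rewrite mulSn bits_mean_cat addSn /=; apply: eq_bits_mean => // b bl.
rewrite ih; apply: eq_bits_mean => // ws _.
congr (cells_mean _ _ _ _); apply/funext => y; congr F; apply/funext => -[|q].
  rewrite /fcat /= /bit_cells mul1n mul0n bit_sum0 subr0 -[X in bit_sum (b ++ ws) X]addn0 -[in RHS]bl.
  by rewrite bit_sum_cat bit_sum0 addr0 bl.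
rewrite /fcat /= ltnS subSS; case: ifP => // _.
have e j : bit_sum (b ++ ws) (l + j) = bit_sum b l + bit_sum ws j :> R.
  by rewrite -{1}bl bit_sum_cat bl.
by rewrite /bit_cells !mulSn !e opprD addrACA subrr add0r.
Qed.

Definition lines_cells h l K (wss : seq (seq bool)) : nat -> R :=
  foldr (fun ws y => fcat K (bit_cells h l ws) y) (fun=> 0) wss.

Lemma cells_mean_lines h l K n F :
  cells_mean h l (n * K) F =
  lines_mean (K * l) n (fun wss => (F (lines_cells h l K wss))%:E).
Proof.
have half0 : 0 <= half by rewrite invr_ge0.
have half1 : half <= 1 by rewrite invf_le1 ?ler1n.
elim: n F => [|n ih] F //=.
by rewrite mulSn cells_mean_line; apply: eq_bits_mean => // ws _.
Qed.

Lemma lines_cellsE h l K wss a c : (c < K)%N -> (a < size wss)%N ->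
  lines_cells h l K wss (a * K + c) = bit_cells h l (nth [::] wss a) c.
Proof.
move=> cK; elim: wss a => [|ws wss ih] [|a]//= aw; rewrite /fcat.
  by rewrite mul0n add0n cK.
by rewrite mulSn -addnA ltnNge leq_addr/= addKn ih.
Qed.

Lemma lines_cells_sum h l K wss a k j : (k <= j <= K)%N -> (a < size wss)%N ->
  \sum_(k <= c < j) lines_cells h l K wss (a * K + c) =
  h * (bit_sum (nth [::] wss a) (j * l) - bit_sum (nth [::] wss a) (k * l)).
Proof.
move=> /andP[kj jK] aw.
rewrite -(telescope_sumr (fun c => bit_sum (nth [::] wss a) (c * l)) kj) mulr_sumr.
rewrite !big_nat; apply: eq_bigr => c /andP[_ cj].
by rewrite lines_cellsE// (leq_trans cj).
Qed.

(** Column [k] of the array is bit time [k * l], and on the right a path may jump at all bit times,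
    whence an inequality only. In the first line the term of the narrow wedge at 0 is selected. *)
Lemma array_lpp_bits h l K wss N i t : 0 <= h -> (i <= K)%N -> (N < size wss)%N ->
  array_lpp K (lines_cells h l K wss) N i <=
  h * lpp_steps (narrow_wedge t) (take N.+1 wss) (i * l).
Proof.
move=> h0; elim: N i => [|N ih] i iK Nw.
  rewrite /= -[X in X <= _]/(\sum_(0 <= c < i) lines_cells h l K wss (0 * K + c)).
  rewrite lines_cells_sum// mul0n bit_sum0 subr0 ler_wpM2l//.
  case: wss Nw => //= ws wss _; rewrite take0 /lpp_steps /= /lpp_step.
  apply: le_trans (le_bigmax _ (fun k : 'I_(i * l).+1 => narrow_wedge t k + (bit_sum ws (i * l) - bit_sum ws k)) ord0).
  by rewrite /= bit_sum0 subr0 add0r.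
rewrite (take_nth [::])// /lpp_steps -cats1 foldl_cat /=.
set G := foldl _ _ _; have ihG j : (j <= K)%N -> array_lpp K (lines_cells h l K wss) N j <= h * G (j * l)%N.
  by move=> jK; apply: ih => //; apply: ltnW.
rewrite {1}/lpp_step; apply: bigmax_le => [|k _].
  apply: le_trans (ihG i iK) _; rewrite ler_wpM2l//.
  exact: bigmax_ge_id.
have ki : (k <= i)%N by rewrite -ltnS.
rewrite lines_cells_sum ?ki//.
apply: le_trans (lerD (ihG k (leq_trans ki iK)) (lexx _)) _.
rewrite -mulrDr ler_wpM2l//.
have kl : (k * l < (i * l).+1)%N by rewrite ltnS leq_mul2r ki orbT.
exact: (le_bigmax _ (fun k : 'I_(i * l).+1 => G k + (bit_sum (nth [::] wss N.+1) (i * l) - bit_sum (nth [::] wss N.+1) k)) (Ordinal kl)).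
Qed.
End array_lpp.

(** * The queueing bound for weak drift and its Brownian limit *)

Section burke_bound.
Context {R : realType}.

Lemma inv_le_expR (z : R) : z < 1 -> (1 - z)^-1 <= expR (z / (1 - z)).
Proof.
move=> z1; have z0 : 0 < 1 - z by rewrite subr_gt0.
apply: le_trans (expR_ge1Dx _).
by rewrite le_eqVlt; apply/orP; left; apply/eqP; field; rewrite gt_eqF.
Qed.

(** With input drift [a = mu * rho] and exponent [th = s * rho], this is
    [a * th + a * th ^+ 2 - th ^+ 2 / 2], an upper bound for 1 minus the mean of
    [expR (- th * step)] for one input step. *)
Definition drift_defect (s mu rho : R) : R :=
  rho ^+ 2 * (s * mu - s ^+ 2 / 2 + mu * s ^+ 2 * rho).

(** [lines_mean_bound] at [p = (1 + mu * rho) / 2] and [th = s * rho]. When [rho] tends to 0, twice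
    the geometric length times [rho] becomes exponential of rate [mu], whose exponential moment at
    [s] is [(1 - s / mu)^-1]; this explains the power of [n]. *)
Lemma lines_mean_drift (s mu rho : R) t n :
  0 < s -> s < mu -> 0 < rho -> mu * rho <= 2^-1 -> s / mu + s * rho < 1 ->
  drift_defect s mu rho < 1 ->
  (lines_mean t n (fun wss => (expR (s * rho * lpp_steps (narrow_wedge t) wss t))%:E) <=
   (expR (t%:R * (drift_defect s mu rho / (1 - drift_defect s mu rho))) *
    (1 - s / mu - s * rho) ^- n)%:E)%E.
Proof.
move=> s0 smu rho0 a2 g1 z1; set z := drift_defect s mu rho.
have mu0 : 0 < mu by apply: lt_trans smu.
set a := mu * rho; set th := s * rho.
have a0 : 0 < a by rewrite mulr_gt0.
have th0 : 0 < th by rewrite mulr_gt0.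
have tha : th < a by rewrite ltr_pM2r.
have z0 : 0 < 1 - z by rewrite subr_gt0.
have thmu : th / a = s / mu by rewrite /th /a; field; rewrite !gt_eqF.
have g0 : 0 < 1 - s / mu - th by rewrite -/th in g1; lra.
have g0' : 0 < a - th - a * th.
  have -> : a - th - a * th = a * (1 - s / mu - th) by rewrite -thmu; field; rewrite gt_eqF.
  exact: mulr_gt0.
pose p := (1 + a) / 2; pose r := (1 - p) / p.
have p0 : 0 < p by rewrite divr_gt0//; lra.
have ra : r = (1 - a) / (1 + a) by rewrite /r /p; field; rewrite !gt_eqF//; lra.
have e2 : expR (th *+ 2) <= (1 - th *+ 2)^-1.
  rewrite -[leLHS]invrK -expRN lef_pV2 ?posrE ?expR_gt0//; last first.
    by rewrite -/a in a2; lra.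
  by apply: le_trans (expR_ge1Dx _); lra.
have th2 : 0 < 1 - th *+ 2 by rewrite -/a in a2; lra.
have r0 : 0 <= r by rewrite ra divr_ge0//; rewrite -/a in a2; lra.
have den : (a - th - a * th) *+ 2 / ((1 + a) * (1 - th *+ 2)) <= 1 - r * expR (th *+ 2).
  apply: (@le_trans _ _ (1 - r * (1 - th *+ 2)^-1)); last first.
    by rewrite lerD2l lerN2 ler_wpM2l.
  rewrite ra le_eqVlt; apply/orP; left; apply/eqP; field.
  by rewrite !gt_eqF//; lra.
have den0 : 0 < (a - th - a * th) *+ 2 / ((1 + a) * (1 - th *+ 2)).
  by rewrite divr_gt0 ?mulrn_wgt0// mulr_gt0//; lra.
have re1 : r * expR (th *+ 2) < 1 by rewrite -subr_gt0; exact: lt_le_trans den.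
have p1 : p <= 1 by rewrite -/a in a2; rewrite /p; lra.
have p2 : 2^-1 < p by rewrite /p; lra.
have := lines_mean_bound p1 p2 t n (ltW th0) re1.
set LM := lines_mean _ _ _; set be := p * _ + _ => h.
have be1 : 1 - z <= be.
  have beE : be = (expR th + expR (- th)) / 2 - a * ((expR th - expR (- th)) / 2).
    by rewrite /be /p; field.
  have c := cosh_ge th.
  have sh : (expR th - expR (- th)) / 2 <= th + th ^+ 2.
    have e1 : expR th <= (1 - th)^-1.
      rewrite -[leLHS]invrK -expRN lef_pV2 ?posrE ?expR_gt0//; last by lra.
      by apply: le_trans (expR_ge1Dx _); lra.
    have e3 := expR_ge1Dx (- th).
    have : (1 - th)^-1 <= 1 + th + 2 * th ^+ 2.
      rewrite -[leLHS]mul1r ler_pdivrMr; last by lra.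
      rewrite -subr_ge0 (_ : _ - 1 = th ^+ 2 * (1 - th *+ 2)); last by ring.
      by rewrite mulr_ge0 ?sqr_ge0// ltW.
    by lra.
  have := ler_wpM2l (ltW a0) sh.
  have -> : z = a * th + a * th ^+ 2 - th ^+ 2 / 2 by rewrite /z /drift_defect /a /th; field.
  by rewrite beE; lra.
have LM0 : (0 <= LM)%E by apply: lines_mean_ge0 => w; rewrite lee_fin expR_ge0.
have bet : (((1 - z) ^+ t)%:E * LM <= (((1 - r) / (1 - r * expR (th *+ 2))) ^+ n)%:E)%E.
  apply: le_trans h; rewrite lee_wpmul2r// lee_fin lerXn2r// nnegrE ltW//.
  exact: lt_le_trans be1.
have LME : LM = (((1 - z) ^- t)%:E * (((1 - z) ^+ t)%:E * LM))%E.
  by rewrite muleA -EFinM mulVf ?mul1e// gt_eqF// exprn_gt0.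
rewrite LME EFinM lee_pmul//.
- by rewrite lee_fin invr_ge0 exprn_ge0// ltW.
- by rewrite mule_ge0// lee_fin exprn_ge0// ltW.
- rewrite lee_fin -exprVn expRM_natl lerXn2r ?nnegrE ?expR_ge0 ?inv_le_expR//.
  by rewrite invr_ge0 ltW.
apply: le_trans bet _; rewrite lee_fin -exprVn lerXn2r ?nnegrE//.
- by rewrite divr_ge0 ?subr_ge0 ?(ltW re1)// ra ler_pdivrMr; lra.
- by rewrite invr_ge0 ltW.
have -> : 1 - r = a *+ 2 / (1 + a) by rewrite ra; field; rewrite gt_eqF//; lra.
rewrite ler_pdivrMr; last by rewrite subr_gt0.
apply: le_trans (ler_wpM2l _ den); last by rewrite invr_ge0 ltW.
rewrite -thmu -subr_ge0.
have n1 : a - th - th * a != 0 by rewrite mulrC in g0'; rewrite mulrC gt_eqF//; lra.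
rewrite (_ : _ - _ = a *+ 2 / (1 + a) * (th *+ 2 / (1 - th *+ 2))); last first.
  by field; rewrite !gt_eqF//; lra.
by rewrite mulr_ge0 ?divr_ge0//; lra.
Qed.
End burke_bound.

Lemma array_lpp_ext (R : realType) K (y y' : nat -> R) N i : (i <= K)%N ->
  (forall q, (q < N.+1 * K)%N -> y q = y' q) -> array_lpp K y N i = array_lpp K y' N i.
Proof.
elim: N i => [|N ih] i iK yy /=.
  by rewrite !big_nat; apply: eq_bigr => c /andP[_ ci]; rewrite yy// mul1n (leq_trans ci).
have yy' q : (q < N.+1 * K)%N -> y q = y' q.
  by move=> qN; apply: yy; rewrite (leq_trans qN)// leq_mul2r leqnSn orbT.
rewrite (ih i)//; apply: eq_bigr => k _; rewrite (ih k)//; last first.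
  by rewrite (leq_trans _ iK)// -ltnS.
congr (_ + _); rewrite !big_nat; apply: eq_bigr => c /andP[_ ci]; apply: yy.
by rewrite [(N.+2 * K)%N]mulSn [(K + _)%N]addnC ltn_add2l (leq_trans ci).
Qed.

(** Below the level [C] the slope of the exponential is at most [C]. Truncation yields the bounded
    Lipschitz functionals that the replacement asks for. *)
Lemma truncated_expR_lipschitz (R : realType) (C x y : R) : 0 <= C ->
  `|Num.min (expR x) C - Num.min (expR y) C| <= C * `|x - y|.
Proof.
move=> C0; wlog xy : x y / x <= y.
  by move=> h; have [xy|/ltW yx] := leP x y; [exact: h|rewrite distrC (distrC x); exact: h].
have mo : Num.min (expR x) C <= Num.min (expR y) C.
  by rewrite le_min !ge_min ler_expR xy lexx !orbT.
rewrite distrC (distrC x) !ger0_norm ?subr_ge0//.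
have mC : Num.min (expR y) C <= C by rewrite ge_min lexx orbT.
have m0 : 0 <= Num.min (expR y) C by rewrite le_min expR_ge0.
have Cyx : 0 <= C * (y - x) by rewrite mulr_ge0// subr_ge0.
have [xC|xC] := leP (expR x) C; last by lra.
have : Num.min (expR y) C * expR (x - y) <= expR x.
  by rewrite expRD expRN mulrCA -[leRHS]mulr1 ler_wpM2l ?expR_ge0// ler_pdivrMr ?expR_gt0// mul1r ge_min lexx.
have := ler_wpM2l m0 (expR_ge1Dx (x - y)).
have := ler_wpM2r (_ : 0 <= y - x) mC.
rewrite subr_ge0 => /(_ xy); lra.
Qed.

Section lpp_mgf.
Context {R : realType} {d : measure_display} {T : measurableType d}.
Variable P : probability T R.
Variable W : int -> R -> T -> R.
Hypothesis WW : two_sided_brownian_family P W.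
Variables (m : int) (N : nat) (u v : R).
Hypothesis uv : u < v.
Variables (s mu : R).
Hypotheses (s0 : 0 < s) (smu : s < mu).

(** The bound of a tandem of Brownian queues: the first factor is the inverse of the mean of
    [expR (- s * input)] for an input with drift [mu] over [[u, v]], the second comes from [N.+1]
    exponential queue lengths of rate [mu]. *)
Definition lpp_mgf_bound : R :=
  expR ((v - u) * (s * mu - s ^+ 2 / 2)) * (1 - s / mu) ^- N.+1.

Let mu0 : 0 < mu. Proof. exact: lt_trans smu. Qed.

Definition drift_bound (rho : R) : R :=
  expR ((v - u) * ((s * mu - s ^+ 2 / 2 + mu * s ^+ 2 * rho) /
    (1 - drift_defect s mu rho))) * (1 - s / mu - s * rho) ^- N.+1.

Lemma drift_bound_near (e : R) : 0 < e -> exists2 rho0 : R, 0 < rho0 &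
  forall rho, 0 < rho < rho0 -> [/\ mu * rho <= 2^-1, s / mu + s * rho < 1,
    drift_defect s mu rho < 1 & drift_bound rho <= lpp_mgf_bound + e].
Proof.
move=> e0.
have id0 : (rho : R) @[rho --> 0] --> (0 : R) by exact: cvg_id.
have c1 : mu * rho @[rho --> (0 : R)] --> mu * 0 by apply: cvgMr.
have c2 : s / mu + s * rho @[rho --> (0 : R)] --> s / mu + s * 0.
  by apply: cvgD; [exact: cvg_cst|exact: cvgMr].
have c3 : s * mu - s ^+ 2 / 2 + mu * s ^+ 2 * rho @[rho --> (0 : R)] -->
    s * mu - s ^+ 2 / 2 + mu * s ^+ 2 * 0.
  by apply: cvgD; [exact: cvg_cst|exact: cvgMr].
have c4 : drift_defect s mu rho @[rho --> (0 : R)] --> drift_defect s mu 0.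
  by apply: cvgM c3; rewrite !expr2; apply: cvgM.
have d0 : drift_defect s mu 0 = 0 by rewrite /drift_defect expr0n mul0r.
have smu1 : s / mu < 1 by rewrite ltr_pdivrMr// mul1r.
have c5 : drift_bound rho @[rho --> (0 : R)] --> drift_bound 0.
  have c6 : (v - u) * ((s * mu - s ^+ 2 / 2 + mu * s ^+ 2 * rho) /
      (1 - drift_defect s mu rho)) @[rho --> (0 : R)] -->
      (v - u) * ((s * mu - s ^+ 2 / 2 + mu * s ^+ 2 * 0) / (1 - drift_defect s mu 0)).
    apply: cvgMr; apply: cvgM => //; apply: cvgV; first by rewrite d0 subr0 oner_eq0.
    by apply: cvgB => //; exact: cvg_cst.
  have c7 : 1 - s / mu - s * rho @[rho --> (0 : R)] --> 1 - s / mu - s * 0.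
    by apply: cvgB; [exact: cvg_cst|exact: cvgMr].
  apply: cvgM; first by apply: (cvg_comp _ _ c6); exact: continuous_expR.
  apply: cvgV; first by rewrite expf_neq0// mulr0 subr0 gt_eqF// subr_gt0.
  exact: (cvg_comp _ (fun x : R => x ^+ N.+1) c7 (@exprn_continuous _ _ _)).
have b0 : drift_bound 0 = lpp_mgf_bound.
  by rewrite /drift_bound /lpp_mgf_bound d0 !mulr0 !subr0 addr0 divr1.
have [rho0 /= r0 h] : exists2 r : R, 0 < r & forall rho, `|0 - rho| < r ->
    [/\ mu * rho <= 2^-1, s / mu + s * rho < 1, drift_defect s mu rho < 1 &
     drift_bound rho <= lpp_mgf_bound + e].
  apply/(@nbhs_ballP R R); near=> rho; split.
  - apply/ltW; near: rho; apply: (cvgr_lt (mu * 0)) => //; by rewrite mulr0 invr_gt0.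
  - near: rho; apply: (cvgr_lt (s / mu + s * 0)) => //; by rewrite mulr0 addr0.
  - near: rho; apply: (cvgr_lt (drift_defect s mu 0)) => //; by rewrite d0.
  - apply/ltW; near: rho; apply: (cvgr_lt (drift_bound 0)) => //.
    by rewrite b0 ltrDl.
exists rho0 => // rho /andP[rho_gt0 rho_lt]; apply: h.
by rewrite sub0r normrN gtr0_norm.
Unshelve. all: by end_near. Qed.

(** First [tau] is made small against [QL], then the number [l] of flips large against
    [1 / tau ^+ 2]: since [c] is of order [1 / l], so is the total splitting error. *)
Lemma cell_parameters (K e QL QC rho0 : R) : 0 < K -> 0 < e -> 0 <= QL -> 0 <= QC -> 0 < rho0 ->
  exists (tau c : R) (l : nat), [/\ 0 < c <= tau, tau + l%:R * c = K, Num.sqrt c < rho0,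
    QL * Num.sqrt tau <= e & QC * (l%:R * (c / tau) ^+ 2) <= e].
Proof.
move=> K0 e0 QL0 QC0 r0.
have QL1 : 0 < QL + 1 by rewrite ltr_wpDl.
pose x := e / (QL + 1); have x0 : 0 < x by rewrite divr_gt0.
pose tau := Num.min (K / 2) (x ^+ 2).
have tau0 : 0 < tau by rewrite lt_min exprn_gt0// divr_gt0.
have tauK : tau < K.
  rewrite (@le_lt_trans _ _ (K / 2))//; first by rewrite ge_min lexx.
  by rewrite ltr_pdivrMr// ltr_pMr// ltr1n.
have Kt0 : 0 < K - tau by rewrite subr_gt0.
pose A := (K - tau) / tau + (K - tau) / rho0 ^+ 2 + QC * (K - tau) ^+ 2 / (e * tau ^+ 2) + 1.
have A1 : 0 <= (K - tau) / tau by rewrite divr_ge0 ?ltW.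
have A2 : 0 <= (K - tau) / rho0 ^+ 2 by rewrite divr_ge0 ?sqr_ge0 ?ltW.
have A3 : 0 <= QC * (K - tau) ^+ 2 / (e * tau ^+ 2).
  exact: (divr_ge0 (mulr_ge0 QC0 (sqr_ge0 _)) (mulr_ge0 (ltW e0) (sqr_ge0 _))).
have A0 : 0 <= A by rewrite /A; lra.
pose l := (Num.truncn A).+1.
have Al : A < l%:R by have /andP[] := truncn_itv A0.
have l0 : 0 < l%:R :> R by rewrite ltr0n.
exists tau, ((K - tau) / l%:R), l; split.
- rewrite divr_gt0//= ler_pdivrMr// mulrC -ler_pdivrMr//; rewrite /A in Al; lra.
- by rewrite mulrC divfK ?gt_eqF// addrC subrK.
- rewrite -[ltRHS]gtr0_norm// -sqrtr_sqr ltr_sqrt ?exprn_gt0//.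
  rewrite ltr_pdivrMr// mulrC -ltr_pdivrMr ?exprn_gt0//; rewrite /A in Al; lra.
- apply: (@le_trans _ _ (QL * x)).
    rewrite ler_wpM2l// -[leRHS]gtr0_norm// -sqrtr_sqr ler_sqrt ?sqr_ge0//.
    by rewrite ge_min lexx orbT.
  by rewrite /x mulrCA -[leRHS]mulr1 ler_wpM2l ?(ltW e0)// ler_pdivrMr//; lra.
- rewrite [leLHS](_ : _ = QC * (K - tau) ^+ 2 / (e * tau ^+ 2) / l%:R * e); last first.
    by field; rewrite !gt_eqF.
  rewrite -[leRHS]mul1r ler_wpM2r ?(ltW e0)// ler_pdivrMr// mul1r; rewrite /A in Al; lra.
Qed.

Lemma grid_cells_indep (t : nat -> R) (K : nat) : (0 < K)%N ->
  {homo t : i j / (i <= j)%N >-> i <= j} ->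
  let X q := increment W t (m + 1 + (q %/ K)%:Z, (q %% K)%N) in
  forall q, indep2 P (preimage_sigma (X q)) (process_sigma [set k | (q < k)%N] X).
Proof.
move=> K0 ht X q.
pose J q := (m + 1 + (q %/ K)%:Z, (q %% K)%N).
have Jinj : injective J.
  move=> a b [ab1 ab2]; rewrite (divn_eq a K) (divn_eq b K) ab2.
  by have -> : (a %/ K)%N = (b %/ K)%N by move: ab1; lia.
apply: (@indep2_sub _ _ _ P <<s \bigcup_(i in [set J q]) preimage_sigma (increment W t i) >>
  <<s \bigcup_(i in J @` [set k | (q < k)%N]) preimage_sigma (increment W t i) >>).
- by move=> A XA; apply: sub_sigma_algebra; exists (J q).
- apply: g_sigma_mono => A [k /= qk XA]; apply: sub_sigma_algebra.
  by exists (J k) => //; exists k.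
apply: mutual_indep_group.
- by move=> i; exact: preimage_sigmaT.
- by move=> i; exact: preimage_sigmaI.
- by move=> i; apply: preimage_sigma_measurable; exact: increment_measurable WW.
- exact: increment_indep WW ht.
- rewrite -subset0 => _ /= [-> [k qk /Jinj kq]].
  by rewrite kq /= ltnn in qk.
Qed.

(** The error [e] is split in three: the distance of [drift_bound] from its limit, the Gaussian
    reserves that are dropped, and the coin flips. *)
Lemma grid_mgf_truncated (k : nat) (C : R) : 0 < C ->
  (\int[P]_w (Num.min (expR (s * grid_lpp (fun q => W q.1 q.2 w) m
     (uniform_grid u v k) N k.+1)) C)%:E <= lpp_mgf_bound%:E)%E.
Proof.
move=> C0; set K := k.+1; set t := uniform_grid u v k.
have K0 : 0 < K%:R :> R by rewrite ltr0n.
have ht : {homo t : i j / (i <= j)%N >-> i <= j} by apply: uniform_grid_homo; exact: ltW.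
have vu0 : 0 < v - u by rewrite subr_gt0.
pose X q := increment W t (m + 1 + (q %/ K)%:Z, (q %% K)%N).
pose F (y : nat -> R) := Num.min (expR (s * array_lpp K y N K)) C.
pose L := C * (s * (N.+1 * K)%:R).
have L0 : 0 <= L by rewrite !mulr_ge0// ltW.
pose Q := (N.+1 * K)%N.
have mX q : measurable_fun setT (X q) by exact: increment_measurable WW.
have tF : test_functional C L F.
  split => [y|y y' h yh|d' T' Y mY].
  - by rewrite le_min expR_ge0 (ltW C0)/= ge_min lexx orbT.
  - have h0 : 0 <= h by apply: le_trans (yh 0%N).
    apply: le_trans (truncated_expR_lipschitz _ _ (ltW C0)) _.
    rewrite -mulrBr normrM gtr0_norm// /L -!mulrA ler_wpM2l ?(ltW C0)// ler_wpM2l ?(ltW s0)//.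
    exact: array_lpp_lipschitz.
  - apply: measurable_minr => //; apply: measurableT_comp => //.
    by apply: measurable_funM => //; exact: measurable_array_lpp.
have gE w : Num.min (expR (s * grid_lpp (fun q => W q.1 q.2 w) m t N K)) C = F (pad Q (X^~ w)).
  rewrite /F -(@array_lpp_grid _ _ _ _ K)//; congr (Num.min (expR (_ * _)) _).
  by apply: array_lpp_ext => // q qQ; rewrite /pad qQ.
under eq_integral do rewrite gE.
apply/lee_addgt0Pr => e e0.
have e3 : 0 < e / 3 by rewrite divr_gt0.
have [rho0 r0 hr] := drift_bound_near e3.
have cell0 : 0 < (v - u) / K%:R by rewrite divr_gt0.
have C00 := ltW C0.
have [||tau [c [l [ct tlc cr e1 e2]]]] := @cell_parameters ((v - u) / K%:R) (e / 3)
  (Q%:R * (L * lipschitz_error)) (Q%:R * (C * split_error)) rho0 cell0 e3 _ _ r0.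
- by rewrite mulr_ge0// mulr_ge0// /lipschitz_error mulr_ge0// mulr_ge0// expR_ge0.
- by rewrite mulr_ge0// mulr_ge0 ?split_error_ge0.
have /andP[c0 ctau] := ct.
have lawX q (A : set R) : measurable A ->
    P (X q @^-1` A) = normal_prob 0 (Num.sqrt (tau + l%:R * c)) A.
  move=> mA; rewrite tlc; set j := (m + 1 + (q %/ K)%:Z).
  have lt1 : t (q %% K)%N < t (q %% K).+1.
    by rewrite /t /uniform_grid ltrD2l ltr_pM2l// ltr_pM2r ?invr_gt0// ltr_nat.
  have := brownian_gaussian (WW.1 j) lt1 mA => ->.
  congr (normal_prob 0 (Num.sqrt _) A); rewrite /t /uniform_grid -[(q %% K).+1%:R]natr1 -/K.
  by field; rewrite pnatr_eq0.
have main := cells_replacement mX (grid_cells_indep (ltn0Sn k) ht) ct lawX 0 Q tF.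
apply: le_trans main _.
have rc0 : 0 < Num.sqrt c by rewrite sqrtr_gt0.
have [|a2 g1 z1 db] := hr (Num.sqrt c); first by rewrite rc0.
have cE : Num.sqrt c ^+ 2 = c by rewrite sqr_sqrtr// ltW.
have bits : (cells_mean (Num.sqrt c) l Q F <= (drift_bound (Num.sqrt c))%:E)%E.
  rewrite cells_mean_lines.
  apply: le_trans (_ : _ <= (expR ((K * l)%:R * (drift_defect s mu (Num.sqrt c) /
     (1 - drift_defect s mu (Num.sqrt c)))) * (1 - s / mu - s * Num.sqrt c) ^- N.+1)%:E)%E _.
    apply: le_trans (lines_mean_drift (K * l) N.+1 s0 smu rc0 a2 g1 z1).
    apply: le_lines_mean => wss wN wt; rewrite lee_fin /F ge_min ler_expR -mulrA ler_wpM2l ?(ltW s0)//.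
    have := @array_lpp_bits _ (Num.sqrt c) l K wss N K (K * l) (ltW rc0) (leqnn _).
    by rewrite -wN take_size wN => ->.
  rewrite lee_fin ler_wpM2r//.
    by rewrite invr_ge0 exprn_ge0// ltW//; lra.
  have z0 : 0 < 1 - drift_defect s mu (Num.sqrt c) by rewrite subr_gt0.
  rewrite ler_expR (mulrA (K * l)%:R) (mulrA (v - u)) ler_wpM2r ?invr_ge0 ?(ltW z0)//.
  rewrite /drift_defect cE mulrA natrM ler_wpM2r//.
    have : 0 < mu * s ^+ 2 * Num.sqrt c by rewrite !mulr_gt0.
    have := mulr_gt0 s0 (_ : 0 < mu - s); rewrite subr_gt0 => /(_ smu).
    by have := sqr_ge0 s; rewrite !expr2; lra.
  rewrite -mulrA mulrC -ler_pdivlMr// -tlc.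
  by rewrite lerDr ltW// (lt_le_trans c0).
rewrite (_ : lpp_mgf_bound%:E + e%:E = (lpp_mgf_bound + e / 3)%:E + (e / 3 + e / 3)%:E)%E; last first.
  by rewrite -!EFinD; congr EFin; lra.
apply: leeD; first by apply: le_trans bits _; rewrite lee_fin.
rewrite lee_fin /cell_error mulrDr lerD//.
  by rewrite -!mulrA in e1 *.
by apply: le_trans e2; rewrite le_eqVlt; apply/orP; left; apply/eqP; ring.
Qed.

(** Fatou's lemma along finer and finer grids; the truncation level [k.+1] grows with the grid, and
    all truncated moments obey the same bound. *)
Lemma lpp_mgf :
  (\int[P]_w (expR (s * lpp_of W (m, N, u, v) w))%:E <= lpp_mgf_bound%:E)%E.
Proof.
pose g k w := grid_lpp (fun q => W q.1 q.2 w) m (uniform_grid u v k) N k.+1.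
pose f k w := (Num.min (expR (s * g k w)) k.+1%:R)%:E.
have mg k : measurable_fun setT (g k).
  apply: (@measurableT_comp _ _ _ _ _ _ (fun x : path_space R (int * R) => grid_lpp x m (uniform_grid u v k) N k.+1)).
    exact: measurable_grid_lpp.
  by apply: measurable_path => q; exact: brownian_family_measurable WW.
have mf k : measurable_fun setT (f k).
  apply/measurable_EFinP; apply: measurable_minr => //; apply: measurableT_comp => //.
  exact: measurable_funM.
have f0 k w : (0 <= f k w)%E by rewrite lee_fin le_min expR_ge0/=.
have cf w : f k w @[k --> \oo] --> (expR (s * lpp_of W (m, N, u, v) w))%:E.
  have cg : expR (s * g k w) @[k --> \oo] --> expR (s * lpp_of W (m, N, u, v) w).
    have cs : s * g k w @[k --> \oo] --> s * lpp_of W (m, N, u, v) w.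
      by apply: cvgMr; apply: grid_lpp_cvg => // j; exact: brownian_family_continuous WW _ _.
    exact: (cvg_comp _ (@expR R) cs (@continuous_expR R _)).
  apply: cvg_EFin; first exact: nearW.
  apply: cvg_trans (cg); apply: near_eq_cvg; near=> k => /=.
  apply/esym/min_idPl; apply: (@le_trans _ _ (expR (s * lpp_of W (m, N, u, v) w) + 1)).
    apply/ltW; near: k; by apply: (cvgr_lt _ cg); rewrite ltrDl.
  apply: (@le_trans _ _ k%:R); last by rewrite ler_nat.
  by near: k; exact: nbhs_infty_ger.
apply: (@le_trans _ _ (\int[P]_w limn_einf (f^~ w))%E).
  rewrite le_eqVlt; apply/orP; left; apply/eqP; apply: eq_integral => w _.
  rewrite is_cvg_limn_einfE; last by apply/cvg_ex; eexists; exact: cf.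
  by apply/esym/cvg_lim => //; exact: cf.
apply: le_trans (fatou P measurableT mf (fun k w _ => f0 k w)) _.
apply: le_trans (limn_einf_sup _) _.
rewrite limn_esup_lim.
apply: lime_le; first exact: is_cvg_esups.
apply: nearW => k; apply: ub_ereal_sup => _ [j _ <-].
exact: grid_mgf_truncated.
Unshelve. all: by end_near. Qed.
End lpp_mgf.

(** * Scaling and lower tails of last passage values *)

Section lpp_invariance.
Context {R : realType}.
Variables (d : measure_display) (T : measurableType d) (P : probability T R).
Variable W : int -> R -> T -> R.
Hypothesis WW : two_sided_brownian_family P W.

Definition affine_block (a : int) (al be : R) (b : int * nat * R * R) : int * nat * R * R :=
  (b.1.1.1 + a, b.1.1.2, al * b.1.2 + be, al * b.2 + be).

Definition reflect_block (c : int) (be : R) (b : int * nat * R * R) : int * nat * R * R :=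
  (c - b.1.1.1 - b.1.1.2.+2%:Z, b.1.1.2, be - b.2, be - b.1.2).

Lemma lpp_affine_law (K : Type) (b : K -> int * nat * R * R) (a : int) (al be : R) :
  0 < al -> (forall k, (b k).1.2 < (b k).2) ->
  same_law P P (fun k => lpp_of W (affine_block a al be (b k)))
               (fun k w => Num.sqrt al * lpp_of W (b k) w).
Proof.
move=> al0 hb; pose f (j : int) := j + a.
have finj : injective f by move=> x y /addIr.
have sal : 0 < Num.sqrt al by rewrite sqrtr_gt0.
have := lpp_law (brownian_family_affine be finj al0 WW) WW hb.
move=> /(same_law_comp (g := fun (x : path_space R K) k => Num.sqrt al * x k)).
have -> : (fun k w => Num.sqrt al * lpp_of (fun j t w0 => (Num.sqrt al)^-1 *
    (W (f j) (al * t + be) w0 - W (f j) be w0)) (b k) w) =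
    (fun k => lpp_of W (affine_block a al be (b k))).
  apply/funext => k; apply/funext => w.
  rewrite /lpp_of (@lpp_affine _ (fun j t => W j t w))//.
  - by rewrite mulrA divff ?gt_eqF// mul1r.
  - by move=> j; exact: brownian_family_continuous WW _ _.
  - by rewrite invr_gt0.
  - exact: ltW.
apply; apply: measurable_path => k; apply: measurable_funM => //; exact: measurable_coord.
Qed.

Lemma lpp_reflect_law (K : Type) (b : K -> int * nat * R * R) (c : int) (be : R) :
  (forall k, (b k).1.2 < (b k).2) ->
  same_law P P (fun k => lpp_of W (reflect_block c be (b k))) (fun k => lpp_of W (b k)).
Proof.
move=> hb; pose f (j : int) := c - j.
have finj : injective f by move=> x y /addrI /oppr_inj.
have := lpp_law (brownian_family_reflect be finj WW) WW hb.
suff -> : (fun k => lpp_of (fun j t w => W (f j) be w - W (f j) (be - t) w) (b k)) =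
    (fun k => lpp_of W (reflect_block c be (b k))) by [].
apply/funext => k; apply/funext => w.
rewrite /lpp_of (@lpp_reflect _ (fun j t => W j t w))//; last exact: ltW.
by move=> j; exact: brownian_family_continuous WW _ _.
Qed.

Lemma ge0_integral_indep (X Y : T -> \bar R) :
  measurable_fun setT X -> measurable_fun setT Y ->
  (forall A B, measurable A -> measurable B ->
    P (X @^-1` A `&` Y @^-1` B) = P (X @^-1` A) * P (Y @^-1` B))%E ->
  (forall w, 0 <= X w)%E -> (forall w, 0 <= Y w)%E ->
  (\int[P]_w (X w * Y w) = \int[P]_w X w * \int[P]_w Y w)%E.
Proof.
move=> mX mY XY X0 Y0.
(* The absolute values make [f] nonnegative everywhere, as [decoupling] asks; on the values of [X]
   and [Y] they change nothing. *)
pose f (z : \bar R * \bar R) := (`|z.1| * `|z.2|)%E.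
have mf : measurable_fun setT f.
  by apply: emeasurable_funM; apply: measurableT_comp => //.
have := decoupling mX mY XY mf (fun z => mule_ge0 (abse_ge0 _) (abse_ge0 _)).
rewrite /f /=; under eq_integral do rewrite !gee0_abs//.
move=> ->.
under eq_integral => w _.
  under eq_integral do rewrite !gee0_abs//.
  rewrite ge0_integralZl//.
over.
rewrite /= ge0_integralZr//; exact: integral_ge0.
Qed.

Definition lpp_lower_mgf (s : R) (b : int * nat * R * R) : \bar R :=
  (\int[P]_w (expR (- (s * lpp_of W b w)))%:E)%E.

Lemma measurable_expR_lpp (s : R) b : b.1.2 < b.2 ->
  measurable_fun setT (fun w => (expR (- (s * lpp_of W b w)))%:E).
Proof.
move=> hb; apply/measurable_EFinP; apply: measurableT_comp => //.
apply: measurableT_comp => //; apply: measurable_funM => //.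
exact: measurable_lpp WW _ hb.
Qed.

Lemma lpp_lower_mgf_affine (s : R) b (a : int) (al be : R) : 0 < al -> b.1.2 < b.2 ->
  lpp_lower_mgf s (affine_block a al be b) = lpp_lower_mgf (s * Num.sqrt al) b.
Proof.
move=> al0 hb; pose F (x : path_space R unit) : \bar R := (expR (- (s * x tt)))%:E.
have hb' : (affine_block a al be b).1.2 < (affine_block a al be b).2.
  by rewrite /= ltrD2r ltr_pM2l.
have mb b' : b'.1.2 < b'.2 -> forall i : unit, measurable_fun setT (lpp_of W b').
  by move=> h _; exact: measurable_lpp WW _ h.
have mb1 (i : unit) : measurable_fun setT (fun w => Num.sqrt al * lpp_of W b w).
  by apply: measurable_funM => //; exact: (mb b hb i).
have mF : measurable_fun setT F.
  apply/measurable_EFinP; apply: measurableT_comp => //; apply: measurableT_comp => //.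
  by apply: measurable_funM => //; exact: measurable_coord.
have := same_law_integral (mb _ hb') mb1
  (lpp_affine_law a be al0 (fun _ : unit => hb)) mF (fun x => expR_ge0 _).
rewrite /lpp_lower_mgf /F => ->; apply: eq_integral => w _.
by rewrite mulrA.
Qed.

(** The two blocks use disjoint lines and are therefore independent, so superadditivity becomes
    submultiplicativity of negative exponential moments. *)
Lemma lpp_lower_mgf_super (s : R) (m : int) (N1 N2 : nat) (u w0 v : R) :
  0 <= s -> u < w0 -> w0 < v ->
  (lpp_lower_mgf s (m, (N1.+1 + N2)%N, u, v) <=
   lpp_lower_mgf s (m, N1, u, w0) * lpp_lower_mgf s ((m + N1.+1%:Z)%R, N2, w0, v))%E.
Proof.
move=> s0 uw wv.
have b1 : (m, N1, u, w0).1.2 < (m, N1, u, w0).2 by [].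
have b2 : (m + N1.+1%:Z, N2, w0, v).1.2 < (m + N1.+1%:Z, N2, w0, v).2 by [].
have b3 : (m, (N1.+1 + N2)%N, u, v).1.2 < (m, (N1.+1 + N2)%N, u, v).2 by exact: lt_trans wv.
have me1 := measurable_expR_lpp s b1; have me2 := measurable_expR_lpp s b2.
have ind A B : measurable A -> measurable B ->
    P ((fun w => (expR (- (s * lpp_of W (m, N1, u, w0) w)))%:E) @^-1` A `&`
       (fun w => (expR (- (s * lpp_of W (m + N1.+1%:Z, N2, w0, v) w)))%:E) @^-1` B) =
    (P ((fun w => (expR (- (s * lpp_of W (m, N1, u, w0) w)))%:E) @^-1` A) *
     P ((fun w => (expR (- (s * lpp_of W ((m + N1.+1%:Z)%R, N2, w0, v) w)))%:E) @^-1` B))%E.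
  move=> mA mB.
  pose K1 := [set j : int | j <= m + N1.+1%:Z]; pose K2 := [set j : int | m + N1.+1%:Z < j].
  have K12 : K1 `&` K2 = set0.
    by rewrite -subset0 => j []; rewrite /K1 /K2/= => h1 h2; lia.
  apply: (lpp_indep WW K12 _ _ mA mB).
  - apply/measurable_EFinP; do 2 apply: measurableT_comp => //; apply: measurable_funM => //.
    by apply: (measurable_lpp_lines WW b1) => j /andP[].
  - apply/measurable_EFinP; do 2 apply: measurableT_comp => //; apply: measurable_funM => //.
    by apply: (measurable_lpp_lines WW b2) => j /andP[].
rewrite /lpp_lower_mgf -(ge0_integral_indep me1 me2 ind (fun=> expR_ge0 _) (fun=> expR_ge0 _)).
apply: ge0_le_integral => //.
- exact: measurable_expR_lpp.
- exact: emeasurable_funM.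
move=> x _; rewrite -EFinM lee_fin -expRD ler_expR -opprD lerN2 -mulrDr ler_wpM2l//.
apply: lpp_superadditive; [|exact: ltW|exact: ltW].
by move=> j; exact: brownian_family_continuous WW _ _.
Qed.
End lpp_invariance.

Section events.
Context {R : realType} {d : measure_display} {T : measurableType d}.
Variable P : probability T R.
Implicit Types X Y : T -> R.

Lemma measurable_lt_event X Y : measurable_fun setT X -> measurable_fun setT Y ->
  measurable [set w | X w < Y w].
Proof.
move=> mX mY; have m1 : measurable [set true] by [].
by have := measurable_fun_ltr mX mY measurableT m1; rewrite setTI.
Qed.

Lemma exponential_markov X (s c : R) : 0 <= s -> measurable_fun setT X ->
  (P [set w | (c < X w)%R] <= (expR (- (s * c)))%:E * \int[P]_w (expR (s * X w))%:E)%E.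
Proof.
move=> s0 mX; have mA : measurable [set w | c < X w] by exact: measurable_lt_event.
have me : measurable_fun setT (fun w => (expR (s * X w))%:E).
  by apply/measurable_EFinP; apply: measurableT_comp => //; exact: measurable_funM.
rewrite -ge0_integralZl// -(setIT [set w | _]) -integral_indic//.
apply: ge0_le_integral => //.
- exact/measurable_EFinP/measurable_indic.
- exact: emeasurable_funM.
move=> w _; rewrite -EFinM lee_fin -expRD indicE; have [/set_mem /= cw|_] := boolP (w \in _).
  by rewrite -expR0 ler_expR addrC subr_ge0 ler_wpM2l// ltW.
exact: expR_ge0.
Qed.

Lemma ge0_integral_normal_law X (s : R) (f : R -> \bar R) : measurable_fun setT X ->
  (forall A : set R, measurable A -> P (X @^-1` A) = normal_prob 0 s A) ->
  measurable_fun setT f -> (forall x, 0 <= f x)%E ->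
  (\int[P]_w f (X w) = \int[normal_prob 0 s]_x f x)%E.
Proof.
move=> mX lawX mf f0.
have mX' : measurable_fun setT (X : T -> measurableTypeR R) by exact: mX.
rewrite -(ge0_integral_law P mX')//.
by apply: eq_measure_integral => A mA _; exact: lawX mA.
Qed.
End events.

(** * Lower tails by self-improvement *)

Section lower_tail.
Context {R : realType}.
Variables (d : measure_display) (T : measurableType d) (P : probability T R).
Variable W : int -> R -> T -> R.
Hypothesis WW : two_sided_brownian_family P W.

Definition unit_block (n : nat) : int * nat * R * R := (0, n.-1, 0, 1).

Definition centered_lpp (n : nat) (w : T) : R :=
  n%:R `^ (1 / 6) * (lpp_of W (unit_block n) w - 2 * Num.sqrt n%:R).

Lemma measurable_centered_lpp n : measurable_fun setT (centered_lpp n).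
Proof.
apply: measurable_funM => //; apply: measurable_funB => //.
by apply: measurable_lpp WW _ _ => /=.
Qed.

Definition centered_mgf (th : R) (n : nat) : \bar R :=
  (\int[P]_w (expR (- (th * centered_lpp n w)))%:E)%E.

Lemma centered_mgfE th n : centered_mgf th n =
  ((expR (th * n%:R `^ (1 / 6) * (2 * Num.sqrt n%:R)))%:E *
    lpp_lower_mgf P W (th * n%:R `^ (1 / 6)) (unit_block n))%E.
Proof.
rewrite /lpp_lower_mgf -ge0_integralZl//; last exact: (measurable_expR_lpp WW).
apply: eq_integral => w _; rewrite -EFinM -expRD; congr (expR _)%:E.
by rewrite /centered_lpp; ring.
Qed.

(** Two blocks of [n] lines over the two halves of the unit interval; Brownian scaling brings each
    back to length 1 and multiplies its value by [sqrt 2^-1]. *)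
Lemma lower_mgf_double (s b : R) n : 0 <= s -> (0 < n)%N ->
  (lpp_lower_mgf P W (s * Num.sqrt 2^-1) (unit_block n) <= b%:E)%E ->
  (lpp_lower_mgf P W s (unit_block (n + n)) <= (b ^+ 2)%:E)%E.
Proof.
case: n => // n s0 _ hG; have h : (0 : R) < 2^-1 by rewrite invr_gt0.
have h1 : (2^-1 : R) < 1 by rewrite invf_lt1// ltr1n.
have hb : (unit_block n.+1).1.2 < (unit_block n.+1).2 by rewrite /= ltr01.
have e1 : (0, n, 0, 2^-1) = affine_block 0 2^-1 0 (unit_block n.+1).
  by rewrite /affine_block /= !addr0 mulr0 mulr1.
have e2 : (0 + n.+1%:Z, n, 2^-1, 1) = affine_block n.+1%:Z 2^-1 2^-1 (unit_block n.+1).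
  have hh : 2^-1 + 2^-1 = 1 :> R by lra.
  by rewrite /affine_block /= mulr0 !add0r mulr1 hh.
have := lpp_lower_mgf_super WW 0 n n s0 h h1.
rewrite e1 e2 !lpp_lower_mgf_affine//.
rewrite /unit_block addnS /= -/(unit_block n.+1) => /le_trans; apply.
have G0 : (0 <= lpp_lower_mgf P W (s * Num.sqrt 2^-1) (unit_block n.+1))%E.
  by apply: integral_ge0 => w _; rewrite lee_fin expR_ge0.
by rewrite expr2 EFinM lee_pmul.
Qed.

(** Three doublings. The centering is exactly additive, the scalings divide the exponent by
    [2 * sqrt 2], and the sixth root of the number of lines grows by [sqrt 2]: eight blocks allow
    for twice the exponent, which is the fluctuation exponent 1/3. *)
Lemma centered_mgf_octuple (th b : R) n : 0 <= th -> (0 < n)%N ->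
  (centered_mgf th n <= b%:E)%E -> (centered_mgf (2 * th) (8 * n) <= (b ^+ 8)%:E)%E.
Proof.
move=> th0 n0; rewrite !centered_mgfE => hG.
have nR : 0 < n%:R :> R by rewrite ltr0n.
set q : R := (n%:R : R) `^ (1 / 6); have q0 : 0 <= q by exact: powR_ge0.
have s2 : 0 < Num.sqrt (2 : R) by rewrite sqrtr_gt0.
have s22 : Num.sqrt (2 : R) ^+ 2 = 2 by rewrite sqr_sqrtr.
have q8 : ((8 * n)%:R : R) `^ (1 / 6) = Num.sqrt 2 * q.
  rewrite natrM powRM ?ler0n// (_ : (8 : R) = 2 `^ 3%:R); last by rewrite powR_mulrn// -natrX.
  by rewrite -powRrM (_ : 3%:R * (1 / 6) = 2^-1) ?powR12_sqrt//; field.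
have r8 : Num.sqrt ((8 * n)%:R : R) = 2 * Num.sqrt 2 * Num.sqrt n%:R.
  rewrite natrM sqrtrM ?ler0n// (_ : (8 : R) = 2 ^+ 2 * 2); last by rewrite -natrX -natrM.
  by rewrite sqrtrM ?sqr_ge0// sqrtr_sqr ger0_norm.
set c := th * q * (2 * Num.sqrt n%:R).
rewrite q8 r8 (_ : 2 * th * _ * _ = c *+ 8); last first.
  rewrite (_ : 2 * th * (Num.sqrt 2 * q) * (2 * (2 * Num.sqrt 2 * Num.sqrt n%:R)) =
    8 * (Num.sqrt 2 ^+ 2 * th * q * Num.sqrt n%:R)); last by ring.
  by rewrite s22 /c; ring.
have hG' : (lpp_lower_mgf P W (th * q) (unit_block n) <= (b * expR (- c))%:E)%E.
  rewrite [b * _]mulrC EFinM.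
  rewrite -[leLHS]mul1e -(@expR0 R) -(subrr c) addrC expRD EFinM -muleA lee_wpmul2l//.
have i2 : Num.sqrt (2^-1 : R) = (Num.sqrt 2)^-1 by rewrite sqrtrV.
have h8 : (lpp_lower_mgf P W (2 * th * (Num.sqrt 2 * q)) (unit_block (8 * n)) <=
    ((b * expR (- c)) ^+ 8)%:E)%E.
  have p0 : 0 <= 2 * th * (Num.sqrt 2 * q) by rewrite !mulr_ge0// ltW.
  have i20 : 0 <= Num.sqrt (2^-1 : R) by [].
  rewrite (_ : (8 * n = (n + n + (n + n)) + (n + n + (n + n)))%N); last by lia.
  rewrite (_ : 8%N = (2 * 2 * 2)%N)// !exprM.
  apply: lower_mgf_double => //; first by lia.
  apply: lower_mgf_double; [exact: mulr_ge0|lia|].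
  apply: lower_mgf_double; [by rewrite !mulr_ge0|lia|].
  rewrite (_ : 2 * th * (Num.sqrt 2 * q) * _ * _ * _ = th * q)// i2.
  rewrite -[X in X * th * _]s22; field.
  by rewrite gt_eqF.
rewrite [leRHS](_ : _ = (expR (c *+ 8))%:E * ((b * expR (- c)) ^+ 8)%:E)%E.
  by rewrite lee_wpmul2l.
rewrite -EFinM exprMn -expRM_natl mulrCA -expRD (_ : c *+ 8 + _ = 0) ?expR0 ?mulr1//; ring.
Qed.

(** With [e] the integrand, [e <= 2] off the bad event, and on it completing a square gives
    [e <= 2^-17 * e ^+ 2 + 2^15]. As [4 ^ 8 = 2 ^ 16], the total is at most 2 + 1/2 + 1/2. Together
    with [centered_mgf_octuple], the bound 4 at a fixed exponent reproduces itself from [n] to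
    [8 * n]. *)
Lemma centered_mgf_tight (th La : R) n : 0 < La -> 0 <= th -> expR (th * La) <= 2 ->
  (P [set w | (centered_lpp n w < - La)%R] <= ((2 ^+ 16)^-1)%:E)%E ->
  (centered_mgf (2 * th) n <= (4 ^+ 8)%:E)%E -> (centered_mgf th n <= 4%:E)%E.
Proof.
move=> La0 th0 thLa tight h2; pose A := [set w | (centered_lpp n w < - La)%R].
have mc := measurable_centered_lpp n.
have mA : measurable A by exact: measurable_lt_event.
pose de : R := (2 ^+ 17)^-1; pose k : R := 2 ^+ 15.
have mexp (r : R) : measurable_fun setT (fun w => (expR (- (r * centered_lpp n w)))%:E).
  apply/measurable_EFinP; do 2 apply: measurableT_comp => //.
  exact: measurable_funM.
have mind : measurable_fun setT (fun w => (\1_A w)%:E : \bar R).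
  exact/measurable_EFinP/measurable_indic.
have de0 : 0 <= de by rewrite invr_ge0.
apply: (@le_trans _ _ (\int[P]_w (2%:E + (de%:E * (expR (- (2 * th * centered_lpp n w)))%:E +
    k%:E * (\1_A w)%:E)))%E).
  apply: ge0_le_integral => //.
  - apply: emeasurable_funD => //; apply: emeasurable_funD; exact: emeasurable_funM.
  move=> w _; set A0 := centered_lpp n w; set e := expR (- (th * A0)).
  have e0 : 0 <= e by exact: expR_ge0.
  have eE : expR (- (2 * th * A0)) = e ^+ 2.
    by rewrite /e -expRM_natl; congr expR; ring.
  suff : e <= 2 + (de * expR (- (2 * th * A0)) + k * \1_A w) by rewrite -lee_fin.
  rewrite eE indicE; have [_|/negP wA] := boolP (w \in A).
    have : 0 <= (e - 2 ^+ 16) ^+ 2 by exact: sqr_ge0.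
    rewrite /de /k !expr2 => h; rewrite mulr1.
    have : 0 <= (2 ^+ 17)^-1 * ((e - 2 ^+ 16) * (e - 2 ^+ 16)) by rewrite mulr_ge0// invr_ge0.
    by lra.
  rewrite mulr0 addr0; apply: (@le_trans _ _ 2); last by rewrite lerDl mulr_ge0 ?sqr_ge0.
  apply: le_trans thLa; rewrite ler_expR -mulrN ler_wpM2l// lerNl leNgt.
  by apply/negP => h; apply: wA; apply/mem_set.
have b1 w : (0 <= de%:E * (expR (- (2 * th * centered_lpp n w)))%:E)%E.
  by apply: mule_ge0; rewrite lee_fin ?expR_ge0.
have b2 w : (0 <= k%:E * (\1_A w)%:E)%E by apply: mule_ge0; rewrite lee_fin ?exprn_ge0.
rewrite ge0_integralD//=; last 2 first.
- by move=> w _; exact: adde_ge0.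
- by apply: emeasurable_funD; exact: emeasurable_funM.
rewrite ge0_integralD//=; last 2 first.
- exact: emeasurable_funM.
- exact: emeasurable_funM.
rewrite integral_cst//= ge0_integralZl//.
rewrite ge0_integralZl//; last by rewrite lee_fin exprn_ge0.
rewrite integral_indic// setIT.
apply: (@le_trans _ _ (2%:E * 1 + (de%:E * (4 ^+ 8)%:E + k%:E * ((2 ^+ 16)^-1)%:E))%E).
  rewrite leeD ?lee_wpmul2l ?lee_fin//; first exact: probability_le1.
  by rewrite leeD ?lee_wpmul2l ?lee_fin// exprn_ge0.
rewrite mule1; suff : 2 + (de * 4 ^+ 8 + k * (2 ^+ 16)^-1) <= 4 by rewrite -lee_fin.
rewrite /de /k; lra.
Qed.

(** A crude bound from the last line alone, good enough to start the induction at one fixed [n]. *)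
Lemma centered_mgf_base (th : R) n : 0 <= th -> (0 < n)%N ->
  (centered_mgf th n <= (Num.sqrt 2 * expR ((th * n%:R `^ (1 / 6)) ^+ 2 +
     th * n%:R `^ (1 / 6) * (2 * Num.sqrt n%:R)))%:E)%E.
Proof.
case: n => // n th0 _; rewrite centered_mgfE; set s := th * _.
have s0 : 0 <= s by rewrite mulr_ge0 ?powR_ge0.
set c := s * (2 * _).
have -> : Num.sqrt 2 * expR (s ^+ 2 + c) = expR c * (Num.sqrt 2 * expR (s ^+ 2)).
  by rewrite expRD; ring.
rewrite [leRHS]EFinM lee_wpmul2l//.
pose D w := W (0 + n.+1%:Z) 1 w - W (0 + n.+1%:Z) 0 w.
have mD : measurable_fun setT D.
  by apply: measurable_funB; exact: (brownian_measurable (WW.1 _)).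
have mexp (r : R) : measurable_fun setT (fun x : R => (expR (r * x))%:E).
  by apply/measurable_EFinP; apply: measurableT_comp => //; exact: measurable_funM.
have lawD := ge0_integral_normal_law mD
  (fun A mA => brownian_gaussian (WW.1 _) ltr01 mA) (mexp (- s)) (fun x => expR_ge0 _).
apply: (@le_trans _ _ (\int[P]_w (expR (- s * D w))%:E)%E).
  apply: ge0_le_integral => //.
  - exact: (measurable_expR_lpp WW).
  - exact: (measurableT_comp (mexp (- s)) mD).
  move=> w _; rewrite lee_fin ler_expR mulNr lerN2 ler_wpM2l//.
  apply: (@lpp_ge_last _ (fun j t => W j t w)) => // j.
  exact: brownian_family_continuous WW _ _.
have s1 : 0 < Num.sqrt (1 - 0 : R) by rewrite subr0 sqrtr1.
rewrite lawD; apply: le_trans (normal_mgf_bound (- s) s1) _.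
by rewrite subr0 sqrtr1 expr1n mulr1 sqrrN.
Qed.

Lemma centered_mgf_small n : (0 < n)%N -> exists2 t0 : R, 0 < t0 &
  forall th, 0 <= th <= t0 -> (centered_mgf th n <= 4%:E)%E.
Proof.
move=> n0; set q : R := n%:R `^ (1 / 6); set r : R := Num.sqrt n%:R.
have q0 : 0 <= q by exact: powR_ge0.
have r0 : 0 <= r by exact: sqrtr_ge0.
have D0 : 0 < (q + 1) * (2 * r + 1) by rewrite mulr_gt0//; lra.
exists (2^-1 / ((q + 1) * (2 * r + 1))); first by rewrite divr_gt0// invr_gt0.
move=> th /andP[th0 tht]; apply: le_trans (centered_mgf_base th0 n0) _.
rewrite -/q -/r lee_fin.
have h1 : th * ((q + 1) * (2 * r + 1)) <= 2^-1 by rewrite -ler_pdivlMr.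
have tq0 : 0 <= th * q by exact: mulr_ge0.
have h2 : th * q + th * q * (2 * r) <= 2^-1.
  apply: le_trans h1; rewrite -subr_ge0.
  rewrite (_ : _ - _ = th * (2 * r + 1)); last by ring.
  by rewrite mulr_ge0//; lra.
have tqr : 0 <= th * q * (2 * r) by rewrite mulr_ge0// mulr_ge0.
have h3 : (th * q) ^+ 2 <= th * q by rewrite expr2 ler_piMr//; lra.
have e1 : expR ((th * q) ^+ 2 + th * q * (2 * r)) <= 2.
  apply: (@le_trans _ _ (expR 2^-1)); first by rewrite ler_expR; lra.
  rewrite -[X in expR X]opprK expRN; apply: (@le_trans _ _ (2^-1)^-1); last by rewrite invrK.
  rewrite lef_pV2 ?posrE ?expR_gt0 ?invr_gt0//.
  by apply: le_trans (expR_ge1Dx _); lra.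
have s2 : Num.sqrt 2 <= 2 :> R.
  by rewrite -[leRHS]ger0_norm// -sqrtr_sqr ler_sqrt// expr2; lra.
apply: (@le_trans _ _ (2 * 2)); last by lra.
by rewrite ler_pM ?expR_ge0.
Qed.

(** The bound 4 at exponent [th] is uniform in [i]; [l] further steps from [n] to [8 * n] raise the
    exponent to [2 ^ l * th] and the bound to [4 ^ (8 ^ l)]. The parameter [l] stays free: taking
    [4 ^ l] of order [la] gives the tail exponent 3/2. *)
Lemma centered_lower_tail (n0 : nat) (La : R) : (0 < n0)%N -> 0 < La ->
  (forall n, (n0 <= n)%N ->
     (P [set w | (centered_lpp n w < - La)%R] <= ((2 ^+ 16)^-1)%:E)%E) ->
  exists2 th : R, 0 < th & forall (l i : nat) (la : R),
    (P [set w | (centered_lpp (8 ^ (l + i) * n0) w < - la)%R] <=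
     (expR (- (2 ^+ l * th * la)) * 4 ^+ (8 ^ l))%:E)%E.
Proof.
move=> n00 La0 tight; have [t0 t00 ht] := centered_mgf_small n00.
pose th := Num.min t0 (La * 2)^-1.
have th0 : 0 < th by rewrite lt_min t00 invr_gt0 mulr_gt0.
have thLa : expR (th * La) <= 2.
  have h : th * La <= 2^-1.
    have : th <= (La * 2)^-1 by rewrite ge_min lexx orbT.
    by move=> h; rewrite -ler_pdivlMr// (le_trans h)// invfM mulrC.
  apply: (@le_trans _ _ (expR 2^-1)); first by rewrite ler_expR.
  rewrite -[X in expR X]opprK expRN; apply: (@le_trans _ _ (2^-1)^-1); last by rewrite invrK.
  rewrite lef_pV2 ?posrE ?expR_gt0 ?invr_gt0//.
  by apply: le_trans (expR_ge1Dx _); lra.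
have pos i : (0 < 8 ^ i * n0)%N by rewrite muln_gt0 expn_gt0.
have bound i : (centered_mgf th (8 ^ i * n0) <= 4%:E)%E.
  elim: i => [|i ih].
    by rewrite expn0 mul1n; apply: ht; rewrite (ltW th0)/= ge_min lexx.
  apply: (centered_mgf_tight La0 (ltW th0) thLa).
    by apply: tight; rewrite leq_pmull// expn_gt0.
  by rewrite expnS -mulnA; apply: centered_mgf_octuple => //; exact: ltW.
have bounds l i : (centered_mgf (2 ^+ l * th) (8 ^ (l + i) * n0) <= (4 ^+ (8 ^ l))%:E)%E.
  elim: l => [|l ih]; first by rewrite expr0 mul1r add0n expn0 expr1.
  rewrite addSn expnS -mulnA exprS -mulrA expnSr exprM.
  by apply: centered_mgf_octuple => //; rewrite mulr_ge0 ?exprn_ge0// ltW.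
exists th => // l i la.
have s0 : 0 <= 2 ^+ l * th by rewrite mulr_ge0 ?exprn_ge0// ltW.
have mN : measurable_fun setT (fun w => - centered_lpp (8 ^ (l + i) * n0) w).
  by apply: measurableT_comp => //; exact: measurable_centered_lpp.
have := exponential_markov P la s0 mN.
rewrite (_ : [set w | _] = [set w | centered_lpp (8 ^ (l + i) * n0) w < - la]); last first.
  by apply/seteqP; split => w /=; rewrite ltrNr.
move=> /le_trans; apply; rewrite EFinM lee_wpmul2l ?lee_fin ?expR_ge0//.
apply: le_trans (bounds l i); rewrite le_eqVlt; apply/orP; left; apply/eqP.
by apply: eq_integral => w _; rewrite mulrN.
Qed.
End lower_tail.

(** * Tail bounds for the landscape *)

Section excess.
Context {R : realType}.
Local Notation point := (R * R * R * R)%type.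
Implicit Types (D : seq (R * point * R)) (g : point -> R).

(** Positive exactly when one of the finitely many thresholds in [D] is crossed; a coefficient 1
    serves for upper and -1 for lower bounds. In contrast to the event, this is a continuous
    functional on [landscape_space]. *)
Definition excess D g : R := \big[Num.max/0]_(i <- D) (i.1.1 * g i.1.2 - i.2).

Definition clipped_excess D (K : R) g : R := Num.min (K * excess D g) 1.

Lemma excess_gtP D g e : 0 <= e ->
  e < excess D g <-> exists2 i, i \in D & e < i.1.1 * g i.1.2 - i.2.
Proof.
move=> e0; rewrite /excess; elim: D => [|i D ih].
  by rewrite big_nil; split; [rewrite ltNge e0|case].
rewrite big_cons lt_max; split.
- case/orP => [h|/ih[j jD h]]; first by exists i; rewrite ?mem_head.
  by exists j => //; rewrite inE jD orbT.
- case=> j; rewrite inE => /predU1P[-> ->//|jD h]; apply/orP; right; apply/ih.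
  by exists j.
Qed.

Lemma excess_ge0 D g : 0 <= excess D g.
Proof. by rewrite /excess; elim: D => [|i D ih]; rewrite ?big_nil// big_cons le_max ih orbT. Qed.

Lemma evaluation_continuous (p : point) : R4up p ->
  continuous (fun g : landscape_space => g p : R).
Proof.
move=> hp g.
have : {family compactly_in R4up, nbhs (g : landscape_space) --> g} by exact: cvg_id.
move=> /fam_cvgP/(_ [set p]); rewrite uniform_set1.
by apply; split; [move=> _ ->|exact: compact_set1].
Qed.

Lemma continuous_maxR (S : topologicalType) (f g : S -> R) :
  continuous f -> continuous g -> continuous (fun x => Num.max (f x) (g x)).
Proof. by move=> cf cg x; apply: (@continuous_max R S f g); [exact: cf|exact: cg]. Qed.

Lemma continuous_minR (S : topologicalType) (f g : S -> R) :
  continuous f -> continuous g -> continuous (fun x => Num.min (f x) (g x)).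
Proof. by move=> cf cg x; apply: (@continuous_min R S f g); [exact: cf|exact: cg]. Qed.

Lemma continuous_affineR (S : topologicalType) (f : S -> R) (a c : R) :
  continuous f -> continuous (fun x => a * f x - c).
Proof. by move=> cf x; apply: cvgB; [apply: cvgMr; exact: cf|exact: cvg_cst]. Qed.

Lemma clipped_excess_continuous D K : (forall i, i \in D -> R4up i.1.2) ->
  continuous (clipped_excess D K : landscape_space -> R).
Proof.
move=> hD; have cE : continuous (excess D : landscape_space -> R).
  rewrite /excess; elim: D hD => [|i D ih] hD.
    rewrite (_ : (fun g => _) = cst 0); first exact: cst_continuous.
    by apply/funext => g; rewrite big_nil.
  rewrite (_ : (fun g => _) = fun g : landscape_space =>
    Num.max (i.1.1 * g i.1.2 - i.2) (\big[Num.max/0]_(i <- D) (i.1.1 * g i.1.2 - i.2))); last first.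
    by apply/funext => g; rewrite big_cons.
  apply: (@continuous_maxR landscape_space).
    apply: (@continuous_affineR landscape_space (fun g => g i.1.2)).
    by apply: evaluation_continuous; apply: hD; rewrite mem_head.
  by apply: ih => j jD; apply: hD; rewrite inE jD orbT.
rewrite (_ : clipped_excess D K = fun g : landscape_space => Num.min (K * excess D g - 0) 1).
  apply: (@continuous_minR landscape_space); last exact: cst_continuous.
  exact: (@continuous_affineR landscape_space (excess D)).
by apply/funext => g; rewrite /clipped_excess subr0.
Qed.

(** A continuous function squeezed between two indicators: convergence of its expectations compares
    probabilities up to the margin [e]. *)
Lemma clipped_excess_le D (e : R) g : 0 < e ->
  (e < excess D g)%R%:R <= clipped_excess D e^-1 g <= (0 < excess D g)%R%:R.
Proof.
move=> e0; have x0 := excess_ge0 D g; apply/andP; split.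
  rewrite le_min; case: (ltP e (excess D g)) => [h|h] /=.
    by rewrite lexx andbT mulrC ler_pdivlMr ?mul1r// ltW.
  by rewrite ler01 andbT mulr_ge0// invr_ge0 ltW.
rewrite ge_min; case: (ltP 0 (excess D g)) => [h|h] /=; first by rewrite lexx orbT.
by rewrite (_ : excess D g = 0) ?mulr0 ?lexx//; apply/eqP; rewrite eq_le h.
Qed.

Lemma clipped_excess_bounded D (e : R) g : 0 < e -> 0 <= clipped_excess D e^-1 g <= 1.
Proof.
move=> e0; have /andP[h1 h2] := clipped_excess_le D g e0.
rewrite (le_trans _ h1)// (le_trans h2)//; by case: (_ < _).
Qed.

Lemma measurable_excess d (T : measurableType d) D (L : T -> point -> R) :
  (forall i, i \in D -> measurable_fun setT (fun w => L w i.1.2)) ->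
  measurable_fun setT (fun w => excess D (L w)).
Proof.
rewrite /excess; elim: D => [|i D ih] mD.
  by under eq_fun do rewrite big_nil; exact: measurable_cst.
under eq_fun do rewrite big_cons; apply: measurable_maxr.
  by apply: measurable_funB => //; apply: measurable_funM => //; apply: mD; rewrite mem_head.
by apply: ih => j jD; apply: mD; rewrite inE jD orbT.
Qed.

Section one_space.
Context {d : measure_display} {T : measurableType d}.
Variables (P : probability T R) (L : T -> point -> R) (D : seq (R * point * R)).
Hypothesis mD : forall i, i \in D -> measurable_fun setT (fun w => L w i.1.2).

Lemma measurable_excess_event (e : R) : measurable [set w | e < excess D (L w)].
Proof. by apply: measurable_lt_event => //; exact: measurable_excess. Qed.

Lemma measurable_clipped_excess (K : R) :
  measurable_fun setT (fun w => (clipped_excess D K (L w))%:E).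
Proof.
apply/measurable_EFinP; apply: measurable_minr => //; apply: measurable_funM => //.
exact: measurable_excess.
Qed.

Lemma clipped_excess_event (e : R) : 0 < e ->
  (P [set w | (e < excess D (L w))%R] <= \int[P]_w (clipped_excess D e^-1 (L w))%:E)%E /\
  (\int[P]_w (clipped_excess D e^-1 (L w))%:E <= P [set w | (0 < excess D (L w))%R])%E.
Proof.
move=> e0.
have me (c : R) : measurable_fun setT (fun w => (\1_[set w | c < excess D (L w)] w : R)%:E).
  by apply/measurable_EFinP/measurable_indic; exact: measurable_excess_event.
have f0 w : (0 <= (clipped_excess D e^-1 (L w))%:E)%E.
  by rewrite lee_fin; have /andP[] := clipped_excess_bounded D (L w) e0.
have ie (c : R) : P [set w | (c < excess D (L w))%R] =
    (\int[P]_w (\1_[set w | (c < excess D (L w))%R] w : R)%:E)%E.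
  by rewrite integral_indic ?setIT//; exact: measurable_excess_event.
have iE (c : R) (w : T) : (\1_[set w | c < excess D (L w)] w : R) = (c < excess D (L w))%R%:R.
  rewrite indicE; congr (_%:R); congr nat_of_bool.
  by apply/idP/idP => [/set_mem|h]//; apply/mem_set.
rewrite !ie; split; apply: ge0_le_integral => //; try exact: measurable_clipped_excess;
  move=> w _; rewrite lee_fin iE; by have /andP[] := clipped_excess_le D (L w) e0.
Qed.
End one_space.
End excess.

Lemma measure_nondecreasing_le (R : realType) d (T : measurableType d)
    (P : probability T R) (F : nat -> set T) (b : \bar R) :
  (forall n, measurable (F n)) -> (forall n m, (n <= m)%N -> F n `<=` F m) ->
  (forall n, (P (F n) <= b)%E) -> (P (\bigcup_n F n) <= b)%E.
Proof.
move=> mF ndF Fb.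
have cv : P (F n) @[n --> \oo] --> P (\bigcup_n F n).
  apply: nondecreasing_cvg_mu => //; first exact: bigcupT_measurable.
  by move=> n m nm; rewrite subsetEset; exact: ndF.
rewrite -(cvg_lim _ cv)//; apply: lime_le; last exact: nearW.
by apply/cvg_ex; exists (P (\bigcup_n F n)).
Qed.

Section transfer.
Context {R : realType}.
Local Notation point := (R * R * R * R)%type.
Variables (d : measure_display) (T : measurableType d) (P : probability T R).
Variable L : T -> point -> R.
Hypothesis LL : directed_landscape P L.
Variables (d' : measure_display) (T' : measurableType d') (P' : probability T' R).
Variable W : int -> R -> T' -> R.
Hypothesis limW : forall f : landscape_space -> R,
  continuous f -> (exists K : R, forall g, `|f g| <= K) ->
  ('E_P'[fun w => f (prelandscape (fun j u => W j u w) n)]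
     @[n --> \oo] --> 'E_P[fun w => f (L w)])%E.
Implicit Types D : seq (R * point * R).

Local Notation pl n := (fun w => prelandscape (fun j u => W j u w) n).

Definition premeasurable D (n : nat) : Prop :=
  forall i, i \in D -> measurable_fun setT (fun w => pl n w i.1.2).

Let mL D : (forall i, i \in D -> R4up i.1.2) ->
  forall i, i \in D -> measurable_fun setT (fun w => L w i.1.2).
Proof. by move=> hD i iD; apply: (landscape_measurable LL); exact: hD. Qed.

Lemma clipped_excess_cvg D (e : R) : (forall i, i \in D -> R4up i.1.2) -> 0 < e ->
  (\int[P']_w (clipped_excess D e^-1 (pl n w))%:E @[n --> \oo] -->
   \int[P]_w (clipped_excess D e^-1 (L w))%:E)%E.
Proof.
move=> hD e0; have := limW (clipped_excess_continuous (K := e^-1) hD).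
rewrite unlock; apply; exists 1 => g.
by have /andP[h1 h2] := clipped_excess_bounded D g e0; rewrite ger0_norm.
Qed.

(** The expectations converge, so infinitely many [n] with the bound suffice. The lower tail is
    indeed known along [8 ^ i * n0] only. *)
Lemma landscape_upper D (e b : R) : (forall i, i \in D -> R4up i.1.2) -> 0 < e ->
  (forall m, exists n, [/\ (m <= n)%N, premeasurable D n &
     (P' [set w | (0 < excess D (pl n w))%R] <= b%:E)%E]) ->
  (P [set w | (e < excess D (L w))%R] <= b%:E)%E.
Proof.
move=> hD e0 hb; apply: le_trans (clipped_excess_event P (mL hD) e0).1 _.
rewrite leNgt; apply/negP => bI.
have := clipped_excess_cvg hD e0 => cv.
have [m _ hm] : \forall n \near \oo, (b%:E < \int[P']_w (clipped_excess D e^-1 (pl n w))%:E)%E.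
  by apply: (cv [set x | (b%:E < x)%E]); apply: open_nbhs_nbhs; split; [exact: open_ereal_gt_ereal|exact: bI].
have [n [mn mD Pb]] := hb m.
have := hm n mn => /=; rewrite ltNge => /negP; apply.
exact: le_trans (clipped_excess_event P' mD e0).2 Pb.
Qed.

Lemma prelandscape_upper D (e b : R) : (forall i, i \in D -> R4up i.1.2) -> 0 < e ->
  (P [set w | (0 < excess D (L w))%R] < b%:E)%E ->
  exists m, forall n, (m <= n)%N -> premeasurable D n ->
    (P' [set w | (e < excess D (pl n w))%R] <= b%:E)%E.
Proof.
move=> hD e0 Pb.
have := clipped_excess_cvg hD e0 => cv.
have [m _ hm] : \forall n \near \oo, (\int[P']_w (clipped_excess D e^-1 (pl n w))%:E < b%:E)%E.
  apply: (cv [set x | (x < b%:E)%E]); apply: open_nbhs_nbhs; split; first exact: open_ereal_lt_ereal.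
  exact: le_lt_trans (clipped_excess_event P (mL hD) e0).2 Pb.
exists m => n mn mD; apply: le_trans (clipped_excess_event P' mD e0).1 _.
by apply/ltW; exact: hm.
Qed.

(** The margin is removed at the end, the event [0 < excess] being an increasing union of events
    with a positive margin. *)
Lemma landscape_excess_le D D' : (forall i, i \in D -> R4up i.1.2) ->
  (forall i, i \in D' -> R4up i.1.2) ->
  (forall e : R, 0 < e -> exists m, forall n, (m <= n)%N ->
    (\int[P']_w (clipped_excess D e^-1 (pl n w))%:E =
     \int[P']_w (clipped_excess D' e^-1 (pl n w))%:E)%E) ->
  (P [set w | (0 < excess D (L w))%R] <= P [set w | (0 < excess D' (L w))%R])%E.
Proof.
move=> hD hD' hE.
have le k : (P [set w | (k.+1%:R^-1 < excess D (L w))%R] <= P [set w | (0 < excess D' (L w))%R])%E.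
  have e0 : 0 < k.+1%:R^-1 :> R by rewrite invr_gt0.
  apply: le_trans (clipped_excess_event P (mL hD) e0).1 _.
  apply: le_trans (clipped_excess_event P (mL hD') e0).2.
  have [m hm] := hE _ e0.
  rewrite le_eqVlt; apply/orP; left; apply/eqP.
  apply: (cvg_unique _ _ (clipped_excess_cvg hD' e0)) => //.
  apply: cvg_trans (clipped_excess_cvg hD e0); apply: near_eq_cvg.
  by exists m => // n mn; rewrite /= hm.
have -> : [set w | (0 < excess D (L w))%R] = \bigcup_k [set w | (k.+1%:R^-1 < excess D (L w))%R].
  apply/seteqP; split => [w /= h|w [k _] /=]; last by apply: lt_trans; rewrite invr_gt0.
  exists (Num.truncn (excess D (L w))^-1) => //=.
  rewrite invf_plt ?posrE// (lt_le_trans (truncnS_gt _))//.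
have mE k : measurable [set w | (k.+1%:R^-1 < excess D (L w))%R].
  exact: measurable_excess_event (mL hD) _.
apply: measure_nondecreasing_le => // m k mk w /= /(le_lt_trans _); apply.
by rewrite lef_pV2 ?posrE// ler_nat ltnS.
Qed.
End transfer.

(** * Scaled last passage values and their symmetries *)

Section scaled_lpp.
Context {R : realType}.
Local Notation root6 n := ((n%:R : R) `^ (1 / 6)).
Local Notation root3 n := ((n%:R : R) `^ (- (1 / 3))).

Lemma scaling_exponents n : (0 < n)%N ->
  [/\ 0 < root6 n, root3 n = root6 n ^- 2, Num.sqrt n%:R = root6 n ^+ 3 & n%:R = root6 n ^+ 6].
Proof.
move=> n0; have nR : (0 : R) < n%:R by rewrite ltr0n.
have e k : root6 n ^+ k = n%:R `^ (1 / 6 * k%:R) by rewrite (powRrM _ (1 / 6)) powR_mulrn// powR_ge0.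
split; first exact: powR_gt0.
- by rewrite e -powRN; congr (_ `^ _); field.
- by rewrite e -powR12_sqrt ?ltW//; congr (_ `^ _); field.
- rewrite e (_ : 1 / 6 * 6%:R = 1 :> R); last by field.
  by rewrite powRr1// ltW.
Qed.

(* The scaled last passage value from (x, a) to (y, a + dt), for integer times. *)
Definition scaled_block (n : nat) (a : int) (dt : nat) (p : R * R) : int * nat * R * R :=
  (n%:Z * a, (dt * n).-1, a%:~R + 2 * p.1 * root3 n, a%:~R + dt%:R + 2 * p.2 * root3 n).

Definition scaled_lpp (T : Type) (W : int -> R -> T -> R) n a dt p (w : T) : R :=
  root6 n * (lpp (fun j t => W j t w) (scaled_block n a dt p).1.1.1 (scaled_block n a dt p).1.1.2
      (scaled_block n a dt p).1.2 (scaled_block n a dt p).2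
    - 2 * dt%:R * Num.sqrt n%:R - 2 * (p.2 - p.1) * root6 n).

Lemma prelandscape_unit (W : int -> R -> R) n x y : (0 < n)%N ->
  prelandscape W n (x, 0, y, 1) = scaled_lpp (fun j t (_ : unit) => W j t) n 0 1 (x, y) tt.
Proof.
move=> n0; rewrite /prelandscape /scaled_lpp /lpp /scaled_block /= mul1n.
have fn : Num.floor (n%:R : R) = n%:Z by exact: (intrKfloor n%:Z).
by rewrite !mulr0 mulr1 mulr0z floor0 fn !add0r subr0 mulr1 prednK.
Qed.

(** In the unscaled coordinate a spatial point moves its endpoint by a multiple of the inverse cube
    root of [n]; beyond [c ^+ 3] the endpoints come in the right order. *)
Lemma scaled_block_lt dt a p : (0 < dt)%N -> exists m, forall n, (m <= n)%N ->
  (0 < n)%N /\ (scaled_block n a dt p).1.2 < (scaled_block n a dt p).2.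
Proof.
move=> dt0; pose c := 2 * `|p.1 - p.2| + 1.
have c0 : 0 < c by rewrite /c; have := normr_ge0 (p.1 - p.2); lra.
exists (Num.truncn (c ^+ 3)).+1 => n nc.
have n0 : (0 < n)%N by apply: leq_trans nc.
split=> //; rewrite /scaled_block/=.
have [q0 e3 _ nE] := scaling_exponents n0; rewrite e3.
have : c ^+ 3 < n%:R.
  by rewrite (lt_le_trans (truncnS_gt _))// ler_nat.
move: (root6 n) q0 {e3} nE => q q0 ->.
rewrite (_ : 6 = 2 * 3)%N// exprM ltr_pXn2r// ?nnegrE ?sqr_ge0 ?(ltW c0)// => cq.
have q20 : 0 < q ^+ 2 by rewrite exprn_gt0.
rewrite -subr_gt0 (_ : _ - _ = dt%:R - 2 * (p.1 - p.2) / q ^+ 2); last by ring.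
rewrite subr_gt0 ltr_pdivrMr//; apply: (@lt_le_trans _ _ (1 * q ^+ 2)).
  by have := ler_norm (p.1 - p.2); rewrite /c in cq; lra.
by rewrite ler_wpM2r ?(ltW q20)// ler1n.
Qed.

Variables (d : measure_display) (T : measurableType d) (P : probability T R).
Variable W : int -> R -> T -> R.
Hypothesis WW : two_sided_brownian_family P W.

Definition affine_scale n dt (p : R * R) (x : R) : R :=
  root6 n * (x - 2 * dt%:R * Num.sqrt n%:R - 2 * (p.2 - p.1) * root6 n).

Lemma scaled_lppE n a dt p :
  scaled_lpp W n a dt p = affine_scale n dt p \o lpp_of W (scaled_block n a dt p).
Proof. by []. Qed.

Lemma measurable_affine_scale n dt p : measurable_fun setT (affine_scale n dt p).
Proof. by apply: measurable_funM => //; do 2 apply: measurable_funB => //. Qed.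

Lemma measurable_scaled_lpp n a dt p : (scaled_block n a dt p).1.2 < (scaled_block n a dt p).2 ->
  measurable_fun setT (scaled_lpp W n a dt p).
Proof.
by move=> h; exact: (measurableT_comp (measurable_affine_scale n dt p) (measurable_lpp WW h)).
Qed.

Lemma measurable_scaled_lpp_lines (K : set int) n a dt p :
  (0 < dt * n)%N -> (scaled_block n a dt p).1.2 < (scaled_block n a dt p).2 ->
  (forall j : int, n%:Z * a < j <= n%:Z * a + (dt * n)%:Z -> K j) ->
  measurable_fun setT
    (scaled_lpp W n a dt p : process_type [set p : int * R | K p.1] (fun p => W p.1 p.2) -> R).
Proof.
move=> n0 h hK; apply: (measurableT_comp (measurable_affine_scale n dt p) (measurable_lpp_lines WW h _)).
by move=> j /=; rewrite prednK//; exact: hK.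
Qed.

(** The centering terms, including the displacements, add up over consecutive time intervals, so
    that superadditivity survives the scaling. The three slabs fill the times from -1 to 2. *)
Lemma scaled_lpp_super n (k x y z : R) w : (0 < n)%N ->
  (scaled_block n (-1) 1 (k, x)).1.2 < (scaled_block n (-1) 1 (k, x)).2 ->
  (scaled_block n 0 1 (x, y)).1.2 < (scaled_block n 0 1 (x, y)).2 ->
  (scaled_block n 1 1 (y, z)).1.2 < (scaled_block n 1 1 (y, z)).2 ->
  scaled_lpp W n (-1) 1 (k, x) w + scaled_lpp W n 0 1 (x, y) w + scaled_lpp W n 1 1 (y, z) w <=
  scaled_lpp W n (-1) 3 (k, z) w.
Proof.
move=> n0 h1 h2 h3; have [q0 _ _ _] := scaling_exponents n0.
rewrite /scaled_lpp -!mulrDr ler_wpM2l ?(ltW q0)//.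
have cW j : continuous (fun t => W j t w) by exact: brownian_family_continuous WW _ _.
case: n n0 q0 h1 h2 h3 => // n _ q0; rewrite /scaled_block /= => h1 h2 h3.
set e := root3 n.+1 in h1 h2 h3 *.
have s1 := @lpp_superadditive _ (fun j t => W j t w) (n.+1%:Z * -1) n n
  ((-1)%:~R + 2 * k * e) (2 * x * e) (1 + 2 * y * e) cW.
have s2 := @lpp_superadditive _ (fun j t => W j t w) (n.+1%:Z * -1) (n.+1 + n) n
  ((-1)%:~R + 2 * k * e) (1 + 2 * y * e) (2 + 2 * z * e) cW.
rewrite (_ : (n + 0 * n.+1)%coq_nat = n); last by lia.
move: s1 s2 h1 h2 h3.
rewrite (_ : n.+1%:Z * -1 + n.+1%:Z = 0); last by lia.
rewrite (_ : n.+1%:Z * -1 + (n.+1 + n).+1%:Z = n.+1%:Z); last by lia.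
rewrite (_ : (n + 2 * n.+1)%coq_nat = ((n.+1 + n).+1 + n)%N); last by lia.
rewrite mulr0 mulr1 /= mulr0z mulr1z mulrN1z !add0r.
rewrite (_ : -1 + 1 = 0 :> R); last by lra.
rewrite (_ : -1 + 3%:R = 2 :> R); last by lra.
rewrite (_ : 1 + 1 = 2 :> R)// add0r => s1 s2 h1 h2 h3.
have := s1 (ltW h1) (ltW h2); have := s2 (ltW (lt_trans h1 h2)) (ltW h3).
lra.
Qed.

(** Both a shift in time and a common shift of the spatial endpoints are translations of the
    Brownian lines, and the centering depends on [p.2 - p.1] only. *)
Lemma scaled_lpp_translate (K : Type) n a dt (c : R) (p : K -> R * R) :
  (forall k, (scaled_block n 0 dt (p k)).1.2 < (scaled_block n 0 dt (p k)).2) ->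
  same_law P P (fun k => scaled_lpp W n a dt ((p k).1 + c, (p k).2 + c))
               (fun k => scaled_lpp W n 0 dt (p k)).
Proof.
move=> h; have := lpp_affine_law WW (n%:Z * a) (a%:~R + 2 * c * root3 n) ltr01 h.
move=> /(same_law_comp (g := fun (x : path_space R K) k => affine_scale n dt (p k) (x k))).
rewrite sqrtr1.
have -> : (fun k w => affine_scale n dt (p k) (lpp_of W (affine_block (n%:Z * a) 1
    (a%:~R + 2 * c * root3 n) (scaled_block n 0 dt (p k))) w)) =
    (fun k => scaled_lpp W n a dt ((p k).1 + c, (p k).2 + c)).
  apply/funext => k; apply/funext => w.
  rewrite scaled_lppE /affine_scale /=; congr (_ * (_ - _ - 2 * _ * _)); last by ring.
  congr (lpp_of W _ w); rewrite /affine_block /scaled_block /= mulr0 mulr0z !add0r.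
  by congr (_, _, _, _); ring.
have -> : (fun k w => affine_scale n dt (p k) (1 * lpp_of W (scaled_block n 0 dt (p k)) w)) =
    (fun k => scaled_lpp W n 0 dt (p k)).
  by apply/funext => k; apply/funext => w; rewrite mul1r.
apply; apply: measurable_path => k.
exact: (measurableT_comp (measurable_affine_scale n dt (p k)) (@measurable_coord _ K k)).
Qed.

Lemma scaled_lpp_reflect (K : Type) n (p : K -> R * R) : (0 < n)%N ->
  (forall k, (scaled_block n 0 1 (p k)).1.2 < (scaled_block n 0 1 (p k)).2) ->
  same_law P P (fun k => scaled_lpp W n 0 1 (- (p k).2, - (p k).1))
               (fun k => scaled_lpp W n 0 1 (p k)).
Proof.
move=> n0 h; have := lpp_reflect_law WW n.+1%:Z 1 h.
move=> /(same_law_comp (g := fun (x : path_space R K) k => affine_scale n 1 (p k) (x k))).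
have -> : (fun k w => affine_scale n 1 (p k) (lpp_of W (reflect_block n.+1%:Z 1
    (scaled_block n 0 1 (p k))) w)) =
    (fun k => scaled_lpp W n 0 1 (- (p k).2, - (p k).1)).
  apply/funext => k; apply/funext => w.
  rewrite scaled_lppE /affine_scale /=; congr (_ * (_ - _ - 2 * _ * _)); last by ring.
  congr (lpp_of W _ w); rewrite /reflect_block /scaled_block /= mulr0 mulr0z mul1n !add0r.
  congr (_, _, _, _); [by case: n n0 {h} => // n _ /=; lia|ring|ring].
apply; apply: measurable_path => k.
exact: (measurableT_comp (measurable_affine_scale n 1 (p k)) (@measurable_coord _ K k)).
Qed.

End scaled_lpp.

Lemma scaled_lpp_law (R : realType) d (T : measurableType d) (P : probability T R)
    d' (T' : measurableType d') (P' : probability T' R) W W' (K : Type) n a dt (p : K -> R * R) :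
  two_sided_brownian_family P W -> two_sided_brownian_family P' W' ->
  (forall k, (scaled_block n a dt (p k)).1.2 < (scaled_block n a dt (p k)).2) ->
  same_law P P' (fun k => scaled_lpp W n a dt (p k)) (fun k => scaled_lpp W' n a dt (p k)).
Proof.
move=> WW WW' h; have := lpp_law WW WW' h.
move=> /(same_law_comp (g := fun (x : path_space R K) k => affine_scale n dt (p k) (x k))).
apply; apply: measurable_path => k.
exact: (measurableT_comp (measurable_affine_scale n dt (p k)) (@measurable_coord _ K k)).
Qed.

Section unit_grid.
Context {R : realType}.

(** A dense sequence in the unit square, decoded from triples of naturals; a number that codes no
    triple gives the corner [(0, 0)], and [Num.min] keeps the fractions in the square. It indexes
    all the countable suprema below. *)
Definition unit_grid (c : nat) : R * R :=
  let: (m, i, j) := odflt (0, 0, 0)%N (@choice.unpickle (nat * nat * nat)%type c) in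
  (Num.min (i%:R / m.+1%:R) 1, Num.min (j%:R / m.+1%:R) 1).

Lemma unit_grid_itv c : [/\ 0 <= (unit_grid c).1, (unit_grid c).1 <= 1,
  0 <= (unit_grid c).2 & (unit_grid c).2 <= 1].
Proof.
rewrite /unit_grid; case: (odflt _ _) => [[m i] j] /=.
by rewrite !le_min !ge_min ler01 !lexx !orbT !andbT !divr_ge0.
Qed.

Lemma unit_grid_dense (f : R * R -> R) (b : R) (z : R * R) : continuous f ->
  (forall c, f (unit_grid c) <= b) -> 0 <= z.1 <= 1 -> 0 <= z.2 <= 1 -> f z <= b.
Proof.
move=> cf fb /andP[z10 z11] /andP[z20 z21].
pose q (x : R) k : R := (Num.truncn (x * k.+1%:R))%:R / k.+1%:R.
have qE x k : 0 <= x -> x <= 1 -> Num.min (q x k) 1 = q x k.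
  move=> x0 x1; apply/min_idPl; rewrite /q ler_pdivrMr// mul1r.
  apply: (@le_trans _ _ (x * k.+1%:R)); last by rewrite ler_piMl.
  by rewrite truncn_le mulr_ge0.
have cq : f (q z.1 k, q z.2 k) @[k --> \oo] --> f z.
  have c1 := truncn_grid_cvg z10; have c2 := truncn_grid_cvg z20.
  have c3 := cvg_pair c1 c2.
  have cz : f x @[x --> (z.1, z.2)] --> f z.
    by rewrite (_ : (z.1, z.2) = z); [exact: cf|case: (z)].
  have c4 : (q z.1 k, q z.2 k) @[k --> \oo] --> (z.1, z.2) by exact: c3.
  by have := cvg_comp (fun k => (q z.1 k, q z.2 k)) f c4 cz; exact.
apply: (cvgr_to_le cq); apply: nearW => k.
have := fb (@choice.pickle (nat * nat * nat)%type (k, Num.truncn (z.1 * k.+1%:R), Num.truncn (z.2 * k.+1%:R))).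
by rewrite /unit_grid choice.pickleK /= -!/(q _ _) !qE.
Qed.
End unit_grid.

Section landscape_unit.
Context {R : realType}.
Local Notation point := (R * R * R * R)%type.
Variables (d : measure_display) (T : measurableType d) (P : probability T R).
Variable L : T -> point -> R.
Hypothesis LL : directed_landscape P L.

Definition unit_landscape (w : T) (z : R * R) : R := L w (z.1, 0, z.2, 1).

Lemma R4up_unit (x y : R) : R4up (x, 0, y, 1).
Proof. by rewrite /R4up /= ltr01. Qed.

Lemma measurable_unit_landscape z : measurable_fun setT (unit_landscape ^~ z).
Proof. exact: landscape_measurable LL _ (R4up_unit _ _). Qed.

Lemma unit_landscape_continuous w : continuous (unit_landscape w).
Proof.
move=> z; have /subspace_continuousP := @landscape_continuous _ _ _ _ _ LL w.
move=> /(_ _ (R4up_unit z.1 z.2)) h; apply: cvg_trans h.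
pose i (z : R * R) : point := (z.1, 0, z.2, 1).
have ci : i z' @[z' --> z] --> i z.
  have c1 : z'.1 @[z' --> z] --> z.1 by exact: cvg_fst.
  have c2 : z'.2 @[z' --> z] --> z.2 by exact: cvg_snd.
  have c0 (c : R) : (fun _ : R * R => c) z' @[z' --> z] --> c by exact: cvg_cst.
  exact: (cvg_pair (cvg_pair (cvg_pair c1 (c0 0)) c2) (c0 1)).
move=> A /= hA; have := ci _ hA; rewrite /nbhs /=.
apply: filterS => z' h'; apply: (h' _); exact: R4up_unit.
Qed.

Lemma unit_landscape_dense w (k l : R) (c : R) (z : R * R) :
  (forall n, unit_landscape w (k + (unit_grid n).1, l + (unit_grid n).2) <= c) ->
  k <= z.1 <= k + 1 -> l <= z.2 <= l + 1 -> unit_landscape w z <= c.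
Proof.
move=> h /andP[a1 a2] /andP[b1 b2].
pose f (u : R * R) := unit_landscape w (k + u.1, l + u.2).
have cf : continuous f.
  move=> u.
  have c1 : k + u'.1 @[u' --> u] --> k + u.1 by apply: cvgD; [exact: cvg_cst|exact: cvg_fst].
  have c2 : l + u'.2 @[u' --> u] --> l + u.2 by apply: cvgD; [exact: cvg_cst|exact: cvg_snd].
  exact: (cvg_comp (fun u' => (k + u'.1, l + u'.2)) (unit_landscape w) (cvg_pair c1 c2)
    (@unit_landscape_continuous w (k + u.1, l + u.2))).
have := @unit_grid_dense _ f c (z.1 - k, z.2 - l) cf h.
rewrite /f /= [k + _]addrC [l + _]addrC !subrK; case: z {h} a1 a2 b1 b2 => z1 z2 /= a1 a2 b1 b2 h.
by apply: h; lra.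
Qed.
End landscape_unit.

(** * Tightness, and the upper tail over a box *)

Section strips.
Context {R : realType}.

Definition in_strips (p : R * R) : Prop :=
  (p.1 = 0 /\ 0 <= p.2 <= 1) \/ (p.2 = 0 /\ 0 <= p.1 <= 1).

(** Quantified over all Brownian families, so that a constant found with one landscape serves for
    every other. The level 2^-16 is the one that [centered_mgf_tight] consumes. *)
Definition tight_strips (La : R) : Prop :=
  forall D : seq (R * R), (forall p, p \in D -> in_strips p) ->
  exists n0, forall n, (n0 <= n)%N ->
  forall d (T : measurableType d) (P : probability T R) (W : int -> R -> T -> R),
    two_sided_brownian_family P W ->
    (P [set w | has (fun p => (scaled_lpp W n 0 1 p w < - La)%R) D] <= ((2 ^+ 16)^-1)%:E)%E.

Lemma measurable_has_event d (T : measurableType d) (I : Type) (X : I -> T -> R) (c : R) (D : seq I) :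
  (forall i, measurable_fun setT (X i)) -> measurable [set w | has (fun i => X i w < c) D].
Proof.
move=> mX; elim: D => [|i D ih] /=.
  by rewrite (_ : [set _ | _] = set0)//; apply/seteqP; split.
rewrite (_ : [set _ | _] = [set w | X i w < c] `|` [set w | has (fun i => X i w < c) D]).
  by apply: measurableU => //; exact: measurable_lt_event.
by apply/seteqP; split => w /= /orP.
Qed.

Lemma same_law_has d (T : measurableType d) (P : probability T R)
    d' (T' : measurableType d') (P' : probability T' R) (I : Type)
    (X : I -> T -> R) (X' : I -> T' -> R) (c : R) (D : seq I) :
  same_law P P' X X' ->
  P [set w | has (fun i => X i w < c) D] = P' [set w | has (fun i => X' i w < c) D].
Proof.
move=> h; apply: (h [set x : path_space R I | has (fun i => x i < c) D]).
apply: (@measurable_has_event _ (path_space R I) I (fun i x => x i)) => i.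
exact: measurable_coord.
Qed.

Lemma has_nth (I : Type) (x0 : I) (D : seq I) (a : pred I) :
  has a D = has (fun k => a (nth x0 D k)) (iota 0 (size D)).
Proof. by rewrite -[in LHS](mkseq_nth x0 D) /mkseq has_map. Qed.

Lemma scaled_blocks_lt (D : seq (R * R)) a dt : (0 < dt)%N -> exists n0, forall n, (n0 <= n)%N ->
  (0 < n)%N /\ forall k, (scaled_block n a dt (nth (0, 0) D k)).1.2 <
                         (scaled_block n a dt (nth (0, 0) D k)).2.
Proof.
move=> dt0; elim: D => [|p D [n0 h]].
  have [n0 h] := @scaled_block_lt R dt a (0, 0) dt0.
  by exists n0 => n nn; split => [|k]; rewrite ?nth_nil; have [] := h n nn.
have [n1 h1] := @scaled_block_lt R dt a p dt0.
exists (maxn n0 n1) => n; rewrite geq_max => /andP[nn0 nn1].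
have [n00 hD] := h n nn0; have [_ hp] := h1 n nn1.
by split => // -[|k]; [exact: hp|exact: hD].
Qed.

Lemma scaled_has_law d (T : measurableType d) (P : probability T R) W
    d' (T' : measurableType d') (P' : probability T' R) W' n a dt c (D : seq (R * R)) :
  two_sided_brownian_family P W -> two_sided_brownian_family P' W' ->
  (forall k, (scaled_block n a dt (nth (0, 0) D k)).1.2 <
             (scaled_block n a dt (nth (0, 0) D k)).2) ->
  P [set w | has (fun p => scaled_lpp W n a dt p w < c) D] =
  P' [set w | has (fun p => scaled_lpp W' n a dt p w < c) D].
Proof.
move=> WW WW' h; have := same_law_has c (iota 0 (size D)) (scaled_lpp_law WW WW' h).
under eq_fun do rewrite -(has_nth (0, 0) D (fun p => scaled_lpp W n a dt p _ < c)).
by under [in X in _ = P' X]eq_fun do rewrite -(has_nth (0, 0) D (fun p => scaled_lpp W' n a dt p _ < c)).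
Qed.
End strips.

Section tightness.
Context {R : realType}.
Local Notation point := (R * R * R * R)%type.
Variables (d : measure_display) (T : measurableType d) (P : probability T R).
Variable L : T -> point -> R.
Hypothesis LL : directed_landscape P L.

Definition unit_thresholds (s c : R) (D : seq (R * R)) : seq (R * point * R) :=
  [seq (s, (p.1, 0, p.2, 1), c) | p <- D].

Lemma unit_thresholds_R4up s c D i : i \in unit_thresholds s c D -> R4up i.1.2.
Proof. by case/mapP => p _ ->; exact: R4up_unit. Qed.

Lemma unit_thresholds_gtP s c D (g : point -> R) e : 0 <= e ->
  e < excess (unit_thresholds s c D) g <->
  exists2 p, p \in D & c + e < s * g (p.1, 0, p.2, 1).
Proof.
move=> e0; rewrite excess_gtP//; split.
  by case=> i /mapP[p pD ->] /=; rewrite ltrBrDl => h; exists p.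
by case=> p pD h; exists (s, (p.1, 0, p.2, 1), c); [apply/mapP; exists p|rewrite /= ltrBrDl].
Qed.

Lemma unit_landscape_bounded w : exists m : nat, forall p, in_strips p ->
  - m%:R <= unit_landscape L w p.
Proof.
have cL := unit_landscape_continuous LL (w := w).
have sec (g : R -> R * R) : continuous g -> exists c : R, forall x, 0 <= x <= 1 ->
    c <= unit_landscape L w (g x).
  move=> cg; have cf : continuous (unit_landscape L w \o g).
    by move=> x; apply: continuous_comp; [exact: cg|exact: cL].
  have [c _ h] := EVT_min ler01 (continuous_subspaceT cf).
  by exists ((unit_landscape L w \o g) c) => x x01; apply: (h x); rewrite in_itv.
have c0 (x : R) : (fun _ : R => 0 : R) y @[y --> x] --> (0 : R) by exact: cvg_cst.
have ci (x : R) : (y : R) @[y --> x] --> x by exact: cvg_id.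
have [a ha] := sec (fun x => (0, x)) (fun x => cvg_pair (c0 x) (ci x)).
have [b hb] := sec (fun x => (x, 0)) (fun x => cvg_pair (ci x) (c0 x)).
exists (Num.truncn (`|a| + `|b|)).+1 => -[x y] h.
have := truncnS_gt (`|a| + `|b|).
have := ler_norm (- a); have := ler_norm (- b); rewrite !normrN.
have := normr_ge0 a; have := normr_ge0 b.
case: h => /= -[-> h]; [have := ha _ h|have := hb _ h]; lra.
Qed.

(** Each path is bounded below on the two compact strips, so the events of falling below [- m]
    somewhere decrease to the empty set, and one of them has probability below [eta]. *)
Lemma strips_lower (eta : R) : 0 < eta -> exists2 La : R, 0 < La &
  forall D, (forall p, p \in D -> in_strips p) ->
  (P [set w | (0 < excess (unit_thresholds (-1) La D) (L w))%R] < eta%:E)%E.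
Proof.
move=> eta0.
pose bad (m c : nat) := [set w | unit_landscape L w (0, (unit_grid c).2) < - m%:R] `|`
  [set w | unit_landscape L w ((unit_grid c).1, 0) < - m%:R].
pose F m := ~` \bigcup_c bad m c.
have mU := measurable_unit_landscape LL.
have mB m : measurable (\bigcup_c bad m c).
  by apply: bigcupT_measurable => c; apply: measurableU; apply: measurable_lt_event.
have mF m : measurable (F m) by exact: measurableC.
have grid1 c : in_strips (0, (unit_grid c).2 : R).
  by left; have [_ _ -> ->] := @unit_grid_itv R c.
have grid2 c : in_strips ((unit_grid c).1 : R, 0).
  by right; have [-> -> _ _] := @unit_grid_itv R c.
have [m hm] : exists m, (P (\bigcup_c bad m c) < eta%:E)%E.
  apply: contrapT => /forallNP h.
  have FT : \bigcup_m F m = setT.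
    apply/seteqP; split => // w _; have [m hm] := unit_landscape_bounded w.
    exists m => // -[c _] [] /=; rewrite ltNge => /negP; apply; apply: hm; [exact: grid1|exact: grid2].
  have : (P (\bigcup_m F m) <= 1 - eta%:E)%E.
    apply: measure_nondecreasing_le => //.
      move=> n k nk w h1 [c _ h2]; apply: h1; exists c => //.
      have nk' : (- k%:R : R) <= - n%:R by rewrite lerN2 ler_nat.
      by case: h2 => /= h2; [left|right] => /=; exact: lt_le_trans nk'.
    move=> n; rewrite probability_setC// leeB//.
    by rewrite leNgt; apply/negP; exact: h.
  rewrite FT probability_setT -EFinD lee_fin; lra.
exists (m%:R + 1) => [|D hD]; first by rewrite ltr_wpDl.
apply: le_lt_trans hm; apply: le_measure; rewrite ?inE.
- by apply: measurable_excess_event => i iD; apply: (landscape_measurable LL); exact: unit_thresholds_R4up iD.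
- exact: mB.
move=> w /= /(unit_thresholds_gtP _ _ _ _ (lexx _)) [[x y] pD]; rewrite addr0 mulN1r /= => hp.
apply: contrapT => nb; have cL := unit_landscape_continuous LL (w := w).
have good1 c : - unit_landscape L w (0, (unit_grid c).2) <= m%:R.
  by rewrite lerNl leNgt; apply/negP => h; apply: nb; exists c => //; left.
have good2 c : - unit_landscape L w ((unit_grid c).1, 0) <= m%:R.
  by rewrite lerNl leNgt; apply/negP => h; apply: nb; exists c => //; right.
have := hD _ pD => -[] /= [e0 h01]; rewrite /= e0 in hp.
- have cf : continuous (fun z : R * R => - unit_landscape L w (0, z.2)).
    move=> z; apply: cvgN.
    have c1 : (fun _ : R * R => 0 : R) z' @[z' --> z] --> (0 : R) by exact: cvg_cst.
    have c2 : z'.2 @[z' --> z] --> z.2 by exact: cvg_snd.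
    exact: (cvg_comp (fun z' => (0, z'.2)) (unit_landscape L w) (cvg_pair c1 c2) (cL (0, z.2))).
  have := unit_grid_dense (z := (0, y)) cf good1; rewrite /= lexx ler01 h01 => /(_ isT isT).
  rewrite /unit_landscape /=; lra.
- have cf : continuous (fun z : R * R => - unit_landscape L w (z.1, 0)).
    move=> z; apply: cvgN.
    have c1 : (fun _ : R * R => 0 : R) z' @[z' --> z] --> (0 : R) by exact: cvg_cst.
    have c2 : z'.1 @[z' --> z] --> z.1 by exact: cvg_fst.
    exact: (cvg_comp (fun z' => (z'.1, 0)) (unit_landscape L w) (cvg_pair c2 c1) (cL (z.1, 0))).
  have := unit_grid_dense (z := (x, 0)) cf good2; rewrite /= lexx ler01 h01 => /(_ isT isT).
  rewrite /unit_landscape /=; lra.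
Qed.

Lemma premeasurable_unit d' (T' : measurableType d') (P' : probability T' R) W s c D n :
  two_sided_brownian_family P' W -> (0 < n)%N ->
  (forall k, (scaled_block n 0 1 (nth (0, 0) D k)).1.2 < (scaled_block n 0 1 (nth (0, 0) D k)).2) ->
  premeasurable (T' := T') W (unit_thresholds s c D) n.
Proof.
move=> WW n0 h i /mapP[p pD ->].
rewrite (_ : (fun w => _) = scaled_lpp W n 0 1 p); last first.
  by apply/funext => w; rewrite [p in RHS]surjective_pairing; exact: prelandscape_unit.
have := h (index p D); rewrite nth_index// => hp.
exact: (measurable_scaled_lpp WW hp).
Qed.

(** Tightness of the prelimits is read off from the existence of a continuous limit; the 1 added to
    [La] is the margin spent in [prelandscape_upper]. *)
Lemma tight_strips_exists : exists2 La : R, 0 < La & tight_strips La.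
Proof.
have [d' [T' [P' [W [WW lim]]]]] := landscape_limit LL.
have h0 : 0 < (2 ^+ 16)^-1 :> R by [].
have [La La0 hLa] := strips_lower h0.
exists (La + 1) => [|D hD]; first by rewrite ltr_wpDr.
have [n0 hn0] := @scaled_blocks_lt R D 0 1 isT.
have := hLa _ hD => /(prelandscape_upper LL lim (@unit_thresholds_R4up (-1) La D) ltr01)[n1 hn1].
exists (maxn n0 n1) => n; rewrite geq_max => /andP[nn0 nn1] d2 T2 P2 W2 WW2.
have [n_gt0 hb] := hn0 n nn0.
rewrite (scaled_has_law (- (La + 1)) WW2 WW hb).
have pm : premeasurable W (unit_thresholds (-1) La D) n by exact: premeasurable_unit WW n_gt0 hb.
have H := hn1 n nn1 pm.
apply: (le_trans _ H).
rewrite le_eqVlt; apply/orP; left; apply/eqP; congr (P' _); apply/seteqP; split => w /=.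
  move=> /hasP[p pD hp]; apply/(unit_thresholds_gtP _ _ _ _ ler01); exists p => //.
  by rewrite mulN1r prelandscape_unit// ltrNr -surjective_pairing.
move=> /(unit_thresholds_gtP _ _ _ _ ler01)[p pD]; rewrite mulN1r prelandscape_unit// ltrNr -surjective_pairing => h.
by apply/hasP; exists p.
Qed.
End tightness.

Section box_mgf.
Context {R : realType}.
Local Notation root6 n := ((n%:R : R) `^ (1 / 6)).
Local Notation root3 n := ((n%:R : R) `^ (- (1 / 3))).

Lemma inv_expR_bound (x : R) : 0 <= x -> x <= 2^-1 ->
  (1 - x)^-1 <= expR (x + x ^+ 2 / 2 + x ^+ 3).
Proof.
move=> x0 x2; have x1 : 0 < 1 - x by lra.
set t := x + x ^+ 2 / 2 + x ^+ 3.
have t0 : 0 <= t by rewrite /t !addr_ge0 ?divr_ge0 ?exprn_ge0.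
apply: le_trans (expR_ge_quadratic t0).
rewrite -[X in X <= _]mul1r ler_pdivrMr// -subr_ge0.
rewrite (_ : _ - 1 = x ^+ 3 * (2^-1 - 3 / 8 * x - 5 / 8 * x ^+ 2 - x ^+ 4 / 2)); last first.
  by rewrite /t; field.
rewrite mulr_ge0 ?exprn_ge0//.
have x22 : x ^+ 2 <= 4^-1 by rewrite expr2; nra.
have x44 : x ^+ 4 <= 16^-1.
  by rewrite (_ : x ^+ 4 = x ^+ 2 * x ^+ 2); [nra|rewrite -exprD].
lra.
Qed.

(** The exponent that results from [lpp_mgf_bound] for duration 3 and displacement [j], where [e] is
    the inverse cube root of [n]. The drift is [mu = sqrt n * c], to first order the minimizer of
    [(v - u) * s * mu + 3 * n * s / mu]. For [e] tending to 0 the exponent tends to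
    [3 * th ^+ 3 - th * j ^+ 2 / 3], a cubic and a parabola. *)
Definition strip_exponent (th j e : R) : R :=
  let c := 1 - j * e / 3 in
  th * j ^+ 2 * ((3 * c)^-1 - 2 / 3) + th ^+ 2 * j ^+ 2 * e * (3 - 2 * (j * e / 3)) / (6 * c ^+ 2)
  + 3 * th ^+ 3 / c ^+ 3.

Lemma strip_exponent_near (th j : R) : 0 < th -> exists2 e0 : R, 0 < e0 & forall e, 0 < e < e0 ->
  [/\ 2^-1 < 1 - j * e / 3, th * e / (1 - j * e / 3) < 2^-1 &
      strip_exponent th j e <= 3 * th ^+ 3 - th * j ^+ 2 / 3 + 1].
Proof.
move=> th0.
have id0 : (e : R) @[e --> 0] --> (0 : R) by exact: cvg_id.
have cc : 1 - j * e / 3 @[e --> (0 : R)] --> 1 - j * 0 / 3.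
  by apply: cvgB; [exact: cvg_cst|apply: cvgMl; exact: cvgMr].
have c0 : 1 - j * 0 / 3 = 1 :> R by rewrite mulr0 mul0r subr0.
have cx : th * e / (1 - j * e / 3) @[e --> (0 : R)] --> th * 0 / (1 - j * 0 / 3).
  by apply: cvgM; [exact: cvgMr|apply: cvgV => //; rewrite c0 oner_eq0].
have cX k : (1 - j * e / 3) ^+ k @[e --> (0 : R)] --> (1 - j * 0 / 3) ^+ k.
  exact: (cvg_comp _ (fun x : R => x ^+ k) cc (@exprn_continuous _ _ _)).
have cE : strip_exponent th j e @[e --> (0 : R)] --> strip_exponent th j 0.
  rewrite /strip_exponent; apply: cvgD.
    apply: cvgD.
      apply: cvgMr; apply: cvgB; last exact: cvg_cst.
      by apply: cvgV; [rewrite c0 mulr1|exact: cvgMr].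
    apply: cvgM.
      apply: cvgM; first exact: cvgMr.
      by apply: cvgB; [exact: cvg_cst|apply: cvgMr; apply: cvgMl; exact: cvgMr].
    by apply: cvgV; [rewrite c0 expr1n mulr1|apply: cvgMr; exact: cX].
  by apply: cvgMr; apply: cvgV; [rewrite c0 expr1n oner_eq0|exact: cX].
have E0 : strip_exponent th j 0 = 3 * th ^+ 3 - th * j ^+ 2 / 3.
  by rewrite /strip_exponent; field.
have [e0 /= r0 h] : exists2 r : R, 0 < r & forall e, `|0 - e| < r ->
    [/\ 2^-1 < 1 - j * e / 3, th * e / (1 - j * e / 3) < 2^-1 &
      strip_exponent th j e <= 3 * th ^+ 3 - th * j ^+ 2 / 3 + 1].
  apply/(@nbhs_ballP R R); near=> e; split.
  - by near: e; apply: (cvgr_gt _ cc); rewrite c0; lra.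
  - by near: e; apply: (cvgr_lt _ cx); rewrite mulr0 mul0r.
  - by apply/ltW; near: e; apply: (cvgr_lt _ cE); rewrite E0 ltrDl.
exists e0 => // e /andP[e_gt0 e_lt]; apply: h.
by rewrite sub0r normrN gtr0_norm.
Unshelve. all: by end_near. Qed.

Lemma root3_lt (e0 : R) : 0 < e0 -> exists n0, forall n, (n0 <= n)%N -> (0 < n)%N /\ 0 < root3 n < e0.
Proof.
move=> r0; exists (Num.truncn (e0^-1 ^+ 3)).+1 => n nc.
have n0 : (0 < n)%N by apply: leq_trans nc.
split=> //; have [q0 e3 _ nE] := @scaling_exponents R n n0; rewrite e3.
have : e0^-1 ^+ 3 < n%:R by rewrite (lt_le_trans (truncnS_gt _))// ler_nat.
move: (root6 n) q0 {e3} nE => q q0 ->.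
rewrite (_ : 6 = 2 * 3)%N// exprM ltr_pXn2r// ?nnegrE ?sqr_ge0 ?invr_ge0 ?(ltW r0)// => cq.
rewrite invr_gt0 exprn_gt0//= -[ltRHS]invrK ltf_pV2// posrE ?invr_gt0// exprn_gt0//.
Qed.

Lemma scaled_mgf (th k j : R) : 0 < th -> exists n0, forall n, (n0 <= n)%N ->
  forall d (T : measurableType d) (P : probability T R) (W : int -> R -> T -> R),
    two_sided_brownian_family P W ->
  (\int[P]_w (expR (th * scaled_lpp W n (-1) 3 (k, k + j) w))%:E <=
   (expR (3 * th ^+ 3 - th * j ^+ 2 / 3 + 1))%:E)%E.
Proof.
move=> th0; have [e0 e00 he] := strip_exponent_near j th0.
have [n1 h1] := root3_lt e00.
have [n2 h2] := @scaled_block_lt R 3 (-1) (k, k + j) isT.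
exists (maxn n1 n2) => n; rewrite geq_max => /andP[nn1 nn2] d T P W WW.
have [n0 e_itv] := h1 n nn1; have [_ hb] := h2 n nn2.
have [hc hx hE] := he _ e_itv.
have [q0 e3 rn nE] := @scaling_exponents R n n0.
set e := root3 n in e_itv hc hx hE e3.
set c := 1 - j * e / 3 in hc hx.
have c0 : 0 < c by lra.
set q := root6 n in q0 e3 rn nE.
have x0 : 0 < th * e / c by rewrite divr_gt0// mulr_gt0//; case/andP: e_itv.
have s0 : 0 < th * q by rewrite mulr_gt0.
(* Here [s = th * q] and [mu = q ^+ 3 * c] with [q ^+ 3 = sqrt n]; their quotient is of order
   [e]. *)
have xE : th * q / (q ^+ 3 * c) = th * e / c by rewrite e3; field; rewrite !gt_eqF.
have smu : th * q < q ^+ 3 * c.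
  have mu0 : 0 < q ^+ 3 * c by rewrite mulr_gt0// exprn_gt0.
  by rewrite -[ltRHS]mul1r -ltr_pdivrMr// xE; lra.
have := lpp_mgf WW (scaled_block n (-1) 3 (k, k + j)).1.1.1
  (scaled_block n (-1) 3 (k, k + j)).1.1.2 hb s0 smu.
set b := scaled_block n (-1) 3 (k, k + j) in hb *.
rewrite -!surjective_pairing.
pose K := expR (- (th * q * (2 * 3%:R * Num.sqrt n%:R + 2 * j * q))).
have K0 : (0 <= K%:E)%E by rewrite lee_fin expR_ge0.
have -> : (\int[P]_w (expR (th * scaled_lpp W n (-1) 3 (k, k + j) w))%:E =
    K%:E * \int[P]_w (expR (th * q * lpp_of W b w))%:E)%E.
  rewrite -ge0_integralZl//; last first.
    apply/measurable_EFinP; apply: measurableT_comp => //; apply: measurable_funM => //.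
    by apply: (measurable_lpp WW); exact: hb.
  apply: eq_integral => w _; rewrite -EFinM /K -expRD; congr (expR _)%:E.
  by rewrite /scaled_lpp -/b -/q /lpp_of /=; ring.
move=> hm; apply: (@le_trans _ _ (K%:E * (lpp_mgf_bound b.1.1.2 b.1.2 b.2 (th * q) (q ^+ 3 * c))%:E)%E).
  by rewrite lee_wpmul2l.
rewrite -EFinM lee_fin /lpp_mgf_bound xE.
have bN : b.1.1.2.+1 = (3 * n)%N by rewrite /b /scaled_block /= prednK// muln_gt0.
rewrite bN.
have bl : b.2 - b.1.2 = 3 + 2 * j * e.
  by rewrite /b /scaled_block /= -/e mulrN1z; ring.
rewrite bl.
set x := th * e / c in x0 hx *.
have ib : (1 - x) ^- (3 * n) <= expR ((3 * n)%:R * (x + x ^+ 2 / 2 + x ^+ 3)).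
  rewrite expRM_natl -exprVn lerXn2r ?nnegrE ?expR_ge0//.
    by rewrite invr_ge0; lra.
  by apply: inv_expR_bound; exact: ltW.
apply: (@le_trans _ _ (K * (expR ((3 + 2 * j * e) * (th * q * (q ^+ 3 * c) - (th * q) ^+ 2 / 2)) *
   expR ((3 * n)%:R * (x + x ^+ 2 / 2 + x ^+ 3))))).
  by rewrite ler_wpM2l ?expR_ge0// ler_wpM2l ?expR_ge0.
apply: le_trans (_ : _ <= expR (strip_exponent th j e)) _; last by rewrite ler_expR.
rewrite -!expRD ler_expR /strip_exponent -/c /x rn natrM nE.
have jE : j * e = 3 * (1 - c) by rewrite /c; field.
have ne0 : e != 0 by rewrite gt_eqF//; case/andP: e_itv.
have jc : j = 3 * (1 - c) * q ^+ 2.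
  by rewrite -[j](mulfK ne0) jE e3 invrK.
rewrite le_eqVlt; apply/orP; left; apply/eqP.
rewrite e3 jc; field.
by rewrite !gt_eqF.
Qed.
End box_mgf.

Section box_bound.
Context {R : realType}.
Local Notation point := (R * R * R * R)%type.

Definition strip_event (T : Type) (W : int -> R -> T -> R) n a (c La : R) (D : seq (R * R)) : set T :=
  [set w | has (fun k => scaled_lpp W n a 1 ((nth (0, 0) D k).1 + c, (nth (0, 0) D k).2 + c) w < - La)
     (iota 0 (size D))].

Lemma strip_event_bound (La : R) (D : seq (R * R)) : tight_strips La ->
  (forall p, p \in D -> in_strips p) -> exists n0, forall n, (n0 <= n)%N ->
  forall d (T : measurableType d) (P : probability T R) (W : int -> R -> T -> R) a c,
    two_sided_brownian_family P W ->
    (P (strip_event W n a c La D) <= ((2 ^+ 16)^-1)%:E)%E.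
Proof.
move=> tight hD; have [n0 h0] := tight D hD.
have [n1 h1] := @scaled_blocks_lt R D 0 1 isT.
exists (maxn n0 n1) => n; rewrite geq_max => /andP[nn0 nn1] d T P W a c WW.
have [_ hb] := h1 n nn1.
rewrite /strip_event (same_law_has (- La) (iota 0 (size D)) (scaled_lpp_translate WW a c hb)).
apply: le_trans (h0 n nn0 _ _ _ _ WW); rewrite le_eqVlt; apply/orP; left; apply/eqP.
by congr (P _); apply/seteqP; split => w /=; rewrite (has_nth (0, 0) D).
Qed.

Lemma strip_event_measurable d (T : measurableType d) (P : probability T R)
   (W : int -> R -> T -> R) (K : set int) n a c La (D : seq (R * R)) :
  two_sided_brownian_family P W -> (0 < n)%N ->
  (forall k, (scaled_block n 0 1 (nth (0, 0) D k)).1.2 < (scaled_block n 0 1 (nth (0, 0) D k)).2) ->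
  (forall j : int, n%:Z * a < j <= n%:Z * a + n%:Z -> K j) ->
  process_sigma [set p : int * R | K p.1] (fun p => W p.1 p.2) (strip_event W n a c La D).
Proof.
move=> WW n0 hb hK.
apply: (@measurable_has_event _ _ (process_type [set p : int * R | K p.1] (fun p => W p.1 p.2)) nat
  (fun k => scaled_lpp W n a 1 ((nth (0, 0) D k).1 + c, (nth (0, 0) D k).2 + c))) => k.
apply: (measurable_scaled_lpp_lines WW); rewrite ?mul1n//.
have := hb k; rewrite /scaled_block /= mulr0z !add0r.
by move: (n%:R `^ _) => e; lra.
Qed.

(** If a point of the box has a large value and no strip event occurs, then the passage from [k] at
    time -1 to [k + j] at time 2 through that point is large as well. The three time slabs use
    disjoint lines and are independent; both strip events fail with probability at least 1/2, whence
    the factor 4. *)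
Lemma box_upper_prelimit (La th k j s : R) (D : seq (R * R)) : tight_strips La -> 0 < th ->
  (forall p, p \in D -> k <= p.1 <= k + 1 /\ k + j <= p.2 <= k + j + 1) ->
  exists n0, forall n, (n0 <= n)%N ->
  forall d (T : measurableType d) (P : probability T R) (W : int -> R -> T -> R),
    two_sided_brownian_family P W ->
    (P [set w | has (fun p => (s < scaled_lpp W n 0 1 p w)%R) D] <=
     (4 * expR (- (th * (s - La *+ 2)) + (3 * th ^+ 3 - th * j ^+ 2 / 3 + 1)))%:E)%E.
Proof.
move=> tight th0 hD.
pose D1 := [seq (0 : R, p.1 - k) | p <- D]; pose D2 := [seq (p.2 - (k + j), 0 : R) | p <- D].
have hD1 p : p \in D1 -> in_strips p.
  case/mapP => q /hD[/andP[h1 h2] _] ->; left; split => //=; apply/andP; split; lra.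
have hD2 p : p \in D2 -> in_strips p.
  case/mapP => q /hD[_ /andP[h1 h2]] ->; right; split => //=; apply/andP; split; lra.
have [n1 h1] := strip_event_bound tight hD1.
have [n2 h2] := strip_event_bound tight hD2.
have [n3 h3] := scaled_mgf k j th0.
have [n4 h4] := @scaled_blocks_lt R D 0 1 isT.
have [n5 h5] := @scaled_blocks_lt R D1 0 1 isT.
have [n6 h6] := @scaled_blocks_lt R D2 0 1 isT.
have [n7 h7] := @scaled_block_lt R 3 (-1) (k, k + j) isT.
exists (maxn n1 (maxn n2 (maxn n3 (maxn n4 (maxn n5 (maxn n6 n7)))))) => n.
rewrite !geq_max => /and5P[nn1 nn2 nn3 nn4 /and3P[nn5 nn6 nn7]] d T P W WW.
have [n0 hb] := h4 n nn4; have [_ hb1] := h5 n nn5; have [_ hb2] := h6 n nn6.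
have [_ hb3] := h7 n nn7.
pose S1 := strip_event W n (-1) k La D1; pose S2 := strip_event W n 1 (k + j) La D2.
pose E0 := [set w | has (fun p => (s < scaled_lpp W n 0 1 p w)%R) D].
pose K0 := [set i : int | 0 < i <= n%:Z]; pose K1 := [set i : int | i <= 0].
pose K01 := [set i : int | i <= n%:Z]; pose K2 := [set i : int | n%:Z < i].
pose sig (K : set int) := process_sigma [set p : int * R | K p.1] (fun p => W p.1 p.2).
have mS1 K : K1 `<=` K -> sig K (~` S1).
  move=> KK; apply: (@measurableC _ (process_type [set p : int * R | K p.1] (fun p => W p.1 p.2))).
  by apply: (strip_event_measurable k La WW n0 hb1) => i hi; apply: KK; rewrite /K1 /=; lia.
have mS2 : sig K2 (~` S2).
  apply: (@measurableC _ (process_type [set p : int * R | K2 p.1] (fun p => W p.1 p.2))).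
  by apply: (strip_event_measurable (k + j) La WW n0 hb2) => i hi; rewrite /K2 /=; lia.
have E0E : E0 = [set w | has (fun i => - scaled_lpp W n 0 1 (nth (0, 0) D i) w < - s) (iota 0 (size D))].
  apply/seteqP; split => w; rewrite /E0 /= (has_nth (0, 0) D) => /hasP[i hi h].
    by apply/hasP; exists i => //=; rewrite ltrN2.
  by apply/hasP; exists i => //=; rewrite -ltrN2.
have mE0 K : K0 `<=` K -> sig K E0.
  move=> KK; rewrite E0E.
  apply: (@measurable_has_event _ _ (process_type [set p : int * R | K p.1] (fun p => W p.1 p.2)) nat
    (fun i w => - scaled_lpp W n 0 1 (nth (0, 0) D i) w)) => i.
  apply: measurableT_comp => //; apply: (measurable_scaled_lpp_lines WW); rewrite ?mul1n//.
  by move=> l hl; apply: KK; rewrite /K0 /=; lia.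
have sub K : sig K `<=` measurable.
  by apply: process_sigma_measurable => p _; exact: brownian_family_measurable WW.
have disj1 : K0 `&` K1 = set0 by rewrite -subset0 => i [] /=; rewrite /K0 /K1 /=; lia.
have disj2 : K01 `&` K2 = set0 by rewrite -subset0 => i [] /=; rewrite /K01 /K2 /=; lia.
have K01s0 : K0 `<=` K01 by move=> i /=; rewrite /K0 /K01 /=; lia.
have K01s1 : K1 `<=` K01 by move=> i /=; rewrite /K1 /K01 /=; lia.
have ind1 := brownian_family_indep WW disj1 (mE0 _ (@subset_refl _ _)) (mS1 _ (@subset_refl _ _)).
have ind2 : P (E0 `&` ~` S1 `&` ~` S2) = (P (E0 `&` ~` S1) * P (~` S2))%E.
  apply: (brownian_family_indep WW disj2) mS2.
  apply: (@measurableI _ (process_type [set p : int * R | K01 p.1] (fun p => W p.1 p.2))).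
    exact: mE0.
  exact: mS1.
have half S : measurable S -> (P S <= ((2 ^+ 16)^-1)%:E)%E -> (2^-1%:E <= P (~` S))%E.
  move=> mS PS; rewrite probability_setC//.
  apply: (@le_trans _ _ (1 - ((2 ^+ 16)^-1)%:E)%E); last by rewrite leeB.
  rewrite -EFinD lee_fin; lra.
have mS1' : measurable S1 by rewrite -(setCK S1); apply: measurableC; exact: sub (mS1 _ (@subset_refl _ _)).
have mS2' : measurable S2 by rewrite -(setCK S2); apply: measurableC; exact: sub mS2.
have p1 := half _ mS1' (h1 n nn1 _ _ _ _ _ _ WW); have p2 := half _ mS2' (h2 n nn2 _ _ _ _ _ _ WW).
have mE0' : measurable E0 by exact: sub (mE0 _ (@subset_refl _ _)).
have mB : measurable_fun setT (scaled_lpp W n (-1) 3 (k, k + j)).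
  exact: (measurable_scaled_lpp WW hb3).
have incl : E0 `&` ~` S1 `&` ~` S2 `<=` [set w | s - La *+ 2 < scaled_lpp W n (-1) 3 (k, k + j) w].
  move=> w [[/= /hasP[p pD hp] nS1] nS2].
  have pk := index_mem p D; rewrite pD in pk.
  have b1 : (scaled_block n (-1) 1 (k, p.1)).1.2 < (scaled_block n (-1) 1 (k, p.1)).2.
    have := hb1 (index p D); rewrite (nth_map (0, 0)) ?pk// nth_index// /scaled_block /= mulr0z !add0r.
    by move: (n%:R `^ _) => e; lra.
  have b2 : (scaled_block n 1 1 (p.2, k + j)).1.2 < (scaled_block n 1 1 (p.2, k + j)).2.
    have := hb2 (index p D); rewrite (nth_map (0, 0)) ?pk// nth_index// /scaled_block /= mulr0z !add0r.
    by move: (n%:R `^ _) => e; lra.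
  have b0 : (scaled_block n 0 1 (p.1, p.2)).1.2 < (scaled_block n 0 1 (p.1, p.2)).2.
    by have := hb (index p D); rewrite nth_index// -surjective_pairing.
  have l1 : - La <= scaled_lpp W n (-1) 1 (k, p.1) w.
    rewrite leNgt; apply/negP => h; apply: nS1; apply/hasP; exists (index p D).
      by rewrite mem_iota size_map/= pk.
    by rewrite (nth_map (0, 0)) ?pk// nth_index//= add0r subrK.
  have l2 : - La <= scaled_lpp W n 1 1 (p.2, k + j) w.
    rewrite leNgt; apply/negP => h; apply: nS2; apply/hasP; exists (index p D).
      by rewrite mem_iota size_map/= pk.
    by rewrite (nth_map (0, 0)) ?pk// nth_index//= add0r subrK.
  have := scaled_lpp_super WW w n0 b1 b0 b2; rewrite -surjective_pairing; lra.
have chb := exponential_markov P (s - La *+ 2) (ltW th0) mB.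
have tot : (P (E0 `&` ~` S1 `&` ~` S2) <=
   (expR (- (th * (s - La *+ 2)) + (3 * th ^+ 3 - th * j ^+ 2 / 3 + 1)))%:E)%E.
  apply: (@le_trans _ _ (P [set w | s - La *+ 2 < scaled_lpp W n (-1) 3 (k, k + j) w])).
    apply: le_measure => //; rewrite inE.
    - by apply: measurableI; [apply: measurableI => //; exact: measurableC|exact: measurableC].
    - exact: measurable_lt_event.
  apply: le_trans chb _; rewrite expRD EFinM lee_wpmul2l//.
  exact: h3.
have q4 : ((4^-1)%:E * P E0 <= P (E0 `&` ~` S1 `&` ~` S2))%E.
  rewrite ind2 ind1 (_ : 4^-1 = 2^-1 * 2^-1 :> R); last by field.
  rewrite EFinM [(_ * P E0)%E]muleC muleA lee_pmul ?mule_ge0 ?lee_fin//.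
  by rewrite lee_wpmul2l.
rewrite -/E0 (_ : P E0 = (4 : R)%:E * ((4^-1)%:E * P E0))%E; last first.
  by rewrite muleA -EFinM divff ?mul1e.
by rewrite [leRHS]EFinM lee_wpmul2l// (le_trans q4).
Qed.

Variables (d : measure_display) (T : measurableType d) (P : probability T R).
Variable L : T -> point -> R.
Hypothesis LL : directed_landscape P L.

Lemma landscape_box_points (La th k j s : R) (D : seq (R * R)) : tight_strips La -> 0 < th ->
  (forall p, p \in D -> k <= p.1 <= k + 1 /\ k + j <= p.2 <= k + j + 1) ->
  (P [set w | has (fun p => (s + 1 < unit_landscape L w p)%R) D] <=
     (4 * expR (- (th * (s - La *+ 2)) + (3 * th ^+ 3 - th * j ^+ 2 / 3 + 1)))%:E)%E.
Proof.
move=> tight th0 hD.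
have [d' [T' [P' [W [WW lim]]]]] := landscape_limit LL.
have [n0 h0] := box_upper_prelimit s tight th0 hD.
have [n1 h1] := @scaled_blocks_lt R D 0 1 isT.
have := @landscape_upper _ _ _ _ _ LL _ _ P' W lim (unit_thresholds 1 s D) 1
  (4 * expR (- (th * (s - La *+ 2)) + (3 * th ^+ 3 - th * j ^+ 2 / 3 + 1)))
  (@unit_thresholds_R4up _ 1 s D) ltr01.
rewrite (_ : [set w | 1 < excess (unit_thresholds 1 s D) (L w)] =
    [set w | has (fun p => (s + 1 < unit_landscape L w p)%R) D]); last first.
  apply/seteqP; split => w /=.
    by move=> /(unit_thresholds_gtP _ _ _ _ ler01)[p pD]; rewrite mul1r => h; apply/hasP; exists p.
  by move=> /hasP[p pD h]; apply/(unit_thresholds_gtP _ _ _ _ ler01); exists p => //; rewrite mul1r.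
apply => m; pose n := maxn m (maxn n0 n1).
have nn0 : (n0 <= n)%N by rewrite /n; lia.
have nn1 : (n1 <= n)%N by rewrite /n; lia.
have [n_gt0 hb] := h1 n nn1.
exists n; split; first by rewrite /n; lia.
  exact: premeasurable_unit WW n_gt0 hb.
apply: le_trans (h0 n nn0 _ _ _ _ WW); rewrite le_eqVlt; apply/orP; left; apply/eqP.
congr (P' _); apply/seteqP; split => w /=.
  move=> /(unit_thresholds_gtP _ _ _ _ (lexx 0))[p pD]; rewrite addr0 mul1r prelandscape_unit// -surjective_pairing => h.
  by apply/hasP; exists p.
move=> /hasP[p pD h]; apply/(unit_thresholds_gtP _ _ _ _ (lexx 0)); exists p => //.
by rewrite addr0 mul1r prelandscape_unit// -surjective_pairing.
Qed.

(** Over the dense sequence only, to be measurable; [box_event_path] recovers the whole box by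
    continuity. *)
Definition box_event (k j s : R) : set T :=
  \bigcup_c [set w | s < unit_landscape L w (k + (unit_grid c).1, k + j + (unit_grid c).2)].

Lemma box_event_sigma k j s : process_sigma R4up (fun p w => L w p) (box_event k j s).
Proof.
pose S := process_type R4up (fun p w => L w p).
suff h : measurable (box_event k j s : set S) by exact: h.
apply: bigcupT_measurable => c; apply: (@measurable_lt_event _ _ S) => //.
by apply: measurable_process_type; exact: R4up_unit.
Qed.

Lemma box_event_measurable k j s : measurable (box_event k j s).
Proof.
apply: bigcupT_measurable => c; apply: measurable_lt_event => //.
exact: measurable_unit_landscape LL _.
Qed.

Lemma box_event_path k j s w (z : R * R) : ~ box_event k j s w ->
  k <= z.1 <= k + 1 -> k + j <= z.2 <= k + j + 1 -> unit_landscape L w z <= s.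
Proof.
move=> nB z1 z2; apply: (unit_landscape_dense LL (k := k) (l := k + j)) => // c.
by rewrite leNgt; apply/negP => h; apply: nB; exists c.
Qed.

(** The bound for finitely many points is the same for any number of them, hence it survives the
    increasing union. *)
Lemma box_event_bound (La th k j s : R) : tight_strips La -> 0 < th ->
  (P (box_event k j s) <= (4 * expR (- (th * (s - 1 - La *+ 2)) + (3 * th ^+ 3 - th * j ^+ 2 / 3 + 1)))%:E)%E.
Proof.
move=> tight th0.
pose pt c : R * R := (k + (unit_grid c).1, k + j + (unit_grid c).2).
pose F m := [set w | has (fun p => (s - 1 + 1 < unit_landscape L w p)%R) [seq pt c | c <- iota 0 m]].
have mF m : measurable (F m).
  rewrite (_ : F m = [set w | has (fun p => - unit_landscape L w p < - (s - 1 + 1)) [seq pt c | c <- iota 0 m]]).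
    apply: (@measurable_has_event _ _ _ _ (fun p w => - unit_landscape L w p)) => p.
    by apply: measurableT_comp => //; exact: measurable_unit_landscape LL p.
  by apply/seteqP; split => w /=; under eq_has do rewrite ltrN2.
apply: (@le_trans _ _ (P (\bigcup_m F m))).
  apply: le_measure; rewrite ?inE; [exact: box_event_measurable|exact: bigcupT_measurable|].
  move=> w [c _ h]; exists c.+1 => //=.
  apply/hasP; exists (pt c); last by rewrite subrK.
  by apply/mapP; exists c => //; rewrite mem_iota; lia.
apply: measure_nondecreasing_le => // [n m nm w /= /hasP[p /mapP[c]]|m].
  rewrite mem_iota => cn -> h; apply/hasP; exists (pt c) => //.
  by apply/mapP; exists c => //; rewrite mem_iota; lia.
apply: (@landscape_box_points La th k j (s - 1)) tight th0 _ => p /mapP[c _ ->] /=.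
have [g1 g2 g3 g4] := @unit_grid_itv R c; split; apply/andP; split; lra.
Qed.

Lemma centered_lppE d' (T' : measurableType d') (W : int -> R -> T' -> R) n w :
  centered_lpp W n w = scaled_lpp W n 0 1 (0, 0) w.
Proof.
rewrite /centered_lpp /scaled_lpp /unit_block /scaled_block /lpp_of /=.
by rewrite mulr0 !mulr0 !mul0r mulr0z mul1n !addr0 add0r subrr mulr0 mul0r subr0 mulr1.
Qed.

(** For fixed [l] the numbers [8 ^ (l + i) * n0] are unbounded in [i], which is what
    [landscape_upper] asks for. *)
Lemma landscape_lower_tail (n0 : nat) (th : R) : (0 < n0)%N ->
  (forall d' (T' : measurableType d') (P' : probability T' R) (W : int -> R -> T' -> R),
    two_sided_brownian_family P' W -> forall (l i : nat) (la : R),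
    (P' [set w | (centered_lpp W (8 ^ (l + i) * n0) w < - la)%R] <=
     (expR (- (2 ^+ l * th * la)) * 4 ^+ (8 ^ l))%:E)%E) ->
  forall (l : nat) (la : R),
    (P [set w | (unit_landscape L w (0, 0) < - (la + 1))%R] <=
     (expR (- (2 ^+ l * th * la)) * 4 ^+ (8 ^ l))%:E)%E.
Proof.
move=> n00 hW l la; have [d' [T' [P' [W [WW lim]]]]] := landscape_limit LL.
have [D DE] : exists D : seq (R * R), D = [:: (0, 0)] by exists [:: (0, 0)].
have [n1 h1] := @scaled_blocks_lt R D 0 1 isT.
have := @landscape_upper _ _ _ _ _ LL _ _ P' W lim (unit_thresholds (-1) la D) 1
  (expR (- (2 ^+ l * th * la)) * 4 ^+ (8 ^ l)) (@unit_thresholds_R4up _ (-1) la D) ltr01.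
rewrite (_ : [set w | 1 < excess (unit_thresholds (-1) la D) (L w)] =
    [set w | (unit_landscape L w (0, 0) < - (la + 1))%R]); last first.
  apply/seteqP; split => w /=.
    by move=> /(unit_thresholds_gtP _ _ _ _ ler01)[p]; rewrite DE inE => /eqP ->; rewrite mulN1r ltrNr.
  by move=> h; apply/(unit_thresholds_gtP _ _ _ _ ler01); exists (0, 0); rewrite ?DE ?inE// mulN1r ltrNr.
apply => m; pose i := maxn m n1; pose n := (8 ^ (l + i) * n0)%N.
have ni : (i <= n)%N.
  apply: (@leq_trans (8 ^ (l + i))); last by rewrite leq_pmulr.
  by apply: (leq_trans (leq_addl l i)); apply: ltnW; exact: ltn_expl.
have nn1 : (n1 <= n)%N by rewrite (leq_trans _ ni)// leq_maxr.
have [n_gt0 hb] := h1 n nn1.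
exists n; split; first by rewrite (leq_trans _ ni)// leq_maxl.
  exact: premeasurable_unit WW n_gt0 hb.
apply: le_trans (hW _ _ _ _ WW l i la); rewrite le_eqVlt; apply/orP; left; apply/eqP.
have cE w : prelandscape (fun j u => W j u w) n (0, 0, 0, 1) = centered_lpp W n w.
  by rewrite prelandscape_unit// -centered_lppE.
congr (P' _); apply/seteqP; split => w /=.
  by move=> /(unit_thresholds_gtP _ _ _ _ (lexx 0))[p]; rewrite DE inE => /eqP ->; rewrite addr0 mulN1r cE ltrNr.
by move=> h; apply/(unit_thresholds_gtP _ _ _ _ (lexx 0)); exists (0, 0); rewrite ?DE ?inE// addr0 mulN1r cE ltrNr.
Qed.
End box_bound.

(** * Symmetry of the landscape *)

Section orthants.
Context {R : realType}.
Variables (d : measure_display) (T : measurableType d) (P : probability T R).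
Variables (d' : measure_display) (T' : measurableType d') (P' : probability T' R).

(** Orthants over finite lists are stable under intersection and generate the product sigma-algebra.
    They are chosen because their complements have the form [0 < excess], for which laws can be
    compared in the limit. *)
Lemma same_law_orthant (I : choiceType) (X : I -> T -> R) (X' : I -> T' -> R) :
  (forall i, measurable_fun setT (X i)) ->
  (forall i, measurable_fun setT (X' i)) ->
  (forall D : seq (I * R),
    P [set w | all (fun i => X i.1 w <= i.2) D] = P' [set w | all (fun i => X' i.1 w <= i.2) D]) ->
  same_law P P' X X'.
Proof.
move=> mX mX' XX' E mE.
pose f := (fun w i => X i w) : T -> path_space R I.
pose f' := (fun w i => X' i w) : T' -> path_space R I.
have mf : measurable_fun setT f := measurable_path mX.
have mf' : measurable_fun setT f' := measurable_path mX'.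
pose orth (D : seq (I * R)) : set (path_space R I) := [set x | all (fun i => x i.1 <= i.2) D].
have mo D : measurable (orth D).
  rewrite (_ : orth D = ~` [set x | has (fun i => - x i.1 + i.2 < 0) D]).
    apply: measurableC; apply: (@measurable_has_event _ _ (path_space R I) _ (fun i x => - x i.1 + i.2)) => i.
    by apply: measurable_funD => //; apply: measurableT_comp => //; exact: measurable_coord.
  apply/seteqP; split => x; rewrite /orth /=.
    by move/allP => h /hasP[i /h /=]; lra.
  by move=> h; apply/allP => i iD; rewrite leNgt; apply/negP => hi; apply: h; apply/hasP; exists i => //=; lra.
pose G : set (set (path_space R I)) := range orth.
have GI : setI_closed G.
  move=> _ _ [D1 _ <-] [D2 _ <-]; exists (D1 ++ D2) => //.
  by apply/seteqP; split => x; rewrite /orth/= all_cat => /andP.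
change (law P mf E = law P' mf' E).
apply: (g_sigma_algebra_measure_unique G _ (fun=> setT)) => //.
- by move=> _ [D _ <-].
- by move=> _; exists [::] => //; apply/seteqP; split.
- by rewrite bigcup_const.
- by move=> _ [D _ <-]; exact: XX'.
- by move=> k; apply: (le_lt_trans (probability_le1 _ _)); rewrite ?ltry.
- have mc i : measurable_fun setT ((fun x => x i) : g_sigma_algebraType G -> R).
    apply: (measurability (@RGenOInfty.G R)); first exact: RGenOInfty.measurableE.
    move=> _ [_ [c ->] <-]; rewrite setTI.
    rewrite (_ : _ @^-1` _ = ~` orth [:: (i, c)]).
      by apply: measurableC; apply: sub_sigma_algebra; exists [:: (i, c)].
    by apply/seteqP; split => x /=; rewrite /orth/= in_itv/= andbT andbT ltNge => /negP.
  have : @measurable _ (path_space R I) `<=` <<s G >>.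
    apply: g_sigma_mono => _ [i _ [A mA <-]].
    exact: (mc i measurableT A mA).
  exact.
Qed.
End orthants.

Section landscape_symmetry.
Context {R : realType}.
Local Notation point := (R * R * R * R)%type.
Variables (d : measure_display) (T : measurableType d) (P : probability T R).
Variable L : T -> point -> R.
Hypothesis LL : directed_landscape P L.

Definition antitranspose (z : R * R) : R * R := (- z.2, - z.1).

Let thr (D : seq (R * R * R)) : seq (R * point * R) :=
  [seq (1, (p.1.1, 0, p.1.2, 1), p.2) | p <- D].

Let thrE (D : seq (R * R * R)) (g : point -> R) : excess (thr D) g =
  \big[Num.max/0]_(0 <= k < size D) (g ((nth (0, 0, 0) D k).1.1, 0, (nth (0, 0, 0) D k).1.2, 1)
     - (nth (0, 0, 0) D k).2).
Proof.
rewrite /excess /thr big_map (big_nth (0, 0, 0)).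
by apply: eq_bigr => k _; rewrite mul1r.
Qed.

Let thrR4 (D : seq (R * R * R)) i : i \in thr D -> R4up i.1.2.
Proof. by case/mapP => p _ ->; exact: R4up_unit. Qed.

Let flip (D : seq (R * R * R)) := [seq (antitranspose p.1, p.2) | p <- D].

Let flipK D : flip (flip D) = D.
Proof.
rewrite /flip -map_comp -[RHS]map_id; apply: eq_map => -[[x y] c].
by rewrite /antitranspose /= !opprK.
Qed.

(** One inequality is enough, since [flip] is an involution. *)
Let excess_le D : (P [set w | (0 < excess (thr D) (L w))%R] <=
                   P [set w | (0 < excess (thr (flip D)) (L w))%R])%E.
Proof.
have [d' [T' [P' [W [WW lim]]]]] := landscape_limit LL.
apply: (landscape_excess_le LL lim (@thrR4 D) (@thrR4 (flip D))) => e e0.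
have [n0 h0] := @scaled_blocks_lt R [seq p.1 | p <- D] 0 1 isT.
exists n0 => n nn0; have [n_gt0 hb] := h0 n nn0.
pose p k := nth (0, 0) [seq p.1 | p <- D] k.
have := scaled_lpp_reflect WW n_gt0 hb => hlaw.
pose F (x : path_space R nat) : \bar R := (Num.min (e^-1 *
  \big[Num.max/0]_(0 <= k < size D) (x k - (nth (0, 0, 0) D k).2)) 1)%:E.
have mF : measurable_fun setT F.
  apply/measurable_EFinP; apply: measurable_minr => //; apply: measurable_funM => //.
  apply: measurable_bigmax => // k; apply: measurable_funB => //; exact: measurable_coord.
have F0 x : (0 <= F x)%E.
  rewrite lee_fin le_min ler01 andbT mulr_ge0 ?invr_ge0 ?(ltW e0)//.
  by elim/big_rec: _ => // k y _ y0; rewrite le_max y0 orbT.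
have m1 k : measurable_fun setT (scaled_lpp W n 0 1 (p k)) by apply: (measurable_scaled_lpp WW); exact: hb.
have hb' k : (scaled_block n 0 1 (antitranspose (p k))).1.2 < (scaled_block n 0 1 (antitranspose (p k))).2.
  by have := hb k; rewrite /scaled_block /antitranspose /p /=; move: (n%:R `^ _) => u; lra.
have m2 k : measurable_fun setT (scaled_lpp W n 0 1 (antitranspose (p k))) by apply: (measurable_scaled_lpp WW); exact: hb'.
have := same_law_integral m2 m1 hlaw mF F0.
have e1 w : (clipped_excess (thr D) e^-1 (prelandscape (fun j u => W j u w) n))%:E =
    F (fun k => scaled_lpp W n 0 1 (p k) w).
  rewrite /clipped_excess thrE /F; congr (Num.min (_ * _) _)%:E.
  rewrite !big_nat; apply: eq_bigr => k /andP[_ kD].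
  by rewrite prelandscape_unit// -surjective_pairing /p (nth_map (0, 0, 0)).
have e2 w : (clipped_excess (thr (flip D)) e^-1 (prelandscape (fun j u => W j u w) n))%:E =
    F (fun k => scaled_lpp W n 0 1 (antitranspose (p k)) w).
  rewrite /clipped_excess thrE /F size_map; congr (Num.min (_ * _) _)%:E.
  rewrite !big_nat; apply: eq_bigr => k /andP[_ kD].
  by rewrite prelandscape_unit// -surjective_pairing (nth_map (0, 0, 0))//= /p (nth_map (0, 0, 0)).
under eq_integral do rewrite -e2.
by under [in X in _ = X]eq_integral do rewrite -e1.
Qed.

Lemma unit_landscape_symmetry :
  same_law P P (fun z => unit_landscape L ^~ z) (fun z => unit_landscape L ^~ (antitranspose z)).
Proof.
apply: same_law_orthant => [z|z|D].
- exact: measurable_unit_landscape LL z.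
- exact: measurable_unit_landscape LL (antitranspose z).
have mE D' : measurable [set w | (0 < excess (thr D') (L w))%R].
  by apply: measurable_excess_event => i iD; apply: (landscape_measurable LL); exact: thrR4 iD.
have allE D' : [set w | all (fun i => unit_landscape L w i.1 <= i.2) D'] =
    ~` [set w | (0 < excess (thr D') (L w))%R].
  apply/seteqP; split => w /=.
    move=> /allP h /excess_gtP-/(_ (lexx _))[_ /mapP[p pD ->]] /=.
    by rewrite mul1r; have := h p pD; rewrite /unit_landscape; lra.
  move=> h; apply/allP => p pD; rewrite leNgt; apply/negP => hp; apply: h.
  apply/excess_gtP => //; exists (1, (p.1.1, 0, p.1.2, 1), p.2); first by apply/mapP; exists p.
  by rewrite /= mul1r subr_gt0.
have -> : [set w | all (fun i => unit_landscape L w (antitranspose i.1) <= i.2) D] =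
    [set w | all (fun i => unit_landscape L w i.1 <= i.2) (flip D)].
  by apply/seteqP; split => w /=; rewrite all_map.
rewrite !allE !probability_setC//; congr (1 - _)%E.
apply/eqP; rewrite eq_le excess_le/=.
by have := excess_le (flip D); rewrite flipK.
Qed.
End landscape_symmetry.

(** * Oscillation of Brownian and Bessel paths *)

Section union_bounds.
Context {R : realType} {d : measure_display} {T : measurableType d}.
Variable P : probability T R.

Lemma probability_union_telescope (E : nat -> set T) (a : nat -> R) :
  (forall n, measurable (E n)) -> (forall n, 0 <= a n) ->
  (forall n, (P (E n) <= (a n - a n.+1)%:E)%E) -> (P (\bigcup_n E n) <= (a 0%N)%:E)%E.
Proof.
move=> mE a0 ha; pose F m := \big[setU/set0]_(n < m) E n.
have mF m : measurable (F m) by exact: bigsetU_measurable.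
have FE m : F m = \bigcup_(n in [set n | (n < m)%N]) E n by rewrite /F -bigcup_mkord.
have hF m : (P (F m) <= (a 0%N - a m)%:E)%E.
  elim: m => [|m ih]; first by rewrite /F big_ord0 measure0 subrr.
  rewrite /F big_ord_recr/=; apply: le_trans (measureU2 _ _ _) _ => //; first exact: mF.
  apply: le_trans (leeD ih (ha m)) _; rewrite -EFinD lee_fin; lra.
have -> : \bigcup_n E n = \bigcup_m F m.
  apply/seteqP; split => w [n _ En].
    by exists n.+1 => //; rewrite FE; exists n => //=.
  by move: En; rewrite FE => -[i _ Ei]; exists i.
apply: measure_nondecreasing_le => // [n m nm w|n].
  by rewrite !FE => -[i /= il Ei]; exists i => //=; exact: leq_trans nm.
by apply: le_trans (hF n) _; rewrite lee_fin gerBl.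
Qed.

Lemma probability_union_geometric (E : nat -> set T) (a q : R) : 0 <= a -> 0 <= q -> q < 1 ->
  (forall n, measurable (E n)) -> (forall n, (P (E n) <= (a * q ^+ n)%:E)%E) ->
  (P (\bigcup_n E n) <= (a / (1 - q))%:E)%E.
Proof.
move=> a0 q0 q1 mE hE; have q1' : 0 < 1 - q by rewrite subr_gt0.
have := @probability_union_telescope E (fun n => a / (1 - q) * q ^+ n) mE.
rewrite expr0 mulr1; apply => [n|n]; first by rewrite mulr_ge0 ?divr_ge0 ?exprn_ge0 ?(ltW q1').
apply: le_trans (hE n) _; rewrite lee_fin le_eqVlt; apply/orP; left; apply/eqP.
by rewrite exprS; field; rewrite gt_eqF.
Qed.

Lemma probability_union_ord (m : nat) (E : nat -> set T) (b : R) :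
  (forall n, measurable (E n)) -> (forall n, (P (E n) <= b%:E)%E) ->
  (P (\bigcup_(n in [set n | (n < m)%N]) E n) <= (m%:R * b)%:E)%E.
Proof.
move=> mE hE; rewrite bigcup_mkord; elim: m => [|m ih].
  by rewrite big_ord0 measure0 mul0r.
rewrite big_ord_recr/=; apply: le_trans (measureU2 _ _ _) _ => //; first exact: bigsetU_measurable.
by apply: le_trans (leeD ih (hE m)) _; rewrite -EFinD lee_fin -natr1; lra.
Qed.

Lemma probability_le0 (A : set T) (b q : R) : 0 <= q -> q < 1 ->
  (forall n, (P A <= (b * q ^+ n)%:E)%E) -> P A = 0%E.
Proof.
move=> q0 q1 h; apply/eqP; rewrite eq_le measure_ge0 andbT.
have cv : (b * q ^+ n)%:E @[n --> \oo] --> (0 : R)%:E.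
  apply: cvg_EFin; first exact: nearW.
  rewrite -[X in _ --> X](mulr0 b); apply: cvgMr; apply: cvg_expr.
  by rewrite ger0_norm.
apply: (@le_trans _ _ (limn (fun n => (b * q ^+ n)%:E))); last by rewrite (cvg_lim _ cv).
apply: lime_ge; last exact: nearW.
by apply/cvg_ex; exists (0 : R)%:E.
Qed.

(* If [w] avoids the layer cover, then for the first [m] with [w] outside [O m.+1], also [Q m]
   fails at [w]. *)
Definition layer_cover (O Q : nat -> set T) : set T :=
  (\bigcup_m (O m `&` Q m)) `|` \bigcap_m O m.

Lemma layer_coverP O Q w : O 0%N = setT -> ~ layer_cover O Q w ->
  exists m, ~ O m.+1 w /\ ~ Q m w.
Proof.
move=> O0 /not_orP[h1 h2].
have [m hm] : exists m, ~ O m w.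
  by apply: contrapT => h; apply: h2 => m _; apply: contrapT => Om; apply: h; exists m.
have [n hn] : exists n, O n w /\ ~ O n.+1 w.
  apply: contrapT => h; apply: hm; elim: m => [|m ih]; first by rewrite O0.
  by apply: contrapT => hm; apply: h; exists m.
exists n; split; first by case: hn.
by move=> Qn; apply: h1; exists n => //; split=> //; case: hn.
Qed.

(** The intersection of all [O m] is null, whatever the value of [c], so that only the layers [O m]
    and [Q m] count. *)
Lemma layer_cover_bound O Q (b c : R) : 0 <= b ->
  (forall m, measurable (O m)) -> (forall m, measurable (Q m)) ->
  (forall m, (P (O m `&` Q m) <= (b * 2^-1 ^+ m)%:E)%E) ->
  (forall m, (P (O m) <= (c * 2^-1 ^+ m)%:E)%E) ->
  (P (layer_cover O Q) <= (2 * b)%:E)%E.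
Proof.
move=> b0 mO mQ hOQ hO.
have h1 : (2^-1 : R) < 1 by rewrite invf_lt1// ltr1n.
have mI : measurable (\bigcap_m O m) by apply: bigcapT_measurable.
have mU : measurable (\bigcup_m (O m `&` Q m)).
  by apply: bigcupT_measurable => m; exact: measurableI.
apply: le_trans (measureU2 _ _ _) _ => //.
have I0 : P (\bigcap_m O m) = 0%E.
  apply: (@probability_le0 (\bigcap_m O m) c 2^-1) => // n.
  by apply: le_trans (hO n); apply: le_measure; rewrite ?inE// => w; apply.
rewrite [X in (_ + X)%E]I0 adde0; apply: le_trans (probability_union_geometric b0 _ h1 _ hOQ) _ => //.
  by move=> n; exact: measurableI.
by rewrite lee_fin (_ : 1 - 2^-1 = 2^-1 :> R) ?invrK; [rewrite mulrC|field].
Qed.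
End union_bounds.

Section oscillation.
Context {R : realType} {d : measure_display} {T : measurableType d}.
Variables (P : probability T R) (B : R -> T -> R).
Hypothesis BB : two_sided_brownian P B.

Let mB t : measurable_fun setT (B t). Proof. exact: brownian_measurable BB t. Qed.

Definition dyadic_step (k : R) (n i : nat) (w : T) : R :=
  B (k + i.+1%:R / (2 ^ n)%:R) w - B (k + i%:R / (2 ^ n)%:R) w.

(** The ratio 4/5 is a compromise: the thresholds are summable, with sum [5 * m], and yet they decay
    more slowly than the standard deviations of the steps, as [(4 / 5) ^+ 2 * 2 = 32 / 25] exceeds
    1. *)
Definition oscillation (k m : R) : set T :=
  \bigcup_n \bigcup_(i in [set i | (i < 2 ^ n)%N])
    [set w | m * (4 / 5) ^+ n < `|dyadic_step k n i w|].

Lemma gaussian_increment_tail (u v c : R) : u < v -> 0 <= c ->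
  (P [set w | (c < `|B v w - B u w|)%R] <=
   (Num.sqrt 2 * expR (- (c ^+ 2 / (4 * (v - u)))))%:E)%E.
Proof.
move=> uv c0; have vu : 0 < v - u by rewrite subr_gt0.
have mA : measurable [set x : R | c < `|x|].
  by apply: (@measurable_lt_event _ _ (measurableTypeR R)) => //; exact: measurableT_comp.
rewrite (_ : [set w | _] = (fun w => B v w - B u w) @^-1` [set x | c < `|x|])//.
rewrite (brownian_gaussian BB uv mA).
have s0 : 0 < Num.sqrt (v - u) by rewrite sqrtr_gt0.
apply: le_trans (normal_prob_bound (r := c ^+ 2) s0 mA _) _ => [x /= cx|].
  by rewrite -[leRHS]real_normK ?num_real// ler_sqr ?nnegrE//; exact: ltW.
by rewrite lee_fin ler_wpM2l// ler_expR sqr_sqrtr ?(ltW vu)// -mulr_natl mulNr.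
Qed.

Let step_lt (k : R) n i : k + i%:R / (2 ^ n)%:R < k + i.+1%:R / (2 ^ n)%:R.
Proof. by rewrite ltrD2l ltr_pM2r ?ltr_nat// invr_gt0 ltr0n expn_gt0. Qed.

Lemma dyadic_step_event_measurable k m n i :
  measurable [set w | m * (4 / 5) ^+ n < `|dyadic_step k n i w|].
Proof.
apply: measurable_lt_event => //; apply: measurableT_comp => //.
by apply: measurable_funB; exact: mB.
Qed.

Lemma oscillation_measurable k m : measurable (oscillation k m).
Proof.
apply: bigcupT_measurable => n; apply: bigcup_measurable => i _.
exact: dyadic_step_event_measurable.
Qed.

Definition oscillation_constant : R := 6 + expR 4.

(** A union bound over the Gaussian dyadic steps, carried out inside [A], which will be the event of
    a small value at the left end. For [m < 4] the right-hand side exceeds [pA]; otherwise the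
    levels [n] contribute a geometric series of ratio [q <= 3 / 4], because
    [(32 / 25) ^+ n >= 1 + 7 / 25 * n]. *)
Lemma oscillation_bound (A : set T) (pA k m : R) : 0 <= pA -> 0 <= m -> measurable A ->
  (P A <= pA%:E)%E ->
  (forall n i (c : R), (i < 2 ^ n)%N -> (P (A `&` [set w | (c < `|dyadic_step k n i w|)%R]) <=
     pA%:E * P [set w | (c < `|dyadic_step k n i w|)%R])%E) ->
  (P (A `&` oscillation k m) <= (pA * (oscillation_constant * expR (- (m ^+ 2 / 4))))%:E)%E.
Proof.
move=> pA0 m0 mA PA ind.
have e0 : 0 <= expR (- (m ^+ 2 / 4)) by exact: expR_ge0.
have [m4|m4] := leP 4 m; last first.
  apply: (@le_trans _ _ (P A)).
    by apply: le_measure; rewrite ?inE//; apply: measurableI => //; exact: oscillation_measurable.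
  apply: le_trans PA _; rewrite lee_fin -[X in X <= _]mulr1 ler_wpM2l//.
  rewrite /oscillation_constant mulrDl -expRD -[X in X <= _]add0r lerD ?mulr_ge0//.
  by rewrite -[X in X <= _]expR0 ler_expR subr_ge0 ler_pdivrMr//; nra.
pose q : R := 2 * expR (- (7 / 100 * m ^+ 2)).
have q0 : 0 <= q by rewrite mulr_ge0 ?expR_ge0.
have q34 : q <= 3 / 4.
  set y := 7 / 100 * m ^+ 2; have y1 : 28 / 25 <= y by rewrite /y expr2; nra.
  have y0 : 0 <= y by lra.
  rewrite /q -/y expRN ler_pdivrMr ?expR_gt0//.
  have := expR_ge_quadratic y0; rewrite expr2; nra.
pose a := pA * (Num.sqrt 2 * expR (- (m ^+ 2 / 4))).
have a0 : 0 <= a by rewrite mulr_ge0// mulr_ge0.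
rewrite /oscillation setI_bigcupr.
have mE n : measurable (A `&` \bigcup_(i in [set i | (i < 2 ^ n)%N]) [set w | m * (4 / 5) ^+ n < `|dyadic_step k n i w|]).
  apply: measurableI => //; apply: bigcup_measurable => i _; exact: dyadic_step_event_measurable.
have q1 : q < 1 by apply: le_lt_trans q34 _; rewrite ltr_pdivrMr//; lra.
apply: le_trans (probability_union_geometric a0 q0 q1 mE _) _; last first.
  rewrite lee_fin /a -mulrA ler_wpM2l// mulrAC ler_wpM2r//.
  rewrite ler_pdivrMr ?subr_gt0//.
  have s2 : Num.sqrt 2 <= 3 / 2 :> R.
    by rewrite -[leRHS]ger0_norm ?divr_ge0// -sqrtr_sqr ler_sqrt ?sqr_ge0// expr2; lra.
  have := expR_ge0 (4 : R); rewrite /oscillation_constant; nra.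
move=> n; rewrite setI_bigcupr.
pose b := pA * (Num.sqrt 2 * expR (- (m ^+ 2 * (1 + 7 / 25 * n%:R) / 4))).
apply: (@le_trans _ _ ((2 ^ n)%:R * b)%:E).
  have := @probability_union_ord _ _ _ P (2 ^ n) (fun i => if (i < 2 ^ n)%N then A `&`
    [set w | m * (4 / 5) ^+ n < `|dyadic_step k n i w|] else set0) b.
  rewrite (_ : \bigcup_(n0 in _) _ = \bigcup_(i in [set i | (i < 2 ^ n)%N]) (A `&`
    [set w | m * (4 / 5) ^+ n < `|dyadic_step k n i w|])); last first.
    by apply: eq_bigcupr => i /= ->.
  apply=> i; case: ifPn => // ik.
    by apply: measurableI => //; exact: dyadic_step_event_measurable.
  apply: le_trans (ind n i _ ik) _; rewrite /b EFinM lee_wpmul2l//.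
  apply: le_trans (gaussian_increment_tail (step_lt k n i) _) _.
    by rewrite mulr_ge0// exprn_ge0.
  rewrite lee_fin ler_wpM2l// ler_expR lerN2.
  rewrite (_ : k + i.+1%:R / (2 ^ n)%:R - (k + i%:R / (2 ^ n)%:R) = ((2 ^ n)%:R)^-1); last first.
    by rewrite -natr1; field; rewrite pnatr_eq0 expn_eq0.
  have bern : 1 + 7 / 25 * n%:R <= (32 / 25) ^+ n :> R.
    elim: (n) => [|l ih]; first by rewrite mulr0 addr0 expr0.
    rewrite exprS -natr1; have : (0 : R) <= l%:R by [].
    nra.
  rewrite (_ : (m * (4 / 5) ^+ n) ^+ 2 / (4 * ((2 ^ n)%:R)^-1) = m ^+ 2 * (32 / 25) ^+ n / 4); last first.
    rewrite exprMn -exprM mulnC exprM natrX (_ : 32 / 25 = (4 / 5) ^+ 2 * 2 :> R); last by field.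
    by rewrite [((4 / 5) ^+ 2 * 2) ^+ n]exprMn; field; rewrite expf_neq0.
    by rewrite ler_wpM2r// ler_wpM2l// sqr_ge0.
  by rewrite measure0 lee_fin mulr_ge0// mulr_ge0// expR_ge0.
rewrite lee_fin /b /a /q natrX exprMn -expRM_natl le_eqVlt; apply/orP; left; apply/eqP.
rewrite (_ : - (m ^+ 2 * (1 + 7 / 25 * n%:R) / 4) = - (m ^+ 2 / 4) + n%:R * - (7 / 100 * m ^+ 2)); last by field.
by rewrite expRD; ring.
Qed.

Lemma oscillation_prob (k m : R) : 0 <= m ->
  (P (oscillation k m) <= (oscillation_constant * expR (- (m ^+ 2 / 4)))%:E)%E.
Proof.
move=> m0; have := @oscillation_bound setT 1 k m ler01 m0 measurableT.
rewrite setTI mul1r; apply; first exact: probability_le1.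
by move=> n i c _; rewrite setTI mul1e.
Qed.

(** The value at [k] is the increment over [[0, k]], hence independent of the steps inside
    [[k, k + 1]]; in the sequence [t] these are the increments number 0 and 2. *)
Lemma oscillation_indep (k m a : R) : 0 < k -> 0 <= m -> 0 <= a ->
  (P ([set w | (`|B k w| <= a)%R] `&` oscillation k m) <=
   (a / Num.sqrt k * (oscillation_constant * expR (- (m ^+ 2 / 4))))%:E)%E.
Proof.
move=> k0 m0 a0; have sk0 : 0 < Num.sqrt k by rewrite sqrtr_gt0.
pose A := [set x : R | `|x| <= a].
have mA : measurable A.
  rewrite (_ : A = `[- a, a]%classic) ?measurable_itv//.
  by apply/seteqP; split => x; rewrite /A /= in_itv/= ler_norml.
have A0 : [set w | (`|B k w| <= a)%R] = (fun w => B k w - B 0 w) @^-1` A.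
  by apply/seteqP; split => w; rewrite /A/= (brownian_zero BB) subr0.
have mA' : measurable [set w | (`|B k w| <= a)%R].
  rewrite A0 -[X in measurable X]setTI; apply: measurable_funB => //; exact: mB.
have PA : (P [set w | (`|B k w| <= a)%R] <= (a / Num.sqrt k)%:E)%E.
  rewrite A0 (brownian_gaussian BB k0 mA) subr0; exact: normal_small_ball.
apply: oscillation_bound => //; first by rewrite divr_ge0// ltW.
move=> n i c ik; apply: (@le_trans _ _ (P [set w | (`|B k w| <= a)%R] *
    P [set w | (c < `|dyadic_step k n i w|)%R])%E); last by rewrite lee_wpmul2r.
pose t (l : nat) : R := match l with 0 => 0 | 1 => k | 2 => k + i%:R / (2 ^ n)%:R |
  _ => k + i.+1%:R / (2 ^ n)%:R end.
have ki : k <= k + i%:R / (2 ^ n)%:R by rewrite lerDl divr_ge0.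
have ht : {homo t : x y / (x <= y)%N >-> x <= y}.
  apply: homo_leq => [x|y x z|]; [exact: lexx|exact: le_trans|].
  by case=> [|[|[|l]]] /=; [exact: ltW|exact: ki|exact: ltW|exact: lexx].
pose E (l : nat) := if l == 0%N then [set w | (`|B k w| <= a)%R] else [set w | (c < `|dyadic_step k n i w|)%R].
have hE l : l \in [fset 0%N; 2%N]%fset ->
    preimage_set_system setT (fun w => B (t l.+1) w - B (t l) w) measurable (E l).
  rewrite !inE => /orP[] /eqP -> /=.
    by rewrite /E /= A0; exists A => //; rewrite setTI.
  exists [set x : R | c < `|x|]; last by rewrite setTI.
  by apply: (@measurable_lt_event _ _ (measurableTypeR R)) => //; exact: measurableT_comp.
have := brownian_indep_increments BB ht hE.
rewrite (_ : \bigcap_(l in _) E l = [set w | (`|B k w| <= a)%R] `&` [set w | (c < `|dyadic_step k n i w|)%R]).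
  by rewrite big_fsetU1 ?big_seq_fset1 ?inE// /E /= => ->.
apply/seteqP; split => w /=.
  by move=> h; split; [have := h 0%N|have := h 2%N]; rewrite /= !inE /E/=; apply.
by move=> [h1 h2] l /=; rewrite !inE => /orP[] /eqP ->.
Qed.

(** Chaining: [z n] is [x] rounded down to level [n], and [z n.+1] is either [z n] or the next
    dyadic point. The steps add up to less than [5 * m], and continuity reaches [x]. *)
Lemma oscillation_path (k m x : R) w : 0 <= m -> k <= x <= k + 1 -> ~ oscillation k m w ->
  `|B x w - B k w| <= 5 * m.
Proof.
move=> m0 /andP[kx xk] nO.
have step n i : (i < 2 ^ n)%N -> `|dyadic_step k n i w| <= m * (4 / 5) ^+ n.
  by move=> i2; rewrite leNgt; apply/negP => h; apply: nO; exists n => //; exists i.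
pose y := x - k; have y0 : 0 <= y by rewrite subr_ge0.
have y1 : y <= 1 by rewrite /y; lra.
pose t n := Num.truncn (y * (2 ^ n)%:R); pose z n := k + (t n)%:R / (2 ^ n)%:R.
have p2 n : (0 : R) < (2 ^ n)%:R by rewrite ltr0n expn_gt0.
have ty n : (t n)%:R <= y * (2 ^ n)%:R < (t n).+1%:R by apply: truncn_itv; rewrite mulr_ge0.
have tn n : (t n <= 2 ^ n)%N.
  have /andP[h _] := ty n; rewrite -(ler_nat R); apply: le_trans h _.
  by rewrite ler_piMl// ltW.
have bound n : `|B (z n) w - B k w| <= m * (5 - 4 * (4 / 5) ^+ n).
  elim: n => [|n ih].
    rewrite expr0 mulr1 (_ : 5 - 4 = 1 :> R); last by lra.
    have := step 0%N 0%N isT; rewrite expr0 mulr1 /dyadic_step expn0 divr1 mul0r addr0 => h.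
    rewrite /z expn0 divr1; have := tn 0%N; rewrite expn0; case: (t 0%N) => [|[|//]] _.
      by rewrite addr0 subrr normr0.
    exact: h.
  have zz : `|B (z n.+1) w - B (z n) w| <= m * (4 / 5) ^+ n.+1.
    have /andP[a1 a2] := ty n; have /andP[b1 b2] := ty n.+1.
    rewrite expnS natrM in b1 b2.
    have e2 : z n = k + (2 * t n)%:R / (2 ^ n.+1)%:R.
      by rewrite /z expnS !natrM; field; rewrite gt_eqF.
    have c1 : (2 * t n <= t n.+1)%N.
      rewrite -ltnS -(ltr_nat R) natrM; apply: le_lt_trans b2; lra.
    have c2 : (t n.+1 < (2 * t n).+2)%N.
      rewrite -(ltr_nat R); apply: le_lt_trans b1 _.
      have -> : (2 * t n).+2%:R = 2 * ((t n)%:R + 1) :> R by rewrite -addn2 natrD natrM; ring.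
      by rewrite -natr1 in a2; lra.
    have [te|te] : t n.+1 = (2 * t n)%N \/ t n.+1 = (2 * t n).+1.
      by move: (t n.+1) (2 * t n)%N c1 c2 => p q; clear; lia.
      by rewrite e2 /z te subrr normr0 mulr_ge0// exprn_ge0.
    have lt2 : (2 * t n < 2 ^ n.+1)%N by rewrite -te tn.
    by have := step n.+1 (2 * t n)%N lt2; rewrite /dyadic_step e2 /z te.
  have := ler_normD (B (z n.+1) w - B (z n) w) (B (z n) w - B k w).
  rewrite addrA subrK => /le_trans; apply; apply: le_trans (lerD zz ih) _.
  by rewrite exprS; lra.
have cz : z n @[n --> \oo] --> x.
  apply: (@squeeze_cvgr _ _ _ _ (fun n => x - n.+1%:R^-1) (fun=> x)).
  - apply: nearW => n; have /andP[h1 h2] := ty n.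
    have hz : z n <= x by rewrite /z -lerBrDl ler_pdivrMr.
    rewrite hz andbT /z -lerBlDl ler_pdivlMr//.
    have n2 : n.+1%:R^-1 * (2 ^ n)%:R >= 1 :> R.
      by rewrite mulrC ler_pdivlMr// mul1r ler_nat ltn_expl.
    rewrite (_ : (x - n.+1%:R^-1 - k) * (2 ^ n)%:R = y * (2 ^ n)%:R - n.+1%:R^-1 * (2 ^ n)%:R); last by rewrite /y; ring.
    by rewrite lerBlDr; apply: le_trans (ltW h2) _; rewrite -natr1 lerD2l.
  - rewrite -[X in _ --> X](subr0 x); apply: cvgB; first exact: cvg_cst.
    exact: cvg_harmonic.
  - exact: cvg_cst.
have cB : `|B (z n) w - B k w| @[n --> \oo] --> `|B x w - B k w|.
  apply: cvg_norm; apply: cvgB; last exact: cvg_cst.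
  exact: (cvg_comp _ (fun t => B t w) cz (brownian_continuous BB (w := w) (x := x))).
apply: (cvgr_to_le cB); apply: nearW => n; apply: le_trans (bound n) _.
by rewrite mulrC ler_wpM2r// lerBlDr lerDl mulr_ge0// exprn_ge0.
Qed.
End oscillation.

(** * Small values of the Bessel process *)

Section bessel.
Context {R : realType}.

Lemma pow2_gaussian (m : nat) :
  (m.+1%:R * expR (- (m%:R ^+ 2 / 4)) <= expR 4 * 2^-1 ^+ m :> R) /\
  (expR (- (m%:R ^+ 2 / 4)) <= expR 4 * 2^-1 ^+ m :> R).
Proof.
have m0 : (0 : R) <= m%:R by [].
have p2 : (0 : R) < 2 ^+ m by rewrite exprn_gt0.
have e0 : 0 <= expR (- (m%:R ^+ 2 / 4)) :> R by exact: expR_ge0.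
have m2 : m.+1%:R <= 2 ^+ m :> R.
  by rewrite -natrX ler_nat ltn_expl.
have e4 : (4 : R) ^+ m * expR (- (m%:R ^+ 2 / 4)) <= expR 4.
  have f4 : (4 : R) <= expR 2 by have := @expR_ge_quadratic R 2; rewrite ler0n => /(_ isT); rewrite expr2; lra.
  apply: (@le_trans _ _ (expR (m%:R * 2) * expR (- (m%:R ^+ 2 / 4)))).
    by rewrite ler_wpM2r// expRM_natl lerXn2r ?nnegrE ?expR_ge0.
  rewrite -expRD ler_expR -subr_ge0 (_ : _ - _ = (m%:R / 2 - 2) ^+ 2); last by field.
  exact: sqr_ge0.
have e42 : (4 : R) ^+ m = 2 ^+ m * 2 ^+ m by rewrite -exprMn; congr (_ ^+ _); lra.
have h1 : m.+1%:R * expR (- (m%:R ^+ 2 / 4)) <= expR 4 * 2^-1 ^+ m :> R.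
  rewrite exprVn ler_pdivlMr// mulrAC; apply: le_trans e4; rewrite e42 ler_wpM2r//.
  by rewrite ler_wpM2r// ltW.
split=> //; apply: le_trans h1; rewrite -[X in X <= _]mul1r ler_wpM2r// ler1n//.
Qed.

Section one_coordinate.
Variables (d : measure_display) (T : measurableType d) (P : probability T R).
Variable B : R -> T -> R.
Hypothesis BB : two_sided_brownian P B.

Definition osc_layer (k : R) (m : nat) : set T := if m is 0%N then setT else oscillation B k m%:R.

Definition cell_layer (k r : R) (m : nat) : set T := [set w | `|B k w| <= r + 5 * m.+1%:R].

(** A measurable cover of the event that [B] comes within [r] of 0 in [[k, k + 1]]. On layer [m] the
    path oscillates at level [m] and [B k] is within [r + 5 * m.+1] of 0: a Gaussian tail in [m]
    times a probability that grows linearly. *)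
Definition low_cell (k r : R) : set T := layer_cover (osc_layer k) (cell_layer k r).

Lemma low_cellP k r x w : k <= x <= k + 1 -> ~ low_cell k r w -> r < `|B x w|.
Proof.
move=> kx /layer_coverP[//|m [nO nQ]].
have := oscillation_path BB (ler0n R m.+1) kx nO.
move/negP : nQ; rewrite /= -ltNge => h1 h2.
have := ler_normD (B x w) (B k w - B x w); rewrite addrC subrK distrC; lra.
Qed.

Lemma oscillation_sigma k m : process_sigma setT B (oscillation B k m).
Proof.
pose S := process_type setT B.
have mB t : measurable_fun setT (B t : S -> R) by exact: measurable_process_type.
suff h : measurable (oscillation B k m : set S) by exact: h.
apply: bigcupT_measurable => n; apply: bigcup_measurable => i _.
apply: (@measurable_lt_event _ _ S) => //; apply: measurableT_comp => //.
by apply: measurable_funB; exact: mB.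
Qed.

Lemma low_cell_sigma k r : process_sigma setT B (low_cell k r).
Proof.
pose S := process_type setT B.
have mB t : measurable_fun setT (B t : S -> R) by exact: measurable_process_type.
have mO (m : nat) : measurable (oscillation B k m%:R : set S) by exact: oscillation_sigma.
have mL m : measurable (osc_layer k m : set S) by case: m => [|m] /=; [exact: measurableT|exact: mO].
have mC m : measurable (cell_layer k r m : set S).
  rewrite (_ : cell_layer k r m = ~` [set w | r + 5 * m.+1%:R < `|B k w|]).
    apply: measurableC; apply: (@measurable_lt_event _ _ S) => //; apply: measurableT_comp => //; exact: mB.
  by apply/seteqP; split => w; rewrite /cell_layer /= leNgt => /negP.
have mU : measurable (\bigcup_m (osc_layer k m `&` cell_layer k r m) : set S).
  by apply: bigcupT_measurable => m; apply: measurableI.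
have mI : measurable (\bigcap_m osc_layer k m : set S) by exact: bigcapT_measurable.
exact: (measurableU _ _ mU mI).
Qed.

Definition low_cell_constant : R := 10 * (oscillation_constant * expR 4).

Lemma oscillation_constant_ge1 : 1 <= oscillation_constant :> R.
Proof. by rewrite /oscillation_constant; have := expR_ge0 (4 : R); lra. Qed.

Lemma low_cell_bound k r : 0 < k -> 0 <= r ->
  (P (low_cell k r) <= (low_cell_constant * ((1 + r) / Num.sqrt k))%:E)%E.
Proof.
move=> k0 r0; have sk0 : 0 < Num.sqrt k by rewrite sqrtr_gt0.
have oc1 := oscillation_constant_ge1.
have oc0 : 0 <= oscillation_constant :> R by lra.
pose b := 5 * (1 + r) / Num.sqrt k * (oscillation_constant * expR 4).
have b0 : 0 <= b by rewrite !mulr_ge0 ?invr_ge0 ?expR_ge0 ?(ltW sk0)//; lra.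
rewrite (_ : low_cell_constant * _ = 2 * b); last by rewrite /b /low_cell_constant; field; rewrite gt_eqF.
have mB t : measurable_fun setT (B t) by exact: brownian_measurable BB t.
have mO m : measurable (osc_layer k m) by case: m => [|m] //=; exact: oscillation_measurable BB _ _.
have mQ m : measurable (cell_layer k r m).
  rewrite (_ : cell_layer k r m = ~` [set w | r + 5 * m.+1%:R < `|B k w|]).
    by apply: measurableC; apply: measurable_lt_event => //; exact: measurableT_comp.
  by apply/seteqP; split => w; rewrite /cell_layer /= leNgt => /negP.
apply: (@layer_cover_bound _ _ _ _ _ _ b (oscillation_constant * expR 4)) => // m.
- have a0 : 0 <= r + 5 * m.+1%:R by rewrite addr_ge0.
  apply: (@le_trans _ _ (((r + 5 * m.+1%:R) / Num.sqrt k * (oscillation_constant * expR (- (m%:R ^+ 2 / 4))))%:E)).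
    case: m a0 => [|m] a0.
      rewrite /osc_layer setTI expr0n/= mul0r oppr0 expR0 mulr1.
      have h : (P (cell_layer k r 0) <= ((r + 5 * 1%:R) / Num.sqrt k)%:E)%E.
        pose A := [set x : R | `|x| <= r + 5 * 1%:R].
        have mA : measurable A.
          rewrite (_ : A = `[- (r + 5 * 1%:R), r + 5 * 1%:R]%classic) ?measurable_itv//.
          by apply/seteqP; split => x; rewrite /A /= in_itv/= ler_norml.
        rewrite (_ : cell_layer k r 0 = (fun w => B k w - B 0 w) @^-1` A); last first.
          by apply/seteqP; split => w; rewrite /A/cell_layer/= (brownian_zero BB) subr0.
        by rewrite (brownian_gaussian BB k0 mA) subr0; exact: normal_small_ball.
      by apply: le_trans h _; rewrite lee_fin ler_peMr// divr_ge0// ltW.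
    by rewrite setIC; exact: oscillation_indep.
  have [h1 _] := pow2_gaussian m.
  rewrite lee_fin; apply: (@le_trans _ _ (5 * (1 + r) * m.+1%:R / Num.sqrt k *
    (oscillation_constant * expR (- (m%:R ^+ 2 / 4))))).
    rewrite ler_wpM2r ?mulr_ge0 ?expR_ge0// ler_wpM2r ?invr_ge0 ?(ltW sk0)//.
    have : (1 : R) <= m.+1%:R by rewrite ler1n.
    nra.
  rewrite [leLHS](_ : _ = 5 * (1 + r) / Num.sqrt k * oscillation_constant * (m.+1%:R * expR (- (m%:R ^+ 2 / 4)))); last by ring.
  rewrite [leRHS](_ : _ = 5 * (1 + r) / Num.sqrt k * oscillation_constant * (expR 4 * 2^-1 ^+ m)); last by rewrite /b; ring.
  by rewrite ler_wpM2l// !mulr_ge0 ?invr_ge0 ?(ltW sk0)//; lra.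
- have [_ h2] := pow2_gaussian m.
  apply: (@le_trans _ _ ((oscillation_constant * expR (- (m%:R ^+ 2 / 4)))%:E)); last first.
    by rewrite lee_fin -mulrA ler_wpM2l.
  case: m {h2} => [|m] /=; last exact: oscillation_prob.
  by rewrite expr0n/= mul0r oppr0 expR0 mulr1; apply: le_trans (probability_le1 _ _) _.
Qed.
End one_coordinate.

Definition bessel_constant : R := low_cell_constant ^+ 3.

Lemma bessel_measurable d (T : measurableType d) (P : probability T R) (Z : R -> T -> R) t :
  two_sided_bessel3 P Z -> measurable_fun setT (Z t).
Proof.
move=> [W WW ZE].
rewrite (_ : Z t = fun w => Num.sqrt (\sum_(i < 3) W i t w ^+ 2)); last by apply/funext => w.
have ms : measurable_fun setT (fun w => \sum_(i < 3) W i t w ^+ 2).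
  apply: measurable_sum => i; apply: measurable_funX.
  exact: brownian_measurable (WW.1 i) t.
have mq : measurable_fun setT (@Num.sqrt R).
  by apply: continuous_measurable_fun; exact: sqrt_continuous.
exact: (measurableT_comp mq ms).
Qed.

(** Each coordinate is at most [Z] in absolute value and the three are independent, whence the cube
    of the one-dimensional bound. *)
Lemma bessel_small_ball d (T : measurableType d) (P : probability T R) (Z : R -> T -> R)
    (k r : R) (x : nat -> R) : two_sided_bessel3 P Z -> 0 < k -> 0 <= r ->
  (forall c, k <= x c <= k + 1) ->
  (P (\bigcup_c [set w | (Z (x c) w < r)%R]) <= (bessel_constant * ((1 + r) / Num.sqrt k) ^+ 3)%:E)%E.
Proof.
move=> [W WW ZE] k0 r0 kx.
pose i0 : 'I_3 := ord0; pose i1 : 'I_3 := @Ordinal 3 1 isT; pose i2 : 'I_3 := @Ordinal 3 2 isT.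
pose E i := low_cell (W i) k r.
have Wi i := WW.1 i.
have := WW.2 [fset i0; i1; i2]%fset E (fun i _ => low_cell_sigma (B := W i) k r).
rewrite -fsetUA !big_fsetU1 ?big_seq_fset1 ?inE//= => PE.
have mE i : measurable (E i).
  apply: (process_sigma_measurable _ (low_cell_sigma (B := W i) k r)) => t _.
  exact: brownian_measurable (Wi i) t.
have mZ t : measurable_fun setT (Z t) by apply: (bessel_measurable t (P := P)); exists W.
apply: (@le_trans _ _ (P (\bigcap_(i in [set` (i0 |` [fset i1; i2])%fset]) E i))).
  apply: le_measure; rewrite ?inE.
  - by apply: bigcupT_measurable => c; apply: measurable_lt_event.
  - by apply: fin_bigcap_measurable => // i _; exact: mE.
  move=> w [c _ /= Zr] i _; apply: contrapT => nE.
  have := low_cellP (Wi i) (kx c) nE; apply/negP; rewrite -leNgt.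
  apply: le_trans (ltW Zr); rewrite ZE -sqrtr_sqr ler_sqrt; last by apply: sumr_ge0 => j _; exact: sqr_ge0.
  by rewrite (bigD1 i)//= lerDl; apply: sumr_ge0 => j _; exact: sqr_ge0.
pose q := low_cell_constant * ((1 + r) / Num.sqrt k).
have pb i : (P (E i) <= q%:E)%E by exact: low_cell_bound.
rewrite PE /bessel_constant -exprMn -/q (_ : (q ^+ 3)%:E = q%:E * (q%:E * q%:E))%E; last first.
  by rewrite -!EFinM -expr2 -exprS.
by apply: lee_pmul => //; [rewrite mule_ge0|apply: lee_pmul].
Qed.

Lemma bessel_reflect d (T : measurableType d) (P : probability T R) (Z : R -> T -> R) :
  two_sided_bessel3 P Z -> two_sided_bessel3 P (fun t => Z (- t)).
Proof.
move=> [W WW ZE]; have := brownian_family_reflect (f := @id 'I_3) 0 (@inj_id _) WW.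
set W' := (fun j t w => _) => WW'; exists W' => // t w; rewrite ZE.
congr (Num.sqrt _); apply: eq_bigr => i _.
by rewrite /W' (brownian_zero (WW.1 i)) !sub0r sqrrN.
Qed.

Lemma bessel_scale d (T : measurableType d) (P : probability T R) (Z : R -> T -> R) (al : R) :
  0 < al -> two_sided_bessel3 P Z ->
  two_sided_bessel3 P (fun t w => (Num.sqrt al)^-1 * Z (al * t) w).
Proof.
move=> al0 [W WW ZE]; have := brownian_family_affine (f := @id 'I_3) 0 (@inj_id _) al0 WW.
set W' := (fun j t w => _) => WW'; exists W' => // t w; rewrite ZE.
have sal : 0 <= (Num.sqrt al)^-1 by rewrite invr_ge0.
rewrite -[(Num.sqrt al)^-1 in LHS]ger0_norm// -sqrtr_sqr -sqrtrM ?sqr_ge0// mulr_sumr.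
congr (Num.sqrt _); apply: eq_bigr => i _.
by rewrite /W' (brownian_zero (WW.1 i)) addr0 subr0 exprMn.
Qed.

Lemma bessel_continuous d (T : measurableType d) (P : probability T R) (Z : R -> T -> R) w :
  two_sided_bessel3 P Z -> continuous (fun t => Z t w).
Proof.
move=> [W WW ZE]; rewrite (_ : (fun t => Z t w) = fun t => Num.sqrt (\sum_(i < 3) W i t w ^+ 2)); last first.
  by apply/funext => t.
move=> t.
have cs : \sum_(i < 3) W i s w ^+ 2 @[s --> t] --> \sum_(i < 3) W i t w ^+ 2.
  have ci i : W i s w ^+ 2 @[s --> t] --> W i t w ^+ 2.
    exact: (cvg_comp (fun s => W i s w) (fun x : R => x ^+ 2)
      (brownian_continuous (WW.1 i) (w := w) (x := t)) (@exprn_continuous _ _ _)).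
  rewrite !big_ord_recl big_ord0.
  under eq_fun do rewrite !big_ord_recl big_ord0.
  by apply: cvgD; [exact: ci|apply: cvgD; [exact: ci|apply: cvgD; [exact: ci|exact: cvg_cst]]].
exact: (cvg_comp _ (@Num.sqrt R) cs (@sqrt_continuous R _)).
Qed.

Lemma bessel_ge0 d (T : measurableType d) (P : probability T R) (Z : R -> T -> R) t w :
  two_sided_bessel3 P Z -> 0 <= Z t w.
Proof. by move=> [W _ ZE]; rewrite ZE sqrtr_ge0. Qed.

End bessel.

(** * Localization of the maximizers *)

Section escape_rates.
Context {R : realType}.
Local Notation point := (R * R * R * R)%type.

(** With [2 ^ l] of order [b * r], both [2 ^ l * r ^+ 2] and [8 ^ l] are of order [r ^+ 3], and the
    small constant [b] lets the first win. For [b * r < 1] the right-hand side exceeds 1. *)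
Lemma lower_exponent (th : R) : 0 < th -> exists K k : R, [/\ 0 <= K, 0 < k & forall r : nat,
  exists l : nat, expR (- (2 ^+ l * th * (r%:R ^+ 2 / 4 - 1))) * 4 ^+ (8 ^ l) <= K * expR (- (k * r%:R ^+ 3)) \/
   1 <= K * expR (- (k * r%:R ^+ 3))].
Proof.
move=> th0; pose b := Num.min 1 (th / 32).
have b0 : 0 < b by rewrite /b lt_min ltr01/= divr_gt0.
have b1 : b <= 1 by rewrite /b ge_min lexx.
have bth : 32 * b <= th.
  have : b <= th / 32 by rewrite /b ge_min lexx orbT.
  lra.
pose k := b * th / 32; have k0 : 0 < k by rewrite /k divr_gt0// mulr_gt0.
exists (expR (4 * b * th) + expR (k / b ^+ 3)), k; split=> [|//|r]; first by rewrite addr_ge0 ?expR_ge0.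
have e0 := expR_ge0 (k / b ^+ 3); have e1 := expR_ge0 (4 * b * th); have e2 := expR_ge0 (- (k * r%:R ^+ 3)).
have [br|br] := ltP (b * r%:R) 1.
  exists 0%N; right; apply: (@le_trans _ _ (expR (k / b ^+ 3) * expR (- (k * r%:R ^+ 3)))); last first.
    by rewrite ler_wpM2r// lerDr.
  rewrite -expRD -[leLHS]expR0 ler_expR -mulrBr; apply: mulr_ge0; first exact: ltW.
  rewrite subr_ge0 -exprVn lerXn2r ?nnegrE ?invr_ge0 ?(ltW b0)//.
  by rewrite -[leRHS]mul1r ler_pdivlMr// mulrC ltW.
have [l /andP[l1 l2]] : exists l : nat, (2 ^+ l : R) <= b * r%:R < 2 * 2 ^+ l.
  pose n := Num.truncn (b * r%:R).
  have br0 : 0 <= b * r%:R by lra.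
  have /andP[n1 n2] := truncn_itv br0; rewrite -/n in n1 n2.
  have n0 : (0 < n)%N by rewrite lt0n; apply/eqP => n00; move: n2; rewrite n00; lra.
  exists (trunc_log 2 n); have /andP[t1 t2] := trunc_log_bounds (isT : (1 < 2)%N) n0.
  rewrite -natrX -natrM (le_trans _ n1) ?ler_nat//=.
  by apply: lt_le_trans n2 _; rewrite ler_nat -expnS.
exists l; left; set t := 2 ^+ l in l1 l2 *.
have t0 : 0 < t by rewrite exprn_gt0.
have f4 : (4 : R) <= expR 2 by have := @expR_ge_quadratic R 2; rewrite ler0n => /(_ isT); rewrite expr2; lra.
apply: (@le_trans _ _ (expR (4 * b * th) * expR (- (k * r%:R ^+ 3)))); last by rewrite ler_wpM2r// lerDl.
apply: (@le_trans _ _ (expR (- (t * th * (r%:R ^+ 2 / 4 - 1))) * expR (2 * t ^+ 3))).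
  rewrite ler_wpM2l ?expR_ge0//; apply: (@le_trans _ _ (expR 2 ^+ (8 ^ l))).
    by rewrite lerXn2r ?nnegrE ?expR_ge0.
  rewrite -expRM_natl ler_expR mulrC ler_wpM2l// natrX /t -exprM mulnC exprM.
  by rewrite (_ : 2 ^+ 3 = 8%:R :> R)//; ring.
rewrite -!expRD ler_expR; set x := r%:R : R in l1 l2 br *.
have x0 : 0 <= x by [].
have h1 : 2 * t ^+ 3 <= t * th * x ^+ 2 / 16.
  have : t ^+ 2 <= (b * x) ^+ 2 by rewrite lerXn2r ?nnegrE ?(ltW t0)//; lra.
  rewrite exprMn => h2.
  have h3 : b ^+ 2 * x ^+ 2 * 32 <= th * x ^+ 2.
    have : b ^+ 2 * 32 <= th by rewrite expr2; nra.
    have := sqr_ge0 x; nra.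
  have -> : 2 * t ^+ 3 = t * (2 * t ^+ 2) by ring.
  have -> : t * th * x ^+ 2 / 16 = t * (th * x ^+ 2 / 16) by ring.
  rewrite ler_wpM2l ?(ltW t0)//; lra.
have h4 : b * x / 2 * (th * x ^+ 2) <= t * (th * x ^+ 2).
  by rewrite ler_wpM2r ?mulr_ge0 ?sqr_ge0 ?(ltW th0)//; lra.
have h5 : t * th <= b * x * th by rewrite ler_wpM2r// ltW.
have h6 : b * th * x <= b * th * (4 + x ^+ 3 / 16).
  rewrite ler_wpM2l ?mulr_ge0 ?(ltW th0) ?(ltW b0)//.
  have x3 : 0 <= x ^+ 3 by exact: exprn_ge0.
  have [x4|x4] := leP x 4; first lra.
  by rewrite exprS expr2; nra.
rewrite /k.
have -> : - (t * th * (x ^+ 2 / 4 - 1)) + 2 * t ^+ 3 = 2 * t ^+ 3 - t * (th * x ^+ 2) / 4 + t * th by ring.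
have h7 : t * th * x ^+ 2 = t * (th * x ^+ 2) by ring.
have h8 : b * x / 2 * (th * x ^+ 2) = b * th * x ^+ 3 / 2 by field.
have h9 : b * th * (4 + x ^+ 3 / 16) = 4 * b * th + b * th * x ^+ 3 / 16 by field.
have h10 : b * th / 32 * x ^+ 3 = b * th * x ^+ 3 / 32 by ring.
have h11 : b * x * th = b * th * x by ring.
rewrite h7 in h1; rewrite h8 in h4; rewrite h9 in h6; rewrite h11 in h5; rewrite h10.
have : 0 <= b * th * x ^+ 3 by rewrite !mulr_ge0 ?exprn_ge0 ?(ltW th0) ?(ltW b0).
lra.
Qed.

(** For all landscapes at once, as the constants of the theorem precede the probability space. *)
Definition corner_rate (K k : R) : Prop :=
  forall d (T : measurableType d) (P : probability T R) (L : T -> point -> R),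
    directed_landscape P L -> forall r : nat,
  (P [set w | (unit_landscape L w (0, 0) < - (r%:R ^+ 2 / 4))%R] <= (K * expR (- (k * r%:R ^+ 3)))%:E)%E.

Lemma corner_rate_exists d (T : measurableType d) (P : probability T R) (L : T -> point -> R) :
  directed_landscape P L ->
  exists La K k : R, [/\ tight_strips La, 0 <= K, 0 < k & corner_rate K k].
Proof.
move=> LL; have [La La0 tight] := tight_strips_exists LL.
have [d1 [T1 [P1 [W1 [WW1 _]]]]] := landscape_limit LL.
have [D DE] : exists D : seq (R * R), D = [:: (0, 0)] by exists [:: (0, 0)].
have Ds p : p \in D -> in_strips p.
  by rewrite DE inE => /eqP ->; left; rewrite /= lexx ler01.
have [n1 h1] := tight D Ds; have [n2 h2] := @scaled_blocks_lt R D 0 1 isT.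
have hasE d' (T' : measurableType d') (W : int -> R -> T' -> R) n c : [set w | has (fun p => scaled_lpp W n 0 1 p w < c) D] =
    [set w | centered_lpp W n w < c].
  by rewrite DE; apply/seteqP; split => w /=; rewrite orbF centered_lppE.
pose n0 := maxn 1 (maxn n1 n2).
have n00 : (0 < n0)%N by rewrite leq_max.
have [th th0 hth] : exists2 th : R, 0 < th & forall (l i : nat) (la : R),
    (P1 [set w | (centered_lpp W1 (8 ^ (l + i) * n0) w < - la)%R] <=
     (expR (- (2 ^+ l * th * la)) * 4 ^+ (8 ^ l))%:E)%E.
  apply: (centered_lower_tail WW1 n00 La0) => n hn.
  rewrite -hasE; apply: h1 WW1; apply: leq_trans hn; rewrite /n0; lia.
have [K [k [K0 k0 hK]]] := lower_exponent th0.
exists La, K, k; split=> // d' T' P' L' LL' r; have [l [hl|hl]] := hK r; last first.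
  by apply: le_trans (probability_le1 _ _) _ => //; apply: measurable_lt_event => //; exact: measurable_unit_landscape LL' _.
have hfam d2 (T2 : measurableType d2) (P2 : probability T2 R) (W2 : int -> R -> T2 -> R) :
    two_sided_brownian_family P2 W2 -> forall (l' i : nat) (la : R),
    (P2 [set w | (centered_lpp W2 (8 ^ (l' + i) * n0) w < - la)%R] <=
     (expR (- (2 ^+ l' * th * la)) * 4 ^+ (8 ^ l'))%:E)%E.
  move=> WW2 l' i la; apply: le_trans (hth l' i la).
  rewrite -!hasE (scaled_has_law _ WW2 WW1)//; apply: (h2 _ _).2.
  have : (n0 <= 8 ^ (l' + i) * n0)%N by rewrite leq_pmull// expn_gt0.
  by rewrite /n0; lia.
have := landscape_lower_tail LL' n00 hfam l (r%:R ^+ 2 / 4 - 1).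
by rewrite subrK => h; apply: le_trans h _; rewrite lee_fin.
Qed.

(** This is [1 / (4 * 192 ^+ 2)], dictated by [step_exponent]; the boxes of [box_exponent] would
    allow for more. *)
Definition escape_speed : R := (384 ^+ 2)^-1.

Lemma escape_speed_gt0 : 0 < escape_speed. Proof. by rewrite invr_gt0; apply: exprn_gt0; rewrite ltr0n. Qed.

Lemma cube_sum_ge (r n : nat) : r%:R ^+ 3 + n%:R <= (r%:R + n%:R) ^+ 3 :> R.
Proof.
rewrite -natrD -!natrX -natrD ler_nat.
have : (n <= n ^ 3)%N by case: n => // n; rewrite -[X in (X <= _)%N]expn1 leq_pexp2l.
by rewrite (expnS (_ + _)) (expnS r) (expnS n) !expnS !expn0 !muln1; nia.
Qed.

(** The exponent of [box_event_bound] with [th = (r + n) / 20], at the level [box_level]. The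
    divisor 20 keeps the cubic term [3 * th ^+ 3] below the gain, and [c] stands for twice the
    tightness constant. *)
Lemma box_exponent (c r n : R) : 1 <= r + n -> 0 <= r -> 0 <= n ->
  - ((r + n) / 20 * (r ^+ 2 / 4 - n ^+ 2 / 6 - 1 - c)) +
  (3 * ((r + n) / 20) ^+ 3 - (r + n) / 20 * n ^+ 2 / 3 + 1) <=
  1 + (1 + c) ^+ 2 - (r + n) ^+ 3 * escape_speed.
Proof.
rewrite /escape_speed; move=> u1 r0 n0; set u := r + n in u1 *.
have h1 : u ^+ 2 / 12 <= r ^+ 2 / 4 + n ^+ 2 / 6.
  by rewrite /u; have := sqr_ge0 (r - n); have := sqr_ge0 r; rewrite !expr2; nra.
have h2 : u * (u ^+ 2 / 12) <= u * (r ^+ 2 / 4 + n ^+ 2 / 6) by rewrite ler_wpM2l//; lra.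
have h3 : u * (1 + c) / 20 <= u ^+ 3 / 600 + (1 + c) ^+ 2.
  have : u ^+ 2 <= u ^+ 3 by rewrite (exprS u 2) ler_peMl ?sqr_ge0.
  have : u * (1 + c) / 20 <= u ^+ 2 / 600 + 3 / 8 * (1 + c) ^+ 2.
    have := sqr_ge0 (u / 2 - 15 / 2 * (1 + c)); rewrite !expr2; lra.
  have := sqr_ge0 (1 + c); lra.
have h4 : 0 <= u ^+ 3 by rewrite exprn_ge0//; lra.
have -> : - (u / 20 * (r ^+ 2 / 4 - n ^+ 2 / 6 - 1 - c)) + (3 * (u / 20) ^+ 3 - u / 20 * n ^+ 2 / 3 + 1) =
  - (u * (r ^+ 2 / 4 + n ^+ 2 / 6)) / 20 + u * (1 + c) / 20 + 3 / 8000 * u ^+ 3 + 1 by field.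
have h5 : u * (u ^+ 2 / 12) = u ^+ 3 / 12 by rewrite exprS; field.
rewrite h5 in h2; lra.
Qed.

Section landscape_escape.
Variables (d : measure_display) (T : measurableType d) (P : probability T R).
Variable L : T -> point -> R.
Hypothesis LL : directed_landscape P L.

(** The level falls with the distance [n] of the box from the diagonal; 1/6 is half of the
    coefficient 1/3 of the parabola in [box_event_bound], the other half being kept for the
    decay. *)
Definition box_level (r n : nat) : R := r%:R ^+ 2 / 4 - n%:R ^+ 2 / 6.

Definition landscape_escape (k : R) (r : nat) : set T :=
  [set w | unit_landscape L w (0, 0) < - (r%:R ^+ 2 / 4)] `|`
  \bigcup_n (box_event L k n%:R (box_level r n) `|` box_event L k (- n%:R) (box_level r n)).

Lemma landscape_escape_sigma k r : process_sigma R4up (fun p w => L w p) (landscape_escape k r).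
Proof.
pose S := process_type R4up (fun p w => L w p).
have m1 : measurable ([set w | unit_landscape L w (0, 0) < - (r%:R ^+ 2 / 4)] : set S).
  by apply: (@measurable_lt_event _ _ S) => //; apply: measurable_process_type; exact: R4up_unit.
have m2 n : measurable (box_event L k n%:R (box_level r n) : set S) by exact: box_event_sigma.
have m3 n : measurable (box_event L k (- n%:R) (box_level r n) : set S) by exact: box_event_sigma.
have m4 : measurable (\bigcup_n (box_event L k n%:R (box_level r n) `|`
    box_event L k (- n%:R) (box_level r n)) : set S).
  by apply: bigcupT_measurable => n; exact: (measurableU _ _ (m2 n) (m3 n)).
exact: (measurableU _ _ m1 m4).
Qed.

Definition box_rate (La : R) : R := 4 * expR (1 + (1 + La *+ 2) ^+ 2).

Lemma box_rate_bound La k j r n : tight_strips La -> `|j| = n%:R ->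
  (P (box_event L k j (box_level r n)) <=
    (box_rate La * expR (- ((r%:R ^+ 3 + n%:R) * escape_speed)))%:E)%E.
Proof.
move=> tight jn; have jn2 : j ^+ 2 = n%:R ^+ 2 by rewrite -[LHS]real_normK ?num_real// jn.
have r0 : (0 : R) <= r%:R by []. have n0 : (0 : R) <= n%:R by [].
have e1 : 1 <= expR (1 + (1 + La *+ 2) ^+ 2) by rewrite -[leLHS]expR0 ler_expR; have := sqr_ge0 (1 + La *+ 2); lra.
have [u0|u0] := posnP (r + n)%N.
  apply: le_trans (probability_le1 _ _) _ => //; first exact: box_event_measurable LL _ _ _.
  have [-> ->] : r = 0%N /\ n = 0%N by lia.
  by rewrite expr0n/= addr0 mul0r oppr0 expR0 mulr1 lee_fin /box_rate; lra.
have u1 : 1 <= r%:R + n%:R :> R by rewrite -natrD ler1n.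
have th0 : 0 < (r%:R + n%:R) / 20 :> R by lra.
apply: le_trans (box_event_bound LL k j _ tight th0) _.
rewrite lee_fin /box_rate -[leRHS]mulrA -expRD ler_wpM2l// ler_expR jn2 /box_level.
apply: le_trans (box_exponent _ u1 r0 n0) _; rewrite lerD2l lerN2 ler_wpM2r ?(ltW escape_speed_gt0)//.
exact: cube_sum_ge.
Qed.

Lemma landscape_escape_bound La K c k r : tight_strips La -> 0 <= K -> corner_rate K c ->
  (P (landscape_escape k r) <= (K * expR (- (c * r%:R ^+ 3)) +
    2 * box_rate La / (1 - expR (- escape_speed)) * expR (- (escape_speed * r%:R ^+ 3)))%:E)%E.
Proof.
move=> tight K0 rate.
have mb j n : measurable (box_event L k j (box_level r n)) by exact: box_event_measurable LL _ _ _.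
have b0 : 0 <= box_rate La by rewrite mulr_ge0 ?expR_ge0.
apply: le_trans (measureU2 _ _ _) _.
- by apply: measurable_lt_event => //; exact: measurable_unit_landscape LL _.
- by apply: bigcupT_measurable => n; exact: measurableU.
rewrite EFinD; apply: leeD; first exact: rate.
have q1 : expR (- escape_speed) < 1 :> R by rewrite -[ltRHS]expR0 ltr_expR oppr_lt0 escape_speed_gt0.
have a0 : 0 <= 2 * box_rate La * expR (- (escape_speed * r%:R ^+ 3)) by rewrite !mulr_ge0 ?expR_ge0.
rewrite -mulrA [X in 2 * box_rate La * X]mulrC mulrA.
apply: (probability_union_geometric a0 (expR_ge0 _) q1) => n; first exact: measurableU.
apply: le_trans (measureU2 _ _ _) _ => //.
apply: le_trans (leeD (box_rate_bound _ _ tight _) (box_rate_bound _ _ tight _)) _; rewrite ?normrN ?normr_nat//.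
have eE : expR (- (escape_speed * r%:R ^+ 3)) * expR (- escape_speed) ^+ n =
    expR (- ((r%:R ^+ 3 + n%:R) * escape_speed)) :> R by rewrite -expRM_natl -expRD; congr expR; ring.
rewrite -EFinD lee_fin -[leRHS]mulrA eE le_eqVlt; apply/orP; left; apply/eqP; ring.
Qed.
End landscape_escape.

Section brownian_escape.
Variables (d : measure_display) (T : measurableType d) (P : probability T R).
Variable B : R -> T -> R.
Hypothesis BB : two_sided_brownian P B.

(** Off the exceptional event the values of [B] at two points of these cells differ by at most
    [11 * step_level], and [11 / 96 < 1 / 6]: the parabola in [box_level] absorbs the Brownian
    increment. *)
Definition step_level (r n : nat) : R := (r%:R ^+ 2 + n%:R ^+ 2) / 96.

Definition step_escape (k j : R) (r n : nat) : set T :=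
  oscillation B k (step_level r n) `|` oscillation B (k + j) (step_level r n) `|`
  [set w | step_level r n < `|B (k + j) w - B k w|].

Definition brownian_escape (k : R) (r : nat) : set T :=
  \bigcup_n (step_escape k n%:R r n `|` step_escape k (- n%:R) r n).

Lemma brownian_escape_sigma k r : process_sigma setT B (brownian_escape k r).
Proof.
pose S := process_type setT B.
have mB t : measurable_fun setT (B t : S -> R) by exact: measurable_process_type.
have mO t m : measurable (oscillation B t m : set S) by exact: oscillation_sigma.
have mS j n : measurable (step_escape k j r n : set S).
  have m1 : measurable ([set w | step_level r n < `|B (k + j) w - B k w|] : set S).
    by apply: (@measurable_lt_event _ _ S) => //; apply: measurableT_comp => //; apply: measurable_funB; exact: mB.
  exact: (measurableU _ _ (measurableU _ _ (mO _ _) (mO _ _)) m1).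
suff h : measurable (brownian_escape k r : set S) by exact: h.
by apply: bigcupT_measurable => n; exact: (measurableU _ _ (mS _ _) (mS _ _)).
Qed.

Lemma step_level_ge0 r n : 0 <= step_level r n.
Proof. by rewrite divr_ge0// addr_ge0// sqr_ge0. Qed.

Lemma step_exponent r n (v : R) : 0 < v -> (v <= (r + n)%:R) ->
  (r%:R ^+ 3 + n%:R) * escape_speed <= step_level r n ^+ 2 / (4 * v).
Proof.
move=> v0 vu; apply: le_trans (ler_wpM2r (ltW escape_speed_gt0) (cube_sum_ge r n)) _.
rewrite -natrD; set u := (r + n)%:R in vu *.
have u0 : 0 < u by exact: lt_le_trans vu.
have h : u ^+ 2 / 192 <= step_level r n.
  by rewrite /step_level /u natrD; have := sqr_ge0 (r%:R - n%:R : R); rewrite !expr2; nra.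
have h2 : u ^+ 4 / 192 ^+ 2 <= step_level r n ^+ 2.
  rewrite (_ : u ^+ 4 / 192 ^+ 2 = (u ^+ 2 / 192) ^+ 2); last by field.
  by rewrite lerXn2r ?nnegrE ?step_level_ge0 ?divr_ge0 ?sqr_ge0.
rewrite ler_pdivlMr ?mulr_gt0//; apply: le_trans h2; rewrite /escape_speed.
have : u ^+ 3 * v <= u ^+ 3 * u by rewrite ler_wpM2l// exprn_ge0// ltW.
by rewrite -exprSr; lra.
Qed.

Definition step_rate : R := oscillation_constant * 2 + Num.sqrt 2.

Lemma step_escape_bound k j r n : `|j| = n%:R ->
  (P (step_escape k j r n) <= (step_rate * expR (- ((r%:R ^+ 3 + n%:R) * escape_speed)))%:E)%E.
Proof.
move=> jn; have mB t : measurable_fun setT (B t) by exact: brownian_measurable BB t.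
have mO t m : measurable (oscillation B t m) by exact: oscillation_measurable BB _ _.
have s0 := step_level_ge0 r n; have oc1 := @oscillation_constant_ge1 R.
have q0 : 0 <= Num.sqrt 2 :> R by [].
have m1 : measurable [set w | step_level r n < `|B (k + j) w - B k w|].
  by apply: measurable_lt_event => //; apply: measurableT_comp => //; exact: measurable_funB.
have [u0|u0] := posnP (r + n)%N.
  apply: le_trans (probability_le1 _ _) _ => //; first by apply: measurableU => //; exact: measurableU.
  have [-> ->] : r = 0%N /\ n = 0%N by lia.
  by rewrite expr0n/= addr0 mul0r oppr0 expR0 mulr1 lee_fin /step_rate; lra.
have osc t : (P (oscillation B t (step_level r n)) <=
    (oscillation_constant * expR (- ((r%:R ^+ 3 + n%:R) * escape_speed)))%:E)%E.
  apply: le_trans (oscillation_prob BB _ s0) _; rewrite lee_fin ler_wpM2l//; first lra.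
  rewrite ler_expR lerN2; have := @step_exponent r n 1 ltr01; rewrite mulr1; apply.
  by rewrite ler1n.
have inc : (P [set w | (step_level r n < `|B (k + j) w - B k w|)%R] <=
    (Num.sqrt 2 * expR (- ((r%:R ^+ 3 + n%:R) * escape_speed)))%:E)%E.
  have [n0|n0] := posnP n.
    have -> : j = 0 by apply/eqP; rewrite -normr_eq0 jn n0.
    rewrite (_ : [set w | _] = set0) ?measure0 ?lee_fin ?mulr_ge0 ?expR_ge0//.
    by apply/seteqP; split => w //=; rewrite addr0 subrr normr0 ltNge s0.
  have nR : (0 : R) < n%:R by rewrite ltr0n.
  have nu : n%:R <= (r + n)%:R :> R by rewrite ler_nat leq_addl.
  have fin (v1 v2 : R) : v1 < v2 -> v2 - v1 = n%:R ->
      (P [set w | (step_level r n < `|B v2 w - B v1 w|)%R] <=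
    (Num.sqrt 2 * expR (- ((r%:R ^+ 3 + n%:R) * escape_speed)))%:E)%E.
    move=> v12 vn; apply: le_trans (gaussian_increment_tail BB v12 s0) _.
    by rewrite vn lee_fin ler_wpM2l// ler_expR lerN2; exact: step_exponent.
  have [j0|j0] := leP 0 j.
    by rewrite ger0_norm// in jn; apply: fin; lra.
  rewrite ltr0_norm// in jn.
  rewrite (_ : [set w | _] = [set w | step_level r n < `|B k w - B (k + j) w|]); last first.
    by apply/seteqP; split => w /=; rewrite distrC.
  by apply: fin; lra.
apply: le_trans (measureU2 _ _ _) _ => //; first exact: measurableU.
rewrite /step_rate mulrDl EFinD; apply: leeD => //.
apply: le_trans (measureU2 _ _ _) _ => //.
by apply: le_trans (leeD (osc _) (osc _)) _; rewrite -EFinD lee_fin; lra.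
Qed.

Lemma brownian_escape_bound k r : (P (brownian_escape k r) <=
    (2 * step_rate / (1 - expR (- escape_speed)) * expR (- (escape_speed * r%:R ^+ 3)))%:E)%E.
Proof.
have mS j n : measurable (step_escape k j r n).
  have mO t m : measurable (oscillation B t m) by exact: oscillation_measurable BB _ _.
  rewrite /step_escape; apply: measurableU; first exact: measurableU.
  apply: measurable_lt_event => //; apply: measurableT_comp => //.
  by apply: measurable_funB; exact: brownian_measurable BB _.
have b0 : 0 <= step_rate.
  by rewrite /step_rate addr_ge0// mulr_ge0//; have := @oscillation_constant_ge1 R; lra.
have q1 : expR (- escape_speed) < 1 :> R by rewrite -[ltRHS]expR0 ltr_expR oppr_lt0 escape_speed_gt0.
have a0 : 0 <= 2 * step_rate * expR (- (escape_speed * r%:R ^+ 3)) by rewrite !mulr_ge0 ?expR_ge0.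
rewrite -mulrA [X in 2 * step_rate * X]mulrC mulrA.
apply: (probability_union_geometric a0 (expR_ge0 _) q1) => n; first exact: measurableU.
apply: le_trans (measureU2 _ _ _) _ => //.
apply: le_trans (leeD (step_escape_bound _ _ _) (step_escape_bound _ _ _)) _; rewrite ?normrN ?normr_nat//.
have eE : expR (- (escape_speed * r%:R ^+ 3)) * expR (- escape_speed) ^+ n =
    expR (- ((r%:R ^+ 3 + n%:R) * escape_speed)) :> R by rewrite -expRM_natl -expRD; congr expR; ring.
rewrite -EFinD lee_fin -[leRHS]mulrA eE le_eqVlt; apply/orP; left; apply/eqP; ring.
Qed.
End brownian_escape.
End escape_rates.

(** * Exponential moments from a sequence of exceptional events *)

Section exponential_moments.
Context {R : realType} {d : measure_display} {T : measurableType d}.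
Variable P : probability T R.

(** The integral is a supremum over simple minorants, hence monotone for arbitrary nonnegative
    functions, such as the landscape evaluated at a random point. *)
Lemma ge0_le_integral_majorant (f g : T -> \bar R) : (forall w, 0 <= f w)%E ->
  (forall w, f w <= g w)%E -> (\int[P]_w f w <= \int[P]_w g w)%E.
Proof.
move=> f0 fg; have g0 w : (0 <= g w)%E by exact: le_trans (fg w).
rewrite !ge0_integralTE//; apply: le_ereal_sup => _ [h hf <-].
by exists h => // w; exact: le_trans (hf w) (fg w).
Qed.

Lemma geometric_sum_le (a q : R) n : 0 <= a -> 0 <= q -> q < 1 ->
  \sum_(0 <= i < n) a * q ^+ i <= a / (1 - q).
Proof.
move=> a0 q0 q1; have q1' : 0 < 1 - q by rewrite subr_gt0.
suff -> : \sum_(0 <= i < n) a * q ^+ i = (a - a * q ^+ n) / (1 - q).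
  by rewrite ler_wpM2r ?invr_ge0 ?(ltW q1')// gerBl mulr_ge0 ?exprn_ge0.
elim: n => [|n ih]; first by rewrite big_nil expr0 mulr1 subrr mul0r.
by rewrite big_nat_recr//= ih exprS; field; rewrite gt_eqF.
Qed.

(** If [m > 0] is the first index with [w] outside [E m], the exponential is at most the term [m.-1]
    of the series [g]; if [w] lies in all of them, the series is infinite. The 16 comes from
    [n.+1 ^+ 3 <= 8 * n ^+ 3 + 1], which leaves half of the decay [k * n ^+ 3]. *)
Lemma expectation_expR_layers (E : nat -> set T) (V : T -> R) (c C k : R) :
  0 < c -> 0 <= C -> 0 < k -> (forall n, measurable (E n)) ->
  (forall n, (P (E n) <= (C * expR (- (k * n%:R ^+ 3)))%:E)%E) ->
  (forall w n, (0 < n)%N -> ~ E n w -> V w <= c * n%:R ^+ 3) ->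
  (\int[P]_w (expR (k / (16 * c) * V w))%:E < +oo)%E.
Proof.
move=> c0 C0 k0 mE PE hV; pose e n : R := expR (k / 16 * n.+1%:R ^+ 3).
pose E' n : set T := if n is 0%N then setT else E n.
have mE' n : measurable (E' n) by case: n => [|n]; [exact: measurableT|exact: mE].
have e1 n : 1 <= e n.
  rewrite -[leLHS]expR0 ler_expR mulr_ge0// ?exprn_ge0//; lra.
pose g n w : \bar R := ((e n)%:E * (\1_(E' n) w)%:E)%E.
have g0 n w : (0 <= g n w)%E by rewrite mule_ge0 ?lee_fin// expR_ge0.
have mg n : measurable_fun setT (g n).
  by apply: measurable_funeM; apply/measurable_EFinP; exact: measurable_indic.
apply: (@le_lt_trans _ _ (\int[P]_w \sum_(0 <= n <oo) g n w)%E).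
  apply: ge0_le_integral_majorant => w; first by rewrite lee_fin expR_ge0.
  have [[n [n0 nE]]|all] := pselect (exists n, (0 < n)%N /\ ~ E n w).
    have ex : exists n, (0 < n)%N && `[< ~ E n w >] by exists n; rewrite n0; apply/asboolP.
    have [m /andP[m0 /asboolP mE2] mmin] := ex_minnP ex.
    apply: (@le_trans _ _ (g m.-1 w)).
      rewrite /g /E' (_ : \1__ w = 1) ?mule1; last first.
        case: m m0 mE2 mmin => // -[|m] _ mE2 mmin /=; first by rewrite indicT.
        rewrite indicE mem_set//; apply: contrapT => nEm.
        by have := mmin m.+1; rewrite ltnn; move/asboolP : nEm => -> /(_ isT).
      rewrite lee_fin ler_expR prednK// (_ : k / (16 * c) = k / 16 / c); last by field; rewrite gt_eqF.
      rewrite -!mulrA ler_pM2l// ler_wpM2l// mulrC ler_pdivrMr// mulrC.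
      exact: hV.
    apply: le_trans (nneseries_lim_ge m.-1.+1 _) => //.
    by rewrite big_nat_recr//= leeDr// sume_ge0.
  have gw n : (1 <= g n w)%E.
    have -> : g n w = (e n)%:E; last by rewrite lee_fin.
    rewrite /g indicE mem_set ?mule1//; case: n => //= n; apply: contrapT => nE.
    by apply: all; exists n.+1.
  suff -> : (\sum_(0 <= n <oo) g n w = +oo)%E by rewrite leey.
  apply/eqyP => r _; pose n := (Num.truncn `|r|).+1.
  apply: (@le_trans _ _ (n%:R)%:E).
    by rewrite lee_fin; apply: le_trans (ler_norm r) (ltW (truncnS_gt _)).
  apply: le_trans (nneseries_lim_ge n _) => //.
  rewrite (_ : n%:R%:E = (\sum_(0 <= i < n) (1 : R)%:E)%E); last by rewrite sumEFin sumr_const_nat subn0.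
  by apply: lee_sum => i _; exact: gw.
rewrite integral_nneseries//.
pose a := (C + 1) * expR (k / 16); pose q := expR (- (k / 2)).
have q1 : q < 1 by rewrite -[ltRHS]expR0 ltr_expR oppr_lt0; lra.
have a0 : 0 <= a by rewrite mulr_ge0 ?expR_ge0//; lra.
have term n : (\int[P]_w g n w <= (a * q ^+ n)%:E)%E.
  rewrite /g ge0_integralZl//; last 2 first.
    by apply/measurable_EFinP; exact: measurable_indic.
    by rewrite lee_fin expR_ge0.
  rewrite integral_indic// setIT.
  have PE' : (P (E' n) <= ((C + 1) * expR (- (k * n%:R ^+ 3)))%:E)%E.
    case: n => [|n] /=; first by rewrite probability_setT expr0n/= mulr0 oppr0 expR0 mulr1 lee_fin; lra.
    by apply: le_trans (PE _) _; rewrite lee_fin ler_wpM2r ?expR_ge0//; lra.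
  apply: le_trans (lee_wpmul2l _ PE') _; first by rewrite lee_fin expR_ge0.
  rewrite -EFinM lee_fin /a /q /e mulrCA -!mulrA ler_wpM2l//; first lra.
  rewrite -!expRD -expRM_natl -expRD ler_expR.
  have n3 : n%:R <= n%:R ^+ 3 :> R.
    by rewrite -natrX ler_nat; case: n {PE'} => // n; rewrite -[X in (X <= _)%N]expn1 leq_pexp2l.
  have n83 : n.+1%:R ^+ 3 <= 8 * n%:R ^+ 3 + 1 :> R.
    case: n {PE' n3} => [|n]; first by rewrite expr1n expr0n /=; lra.
    have h : n.+2%:R ^+ 3 <= (2 * n.+1%:R) ^+ 3 :> R.
      by rewrite lerXn2r ?nnegrE ?mulr_ge0// -natrM ler_nat; lia.
    by rewrite exprMn in h; lra.
  have : k / 16 * n.+1%:R ^+ 3 <= k / 16 * (8 * n%:R ^+ 3 + 1) by rewrite ler_wpM2l//; lra.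
  have : k * n%:R <= k * n%:R ^+ 3 by rewrite ler_wpM2l// ltW.
  lra.
apply: (@le_lt_trans _ _ (a / (1 - q))%:E); last by rewrite ltry.
apply: lime_le; first by apply: is_cvg_nneseries => n _ _; exact: integral_ge0.
apply: nearW => n; apply: (@le_trans _ _ (\sum_(0 <= i < n) (a * q ^+ i)%:E)%E).
  by apply: lee_sum => i _; exact: term.
by rewrite sumEFin lee_fin geometric_sum_le// expR_ge0.
Qed.
End exponential_moments.

(** * Confinement of the points that beat the origin *)

Section confinement.
Context {R : realType}.
Local Notation point := (R * R * R * R)%type.
Variables (d : measure_display) (T : measurableType d) (P : probability T R).
Variables (B Z : R -> T -> R) (L : T -> point -> R).
Hypothesis BB : two_sided_brownian P B.
Hypothesis ZZ : two_sided_bessel3 P Z.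
Hypothesis LL : directed_landscape P L.
Local Notation F := (bessel_landscape_sum B Z L).

Lemma bessel_zero w : Z 0 w = 0.
Proof.
have [W WW ZE] := ZZ; rewrite ZE big1 ?sqrtr0// => i _.
by rewrite (brownian_zero (WW.1 i)) expr0n.
Qed.

Lemma sum_continuous w : continuous (fun z : R * R => F w z.1 z.2).
Proof.
have cf : continuous (fun z : R * R => z.1) by move=> z; exact: cvg_fst.
have cs : continuous (fun z : R * R => z.2) by move=> z; exact: cvg_snd.
have cB (f : R * R -> R) : continuous f -> continuous (fun z => B (f z) w).
  by move=> cf' z; apply: (cvg_comp f (fun t => B t w) (cf' z)); exact: brownian_continuous BB _ _.
have cZ (f : R * R -> R) : continuous f -> continuous (fun z => Z (f z) w).
  by move=> cf' z; apply: (cvg_comp f (fun t => Z t w) (cf' z)); exact: bessel_continuous ZZ _.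
move=> z; apply: cvgB; last exact: cZ.
apply: cvgB; last exact: cB.
have -> : (fun z : R * R => B z.1 w - Z z.1 w + L w (z.1, 0, z.2, 1)) =
    (fun z : R * R => (B z.1 w - Z z.1 w) + unit_landscape L w z) by [].
apply: cvgD; last exact: unit_landscape_continuous LL w z.
by apply: cvgB; [exact: cB|exact: cZ].
Qed.

Definition cell (k x : R) : Prop := k <= x <= k + 1.

Lemma cell_exists (x : R) : exists i : nat, i%:R <= `|x| < i.+1%:R /\ (cell i%:R x \/ cell (- i.+1%:R) x).
Proof.
have /andP[h1 h2] := truncn_itv (normr_ge0 x); set i := Num.truncn _ in h1 h2.
exists i; split; first by rewrite h1.
rewrite /cell -natr1; rewrite -natr1 in h2.
have [x0|x0] := leP 0 x.
  by left; rewrite ger0_norm// in h1 h2; rewrite h1 ltW.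
by right; rewrite ltr0_norm// in h1 h2; apply/andP; split; lra.
Qed.

Lemma cell_offset (k x y j r : R) (n : nat) : cell k x -> cell (k + j) y ->
  j = n%:R \/ j = - n%:R -> n%:R <= r -> `|y - x| <= r + 1.
Proof.
move=> /andP[x1 x2] /andP[y1 y2] jn nr; have n0 : (0 : R) <= n%:R by [].
by rewrite ler_norml; apply/andP; case: jn => jE; rewrite jE in y1 y2; split; lra.
Qed.

Definition escape (k : R) (r : nat) : set T := landscape_escape L k r `|` brownian_escape B k r.

(** With [n] the offset between the cells of [x] and [y], the bounds for the landscape at the origin
    and on the box and for the increment of [B] combine to [Z x + Z y + 5 / 96 * n ^+ 2 <= 59 / 96 *
    r ^+ 2]. This gives the first two conclusions; the third follows from the box level above and
    from [F w 0 0 <= F w x y] below. *)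
Lemma escape_path k r w x y : ~ escape k r w -> cell k x -> F w 0 0 <= F w x y ->
  [/\ Z x w <= r%:R ^+ 2, `|y - x| <= 4 * r%:R + 1 & `|unit_landscape L w (x, y)| <= 2 * r%:R ^+ 2].
Proof.
move=> /not_orP[/not_orP[nC nL] nB] kx; have /andP[kx1 kx2] := kx.
have [j [jy [n jn]]] : exists j : R, k + j <= y <= k + j + 1 /\ exists n : nat, j = n%:R \/ j = - n%:R.
  exists (Num.floor (y - k))%:~R; split.
    by have := floor_itv (y - k); rewrite intrD => /andP[h1 h2]; apply/andP; split; lra.
  exists `|Num.floor (y - k)|%N; case: (Num.floor (y - k)) => m; first by left.
  by right; rewrite NegzE abszN absz_nat mulrNz.
have jn2 : j ^+ 2 = n%:R ^+ 2 by case: jn => ->; rewrite ?sqrrN.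
have s0 : (0 : R) <= step_level r n by exact: step_level_ge0.
have hbox : unit_landscape L w (x, y) <= box_level r n.
  apply: (box_event_path LL (k := k) (j := j)) => //= h; apply: nL; exists n => //.
  by case: jn h => -> h; [left|right].
have [nO1 nO2 nS] : [/\ ~ oscillation B k (step_level r n) w, ~ oscillation B (k + j) (step_level r n) w
    & ~ (step_level r n < `|B (k + j) w - B k w|)].
  have : ~ step_escape B k j r n w by move=> h; apply: nB; exists n => //; case: jn h => -> h; [left|right].
  by move=> /not_orP[/not_orP[]].
have o1 := oscillation_path BB s0 kx nO1.
have o2 := oscillation_path BB s0 jy nO2.
have o3 : `|B (k + j) w - B k w| <= step_level r n by rewrite leNgt; apply/negP.
have c0 : - (r%:R ^+ 2 / 4) <= unit_landscape L w (0, 0) by rewrite leNgt; apply/negP.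
have z1 := bessel_ge0 x w ZZ; have z2 := bessel_ge0 y w ZZ.
rewrite /bessel_landscape_sum (brownian_zero BB) bessel_zero.
rewrite /unit_landscape /= in hbox c0 *; set l := L w (x, 0, y, 1) in hbox *.
set l0 := L w (0, 0, 0, 1) in c0 *; rewrite /step_level in o1 o2 o3 s0; rewrite /box_level in hbox.
rewrite !ler_norml in o1 o2 o3.
move: o1 => /andP[q1 p1].
move: o2 => /andP[q2 p2].
move: o3 => /andP[q3 p3].
move=> hF.
have r2 : 0 <= r%:R ^+ 2 :> R by exact: sqr_ge0.
have n2 : 0 <= n%:R ^+ 2 :> R by exact: sqr_ge0.
have h1 : n%:R ^+ 2 * 5 <= 59 * r%:R ^+ 2 :> R by lra.
have nr : n%:R <= 4 * r%:R :> R.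
  rewrite -(@ler_pXn2r _ 2) ?nnegrE ?mulr_ge0// exprMn (_ : 4 ^+ 2 = 16 :> R); last by ring.
  lra.
split; [lra| |by rewrite ler_norml; apply/andP; split; lra].
exact: (cell_offset kx jy jn).
Qed.

Definition near_event (k r : R) : set T := \bigcup_c [set w | Z (k + (unit_grid c).1) w < r].

Lemma near_event_sigma k r : process_sigma setT Z (near_event k r).
Proof.
pose S := process_type setT Z.
suff h : measurable (near_event k r : set S) by exact: h.
apply: bigcupT_measurable => c; apply: (@measurable_lt_event _ _ S) => //.
exact: measurable_process_type.
Qed.

Lemma near_event_path k r w x : cell k x -> ~ near_event k r w -> r <= Z x w.
Proof.
move=> /andP[x1 x2] nE; rewrite -lerN2.
have cf : continuous (fun z : R * R => - Z (k + z.1) w).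
  move=> z; apply: cvgN; apply: (cvg_comp (fun z : R * R => k + z.1) (fun t => Z t w)); last exact: bessel_continuous ZZ _.
  by apply: cvgD; [exact: cvg_cst|exact: cvg_fst].
have := @unit_grid_dense R _ (- r) (x - k, 0) cf; rewrite /= subrKC; apply.
- by move=> c; rewrite lerN2 leNgt; apply/negP => h; apply: nE; exists c.
- by apply/andP; split; lra.
- by rewrite lexx ler01.
Qed.

Lemma near_event_bound k r : 0 < k -> 0 <= r ->
  (P (near_event k r) <= (bessel_constant * ((1 + r) / Num.sqrt k) ^+ 3)%:E)%E /\
  (P (near_event (- (k + 1)) r) <= (bessel_constant * ((1 + r) / Num.sqrt k) ^+ 3)%:E)%E.
Proof.
move=> k0 r0; split.
  by apply: bessel_small_ball ZZ k0 r0 _ => c; have [g1 g2 _ _] := @unit_grid_itv R c; apply/andP; split; lra.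
have := @bessel_small_ball _ _ _ P _ k r (fun c => k + 1 - (unit_grid c).1) (bessel_reflect ZZ) k0 r0.
rewrite (_ : \bigcup_c _ = near_event (- (k + 1)) r); last first.
  by congr bigcup; apply/funext => c; apply/funext => w /=; rewrite opprB addrC.
by apply=> c; have [g1 g2 _ _] := @unit_grid_itv R c; apply/andP; split; lra.
Qed.

(** If level [m + 1] is not escaped, then [Z] is at most [(m + 1) ^+ 2] at a point that beats the
    origin; the 1 added to the radius makes this incompatible with the failure of [near_event]. *)
Definition cell_event (k : R) : set T :=
  layer_cover (fun m => if m is 0%N then setT else escape k m)
              (fun m => near_event k ((m%:R + 1) ^+ 2 + 1)).

Lemma cell_event_path k w x y : cell k x -> F w 0 0 <= F w x y -> cell_event k w.
Proof.
move=> kx hF; apply: contrapT => /layer_coverP[//|m [nE nN]].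
have [h _ _] := escape_path nE kx hF; have := near_event_path kx nN.
by rewrite -natr1 in h; lra.
Qed.

Let mL k r : measurable (landscape_escape L k r).
Proof.
apply: (process_sigma_measurable _ (landscape_escape_sigma k r)) => p R4p.
by apply: (landscape_measurable LL).
Qed.

Let mB k r : measurable (brownian_escape B k r).
Proof.
by apply: (process_sigma_measurable _ (brownian_escape_sigma k r)) => t _; exact: brownian_measurable BB t.
Qed.

Lemma escape_measurable k r : measurable (escape k r).
Proof. by apply: measurableU; [exact: mL|exact: mB]. Qed.

Lemma near_event_measurable k r : measurable (near_event k r).
Proof.
by apply: (process_sigma_measurable _ (near_event_sigma k r)) => t _; exact: bessel_measurable ZZ.
Qed.

Lemma cell_event_measurable k : measurable (cell_event k).
Proof.
have mO m : measurable (if m is 0%N then setT else escape k m) by case: m => // m; exact: escape_measurable.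
apply: measurableU; last exact: bigcapT_measurable.
by apply: bigcupT_measurable => m; apply: measurableI => //; exact: near_event_measurable.
Qed.

Hypothesis ind : indep3 P (process_sigma setT B) (process_sigma setT Z)
        (process_sigma R4up (fun p w => L w p)).
Variables K ka : R.
Hypothesis K1 : 1 <= K.
Hypothesis ka0 : 0 < ka.
Hypothesis landscape_rate : forall k r,
  (P (landscape_escape L k r) <= (K * expR (- (ka * r%:R ^+ 3)))%:E)%E.
Hypothesis brownian_rate : forall k r,
  (P (brownian_escape B k r) <= (K * expR (- (ka * r%:R ^+ 3)))%:E)%E.

Let K0 : 0 <= K. Proof. exact: le_trans K1. Qed.

Lemma escape_bound k r : (P (escape k r) <= (2 * K * expR (- (ka * r%:R ^+ 3)))%:E)%E.
Proof.
apply: le_trans (measureU2 _ _ _) _; [exact: mL|exact: mB|].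
by apply: le_trans (leeD (landscape_rate k r) (brownian_rate k r)) _; rewrite -EFinD lee_fin; lra.
Qed.

(** [Z] is independent of [L] and of [B], so the two parts of the escape event are multiplied
    separately. *)
Lemma escape_near_bound k r s b : 0 <= b -> (P (near_event k s) <= b%:E)%E ->
  (P (escape k r `&` near_event k s) <= (2 * K * expR (- (ka * r%:R ^+ 3)) * b)%:E)%E.
Proof.
move=> b0 hb; have mN := near_event_measurable k s.
rewrite /escape setIUl; apply: le_trans (measureU2 _ _ _) _; [by apply: measurableI => //; exact: mL|by apply: measurableI => //; exact: mB|].
have e1 := ind (@process_sigmaT _ _ _ _ setT B) (near_event_sigma k s) (landscape_escape_sigma k r).
rewrite setTI probability_setT mul1e setIC in e1.
have e2 := ind (brownian_escape_sigma k r) (near_event_sigma k s)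
  (@process_sigmaT _ _ _ _ R4up (fun p w => L w p)).
rewrite setIT probability_setT mule1 in e2.
have h1 : (P (landscape_escape L k r `&` near_event k s) <= b%:E * (K * expR (- (ka * r%:R ^+ 3)))%:E)%E.
  by rewrite e1; exact: lee_pmul.
have h2 : (P (brownian_escape B k r `&` near_event k s) <= (K * expR (- (ka * r%:R ^+ 3)))%:E * b%:E)%E.
  by rewrite e2; exact: lee_pmul.
by apply: le_trans (leeD h1 h2) _; rewrite -!EFinM -EFinD lee_fin le_eqVlt; apply/orP; left; apply/eqP; ring.
Qed.

(** Crude absorption of a polynomial: the cube in [layer_constant_bound] is at most [27 * 64 ^ m],
    then [64 * 2 <= expR 7] and [7 * m <= ka * m ^+ 3 + 25 / ka + 5]. *)
Definition layer_constant : R := 27 * expR (25 / ka + 5).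

Lemma layer_constant_bound (m : nat) :
  expR (- (ka * m%:R ^+ 3)) <= layer_constant * 2^-1 ^+ m /\
  expR (- (ka * m%:R ^+ 3)) * (1 + ((m%:R + 1) ^+ 2 + 1)) ^+ 3 <= layer_constant * 2^-1 ^+ m.
Proof.
have e0 := expR_ge0 (- (ka * m%:R ^+ 3)).
have h : expR (- (ka * m%:R ^+ 3)) * (1 + ((m%:R + 1) ^+ 2 + 1)) ^+ 3 <= layer_constant * 2^-1 ^+ m; last first.
  split=> //; apply: le_trans h; rewrite -[leLHS]mulr1 ler_wpM2l//.
  by rewrite exprn_ege1//; have := sqr_ge0 (m%:R + 1 : R); lra.
have m2 : m%:R + 1 <= 2 ^+ m :> R by rewrite natr1 -natrX ler_nat ltn_expl.
have p4 : (4 : R) ^+ m = 2 ^+ m * 2 ^+ m by rewrite -exprMn; congr (_ ^+ _); lra.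
have p41 : 1 <= 4 ^+ m :> R by rewrite exprn_ege1// ler1n.
have h1 : 1 + ((m%:R + 1) ^+ 2 + 1) <= 3 * 4 ^+ m :> R.
  have : (m%:R + 1) ^+ 2 <= 4 ^+ m :> R by rewrite p4 expr2 ler_pM// addr_ge0.
  lra.
have h2 : (1 + ((m%:R + 1) ^+ 2 + 1)) ^+ 3 <= 27 * 64 ^+ m :> R.
  rewrite (_ : 27 * 64 ^+ m = (3 * 4 ^+ m) ^+ 3); last first.
    by rewrite exprMn -exprM mulnC exprM; congr (_ * _ ^+ _); ring.
  by rewrite lerXn2r ?nnegrE// ?mulr_ge0 ?exprn_ge0//; have := sqr_ge0 (m%:R + 1 : R); lra.
have p2 : (0 : R) < 2 ^+ m by rewrite exprn_gt0.
rewrite exprVn ler_pdivlMr//.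
apply: (@le_trans _ _ (expR (- (ka * m%:R ^+ 3)) * (27 * 64 ^+ m) * 2 ^+ m)).
  by rewrite ler_wpM2r ?(ltW p2)// ler_wpM2l.
rewrite -mulrA -[X in _ * X]mulrA -exprMn /layer_constant mulrCA ler_wpM2l//.
have f4 : (4 : R) <= expR 2 by have := @expR_ge_quadratic R 2; rewrite ler0n => /(_ isT); rewrite expr2; lra.
have f2 : (2 : R) <= expR 1 by have := @expR_ge_quadratic R 1; rewrite ler01 => /(_ isT); rewrite expr2; lra.
have f128 : 64 * 2 <= expR 7 :> R.
  have -> : expR 7 = expR 2 * expR 2 * expR 2 * expR 1 :> R by rewrite -!expRD; congr expR; ring.
  have e41 : 4 * 4 <= expR 2 * expR 2 :> R by rewrite ler_pM.
  have e42 : 4 * 4 * 4 <= expR 2 * expR 2 * expR 2 :> R by rewrite ler_pM// mulr_ge0.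
  have : 4 * 4 * 4 * 2 <= expR 2 * expR 2 * expR 2 * expR 1 :> R by rewrite ler_pM// !mulr_ge0.
  lra.
apply: (@le_trans _ _ (expR (- (ka * m%:R ^+ 3)) * expR 7 ^+ m)).
  by rewrite ler_wpM2l// lerXn2r ?nnegrE ?expR_ge0.
rewrite -expRM_natl -expRD ler_expR.
have m0 : (0 : R) <= m%:R by []. set x := m%:R : R in m0 *.
have [hx|hx] := leP 7 (ka * x ^+ 2).
  have : 7 * x <= ka * x ^+ 2 * x by rewrite ler_wpM2r.
  have : 0 <= 25 / ka by rewrite divr_ge0// ltW.
  by rewrite (_ : ka * x ^+ 2 * x = ka * x ^+ 3); [lra|ring].
have : x ^+ 2 < 7 / ka by rewrite ltr_pdivlMr// mulrC.
have : 0 <= ka * x ^+ 3 by rewrite mulr_ge0 ?exprn_ge0// ltW.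
have : 0 < ka^-1 by rewrite invr_gt0.
have := sqr_ge0 (x - 1); rewrite sqrrB1; lra.
Qed.

Definition cell_constant : R := 2 * (2 * K * layer_constant * bessel_constant).

Let bessel_constant_ge0 : 0 <= bessel_constant :> R.
Proof.
have oc : 0 <= oscillation_constant :> R by have := @oscillation_constant_ge1 R; lra.
by rewrite exprn_ge0// /low_cell_constant !mulr_ge0 ?expR_ge0.
Qed.

Let layer_constant_ge0 : 0 <= layer_constant.
Proof. by rewrite /layer_constant mulr_ge0 ?expR_ge0. Qed.

Lemma cell_constant_ge0 : 0 <= cell_constant.
Proof.
rewrite /cell_constant; apply: mulr_ge0 => //; apply: mulr_ge0 => //; apply: mulr_ge0 => //.
exact: mulr_ge0.
Qed.

Lemma cell_event_bound k s : 0 < s ->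
  (forall r, 0 <= r -> (P (near_event k r) <= (bessel_constant * ((1 + r) / s) ^+ 3)%:E)%E) ->
  (P (cell_event k) <= (cell_constant / s ^+ 3)%:E)%E.
Proof.
move=> s0 hN.
have si0 : 0 <= (s ^+ 3)^-1 by rewrite invr_ge0 exprn_ge0// ltW.
have b0 : 0 <= 2 * K * layer_constant * bessel_constant / s ^+ 3.
  by apply: mulr_ge0 => //; apply: mulr_ge0 => //; apply: mulr_ge0 => //; exact: mulr_ge0.
rewrite /cell_constant -[X in X%:E]mulrA.
have lvl m : 0 <= (m%:R + 1) ^+ 2 + 1 :> R by rewrite addr_ge0// sqr_ge0.
have fin (m : nat) : 2 * K * expR (- (ka * m%:R ^+ 3)) * (bessel_constant * ((1 + ((m%:R + 1) ^+ 2 + 1)) / s) ^+ 3) <=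
    2 * K * layer_constant * bessel_constant / s ^+ 3 * 2^-1 ^+ m.
  have [_ h] := layer_constant_bound m.
  rewrite [leLHS](_ : _ = 2 * K * bessel_constant / s ^+ 3 * (expR (- (ka * m%:R ^+ 3)) * (1 + ((m%:R + 1) ^+ 2 + 1)) ^+ 3)); last first.
    by rewrite expr_div_n; ring.
  rewrite [leRHS](_ : _ = 2 * K * bessel_constant / s ^+ 3 * (layer_constant * 2^-1 ^+ m)); last by ring.
  rewrite ler_wpM2l//; apply: mulr_ge0 => //; apply: mulr_ge0 => //; exact: mulr_ge0.
have nb m : 0 <= bessel_constant * ((1 + ((m%:R + 1) ^+ 2 + 1)) / s) ^+ 3 :> R.
  by rewrite mulr_ge0// exprn_ge0// divr_ge0 ?(ltW s0)// addr_ge0.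
apply: (@layer_cover_bound _ _ _ _ _ _ _ (2 * K * layer_constant)) => // m.
- by case: m => [|m]; [exact: measurableT|exact: escape_measurable].
- exact: near_event_measurable.
- have hb := hN _ (lvl m); have nbm := nb m; have fm := fin m; rewrite -lee_fin in fm; apply: (le_trans _ fm).
  case: m hb nbm {fm} => [|m] hb nbm; last exact: escape_near_bound.
  rewrite setTI; apply: le_trans hb _; rewrite lee_fin (_ : ka * 0%:R ^+ 3 = 0) ?oppr0 ?expR0 ?mulr1; last by rewrite expr0n mulr0.
  by rewrite ler_peMl//; have := K1; lra.
- have [h _] := layer_constant_bound m.
  apply: (@le_trans _ _ ((2 * K * expR (- (ka * m%:R ^+ 3)))%:E)); last first.
    by rewrite lee_fin -[leRHS]mulrA ler_wpM2l// mulr_ge0.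
  case: m {h} => [|m]; last exact: escape_bound.
  rewrite expr0n/= mulr0 oppr0 expR0 mulr1; apply: le_trans (probability_le1 _ _) _ => //.
  by rewrite lee_fin; have := K1; lra.
Qed.

Lemma cell_event_pair_bound (i : nat) : (0 < i)%N ->
  (P (cell_event i%:R `|` cell_event (- i.+1%:R)) <= (2 * cell_constant / (Num.sqrt i%:R) ^+ 3)%:E)%E.
Proof.
move=> i0; have iR : (0 : R) < i%:R by rewrite ltr0n.
have s0 : 0 < Num.sqrt i%:R :> R by rewrite sqrtr_gt0.
apply: le_trans (measureU2 _ _ _) _; [exact: cell_event_measurable|exact: cell_event_measurable|].
apply: le_trans (leeD (cell_event_bound s0 _) (cell_event_bound s0 _)) _ => [r r0|r r0|].
- by have [] := near_event_bound iR r0.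
- by have [_] := near_event_bound iR r0; rewrite natr1.
- by rewrite -EFinD lee_fin; lra.
Qed.

Definition far_event (N : nat) : set T :=
  \bigcup_n (cell_event (N + n)%:R `|` cell_event (- (N + n).+1%:R)).

Lemma far_event_measurable N : measurable (far_event N).
Proof. by apply: bigcupT_measurable => n; apply: measurableU; exact: cell_event_measurable. Qed.

Lemma far_event_path N w x y : ~ far_event N w -> F w 0 0 <= F w x y -> `|x| < N%:R.
Proof.
move=> nF hF; rewrite ltNge; apply/negP => Nx; apply: nF.
have [i [/andP[_ ix] hc]] := cell_exists x.
have Ni : (N <= i)%N by rewrite -ltnS -(ltr_nat R); exact: le_lt_trans Nx ix.
exists (i - N)%N => //; rewrite subnKC//.
by case: hc => hc; [left|right]; exact: cell_event_path hc hF.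
Qed.

Definition far_constant : R := 8 * cell_constant.

(** The cells at distance [i] contribute the power -3/2 of [i], from the cube in the small-ball
    bound. With [s] and [t] the square roots of [i] and [i + 1], the sum telescopes through
    [(4 * s ^+ 3)^-1 <= s^-1 - t^-1]; the 8 in [far_constant] is 2 cells times this 4. *)
Lemma far_event_bound N : (0 < N)%N -> (P (far_event N) <= (far_constant / Num.sqrt N%:R)%:E)%E.
Proof.
move=> N0; have c0 := cell_constant_ge0.
have := @probability_union_telescope _ _ _ P _ (fun n => far_constant / Num.sqrt (N + n)%:R)
  (fun n => measurableU _ _ (cell_event_measurable (N + n)%:R) (cell_event_measurable (- (N + n).+1%:R))).
rewrite addn0; apply=> n; first by rewrite divr_ge0// mulr_ge0.
have i0 : (0 < N + n)%N by rewrite addn_gt0 N0.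
apply: le_trans (cell_event_pair_bound i0) _; rewrite lee_fin addnS /far_constant.
set i := (N + n)%N in i0 *; set s := Num.sqrt i%:R; set t := Num.sqrt i.+1%:R.
have s1 : 1 <= s by rewrite -[leLHS]sqrtr1 ler_sqrt// ler1n.
have t0 : 0 < t by rewrite sqrtr_gt0.
have s2 : s ^+ 2 = i%:R by rewrite sqr_sqrtr.
have t2 : t ^+ 2 = s ^+ 2 + 1 by rewrite s2 sqr_sqrtr// natr1.
have st : s <= t by rewrite -(@ler_pXn2r _ 2) ?nnegrE// ?t2; lra.
have ts : t <= 3 / 2 * s.
  rewrite -(@ler_pXn2r _ 2) ?nnegrE ?(ltW t0)//; last by lra.
  by rewrite ?exprMn t2 !expr2; nra.
have h : (4 * s ^+ 3)^-1 <= s^-1 - t^-1.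
  have -> : s^-1 - t^-1 = (s * t * (s + t))^-1.
    have : t ^+ 2 - s ^+ 2 = 1 by lra.
    have -> : t ^+ 2 - s ^+ 2 = (t - s) * (s + t) by ring.
    move=> e; have snz : s != 0 by rewrite gt_eqF//; lra.
    have tnz : t != 0 by rewrite gt_eqF.
    have stnz : s + t != 0 by rewrite gt_eqF//; lra.
    have -> : s^-1 - t^-1 = (t - s) * (s + t) / (s * t * (s + t)) by field; rewrite snz tnz stnz.
    by rewrite e mul1r.
  rewrite lef_pV2 ?posrE; last 2 first.
  - by rewrite mulr_gt0// exprn_gt0//; lra.
  - by rewrite mulr_gt0 ?mulr_gt0//; lra.
  rewrite (_ : 4 * s ^+ 3 = s * (4 * s ^+ 2)); last by ring.
  rewrite -mulrA ler_wpM2l//; first lra.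
  by rewrite expr2; nra.
have -> : 2 * cell_constant / s ^+ 3 = 8 * cell_constant * (4 * s ^+ 3)^-1.
  by field; rewrite gt_eqF//; lra.
by rewrite -mulrBr ler_wpM2l// mulr_ge0.
Qed.

(** The estimate obtained is of order [1 / sqrt t]; as [ln t >= 1 / 2], the logarithm only enlarges
    it, and the summand 1 makes the inequality strict. *)
Lemma tail_bound (X Y : T -> R) t : measurable_fun setT X -> 2 <= t ->
  {ae P, forall w, is_maximizer (F w) (X w) (Y w)} ->
  (P [set w | (t < `|X w|)%R] < ((24 * far_constant + 1) * (ln t / Num.sqrt t))%:E)%E.
Proof.
move=> mX t2 [N0 [mN0 PN0 hN0]]; have c0 : 0 <= far_constant by rewrite mulr_ge0 ?cell_constant_ge0.
have /andP[n1 n2] : (Num.truncn t)%:R <= t < (Num.truncn t).+1%:R by apply: truncn_itv; lra.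
set N := Num.truncn t in n1 n2; rewrite -natr1 in n2.
have NR : t / 2 <= N%:R by lra.
have NR0 : 0 < N%:R :> R by lra.
have st0 : 0 < Num.sqrt t by rewrite sqrtr_gt0; lra.
apply: (@le_lt_trans _ _ (P (far_event N `|` N0))).
  apply: le_measure; rewrite ?inE.
  - by apply: measurable_lt_event => //; exact: measurableT_comp.
  - by apply: measurableU => //; exact: far_event_measurable.
  move=> w /= tX; have [hw|hw] := pselect (is_maximizer (F w) (X w) (Y w)); last by right; exact: hN0.
  left; apply: contrapT => nF; have := far_event_path nF (hw 0 0); lra.
apply: (@le_lt_trans _ _ (far_constant / Num.sqrt N%:R)%:E).
  apply: le_trans (measureU2 _ _ _) _ => //; first exact: far_event_measurable.
  by rewrite [X in (_ + X)%E]PN0 adde0; apply: far_event_bound; rewrite -(ltr0n R).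
rewrite lte_fin mulrA ltr_pdivlMr//.
have sN : Num.sqrt t <= 2 * Num.sqrt N%:R.
  rewrite -[X in X * _](_ : Num.sqrt 4 = 2 :> R); last first.
    by rewrite (_ : 4 = 2 ^+ 2 :> R) ?sqrtr_sqr ?ger0_norm//; ring.
  by rewrite -sqrtrM// ler_sqrt ?mulr_ge0//; lra.
have sN0 : 0 < Num.sqrt N%:R :> R by rewrite sqrtr_gt0.
have l2 : 1 / 2 <= ln t.
  rewrite -ler_expR lnK ?posrE; last lra.
  apply: le_trans t2; rewrite -[1 / 2]opprK expRN -[leRHS]invrK lef_pV2 ?posrE ?expR_gt0 ?invr_gt0//.
  by have := expR_ge1Dx (- (1 / 2) : R); lra.
have h1 := ler_wpM2l c0 sN.
have h2 : far_constant / Num.sqrt N%:R * Num.sqrt t <= 2 * far_constant.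
  by rewrite mulrAC ler_pdivrMr//; lra.
have h3 : (24 * far_constant + 1) * (1 / 2) <= (24 * far_constant + 1) * ln t by rewrite ler_wpM2l//; lra.
lra.
Qed.

(** A balance: the far event then has probability of order [expR (- ka * r ^+ 3 / 4)], while the
    cells within the radius number about [expR (ka * r ^+ 3 / 2)] and each escapes with probability
    of order [expR (- ka * r ^+ 3)]. *)
Definition confine_radius (r : nat) : nat := (Num.truncn (expR (ka * r%:R ^+ 3 / 2))).+1.

Definition confine_event (r : nat) : set T := far_event (confine_radius r) `|`
  \bigcup_(i in [set i | (i < confine_radius r)%N]) (escape i%:R r `|` escape (- i.+1%:R) r).

Lemma confine_event_measurable r : measurable (confine_event r).
Proof.
apply: measurableU; first exact: far_event_measurable.
by apply: bigcup_measurable => i _; apply: measurableU; exact: escape_measurable.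
Qed.

Lemma confine_event_path r w x y : ~ confine_event r w -> F w 0 0 <= F w x y ->
  [/\ `|x| < (confine_radius r)%:R, `|y - x| <= 4 * r%:R + 1 &
      `|unit_landscape L w (x, y)| <= 2 * r%:R ^+ 2].
Proof.
move=> /not_orP[nF nE] hF; have xN := far_event_path nF hF.
have [i [/andP[ix _] hc]] := cell_exists x.
have iN : (i < confine_radius r)%N by rewrite -(ltr_nat R); exact: le_lt_trans xN.
by case: hc => hc; have [|_ h1 h2] := escape_path (r := r) _ hc hF; rewrite ?xN ?h1 ?h2// => h;
  apply: nE; exists i => //; [left|right].
Qed.

Definition confine_constant : R := far_constant + 8 * K.

Lemma confine_event_bound r :
  (P (confine_event r) <= (confine_constant * expR (- (ka / 4 * r%:R ^+ 3)))%:E)%E.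
Proof.
have c0 : 0 <= far_constant by rewrite mulr_ge0 ?cell_constant_ge0.
set e := expR (- (ka / 4 * r%:R ^+ 3)); have e0 : 0 < e by exact: expR_gt0.
pose E := expR (ka * r%:R ^+ 3 / 2).
have r3 : 0 <= ka * r%:R ^+ 3 by rewrite mulr_ge0 ?exprn_ge0// ltW.
have E1 : 1 <= E by rewrite -[leLHS]expR0 ler_expR; lra.
have E0 : 0 <= E by lra.
have e1 : e <= 1 by rewrite -[leRHS]expR0 ler_expR; lra.
have Ee : E * e ^+ 2 = 1.
  by rewrite -expRM_natl -expRD -[RHS]expR0; congr expR; field.
have eE2 : expR (- (ka * r%:R ^+ 3)) = e ^+ 2 * e ^+ 2.
  by rewrite -expRM_natl -expRD; congr expR; field.
have /andP[n1 n2] := truncn_itv E0.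
set N := confine_radius r; have N1 : E <= N%:R by exact: ltW.
have N2 : N%:R <= 2 * E by rewrite /N /confine_radius -natr1 -/E; lra.
apply: le_trans (measureU2 _ _ _) _; first exact: far_event_measurable.
  by apply: bigcup_measurable => i _; apply: measurableU; exact: escape_measurable.
rewrite /confine_constant mulrDl EFinD; apply: leeD.
  apply: le_trans (far_event_bound _) _ => //; rewrite lee_fin ler_wpM2l//.
  have ei : e^-1 <= Num.sqrt N%:R.
    rewrite -[e^-1]gtr0_norm ?invr_gt0// -sqrtr_sqr ler_sqrt//; apply: le_trans N1.
    by rewrite exprVn -div1r ler_pdivrMr ?exprn_gt0// Ee.
  rewrite -[e]invrK lef_pV2 ?posrE ?invr_gt0// sqrtr_gt0; lra.
have mE n : measurable (escape n%:R r `|` escape (- n.+1%:R) r).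
  by apply: measurableU; exact: escape_measurable.
apply: le_trans (probability_union_ord (b := 4 * K * expR (- (ka * r%:R ^+ 3))) _ mE _) _ => [n|].
  apply: le_trans (measureU2 _ _ _) _; [exact: escape_measurable|exact: escape_measurable|].
  by apply: le_trans (leeD (escape_bound _ _) (escape_bound _ _)) _; rewrite -EFinD lee_fin; lra.
rewrite lee_fin eE2; apply: (@le_trans _ _ (2 * E * (4 * K * (e ^+ 2 * e ^+ 2)))).
  rewrite ler_wpM2r//; apply: mulr_ge0; first exact: mulr_ge0.
  by apply: mulr_ge0; exact: sqr_ge0.
rewrite (_ : 2 * E * _ = 8 * K * (E * e ^+ 2) * e ^+ 2); last by ring.
by rewrite Ee mulr1 ler_wpM2l ?mulr_ge0// expr2 ler_piMr// ltW.
Qed.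

Lemma confine_event_null : P (\bigcap_r confine_event r) = 0%E.
Proof.
have q1 : expR (- (ka / 4)) < 1 by rewrite -[ltRHS]expR0 ltr_expR oppr_lt0 divr_gt0.
apply: (probability_le0 (b := confine_constant) (expR_ge0 _) q1) => n.
apply: (@le_trans _ _ (P (confine_event n))).
  apply: le_measure; rewrite ?inE; last by move=> w; exact.
    by apply: bigcapT_measurable => r; exact: confine_event_measurable.
  exact: confine_event_measurable.
apply: le_trans (confine_event_bound n) _; rewrite lee_fin ler_wpM2l//.
  by rewrite addr_ge0// mulr_ge0// cell_constant_ge0.
rewrite -expRM_natl ler_expR.
have n3 : n%:R <= n%:R ^+ 3 :> R.
  by rewrite -natrX ler_nat; case: n => // n; rewrite -[X in (X <= _)%N]expn1 leq_pexp2l.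
have : ka / 4 * n%:R <= ka / 4 * n%:R ^+ 3 by rewrite ler_wpM2l// divr_ge0// ltW.
lra.
Qed.

(** All points that beat the origin lie in one square, so the maximum over this compact square is
    global. *)
Lemma maximizer_exists_path r w : ~ confine_event r w -> exists x y, is_maximizer (F w) x y.
Proof.
move=> nC; pose M : R := (confine_radius r)%:R + 4 * r%:R + 1.
have M0 : 0 <= M by rewrite !addr_ge0// mulr_ge0.
pose A := `[- M, M]%classic `*` `[- M, M]%classic : set (R * R).
have AE z : A z <-> - M <= z.1 <= M /\ - M <= z.2 <= M by rewrite /A /= !in_itv.
have A0 : A (0, 0) by apply/AE; rewrite /= !oppr_le0 M0.
have cA : compact A by apply: compact_setX; exact: segment_compact.
have [c cAc cmax] := @compact_EVT_max _ R (fun z => F w z.1 z.2) A (ex_intro _ _ A0) cA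
  (continuous_subspaceT (@sum_continuous w)).
exists c.1, c.2 => x y.
have h00 := cmax (0, 0) (mem_set A0).
have [h|h] := leP (F w x y) (F w 0 0); first exact: le_trans h h00.
have [h1 h2 _] := confine_event_path nC (ltW h).
apply: (cmax (x, y)); apply/mem_set/AE => /=.
move: h1 h2; rewrite ltr_norml ler_norml => /andP[h1 h1'] /andP[h2 h2'].
have : (0 : R) <= r%:R by [].
rewrite /M; split; apply/andP; split; lra.
Qed.

Lemma maximizer_exists : {ae P, forall w, exists x y, is_maximizer (F w) x y}.
Proof.
exists (\bigcap_r confine_event r); split; last 2 first.
- exact: confine_event_null.
- move=> w nM r _; apply: contrapT => nC; apply: nM; exact: maximizer_exists_path nC.
by apply: bigcapT_measurable => r; exact: confine_event_measurable.
Qed.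

(** The rate [k / (16 * c)] of [expectation_expR_layers], with [k = ka / 4] from
    [confine_event_bound] and [c = 125] from [4 * r + 1 <= 5 * r]. *)
Definition moment_rate : R := ka / 4 / (16 * 125).

Lemma moment_bound (X Y : T -> R) : {ae P, forall w, is_maximizer (F w) (X w) (Y w)} ->
  (\int[P]_w (expR (moment_rate * `|Y w - X w| ^+ 3))%:E < +oo)%E /\
  (\int[P]_w (expR (moment_rate * `|L w (X w, 0, Y w, 1)| `^ (3 / 2)))%:E < +oo)%E.
Proof.
move=> [N0 [mN0 PN0 hN0]]; have cc0 : 0 <= confine_constant.
  by rewrite addr_ge0// mulr_ge0// cell_constant_ge0.
have ka4 : 0 < ka / 4 by rewrite divr_gt0.
have mE n : measurable (confine_event n `|` N0) by apply: measurableU => //; exact: confine_event_measurable.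
have PE n : (P (confine_event n `|` N0) <= (confine_constant * expR (- (ka / 4 * n%:R ^+ 3)))%:E)%E.
  apply: le_trans (measureU2 _ _ _) _ => //; first exact: confine_event_measurable.
  by rewrite [X in (_ + X)%E]PN0 adde0; exact: confine_event_bound.
have hE w n : (0 < n)%N -> ~ (confine_event n `|` N0) w ->
    `|Y w - X w| <= 5 * n%:R /\ `|L w (X w, 0, Y w, 1)| <= (2 * n%:R) ^+ 2.
  move=> n0 /not_orP[nC nN].
  have hw : is_maximizer (F w) (X w) (Y w) by apply: contrapT => h; apply: nN; exact: hN0.
  have [_ h1 h2] := confine_event_path nC (hw 0 0).
  have : (1 : R) <= n%:R by rewrite ler1n.
  split; first lra.
  by apply: le_trans h2 _; rewrite exprMn; have := sqr_ge0 (n%:R : R); lra.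
split; apply: (expectation_expR_layers _ cc0 ka4 mE PE) => // w n n0 nE; have [h1 h2] := hE w n n0 nE.
  apply: le_trans (_ : (5 * n%:R) ^+ 3 <= _); first by rewrite lerXn2r ?nnegrE ?mulr_ge0.
  by rewrite exprMn; lra.
apply: (@le_trans _ _ (((2 * n%:R) ^+ 2) `^ (3 / 2))).
  by apply: ge0_ler_powR; rewrite ?nnegrE ?sqr_ge0//; lra.
rewrite -powR_mulrn ?mulr_ge0// -powRrM (_ : 2%:R * (3 / 2) = 3%:R :> R); last by field.
rewrite powR_mulrn ?mulr_ge0// exprMn ler_wpM2r ?exprn_ge0//.
by rewrite !exprS expr0; lra.
Qed.
End confinement.

(** * Uniqueness of the maximizer *)

Section same_sup.
Context {R : realType}.

(* Equality of two suprema, in a form that stays measurable for parametrised sequences. *)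
Definition same_sup (u v : nat -> R) : Prop :=
  (forall c n, exists c', u c < v c' + n.+1%:R^-1) /\
  (forall c n, exists c', v c < u c' + n.+1%:R^-1).

Lemma same_supC u v : same_sup u v -> same_sup v u.
Proof. by case. Qed.

Lemma same_sup_le u v b : same_sup u v -> (forall c, v c <= b) -> forall c, u c <= b.
Proof.
move=> [h _] vb c; rewrite leNgt; apply/negP => bu.
have := ltr_add_invr bu => -[n hn].
have [c' hc] := h c n; have := vb c'; move: hn hc; move: (n.+1%:R^-1) => e; lra.
Qed.

Lemma same_sup_attained u v (M : R) : (forall c, u c <= M) -> (forall c, v c <= M) ->
  (forall b, (forall c, u c <= b) -> M <= b) -> (forall b, (forall c, v c <= b) -> M <= b) ->
  same_sup u v.
Proof.
have half (u' v' : nat -> R) : (forall c, u' c <= M) -> (forall b, (forall c, v' c <= b) -> M <= b) ->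
    forall c n, exists c', u' c < v' c' + n.+1%:R^-1.
  move=> uM vM c n; apply: contrapT => /forallNP h.
  have i0 : 0 < n.+1%:R^-1 :> R by rewrite invr_gt0.
  have : M <= M - n.+1%:R^-1; last by move: (n.+1%:R^-1) i0 => e; lra.
  apply: vM => c'; rewrite leNgt; apply/negP => h'; apply: (h c').
  have := uM c; move: (n.+1%:R^-1) i0 h' => e; lra.
by move=> h1 h2 h3 h4; split; apply: half.
Qed.

Lemma measurable_same_sup d (T : measurableType d) (U V : nat -> T -> R) :
  (forall c, measurable_fun setT (U c)) -> (forall c, measurable_fun setT (V c)) ->
  measurable [set w | same_sup (fun c => U c w) (fun c => V c w)].
Proof.
have half (U' V' : nat -> T -> R) : (forall c, measurable_fun setT (U' c)) ->
    (forall c, measurable_fun setT (V' c)) ->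
    measurable [set w | forall c n, exists c', U' c w < V' c' w + n.+1%:R^-1].
  move=> mU mV; rewrite (_ : [set w | _] =
      \bigcap_c \bigcap_n \bigcup_c' [set w | U' c w < V' c' w + n.+1%:R^-1]).
    apply: bigcapT_measurable => c; apply: bigcapT_measurable => n; apply: bigcupT_measurable => c'.
    by apply: measurable_lt_event => //; exact: measurable_funD.
  apply/seteqP; split => w /= h; first by move=> c _ n _; have [c' ?] := h c n; exists c'.
  by move=> c n; have [c' _ ?] := h c I n I; exists c'.
by move=> mU mV; apply: measurableI; exact: half.
Qed.

Definition segment_point (p l : R) (c : nat) : R := p + l * (unit_grid c).1.

Lemma segment_point_itv p l c : 0 <= l -> p <= segment_point p l c <= p + l.
Proof.
move=> l0; have [g1 g2 _ _] := @unit_grid_itv R c; rewrite /segment_point lerDl lerD2l.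
by rewrite mulr_ge0// ler_piMr.
Qed.

Lemma segment_dense (f : R -> R) (p l b x : R) : 0 < l -> continuous f ->
  (forall c, f (segment_point p l c) <= b) -> p <= x <= p + l -> f x <= b.
Proof.
move=> l0 cf fb /andP[x1 x2].
have cg : continuous (fun z : R * R => f (p + l * z.1)).
  move=> z; apply: (cvg_comp (fun z : R * R => p + l * z.1) f); last exact: cf.
  by apply: cvgD; [exact: cvg_cst|apply: cvgM; [exact: cvg_cst|exact: cvg_fst]].
have := @unit_grid_dense R _ b ((x - p) / l, 0) cg fb.
rewrite /= mulrCA divff ?gt_eqF// mulr1 subrKC; apply; last by rewrite lexx ler01.
by rewrite divr_ge0 ?subr_ge0 ?(ltW l0)//= ler_pdivrMr// mul1r lerBlDl.
Qed.

Lemma segment_max (f : R -> R) (p l : R) : 0 < l -> continuous f ->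
  exists2 x, p <= x <= p + l & forall y, p <= y <= p + l -> f y <= f x.
Proof.
move=> l0 cf; have pl : p <= p + l by rewrite lerDl ltW.
have [x xI hx] := EVT_max pl (continuous_subspaceT cf).
by exists x => [|y hy]; [move: xI; rewrite in_itv|apply: hx; rewrite in_itv].
Qed.

(* The box [(p, q, l)] is [p, p + l] x [q, q + l]. *)
Definition in_box (A : R * R * R) (z : R * R) : Prop :=
  A.1.1 <= z.1 <= A.1.1 + A.2 /\ A.1.2 <= z.2 <= A.1.2 + A.2.

Definition box_point (A : R * R * R) (c : nat) : R * R :=
  (A.1.1 + A.2 * (unit_grid c).1, A.1.2 + A.2 * (unit_grid c).2).

Lemma box_point_in A c : 0 <= A.2 -> in_box A (box_point A c).
Proof.
move=> l0; have [g1 g2 g3 g4] := @unit_grid_itv R c; rewrite /in_box /box_point /= !lerDl !lerD2l.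
by rewrite !mulr_ge0// !ler_piMr.
Qed.

Lemma box_dense (f : R * R -> R) A b z : 0 < A.2 -> continuous f ->
  (forall c, f (box_point A c) <= b) -> in_box A z -> f z <= b.
Proof.
case: A => [[p q] l] /= l0 cf fb [/= /andP[x1 x2] /andP[y1 y2]].
have cg : continuous (fun z : R * R => f (p + l * z.1, q + l * z.2)).
  move=> t; apply: (cvg_comp (fun z : R * R => (p + l * z.1, q + l * z.2)) f); last exact: cf.
  have c1 : p + l * z.1 @[z --> t] --> p + l * t.1.
    by apply: cvgD; [exact: cvg_cst|apply: cvgM; [exact: cvg_cst|exact: cvg_fst]].
  have c2 : q + l * z.2 @[z --> t] --> q + l * t.2.
    by apply: cvgD; [exact: cvg_cst|apply: cvgM; [exact: cvg_cst|exact: cvg_snd]].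
  exact: (cvg_pair c1 c2).
have := @unit_grid_dense R _ b ((z.1 - p) / l, (z.2 - q) / l) cg fb.
rewrite /= !(mulrCA l) divff ?gt_eqF// !mulr1 !subrKC -surjective_pairing; apply.
  by rewrite divr_ge0 ?subr_ge0 ?(ltW l0)//= ler_pdivrMr// mul1r lerBlDl.
by rewrite divr_ge0 ?subr_ge0 ?(ltW l0)//= ler_pdivrMr// mul1r lerBlDl.
Qed.

Lemma box_max (f : R * R -> R) A : 0 < A.2 -> continuous f ->
  exists2 z, in_box A z & forall z', in_box A z' -> f z' <= f z.
Proof.
case: A => [[p q] l] /= l0 cf.
pose S := `[p, p + l]%classic `*` `[q, q + l]%classic : set (R * R).
have SE z : S z <-> in_box (p, q, l) z by rewrite /S /in_box /= !in_itv.
have S0 : S (p, q) by apply/SE; rewrite /in_box/= !lexx !lerDl (ltW l0).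
have cS : compact S by apply: compact_setX; exact: segment_compact.
have [z zS hz] := @compact_EVT_max _ R f S (ex_intro _ _ S0) cS (continuous_subspaceT cf).
by exists z => [|z' hz']; [apply/SE; exact/set_mem|apply/hz/mem_set/SE].
Qed.

(** For each point of [s] one half of the current interval is kept, the half that does not contain
    it. Rational ends make the possible gaps countable. *)
Lemma gap_interval (s : seq R) (u v : R) : u < v -> exists c d : rat,
  [/\ u < ratr c, ratr c < ratr d :> R, ratr d < v & forall p, p \in s -> p <= ratr c \/ ratr d <= p].
Proof.
elim: s u v => [|p s ih] u v uv.
  have [c] := rat_in_itvoo uv; rewrite in_itv/= => /andP[c1 c2].
  have [d] := rat_in_itvoo c2; rewrite in_itv/= => /andP[d1 d2].
  by exists c, d.
have [pm|mp] := leP p ((u + v) / 2).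
  have [|c [d [h1 h2 h3 h4]]] := ih ((u + v) / 2) v; first lra.
  exists c, d; split=> // [|q]; first lra.
  by rewrite inE => /orP[/eqP ->|/h4//]; left; lra.
have [|c [d [h1 h2 h3 h4]]] := ih u ((u + v) / 2); first lra.
exists c, d; split=> // [|q]; first lra.
by rewrite inE => /orP[/eqP ->|/h4//]; right; lra.
Qed.
End same_sup.

Section process_null.
Context {R : realType} {d : measure_display} {T : measurableType d}.
Variable P : probability T R.

Lemma path_event_sigma (I : Type) (X : I -> T -> R) (E : set (path_space R I)) :
  measurable E -> process_sigma setT X [set w | E (fun i => X i w)].
Proof.
move=> mE; have := @measurable_path R _ (process_type setT X) I X
  (fun i => @measurable_process_type R _ T I setT X i Logic.I).
by move=> /(_ measurableT _ mE); rewrite setTI.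
Qed.

Lemma process_null (I J : Type) (X : I -> T -> R) (Y : J -> T -> R)
    (E : set (path_space R I * path_space R J)) :
  (forall i, measurable_fun setT (X i)) -> (forall j, measurable_fun setT (Y j)) ->
  indep2 P (process_sigma setT X) (process_sigma setT Y) -> measurable E ->
  (forall w, P [set w' | E (fun i => X i w, fun j => Y j w')] = 0%E) ->
  P [set w | E (fun i => X i w, fun j => Y j w)] = 0%E.
Proof.
move=> mX mY iXY mE h.
pose pX w : path_space R I := fun i => X i w; pose pY w : path_space R J := fun j => Y j w.
have mpX : measurable_fun setT pX by exact: measurable_path.
have mpY : measurable_fun setT pY by exact: measurable_path.
have ind A B : measurable A -> measurable B ->
    (P (pX @^-1` A `&` pY @^-1` B) = P (pX @^-1` A) * P (pY @^-1` B))%E.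
  by move=> mA mB; apply: iXY; exact: path_event_sigma.
have mI : measurable_fun setT (fun z => (\1_E z)%:E : \bar R).
  by apply/measurable_EFinP; exact: measurable_indic.
have := decoupling mpX mpY ind mI (fun z => ltac:(by rewrite lee_fin)).
have indicE' (Q : T -> path_space R I * path_space R J) : measurable_fun setT Q ->
    (\int[P]_w (\1_E (Q w))%:E = P [set w | E (Q w)])%E.
  move=> mQ; have mQE : measurable [set w | E (Q w)].
    by have := mQ measurableT _ mE; rewrite setTI.
  rewrite -[X in P X]setIT -integral_indic//; exact: eq_integral.
rewrite indicE'; last by apply/measurable_fun_pairP; split.
move=> e; apply: (etrans e); rewrite (eq_integral (fun=> 0%E)); first by rewrite integral0.
move=> w _; rewrite (indicE' (fun w' => (pX w, pY w'))); first exact: h.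
by apply/measurable_fun_pairP; split => //; exact: measurable_cst.
Qed.

Lemma process_sigma_sub (I J : Type) (D : set I) (D' : set J) (X : I -> T -> R) (Y : J -> T -> R) :
  (forall i, D i -> measurable_fun setT (X i : process_type D' Y -> R)) ->
  process_sigma D X `<=` process_sigma D' Y.
Proof. by move=> h; exact: (@process_sigma_measurable R _ (process_type D' Y) I D X h). Qed.
End process_null.

(** * Cutting one increment out of a Brownian path *)

Section brownian_gap.
Context {R : realType} {d : measure_display} {T : measurableType d}.
Variables (P : probability T R) (B : R -> T -> R).
Hypothesis BB : two_sided_brownian P B.
Variables a b : R.
Hypothesis ab : a < b.

Definition gap_increment (_ : unit) (w : T) : R := B b w - B a w.

(* The path of [B] with the increment over [[a, b]] cut out. *)
Definition gap_removed (x : R) (w : T) : R :=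
  if x <= a then B x w - B a w else if b <= x then B x w - B b w else 0.

Let mB t : measurable_fun setT (B t). Proof. exact: brownian_measurable BB t. Qed.

Lemma measurable_gap_removed x : measurable_fun setT (gap_removed x).
Proof.
rewrite (_ : gap_removed x = if x <= a then fun w => B x w - B a w
    else if b <= x then fun w => B x w - B b w else fun=> 0); last first.
  by apply/funext => w; rewrite /gap_removed; case: (x <= a) => //; case: (b <= x).
by case: (x <= a); [exact: measurable_funB|case: (b <= x); [exact: measurable_funB|exact: measurable_cst]].
Qed.

Lemma measurable_gap_increment i : measurable_fun setT (gap_increment i).
Proof. exact: measurable_funB. Qed.

(** On a time grid through [a] and [b], the increments inside [[a, b]] add up to the gap increment
    and the others determine the removed path. The two groups of indices are disjoint. *)
Lemma gap_indep : indep2 P (process_sigma setT gap_removed) (process_sigma setT gap_increment).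
Proof.
pose F (x : R) := preimage_sigma (gap_removed x).
have sub : process_sigma setT gap_removed `<=` <<s fin_inter setT F >>.
  apply: g_sigma_mono => A [x _ FA]; apply: sub_sigma_algebra.
  exists [fset x]%fset, (fun y => if y == x then A else setT); split=> //.
    by move=> y; case: eqP => [->//|_]; exact: preimage_sigmaT.
  by rewrite set_fset1 bigcap_set1 eqxx.
suff h : indep2 P <<s fin_inter setT F >> (process_sigma setT gap_increment).
  exact: (indep2_sub sub (fun A hA => hA) h).
apply: (indep2_sigmal (G := fin_inter setT F) (H := process_sigma setT gap_increment)).
- by apply: fin_interI => x; [exact: preimage_sigmaT|exact: preimage_sigmaI].
- move=> _ [J [E [_ FE ->]]]; apply: fin_bigcap_measurable => // x _.
  by apply: preimage_sigma_measurable (FE x); exact: measurable_gap_removed.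
- by apply: process_sigma_measurable => i _; exact: measurable_gap_increment.
move=> _ C [J [E [_ FE ->]]] hC.
have [t ht tJ] := time_grid (a :: b :: enum_fset J).
have [ka tka] : exists k, t k = a by apply: tJ; rewrite inE eqxx.
have [kb tkb] : exists k, t k = b by apply: tJ; rewrite !inE eqxx orbT.
have lt_t i j : t i < t j -> (i < j)%N by move=> tij; rewrite ltnNge; apply/negP => /ht; rewrite leNgt tij.
have kab : (ka < kb)%N by apply: lt_t; rewrite tka tkb.
pose D (i : nat) (w : T) : R := B (t i.+1) w - B (t i) w.
pose K1 : set nat := [set i | (ka <= i < kb)%N]; pose K2 : set nat := ~` K1.
have ind : indep2 P (process_sigma K2 D) (process_sigma K1 D).
  apply: (mutual_indep_group (F := fun i => preimage_sigma (D i))) => //.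
  - by move=> i; exact: preimage_sigmaT.
  - by move=> i; exact: preimage_sigmaI.
  - by move=> i; apply: preimage_sigma_measurable; exact: measurable_funB.
  - by move=> J0 E0; exact: (brownian_indep_increments BB ht).
  - by rewrite setICl.
have tele (K : set nat) i j : (i <= j)%N -> (forall k, (i <= k < j)%N -> K k) ->
    measurable_fun setT ((fun w => B (t j) w - B (t i) w) : process_type K D -> R).
  move=> ij hK; rewrite (_ : (fun w => _) = fun w => \sum_(i <= k < j) (if `[< K k >] then D k w else 0)).
    apply: (measurable_sum (T := process_type K D)) => k.
    by case: asboolP => Kk; [exact: measurable_process_type|exact: measurable_cst].
  apply/funext => w; rewrite -(telescope_sumr (fun k => B (t k) w) ij) !big_nat.
  by apply: eq_bigr => k /hK Kk; rewrite asboolT.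
apply: ind.
  suff h : measurable (\bigcap_(x in [set` J]) E x : set (process_type K2 D)) by exact: h.
  apply: fin_bigcap_measurable => // x /= xJ; have [A mA <-] := FE x.
  suff : measurable_fun setT (gap_removed x : process_type K2 D -> R) by move=> /(_ measurableT _ mA).
  have [kx tkx] : exists k, t k = x by apply: tJ; rewrite !inE; apply/orP; right; apply/orP; right.
  have [xa|ax] := leP x a.
    rewrite (_ : gap_removed x = fun w => 0 - (B (t ka) w - B (t kx) w)); last first.
      by apply/funext => w; rewrite /gap_removed xa tka tkx sub0r opprB.
    have [xa'|xa'] := ltP x a; last first.
      rewrite (_ : (fun w => _) = fun=> 0); first exact: measurable_cst.
      by apply/funext => w; rewrite tka tkx (_ : x = a) ?subrr ?subr0//; lra.
    apply: (measurable_funB (T := process_type K2 D)); first exact: measurable_cst.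
    apply: tele; first by apply/ltnW/lt_t; rewrite tkx tka.
    by move=> k /andP[_ k1] /andP[k2 _]; move: k1; rewrite ltnNge k2.
  rewrite (_ : gap_removed x = if b <= x then fun w => B x w - B b w else fun=> 0); last first.
    by apply/funext => w; rewrite /gap_removed leNgt ax; case: ifP.
  case: ifP => bx; last exact: measurable_cst.
  have [xb|xb] := ltP b x; last first.
    rewrite (_ : (fun w => _) = fun=> 0); first exact: measurable_cst.
    by apply/funext => w; rewrite (_ : x = b) ?subrr//; lra.
  rewrite -tkx -tkb; apply: tele; first by apply/ltnW/lt_t; rewrite tkx tkb.
  by move=> k /andP[k1 _] /andP[_ k2]; move: k2; rewrite ltnNge k1.
move: C hC; apply: process_sigma_sub => i _; rewrite /gap_increment -tkb -tka.
by apply: tele => //; exact: ltnW.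
Qed.

Lemma gap_increment_atomless (r : R) : P [set w | gap_increment tt w = r] = 0%E.
Proof.
rewrite (_ : [set w | _] = (fun w => B b w - B a w) @^-1` [set r])//.
rewrite (brownian_gaussian BB ab)//.
have /null_content_dominatesP h := @normal_prob_dominates R 0 (Num.sqrt (b - a)).
by apply: h => //; exact: lebesgue_measure_set1.
Qed.

(** For a frozen removed path at most one value of the gap increment is possible, and its law has no
    atoms. *)
Lemma gap_fiber_null (E : set (path_space R R * path_space R unit)) : measurable E ->
  (forall w r r', E (fun x => gap_removed x w, fun=> r) -> E (fun x => gap_removed x w, fun=> r') -> r = r') ->
  P [set w | E (fun x => gap_removed x w, fun i => gap_increment i w)] = 0%E.
Proof.
move=> mE hE; apply: (process_null measurable_gap_removed measurable_gap_increment gap_indep mE) => w.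
pose S := [set w' | E (fun x => gap_removed x w, fun i => gap_increment i w')].
have mS : measurable S.
  have mQ : measurable_fun setT (fun w' => ((fun x => gap_removed x w) : path_space R R,
      (fun i => gap_increment i w') : path_space R unit)).
    apply/measurable_fun_pairP; split; first exact: measurable_cst.
    by apply: measurable_path => i; exact: measurable_gap_increment.
  by have := mQ measurableT _ mE; rewrite setTI.
have [[w0 Sw0]|S0] := pselect (S !=set0); last first.
  by rewrite (_ : [set w' | _] = set0) ?measure0//; apply/seteqP; split => // w' h; apply: S0; exists w'.
apply/eqP; rewrite eq_le measure_ge0 andbT -(gap_increment_atomless (gap_increment tt w0)).
apply: le_measure; rewrite ?inE//.
  rewrite (_ : [set w' | _] = gap_increment tt @^-1` [set gap_increment tt w0])//.
  by rewrite -[X in measurable X]setTI; exact: measurable_gap_increment.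
have uE w' : (fun i => gap_increment i w') = (fun=> gap_increment tt w') by apply/funext; case.
by move=> w' Sw'; rewrite /S /= uE in Sw0 Sw' *; apply: hE Sw' Sw0.
Qed.
End brownian_gap.

Section brownian_ties.
Context {R : realType}.
Variables (d : measure_display) (T : measurableType d) (P : probability T R).
Variable B : R -> T -> R.
Hypothesis BB : two_sided_brownian P B.

Definition anchor (a b l : R) (s : bool) : R := if s then b else a - l.

(* The box [[a - l, a]] or [[b, b + l]] on each axis, according to the two booleans. *)
Definition gap_box (a b l : R) (s : bool * bool) : R * R * R :=
  (anchor a b l s.1, anchor a b l s.2, l).

(** The coefficient of the gap increment in [B z.1 - B z.2] for [z] in the box [gap_box a b l s]. *)
Definition gap_weight (s : bool * bool) : R := s.1%:R - s.2%:R.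

Let mB t : measurable_fun setT (B t). Proof. exact: brownian_measurable BB t. Qed.

Lemma gap_box_increment a b l s z w : a < b -> in_box (gap_box a b l s) z ->
  B z.1 w - B z.2 w = gap_removed B a b z.1 w - gap_removed B a b z.2 w +
    gap_weight s * gap_increment B a b tt w.
Proof.
move=> ab; case: s => s1 s2; rewrite /in_box /gap_box /anchor /gap_weight /gap_increment /gap_removed /=.
have h (s : bool) (x : R) : (if s then b else a - l) <= x <= (if s then b else a - l) + l ->
    (x <= a) = ~~ s /\ (b <= x) = s.
  case: s => /andP[h1 h2]; split => //=.
  - by apply/negbTE; rewrite -ltNge; exact: lt_le_trans ab h1.
  - by apply/idP; lra.
  - by apply/negbTE; rewrite -ltNge; lra.
case=> /h[-> ->] /h[-> ->]; case: s1 s2 => -[] /=; ring.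
Qed.

(** A change of the gap increment shifts the two suprema by different multiples of the change, so
    they agree for at most one value. [U] writes the function through the removed path and the
    increment, as [gap_fiber_null] asks. *)
Lemma brownian_tie_fixed (g : R * R -> R) a b l s s' : continuous g -> a < b -> 0 < l ->
  gap_weight s != gap_weight s' ->
  P [set w | same_sup
    (fun c => let z := box_point (gap_box a b l s) c in B z.1 w - B z.2 w + g z)
    (fun c => let z := box_point (gap_box a b l s') c in B z.1 w - B z.2 w + g z)] = 0%E.
Proof.
move=> cg ab l0 ss'.
pose U s0 c (p : path_space R R * path_space R unit) : R :=
  let z := box_point (gap_box a b l s0) c in p.1 z.1 - p.1 z.2 + gap_weight s0 * p.2 tt + g z.
have mU s0 c : measurable_fun setT (U s0 c).
  have m1 x : measurable_fun setT (fun p : path_space R R * path_space R unit => p.1 x).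
    exact: (measurableT_comp (measurable_coord x) measurable_fst).
  have m2 : measurable_fun setT (fun p : path_space R R * path_space R unit => p.2 tt).
    exact: (measurableT_comp (measurable_coord tt) measurable_snd).
  by apply: measurable_funD => //; apply: measurable_funD; [exact: measurable_funB|exact: measurable_funM].
have UE s0 c w r : U s0 c (fun x => gap_removed B a b x w, fun=> r) =
    let z := box_point (gap_box a b l s0) c in
    B z.1 w - B z.2 w + g z + gap_weight s0 * (r - gap_increment B a b tt w).
  have hb : in_box (gap_box a b l s0) (box_point (gap_box a b l s0) c) by apply: box_point_in; exact: ltW.
  by rewrite /= (gap_box_increment w ab hb) /U /=; ring.
have := @gap_fiber_null _ _ _ P B BB a b ab [set p | same_sup (U s ^~ p) (U s' ^~ p)]
  (measurable_same_sup (mU s) (mU s')).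
rewrite (_ : [set w | _] = [set w | same_sup
    (fun c => let z := box_point (gap_box a b l s) c in B z.1 w - B z.2 w + g z)
    (fun c => let z := box_point (gap_box a b l s') c in B z.1 w - B z.2 w + g z)]); last first.
  apply/seteqP; split => w /=.
    rewrite (_ : (fun i => gap_increment B a b i w) = fun=> gap_increment B a b tt w); last by apply/funext; case.
    by under eq_fun do rewrite UE /= subrr mulr0 addr0; under [X in same_sup _ X]eq_fun do rewrite UE /= subrr mulr0 addr0.
  rewrite (_ : (fun i => gap_increment B a b i w) = fun=> gap_increment B a b tt w); last by apply/funext; case.
  by under [X in _ -> same_sup X _]eq_fun do rewrite UE /= subrr mulr0 addr0; under [X in _ -> same_sup _ X]eq_fun do rewrite UE /= subrr mulr0 addr0.
apply=> w r r' /= h h'.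
pose f (z : R * R) : R := B z.1 w - B z.2 w + g z.
have cB : continuous (fun t => B t w) by apply: (brownian_continuous BB).
have cf : continuous f.
  move=> z; apply: cvgD; last exact: cg.
  apply: cvgB; [apply: (cvg_comp fst (fun t => B t w)); [exact: cvg_fst|exact: cB]|].
  by apply: (cvg_comp snd (fun t => B t w)); [exact: cvg_snd|exact: cB].
have [z zA hz] := @box_max R f (gap_box a b l s) l0 cf.
have [z' zA' hz'] := @box_max R f (gap_box a b l s') l0 cf.
pose x := gap_increment B a b tt w.
have le s1 s2 z1 z2 r0 : in_box (gap_box a b l s1) z1 -> (forall t, in_box (gap_box a b l s2) t -> f t <= f z2) ->
    same_sup (U s1 ^~ (fun x => gap_removed B a b x w, fun=> r0)) (U s2 ^~ (fun x => gap_removed B a b x w, fun=> r0)) ->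
    f z1 + gap_weight s1 * (r0 - x) <= f z2 + gap_weight s2 * (r0 - x).
  move=> h1 h2 hs; rewrite -lerBrDr; apply: (@box_dense R f (gap_box a b l s1) _ z1 l0 cf _ h1) => c; rewrite lerBrDr.
  have hb : forall c, U s2 c (fun x => gap_removed B a b x w, fun=> r0) <= f z2 + gap_weight s2 * (r0 - x).
    by move=> c'; rewrite UE /= lerD2r; apply: (h2 (box_point (gap_box a b l s2) c')); apply: box_point_in; exact: ltW.
  by have := same_sup_le hs hb c; rewrite UE.
have e1 := le _ _ _ _ r zA hz' h; have e2 := le _ _ _ _ r zA' hz (same_supC h).
have e3 := le _ _ _ _ r' zA hz' h'; have e4 := le _ _ _ _ r' zA' hz (same_supC h').
have : (gap_weight s - gap_weight s') * (r - r') = 0.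
  have e5 : f z + gap_weight s * (r - x) = f z' + gap_weight s' * (r - x) by apply/eqP; rewrite eq_le e1 e2.
  have e6 : f z + gap_weight s * (r' - x) = f z' + gap_weight s' * (r' - x) by apply/eqP; rewrite eq_le e3 e4.
  lra.
by move/eqP; rewrite mulf_eq0 !subr_eq0 (negbTE ss') /= => /eqP.
Qed.

Lemma brownian_tie_null (G : R * R -> T -> R) a b l s s' :
  (forall z, measurable_fun setT (G z)) -> (forall w, continuous (G ^~ w)) ->
  indep2 P (process_sigma setT B) (process_sigma setT G) ->
  a < b -> 0 < l -> gap_weight s != gap_weight s' ->
  P [set w | same_sup
    (fun c => let z := box_point (gap_box a b l s) c in B z.1 w - B z.2 w + G z w)
    (fun c => let z := box_point (gap_box a b l s') c in B z.1 w - B z.2 w + G z w)] = 0%E.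
Proof.
move=> mG cG ind ab l0 ss'.
pose U s0 c (p : path_space R (R * R) * path_space R R) : R :=
  let z := box_point (gap_box a b l s0) c in p.2 z.1 - p.2 z.2 + p.1 z.
have mU s0 c : measurable_fun setT (U s0 c).
  have m1 x : measurable_fun setT (fun p : path_space R (R * R) * path_space R R => p.1 x).
    exact: (measurableT_comp (measurable_coord x) measurable_fst).
  have m2 x : measurable_fun setT (fun p : path_space R (R * R) * path_space R R => p.2 x).
    exact: (measurableT_comp (measurable_coord x) measurable_snd).
  by apply: measurable_funD => //; exact: measurable_funB.
apply: (process_null (E := [set p | same_sup (U s ^~ p) (U s' ^~ p)]) mG mB (indep2C ind)
  (measurable_same_sup (mU s) (mU s'))) => w.
exact: (brownian_tie_fixed (cG w)).
Qed.

(* On [[e, e + l]] the path has a constant sign, so that its square, hence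
   [2 sqrt (B^2 + h)], depends strictly monotonically on an earlier increment. *)
Lemma signed_tie_fixed (g h : R -> R) (sg : bool) a m e l : continuous g -> continuous h ->
  (forall x, 0 <= h x) -> 0 <= a -> a < e -> 0 < m -> 0 < l ->
  P [set w | (forall c, 0 <= (-1) ^+ sg * B (segment_point e l c) w) /\
    same_sup
    (fun c => let x := segment_point (a - m) m c in g x - 2 * Num.sqrt (B x w ^+ 2 + h x))
    (fun c => let x := segment_point e l c in g x - 2 * Num.sqrt (B x w ^+ 2 + h x))] = 0%E.
Proof.
move=> cg ch h0 a0 ae m0 l0.
pose path := (path_space R R * path_space R unit)%type.
(* The path is rebuilt from its two parts. The removed path vanishes at [a], so its value at 0 is
   subtracted to restore [B 0 = 0]; beyond the gap the increment is added as well. *)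
pose V1 x (p : path) : R := p.1 x - p.1 0.
pose V2 x (p : path) : R := p.1 x - p.1 0 + p.2 tt.
have m1 x : measurable_fun setT (fun p : path => p.1 x).
  exact: (measurableT_comp (measurable_coord x) measurable_fst).
have m2 : measurable_fun setT (fun p : path => p.2 tt).
  exact: (measurableT_comp (measurable_coord tt) measurable_snd).
have mV1 x : measurable_fun setT (V1 x) by exact: measurable_funB.
have mV2 x : measurable_fun setT (V2 x) by apply: measurable_funD => //; exact: measurable_funB.
pose val x (v : R) : R := g x - 2 * Num.sqrt (v ^+ 2 + h x).
have mval x (V : path -> R) : measurable_fun setT V -> measurable_fun setT (fun p => val x (V p)).
  move=> mV; apply: measurable_funB => //; apply: measurable_funM => //.
  have mq : measurable_fun setT (@Num.sqrt R) by apply: continuous_measurable_fun; exact: sqrt_continuous.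
  by apply: (measurableT_comp mq); apply: measurable_funD => //; exact: measurable_funX.
pose x1 c := segment_point (a - m) m c; pose x2 c := segment_point e l c.
pose E := [set p : path | forall c, 0 <= (-1) ^+ sg * V2 (x2 c) p] `&`
  [set p | same_sup (fun c => val (x1 c) (V1 (x1 c) p)) (fun c => val (x2 c) (V2 (x2 c) p))].
have mE : measurable E.
  apply: measurableI; last by apply: measurable_same_sup => c; exact: mval.
  rewrite (_ : [set p | _] = \bigcap_c ~` [set p : path | (-1) ^+ sg * V2 (x2 c) p < 0]).
    apply: bigcapT_measurable => c; apply: measurableC; apply: measurable_lt_event => //.
    exact: measurable_funM.
  by apply/seteqP; split => p /= hp c; [move=> _ /=; apply/negP; rewrite -leNgt|rewrite leNgt; apply/negP; exact: hp].
have x1a c : x1 c <= a by have := segment_point_itv (a - m) c (ltW m0); rewrite subrK => /andP[].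
have x2I c : e <= x2 c <= e + l by exact: (segment_point_itv e c (ltW l0)).
have V1E w r x : x <= a -> V1 x (fun x => gap_removed B a e x w, fun=> r) = B x w.
  by move=> xa; rewrite /V1 /gap_removed /= xa a0 (brownian_zero BB); ring.
have V2E w r x : e <= x -> V2 x (fun x => gap_removed B a e x w, fun=> r) =
    B x w + (r - gap_increment B a e tt w).
  move=> ex; rewrite /V2 /gap_removed /gap_increment /= a0 (brownian_zero BB) ex.
  by rewrite leNgt (lt_le_trans ae ex) /=; ring.
have := @gap_fiber_null _ _ _ P B BB a e ae E mE.
have tE w : (fun i => gap_increment B a e i w) = fun=> gap_increment B a e tt w by apply/funext; case.
have e1 w r : (fun c => val (x1 c) (V1 (x1 c) (fun x => gap_removed B a e x w, fun=> r))) =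
    (fun c => val (x1 c) (B (x1 c) w)) by apply/funext => c; rewrite V1E.
have e2 w r : (fun c => val (x2 c) (V2 (x2 c) (fun x => gap_removed B a e x w, fun=> r))) =
    (fun c => val (x2 c) (B (x2 c) w + (r - gap_increment B a e tt w))).
  by apply/funext => c; rewrite V2E//; have /andP[] := x2I c.
have e3 w r : (forall c, 0 <= (-1) ^+ sg * V2 (x2 c) (fun x => gap_removed B a e x w, fun=> r)) <->
    (forall c, 0 <= (-1) ^+ sg * (B (x2 c) w + (r - gap_increment B a e tt w))).
  by split=> hc c; have := hc c; rewrite V2E//; have /andP[] := x2I c.
rewrite (_ : [set w | E _] = [set w | (forall c, 0 <= (-1) ^+ sg * B (x2 c) w) /\
    same_sup (fun c => val (x1 c) (B (x1 c) w)) (fun c => val (x2 c) (B (x2 c) w))]); last first.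
  have z w c : B (x2 c) w + (gap_increment B a e tt w - gap_increment B a e tt w) = B (x2 c) w.
    by rewrite subrr addr0.
  have ez w : (fun c => val (x2 c) (B (x2 c) w + (gap_increment B a e tt w - gap_increment B a e tt w))) =
    fun c => val (x2 c) (B (x2 c) w) by apply/funext => c; rewrite z.
  apply/seteqP; split => w; rewrite /E /= tE e1 e2 ez => -[h1 h2]; split=> //.
    by move=> c; have := (e3 w _).1 h1 c; rewrite z.
  by apply/e3 => c; rewrite z.
apply=> w r r' [/= p1 s1] [/= p2 s2]; rewrite e1 e2 in s1; rewrite e1 e2 in s2.
have cB : continuous (fun t => B t w) by apply: (brownian_continuous BB).
pose x0 := gap_increment B a e tt w.
have cval (k : R) : continuous (fun x => val x (B x w + k)).
  move=> x; apply: cvgB; first exact: cg.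
  apply: cvgM; first exact: cvg_cst.
  have cv : (B x w + k) ^+ 2 + h x @[x --> x] --> (B x w + k) ^+ 2 + h x.
    apply: cvgD; last exact: ch.
    apply: (cvg_comp (fun x => B x w + k) (fun y => y ^+ 2)); last exact: exprn_continuous.
    by apply: cvgD; [exact: cB|exact: cvg_cst].
  exact: (cvg_comp _ (@Num.sqrt R) cv (@sqrt_continuous R _)).
have sign k : (forall c, 0 <= (-1) ^+ sg * (B (x2 c) w + k)) ->
    forall x, e <= x <= e + l -> 0 <= (-1) ^+ sg * (B x w + k).
  move=> hk x xI; rewrite -oppr_le0.
  have ck : continuous (fun x => - ((-1) ^+ sg * (B x w + k))).
    move=> y; apply: cvgN; apply: cvgM; first exact: cvg_cst.
    by apply: cvgD; [exact: cB|exact: cvg_cst].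
  by apply: (segment_dense l0 ck _ xI) => c; rewrite oppr_le0; exact: hk.
have q1 := sign _ ((e3 w r).1 p1); have q2 := sign _ ((e3 w r').1 p2).
(* When the square grows strictly all along the right segment, the maximum there drops strictly,
   while the one on the left is unaffected. *)
have no k k' : (forall x, e <= x <= e + l -> (B x w + k) ^+ 2 < (B x w + k') ^+ 2) ->
    same_sup (fun c => val (x1 c) (B (x1 c) w)) (fun c => val (x2 c) (B (x2 c) w + k)) ->
    same_sup (fun c => val (x1 c) (B (x1 c) w)) (fun c => val (x2 c) (B (x2 c) w + k')) -> False.
  move=> lt12 ss1 ss2.
  have [y yI ymax] := segment_max (a - m) m0 (cval 0).
  have [x xI xmax] := segment_max e l0 (cval k').
  have h1 : val x (B x w + k) <= val y (B y w + 0).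
    apply: (segment_dense l0 (cval k) _ xI) => c.
    apply: (same_sup_le (same_supC ss1)) => c'; rewrite -[B (x1 c') w]addr0; apply: ymax.
    exact: segment_point_itv (ltW m0).
  have h2 : val y (B y w + 0) <= val x (B x w + k').
    apply: (segment_dense m0 (cval 0) _ yI) => c; rewrite addr0.
    by apply: (same_sup_le ss2) => c'; apply: xmax; exact: x2I.
  have : val x (B x w + k') < val x (B x w + k).
    rewrite /val ltrD2l ltrN2 ltr_pM2l// ltr_sqrt; first by rewrite ltrD2r lt12.
    by apply: ltr_pwDl => //; apply: le_lt_trans (lt12 x xI); exact: sqr_ge0.
  lra.
have sq k k' : k < k' -> (forall x, e <= x <= e + l -> 0 <= (-1) ^+ sg * (B x w + k)) ->
    (forall x, e <= x <= e + l -> 0 <= (-1) ^+ sg * (B x w + k')) ->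
    same_sup (fun c => val (x1 c) (B (x1 c) w)) (fun c => val (x2 c) (B (x2 c) w + k)) ->
    same_sup (fun c => val (x1 c) (B (x1 c) w)) (fun c => val (x2 c) (B (x2 c) w + k')) -> False.
  move=> kk' n1 n2 ss1 ss2; case: sg n1 n2 {p1 p2 e3 sign q1 q2 mE E} => n1 n2.
    apply: (no k' k) => // x xI; have := n1 x xI; have := n2 x xI; rewrite expr1 !mulN1r !expr2; nra.
  by apply: (no k k') => // x xI; have := n1 x xI; have := n2 x xI; rewrite expr0 !mul1r !expr2; nra.
apply/eqP; rewrite eq_le; apply/andP; split; rewrite leNgt; apply/negP => rr.
  by apply: (sq (r' - x0) (r - x0)) => //; rewrite ltrD2r.
by apply: (sq (r - x0) (r' - x0)) => //; rewrite ltrD2r.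
Qed.
End brownian_ties.

Section bessel_ties.
Context {R : realType}.

Lemma negligible_countable d (T : measurableType d) (P : probability T R) (I : countType) (F : I -> set T) :
  (forall i, P.-negligible (F i)) -> P.-negligible (\bigcup_i F i).
Proof.
move=> hF; rewrite (_ : \bigcup_i F i = \bigcup_n (if @choice.unpickle I n is Some i then F i else set0)).
  by apply: negligible_bigcup => n; case: choice.unpickle => // ; exact: negligible_set0.
apply/seteqP; split => w; first by case=> i _ h; exists (choice.pickle i) => //; rewrite choice.pickleK.
by case=> n _; case: choice.unpickle => // i h; exists i.
Qed.

Variables (d : measure_display) (T : measurableType d) (P : probability T R).

Lemma null_negligible (A : set T) : measurable A -> P A = 0%E -> P.-negligible A.
Proof. by move=> mA A0; exists A; split. Qed.

(** At stage [n] the interval [[e, f]] is covered by a multiple of [4 ^ n] intervals of length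
    [e / 4 ^ n]. Scaled, they become unit cells at distance at least [4 ^ n], in each of which [Z]
    comes below 1 with probability of order [8 ^- n]; the union has order [2 ^- n]. *)
Lemma bessel_positive (Z : R -> T -> R) (e f : R) : two_sided_bessel3 P Z -> 0 < e -> e < f ->
  P.-negligible [set w | exists2 x, e <= x <= f & Z x w = 0].
Proof.
move=> ZZ e0 ef; pose F := (Num.truncn (f / e)).+1.
have f0 : 0 < f by exact: lt_trans ef.
have fF : f / e < F%:R by have /andP[] := truncn_itv (ltW (divr_gt0 f0 e0)).
pose K n : R := 4 ^+ n; have K0 n : 0 < K n by rewrite exprn_gt0.
have KE n : K n = (4 ^ n)%:R by rewrite natrX.
pose al n := e / K n; have al0 n : 0 < al n by rewrite divr_gt0.
pose Zn n t w := (Num.sqrt (al n))^-1 * Z (al n * t) w.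
have ZZn n : two_sided_bessel3 P (Zn n) by exact: bessel_scale.
pose N n := \bigcup_(i in [set i | (i < 4 ^ n * F)%N]) near_event (Zn n) (4 ^ n + i)%:R 1.
have mN n : measurable (N n).
  by apply: bigcup_measurable => i _; exact: near_event_measurable (ZZn n) _ _.
have bc0 : 0 <= bessel_constant :> R.
  have oc : 0 <= oscillation_constant :> R by have := @oscillation_constant_ge1 R; lra.
  by rewrite exprn_ge0// /low_cell_constant !mulr_ge0 ?expR_ge0.
have PN n : (P (N n) <= ((8 * F%:R * bessel_constant) * 2^-1 ^+ n)%:E)%E.
  apply: le_trans (probability_union_ord (b := bessel_constant * ((1 + 1) / 2 ^+ n) ^+ 3) _ _ _) _ => [i|i|].
  - exact: near_event_measurable (ZZn n) _ _.
  - have i0 : (0 : R) < (4 ^ n + i)%:R by rewrite ltr0n addn_gt0 expn_gt0.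
    have [+ _] := near_event_bound (ZZn n) i0 ler01; move/le_trans; apply.
    have p2 : (0 : R) < 2 ^+ n by rewrite exprn_gt0.
    have s2 : 2 ^+ n <= Num.sqrt (4 ^ n + i)%:R :> R.
      rewrite -[X in X <= _]gtr0_norm// -sqrtr_sqr ler_sqrt// -exprM mulnC exprM natrD natrX.
      by rewrite (_ : (2 : R) ^+ 2 = 4) ?lerDl//; ring.
    rewrite lee_fin ler_wpM2l// lerXn2r ?nnegrE ?divr_ge0 ?(ltW p2)//.
    by rewrite ler_wpM2l// lef_pV2 ?posrE// (lt_le_trans p2).
  rewrite lee_fin natrM natrX (_ : (4 : R) ^+ n = 2 ^+ n * 2 ^+ n); last first.
    by rewrite -exprMn; congr (_ ^+ _); ring.
  rewrite exprVn le_eqVlt; apply/orP; left; apply/eqP.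
  by field; rewrite gt_eqF// exprn_gt0.
have null : P (\bigcap_n N n) = 0%E.
  apply: (probability_le0 (b := 8 * F%:R * bessel_constant) (q := 2^-1)).
  - by rewrite invr_ge0.
  - by rewrite invf_lt1// ltr1n.
  move=> n; apply: le_trans (PN n); apply: le_measure; rewrite ?inE//; first exact: bigcapT_measurable.
  by move=> w; exact.
exists (\bigcap_n N n); split=> //; first exact: bigcapT_measurable.
move=> w [x /andP[x1 x2] Zx] n _; apply: contrapT => nN.
pose y := x / al n; have yE : y = x / e * K n by rewrite /y /al; field; rewrite !gt_eqF.
have y1 : K n <= y by rewrite yE ler_peMl ?(ltW (K0 n))// ler_pdivlMr// mul1r.
have y2 : y < K n * F%:R.
  rewrite yE mulrC ltr_pM2l//; apply: le_lt_trans fF.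
  by rewrite ler_pM2r// invr_gt0.
have /andP[t1 t2] := truncn_itv (le_trans (ltW (K0 n)) y1); set i := Num.truncn y in t1 t2.
have Ki : (4 ^ n <= i)%N by rewrite -ltnS -(ltr_nat R) -KE; exact: le_lt_trans t2.
have iF : (i < 4 ^ n * F)%N by rewrite -(ltr_nat R) natrM -KE; exact: le_lt_trans y2.
have nn : ~ near_event (Zn n) (4 ^ n + (i - 4 ^ n))%:R 1 w.
  by move=> h; apply: nN; exists (i - 4 ^ n)%N => //=; rewrite (leq_ltn_trans (leq_subr _ _)).
rewrite subnKC// in nn.
have cy : cell i%:R y by rewrite /cell t1 natr1 ltW.
have := near_event_path (ZZn n) cy nn.
rewrite /Zn /y (_ : al n * (x / al n) = x); last by field; rewrite gt_eqF.
by rewrite Zx mulr0 ler10.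
Qed.

(** The other two coordinates enter through the sum [h] of their squares, which is independent of
    [W i] and can be frozen. *)
Lemma signed_bessel_tie_null (W : 'I_3 -> R -> T -> R) (i : 'I_3) (g : R -> R) (sg : bool) a m e l :
  two_sided_brownian_family P W -> continuous g -> 0 <= a -> a < e -> 0 < m -> 0 < l ->
  P [set w | (forall c, 0 <= (-1) ^+ sg * W i (segment_point e l c) w) /\
    same_sup
    (fun c => let x := segment_point (a - m) m c in g x - 2 * Num.sqrt (\sum_(j < 3) W j x w ^+ 2))
    (fun c => let x := segment_point e l c in g x - 2 * Num.sqrt (\sum_(j < 3) W j x w ^+ 2))] = 0%E.
Proof.
move=> WW cg a0 ae m0 l0; have [bW _] := WW.
pose h x w : R := \sum_(j < 3 | j != i) W j x w ^+ 2.
have mW x : measurable_fun setT (W i x) by exact: brownian_measurable (bW i) x.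
have mh x : measurable_fun setT (h x).
  rewrite (_ : h x = fun w => \sum_(j < 3) (if j != i then W j x w ^+ 2 else 0)); last first.
    by apply/funext => w; rewrite /h big_mkcond.
  apply: measurable_sum => j; case: (j != i); last exact: measurable_cst.
  by apply: measurable_funX; exact: brownian_measurable (bW j) x.
have ind : indep2 P (process_sigma setT h) (process_sigma setT (W i)).
  have K12 : [set j | j != i] `&` [set i] = set0.
    by apply/seteqP; split => // j [/= /negP ji jE]; apply: ji; apply/eqP.
  apply: (indep2_sub _ _ (brownian_family_indep WW K12)).
    apply: process_sigma_sub => x _.
    pose S := process_type [set p : 'I_3 * R | [set j | j != i] p.1] (fun p => W p.1 p.2).
    rewrite (_ : h x = fun w => \sum_(j < 3) (if j != i then W j x w ^+ 2 else 0)); last first.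
      by apply/funext => w; rewrite /h big_mkcond.
    apply: (@measurable_sum _ S) => j; have [ji|_] := boolP (j != i); last exact: measurable_cst.
    apply: (@measurable_funX _ S).
    exact: (@measurable_process_type _ _ _ _ [set p : 'I_3 * R | [set j | j != i] p.1] (fun p => W p.1 p.2) (j, x)).
  apply: process_sigma_sub => x _.
  exact: (@measurable_process_type _ _ _ _ [set p : 'I_3 * R | [set i] p.1] (fun p => W p.1 p.2) (i, x)).
have ZE x w : \sum_(j < 3) W j x w ^+ 2 = W i x w ^+ 2 + h x w by rewrite (bigD1 i).
pose path := (path_space R R * path_space R R)%type.
pose val x (p : path) : R := g x - 2 * Num.sqrt (p.2 x ^+ 2 + p.1 x).
have m1 x : measurable_fun setT (fun p : path => p.1 x).
  exact: (measurableT_comp (measurable_coord x) measurable_fst).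
have m2 x : measurable_fun setT (fun p : path => p.2 x).
  exact: (measurableT_comp (measurable_coord x) measurable_snd).
have mval x : measurable_fun setT (val x).
  apply: measurable_funB => //; apply: measurable_funM => //.
  have mq : measurable_fun setT (@Num.sqrt R) by apply: continuous_measurable_fun; exact: sqrt_continuous.
  by apply: (measurableT_comp mq); apply: measurable_funD => //; exact: measurable_funX.
pose x1 c := segment_point (a - m) m c; pose x2 c := segment_point e l c.
pose E := [set p : path | forall c, 0 <= (-1) ^+ sg * p.2 (x2 c)] `&`
  [set p | same_sup (fun c => val (x1 c) p) (fun c => val (x2 c) p)].
have mE : measurable E.
  apply: measurableI; last by apply: measurable_same_sup.
  rewrite (_ : [set p | _] = \bigcap_c ~` [set p : path | (-1) ^+ sg * p.2 (x2 c) < 0]).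
    apply: bigcapT_measurable => c; apply: measurableC; apply: measurable_lt_event => //.
    exact: measurable_funM.
  by apply/seteqP; split => p /= hp c; [move=> _ /=; apply/negP; rewrite -leNgt|rewrite leNgt; apply/negP; exact: hp].
have key := process_null mh mW ind mE.
rewrite (_ : [set w | _] = [set w | E (fun x => h x w, fun x => W i x w)]); last first.
  have e1 (y : nat -> R) w : (fun c => let x := y c in g x - 2 * Num.sqrt (\sum_(j < 3) W j x w ^+ 2)) =
      (fun c => val (y c) (fun x => h x w, fun x => W i x w)) by apply/funext => c; rewrite /val /= -ZE.
  by apply/seteqP; split => w; rewrite /E /= !e1.
apply: key => w.
have cW j : continuous (fun x => W j x w) by apply: (brownian_continuous (bW j)).
apply: (signed_tie_fixed (bW i) sg cg _ _ a0 ae m0 l0) => [x|x]; last first.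
  by apply: sumr_ge0 => j _; exact: sqr_ge0.
have cc j : (if j != i then W j y w ^+ 2 else 0) @[y --> x] --> (if j != i then W j x w ^+ 2 else 0).
  case: (j != i); last exact: cvg_cst.
  exact: (cvg_comp (fun s => W j s w) (fun y : R => y ^+ 2) (@cW j x) (@exprn_continuous _ _ _)).
rewrite (_ : (fun x => h x w) = fun y => \sum_(j < 3) (if j != i then W j y w ^+ 2 else 0)); last first.
  by apply/funext => y; rewrite /h big_mkcond.
suff : \sum_(j < 3) (if j != i then W j y w ^+ 2 else 0) @[y --> x] -->
    \sum_(j < 3) (if j != i then W j x w ^+ 2 else 0) by [].
rewrite !big_ord_recl big_ord0; under eq_fun do rewrite !big_ord_recl big_ord0.
by apply: cvgD; [exact: cc|apply: cvgD; [exact: cc|apply: cvgD; [exact: cc|exact: cvg_cst]]].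
Qed.

(** Almost surely [Z] does not vanish on the right segment, so at a maximizer there some coordinate
    is nonzero and keeps its sign on a rational interval around it. Cutting the segment down to this
    interval keeps the maximum, and the choices of coordinate, sign and interval are countable. *)
Lemma bessel_tie_fixed (Z : R -> T -> R) (g : R -> R) a m e l :
  two_sided_bessel3 P Z -> continuous g -> 0 <= a -> a < e -> 0 < m -> 0 < l ->
  P [set w | same_sup
    (fun c => let x := segment_point (a - m) m c in g x - 2 * Z x w)
    (fun c => let x := segment_point e l c in g x - 2 * Z x w)] = 0%E.
Proof.
move=> ZZ cg a0 ae m0 l0; have [W WW ZE] := ZZ; have [bW _] := WW.
have mZ x : measurable_fun setT (Z x) by exact: bessel_measurable ZZ.
set S := [set w | _].
have mS : measurable S.
  by apply: measurable_same_sup => c; apply: measurable_funB => //; exact: measurable_funM.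
apply: (measure_negligible mS).
have e0 : 0 < e by exact: le_lt_trans ae.
pose lo (q : rat) : R := Num.max e (ratr q); pose hi (q : rat) : R := Num.min (e + l) (ratr q).
pose F (p : 'I_3 * bool * rat * rat) : set T := let: (i, sg, q1, q2) := p in
  if lo q1 < hi q2 then [set w | (forall c, 0 <= (-1) ^+ sg * W i (segment_point (lo q1) (hi q2 - lo q1) c) w) /\
    same_sup
    (fun c => let x := segment_point (a - m) m c in g x - 2 * Num.sqrt (\sum_(j < 3) W j x w ^+ 2))
    (fun c => let x := segment_point (lo q1) (hi q2 - lo q1) c in g x - 2 * Num.sqrt (\sum_(j < 3) W j x w ^+ 2))]
  else set0.
have nF : P.-negligible (\bigcup_p F p).
  apply: negligible_countable => -[[[i sg] q1] q2] /=; case: ifPn => [lh|_]; last exact: negligible_set0.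
  have ael : a < lo q1 by rewrite /lo lt_max ae.
  have lh0 : 0 < hi q2 - lo q1 by rewrite subr_gt0.
  have := signed_bessel_tie_null i sg WW cg a0 ael m0 lh0; set A := [set w | _] => A0.
  apply: null_negligible A0; rewrite /A.
  have mf x : measurable_fun setT (fun w => g x - 2 * Num.sqrt (\sum_(j < 3) W j x w ^+ 2)).
    rewrite (_ : (fun w => _) = fun w => g x - 2 * Z x w); last by apply/funext => w; rewrite ZE.
    by apply: measurable_funB => //; exact: measurable_funM.
  apply: measurableI; last by apply: measurable_same_sup => c; exact: mf.
  rewrite (_ : (fun w : T => _) = \bigcap_c ~` [set w | (-1) ^+ sg * W i (segment_point (lo q1) (hi q2 - lo q1) c) w < 0]).
    apply: bigcapT_measurable => c; apply: measurableC; apply: measurable_lt_event => //.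
    by apply: measurable_funM => //; exact: brownian_measurable (bW i) _.
  by apply/seteqP; split => p /= hp c; [move=> _ /=; apply/negP; rewrite -leNgt|rewrite leNgt; apply/negP; exact: hp].
have el : e < e + l by rewrite ltrDl.
have nP := bessel_positive ZZ e0 el.
apply: (negligibleS _ (negligibleU nF nP)) => w Sw.
pose f x := g x - 2 * Z x w.
have cf : continuous f.
  move=> x; apply: cvgB; first exact: cg.
  by apply: cvgM; [exact: cvg_cst|apply: (bessel_continuous ZZ)].
have [x xI xmax] := segment_max e l0 cf.
have [Zx|Zx] := eqVneq (Z x w) 0; [by right; exists x|left].
have [i Wi] : exists i, W i x w != 0.
  apply: contrapT => /forallNP h; move/eqP: Zx; apply; rewrite ZE big1 ?sqrtr0// => j _.
  by have /negP := h j; rewrite negbK => /eqP ->; rewrite expr0n.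
pose sg := W i x w < 0.
have sW : 0 < (-1) ^+ sg * W i x w.
  rewrite /sg; have [h|h] := ltP (W i x w) 0; rewrite /= ?expr1 ?expr0; first by rewrite mulN1r oppr_gt0.
  by rewrite mul1r lt_neqAle eq_sym Wi.
have [del /= del0 hdel] : exists2 del : R, 0 < del & forall t, `|x - t| < del -> 0 < (-1) ^+ sg * W i t w.
  have cW : (-1) ^+ sg * W i t w @[t --> x] --> (-1) ^+ sg * W i x w.
    by apply: cvgM; [exact: cvg_cst|exact: (brownian_continuous (bW i))].
  have near_x : \forall t \near x, 0 < (-1) ^+ sg * W i t w by exact: (cvgr_gt _ cW _ sW).
  have /nbhs_ballP[del del0 h] := near_x.
  by exists del => // t xt; exact: h.
have xl : x - del < x by rewrite gtrBl.
have lx : x < x + del by rewrite ltrDl.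
have [q1] := rat_in_itvoo xl; rewrite in_itv/= => /andP[q1a q1b].
have [q2] := rat_in_itvoo lx; rewrite in_itv/= => /andP[q2a q2b].
have /andP[x1 x2] := xI.
have lo1 : lo q1 <= x by rewrite /lo ge_max x1 ltW.
have hi1 : x <= hi q2 by rewrite /hi le_min x2 ltW.
have lo2 : ratr q1 <= lo q1 by rewrite /lo le_max lexx orbT.
have hi2 : hi q2 <= ratr q2 by rewrite /hi ge_min lexx orbT.
have lo3 : e <= lo q1 by rewrite /lo le_max lexx.
have hi3 : hi q2 <= e + l by rewrite /hi ge_min lexx.
have lh : lo q1 < hi q2.
  by rewrite /lo /hi gt_max !lt_min el /= (le_lt_trans x1 q2a) (lt_le_trans q1b x2) (lt_trans q1b q2a).
have lh0 : 0 < hi q2 - lo q1 by rewrite subr_gt0.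
exists (i, sg, q1, q2) => //=; rewrite lh.
have segI c : lo q1 <= segment_point (lo q1) (hi q2 - lo q1) c <= hi q2.
  by have := segment_point_itv (lo q1) c (ltW lh0); rewrite subrKC.
have fE (y : nat -> R) : (fun c => let x := y c in g x - 2 * Num.sqrt (\sum_(j < 3) W j x w ^+ 2)) = fun c => f (y c).
  by apply/funext => c; rewrite /f ZE.
split=> [c|].
  have /andP[s1 s2] := segI c; apply/ltW/hdel; rewrite ltr_norml; apply/andP; split; lra.
rewrite !fE; apply: (same_sup_attained (M := f x)).
- by apply: (same_sup_le Sw) => c; apply: xmax; exact: (segment_point_itv e c (ltW l0)).
- by move=> c; apply: xmax; have /andP[s1 s2] := segI c; apply/andP; split; lra.
- by move=> b hb; apply: (segment_dense l0 cf _ xI) => c; exact: (same_sup_le (same_supC Sw) hb).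
- by move=> b hb; apply: (segment_dense lh0 cf hb); rewrite subrKC lo1 hi1.
Qed.

Lemma bessel_tie_null (Z g : R -> T -> R) a m e l :
  two_sided_bessel3 P Z -> (forall x, measurable_fun setT (g x)) -> (forall w, continuous (g ^~ w)) ->
  indep2 P (process_sigma setT g) (process_sigma setT Z) ->
  0 <= a -> a < e -> 0 < m -> 0 < l ->
  P [set w | same_sup
    (fun c => let x := segment_point (a - m) m c in g x w - 2 * Z x w)
    (fun c => let x := segment_point e l c in g x w - 2 * Z x w)] = 0%E.
Proof.
move=> ZZ mg cg ind a0 ae m0 l0.
have mZ x : measurable_fun setT (Z x) by exact: bessel_measurable ZZ.
pose path := (path_space R R * path_space R R)%type.
pose U x (p : path) : R := p.1 x - 2 * p.2 x.
have mU x : measurable_fun setT (U x).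
  apply: measurable_funB; first exact: (measurableT_comp (measurable_coord x) measurable_fst).
  apply: measurable_funM => //; exact: (measurableT_comp (measurable_coord x) measurable_snd).
have mE := measurable_same_sup (fun c => mU (segment_point (a - m) m c)) (fun c => mU (segment_point e l c)).
apply: (process_null mg mZ ind mE) => w.
exact: (bessel_tie_fixed ZZ (cg w) a0 ae m0 l0).
Qed.
End bessel_ties.

(** * Gaps that tell two points of the plane apart *)

Section tie_geometry.
Context {R : realType}.
Implicit Types (z : R * R) (c d x y : R).

Definition gap_side d z : bool * bool := (d <= z.1, d <= z.2).

Definition gap_avoids c d z : Prop := (z.1 <= c \/ d <= z.1) /\ (z.2 <= c \/ d <= z.2).

Lemma gap_avoids_box c d z : c < d -> gap_avoids c d z ->
  exists M : nat, forall m, (M <= m)%N -> in_box (gap_box c d m%:R (gap_side d z)) z.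
Proof.
move=> cd [h1 h2]; pose b := `|c| + `|d| + `|z.1| + `|z.2|.
have b0 : 0 <= b by rewrite !addr_ge0.
exists (Num.truncn b).+1 => m Mm; have bm : b <= m%:R.
  by apply: (le_trans (ltW (truncnS_gt b))); rewrite ler_nat.
have hx (x : R) : `|x| <= `|z.1| + `|z.2| -> (x <= c \/ d <= x) ->
    anchor c d m%:R (d <= x) <= x <= anchor c d m%:R (d <= x) + m%:R.
  move=> xb hx; rewrite /anchor; have [dx|xd] := leP d x.
    have := ler_norm x; have := ler_norm (- d); rewrite normrN /b in bm *; have := normr_ge0 c.
    by move=> *; apply/andP; split; lra.
  have xc : x <= c by case: hx => //; rewrite leNgt xd.
  have := ler_norm c; have := ler_norm (- x); rewrite normrN /b in bm *; have := normr_ge0 d.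
  by move=> *; apply/andP; split; lra.
by split; apply: hx => //; rewrite ?lerDl ?lerDr.
Qed.

Lemma gap_weight_neq (s s' : bool * bool) : (s.1 + s'.2 != s'.1 + s.2)%N ->
  gap_weight s != gap_weight s' :> R.
Proof.
by apply: contraNN => /eqP; case: s s' => [[] []] [[] []]; rewrite /gap_weight //= => ?; exfalso; lra.
Qed.

(* The weight of [(x, y)] as a function of the gap is the indicator of the gaps
   between [x] and [y], with a sign: it determines [(x, y)] unless [x = y]. *)
Lemma tie_gap_lt z z' : z.1 < z'.1 -> ~ (z.1 = z.2 /\ z'.1 = z'.2) ->
  exists c d : rat, [/\ ratr c < ratr d :> R, gap_avoids (ratr c) (ratr d) z, gap_avoids (ratr c) (ratr d) z' &
    gap_weight (gap_side (ratr d) z) != gap_weight (gap_side (ratr d) z') :> R].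
Proof.
case: z z' => [x y] [x' y'] /= xx' nd.
have gap (u v : R) : u < v -> exists c d : rat, [/\ ratr c < ratr d :> R, gap_avoids (ratr c) (ratr d) (x, y),
    gap_avoids (ratr c) (ratr d) (x', y') & (forall p, p <= u -> (ratr d <= p) = false) /\
      (forall p, v <= p -> (ratr d <= p) = true)].
  move=> uv; have [c [d [h1 h2 h3 h4]]] := gap_interval [:: x; y; x'; y'] uv.
  exists c, d; split=> //.
  - by split; apply: h4; rewrite !inE eqxx ?orbT.
  - by split; apply: h4; rewrite !inE eqxx ?orbT.
  - split=> p hp; last by apply/idP; apply: le_trans hp; exact: ltW.
    by apply/negbTE; rewrite -ltNge; apply: le_lt_trans hp (lt_trans h1 h2).
have [c [d [cd a1 a2 [lo hi]]]] := gap _ _ xx'.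
(* A gap between [x] and [x'] gives different weights unless it also separates [y] from [y'] in the
   same direction. In that case a gap between the two coordinates of one off-diagonal point does,
   since the other point lies on one side of it. *)
have [|] := boolP (~~ (ratr d <= y) && (ratr d <= y')); last first.
  move=> h; exists c, d; split=> //; apply: gap_weight_neq; rewrite /gap_side /= (lo x)// (hi x')//.
  by move: h; case: (ratr d <= y); case: (ratr d <= y').
move=> /andP[ny dy'].
have yc : y <= ratr c by case: a1 => _ [//|/=]; rewrite (negbTE ny).
have nxd := lo x (lexx x); have xd : x < ratr d by rewrite ltNge nxd.
have yx' : y < x' by apply: le_lt_trans yc (lt_le_trans cd (hi x' (lexx x'))).
have xy' : x < y' by exact: lt_le_trans dy'.
have [yx|xy|xyE] := ltgtP y x.
- have [c2 [d2 [cd2 b1 b2 [lo2 hi2]]]] := gap _ _ yx; exists c2, d2; split=> //; apply: gap_weight_neq.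
  by rewrite /gap_side /= (lo2 y)// (hi2 x)// (hi2 x') ?(ltW xx')// (hi2 y') ?(ltW xy').
- have [c2 [d2 [cd2 b1 b2 [lo2 hi2]]]] := gap _ _ xy; exists c2, d2; split=> //; apply: gap_weight_neq.
  rewrite /gap_side /= (lo2 x)// (hi2 y)// (hi2 x') ?(ltW yx')//.
  by case: (ratr d2 <= y').
have [y'x'|x'y'|E'] := ltgtP y' x'.
- have [c2 [d2 [cd2 b1 b2 [lo2 hi2]]]] := gap _ _ y'x'; exists c2, d2; split=> //; apply: gap_weight_neq.
  by rewrite /gap_side /= (lo2 y')// (hi2 x')// (lo2 x) ?(ltW xy')// (lo2 y) ?xyE ?(ltW xy').
- have [c2 [d2 [cd2 b1 b2 [lo2 hi2]]]] := gap _ _ x'y'; exists c2, d2; split=> //; apply: gap_weight_neq.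
  by rewrite /gap_side /= (lo2 x')// (hi2 y')// (lo2 x) ?(ltW xx')// (lo2 y) ?(ltW yx').
by exfalso; apply: nd.
Qed.

Lemma tie_gap z z' : z <> z' -> ~ (z.1 = z.2 /\ z'.1 = z'.2) ->
  exists c d : rat, [/\ ratr c < ratr d :> R, gap_avoids (ratr c) (ratr d) z, gap_avoids (ratr c) (ratr d) z' &
    gap_weight (gap_side (ratr d) z) != gap_weight (gap_side (ratr d) z') :> R].
Proof.
move=> zz' nd; have [lt|gt|eq1] := ltgtP z.1 z'.1; first exact: tie_gap_lt.
  have [|c [d [h1 h2 h3 h4]]] := tie_gap_lt gt; first by case=> h h'; apply: nd.
  by exists c, d; split=> //; rewrite eq_sym.
have gap (u v : R) : u < v -> exists c d : rat, [/\ ratr c < ratr d :> R, gap_avoids (ratr c) (ratr d) z,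
    gap_avoids (ratr c) (ratr d) z' & (ratr d <= u) = false /\ (ratr d <= v) = true].
  move=> uv; have [c [d [h1 h2 h3 h4]]] := gap_interval [:: z.1; z.2; z'.1; z'.2] uv.
  exists c, d; split=> //.
  - by split; apply: h4; rewrite !inE eqxx ?orbT.
  - by split; apply: h4; rewrite !inE eqxx ?orbT.
  - by split; [apply/negbTE; rewrite -ltNge (lt_trans h1)|rewrite ltW].
have wE (b b1 b2 : bool) : b1 != b2 -> gap_weight (b, b1) != gap_weight (b, b2) :> R.
  by move=> h; apply: gap_weight_neq; move: h; case: b b1 b2 => [] [] [].
have [lt|gt|eq2] := ltgtP z.2 z'.2.
- have [c [d [h1 h2 h3 [h4 h5]]]] := gap _ _ lt; exists c, d; split=> //.
  by rewrite /gap_side eq1; apply: wE; rewrite h4 h5.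
- have [c [d [h1 h2 h3 [h4 h5]]]] := gap _ _ gt; exists c, d; split=> //.
  by rewrite /gap_side eq1; apply: wE; rewrite h4 h5.
by exfalso; apply: zz'; rewrite [z]surjective_pairing eq1 eq2 -surjective_pairing.
Qed.
End tie_geometry.

(** * Symmetry of the maximizer and conclusion *)

Section joint_laws.
Context {R : realType}.

Definition pair_process (T I J : Type) (X : I -> T -> R) (Y : J -> T -> R) (k : I + J) : T -> R :=
  match k with inl i => X i | inr j => Y j end.

Section one_space.
Context d (T : measurableType d) (P : probability T R).

Lemma measurable_pair_process (I J : Type) (X : I -> T -> R) (Y : J -> T -> R) :
  (forall i, measurable_fun setT (X i)) -> (forall j, measurable_fun setT (Y j)) ->
  forall k, measurable_fun setT (pair_process X Y k).
Proof. by move=> mX mY [i|j]; [exact: mX|exact: mY]. Qed.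

Lemma indep3_group (F G H : set (set T)) :
  F setT -> setI_closed G -> setI_closed H ->
  F `<=` measurable -> G `<=` measurable -> H `<=` measurable -> indep3 P F G H ->
  indep2 P F <<s [set A | exists2 g, G g & exists2 h, H h & A = g `&` h] >>.
Proof.
move=> FT GI HI mF mG mH ind; apply: indep2C.
have FE g h : G g -> H h -> (P (g `&` h) = P g * P h)%E.
  by move=> Gg Hh; have := ind _ _ _ FT Gg Hh; rewrite setTI probability_setT mul1e.
set S := [set A | _].
have h : indep2 P S F.
  by move=> _ B [g Gg [h Hh ->]] FB; rewrite setIC setIA (ind _ _ _ FB Gg Hh) FE// -muleA muleC.
apply: (indep2_sigmal _ _ mF h).
- move=> _ _ [g Gg [k Hk ->]] [g' Gg' [k' Hk' ->]]; exists (g `&` g'); first exact: GI.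
  by exists (k `&` k'); [exact: HI|rewrite setIACA].
- by move=> _ [g Gg [k Hk ->]]; apply: measurableI; [exact: mG|exact: mH].
Qed.

Lemma indep3_pair_process (I J K : Type) (D : set K) (X : I -> T -> R) (Y : J -> T -> R) (L : K -> T -> R) :
  (forall i, measurable_fun setT (X i)) -> (forall j, measurable_fun setT (Y j)) ->
  (forall k, D k -> measurable_fun setT (L k)) ->
  indep3 P (process_sigma setT X) (process_sigma setT Y) (process_sigma D L) ->
  forall (M : Type) (V : M -> T -> R),
  (forall m, measurable_fun setT (V m : process_type D L -> R)) ->
  indep2 P (process_sigma setT X) (process_sigma setT (pair_process Y V)) /\
  indep2 P (process_sigma setT Y) (process_sigma setT V).
Proof.
move=> mX mY mL ind M V mV.
have sV : process_sigma setT V `<=` process_sigma D L by apply: process_sigma_sub => m _; exact: mV.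
have mT (I' : Type) (D' : set I') (X' : I' -> T -> R) : (forall i, D' i -> measurable_fun setT (X' i)) ->
    process_sigma D' X' `<=` measurable by move=> ?; exact: process_sigma_measurable.
split; last first.
  move=> A C hA hC; have := ind _ _ _ (@process_sigmaT _ _ _ _ setT X) hA (sV _ hC).
  by rewrite setTI probability_setT mul1e.
have := indep3_group (@process_sigmaT _ _ _ _ setT X) (@process_sigmaI _ _ _ _ setT Y) (@process_sigmaI _ _ _ _ D L)
  (mT _ _ _ (fun i _ => mX i)) (mT _ _ _ (fun i _ => mY i)) (mT _ _ _ mL) ind.
move=> h; apply: (indep2_sub (fun A hA => hA) _ h).
apply: g_sigma_mono => _ [[j|m] _ [A mA <-]]; apply: sub_sigma_algebra; rewrite setTI /=.
  exists (Y j @^-1` A); first exact: process_sigma_preimage.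
  by exists setT; [exact: process_sigmaT|rewrite setIT].
exists setT; first exact: process_sigmaT.
exists (V m @^-1` A); last by rewrite setTI.
by have := mV m measurableT _ mA; rewrite setTI.
Qed.

End one_space.

Lemma same_law_pair d (T : measurableType d) (P : probability T R)
    d' (T' : measurableType d') (P' : probability T' R) (I J : choiceType)
    (X : I -> T -> R) (Y : J -> T -> R) (X' : I -> T' -> R) (Y' : J -> T' -> R) :
  (forall i, measurable_fun setT (X i)) -> (forall j, measurable_fun setT (Y j)) ->
  (forall i, measurable_fun setT (X' i)) -> (forall j, measurable_fun setT (Y' j)) ->
  indep2 P (process_sigma setT X) (process_sigma setT Y) ->
  indep2 P' (process_sigma setT X') (process_sigma setT Y') ->
  same_law P P' X X' -> same_law P P' Y Y' ->
  same_law P P' (pair_process X Y) (pair_process X' Y').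
Proof.
move=> mX mY mX' mY' ind ind' lX lY.
apply: same_law_fdd => [k|k|D A mA]; [exact: measurable_pair_process|exact: measurable_pair_process|].
pose C1 : set (path_space R I) := \bigcap_(k in [set` D])
  (if k is inl i then (fun f : path_space R I => f i) @^-1` A k else setT).
pose C2 : set (path_space R J) := \bigcap_(k in [set` D])
  (if k is inr j then (fun f : path_space R J => f j) @^-1` A k else setT).
have mC1 : measurable C1.
  apply: fin_bigcap_measurable => // -[i|j] _; last exact: measurableT.
  by rewrite -[X in measurable X]setTI; exact: (measurable_coord i).
have mC2 : measurable C2.
  apply: fin_bigcap_measurable => // -[i|j] _; first exact: measurableT.
  by rewrite -[X in measurable X]setTI; exact: (measurable_coord j).
have CE (S : Type) (U : I -> S -> R) (V : J -> S -> R) :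
    \bigcap_(k in [set` D]) (pair_process U V k @^-1` A k) =
    [set w | C1 (fun i => U i w)] `&` [set w | C2 (fun j => V j w)].
  apply/seteqP; split => w.
    by move=> h; split => -[i|j] kD //=; exact: h kD.
  by move=> [h1 h2] [i|j] kD; [exact: (h1 _ kD)|exact: (h2 _ kD)].
rewrite !CE ind; [|exact: path_event_sigma|exact: path_event_sigma].
rewrite ind'; [|exact: path_event_sigma|exact: path_event_sigma].
by rewrite lX// lY.
Qed.

Lemma bessel_law d (T : measurableType d) (P : probability T R) (Z : R -> T -> R)
    d' (T' : measurableType d') (P' : probability T' R) (Z' : R -> T' -> R) :
  two_sided_bessel3 P Z -> two_sided_bessel3 P' Z' -> same_law P P' Z Z'.
Proof.
move=> [W WW ZE] [W' WW' ZE'].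
pose g (f : path_space R ('I_3 * R)) : path_space R R := fun t => Num.sqrt (\sum_(i < 3) f (i, t) ^+ 2).
have mg : measurable_fun setT g.
  apply: measurable_path => t.
  have ms : measurable_fun setT (fun f : path_space R ('I_3 * R) => \sum_(i < 3) f (i, t) ^+ 2).
    by apply: measurable_sum => i; apply: measurable_funX; exact: (measurable_coord (i, t)).
  have mq : measurable_fun setT (@Num.sqrt R) by apply: continuous_measurable_fun; exact: sqrt_continuous.
  exact: (measurableT_comp mq ms).
have := same_law_comp mg (brownian_family_law WW WW').
have -> : Z = (fun t w => g (fun p => W p.1 p.2 w) t) by apply/funext => t; apply/funext => w; rewrite ZE.
by have -> : Z' = (fun t w => g (fun p => W' p.1 p.2 w) t) by apply/funext => t; apply/funext => w; rewrite ZE'.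
Qed.
End joint_laws.

(** * Far maximizers as an event of the path space *)

Section far_maximizers.
Context {R : realType}.

Definition far_box (t : R) (n M : nat) (sg : bool) : R * R * R :=
  let b := t + n.+1%:R^-1 in
  (if sg then - b - M.+1%:R *+ 2 else b, - M.+1%:R, M.+1%:R *+ 2).

Definition central_box (K : nat) : R * R * R := (- K.+1%:R, - K.+1%:R, K.+1%:R *+ 2).

Lemma central_box_in (z : R * R) (K : nat) : `|z.1| <= K.+1%:R -> `|z.2| <= K.+1%:R ->
  in_box (central_box K) z.
Proof. by rewrite !ler_norml /in_box /central_box /= => /andP[? ?] /andP[? ?]; split; apply/andP; split; lra. Qed.

(** Up to every tolerance [j.+1%:R^-1], the values on one far box reach those on every central
    square: a countable description of a maximizer whose first coordinate exceeds [t] in absolute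
    value. The [n.+1%:R^-1] in [far_box] makes the boxes closed. *)
Definition far_reached (t : R) (f : R * R -> R) : Prop := exists n M sg, forall K c j, exists c',
  f (box_point (central_box K) c) < f (box_point (far_box t n M sg) c') + j.+1%:R^-1.

Lemma far_reachedP (t : R) (f : R * R -> R) : 0 <= t -> continuous f ->
  far_reached t f <-> exists2 z, (forall z', f z' <= f z) & t < `|z.1|.
Proof.
move=> t0 cf; have l0 (M : nat) : 0 < M.+1%:R *+ 2 :> R by rewrite pmulrn_rgt0.
have i0 (n : nat) : 0 < n.+1%:R^-1 :> R by rewrite invr_gt0.
split=> [[n [M [sg h]]]|[z hz tz]].
  have [z zA zmax] := @box_max R f (far_box t n M sg) (l0 M) cf.
  exists z => [z'|]; last first.
    have [/andP[z1 z2] _] := zA; move: z1 z2; rewrite /far_box /=; move: (n.+1%:R^-1) (i0 n) => e p.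
    by case: sg {h zA zmax} => /= z1 z2; rewrite ltr_normr; apply/orP; [right|left]; lra.
  pose K := Num.truncn (Num.max `|z'.1| `|z'.2|).
  have hK := ltW (truncnS_gt (Num.max `|z'.1| `|z'.2|)); rewrite ge_max in hK; case/andP: hK => k1 k2.
  apply: (@box_dense R f (central_box K) _ z' (l0 K) cf); last exact: central_box_in.
  move=> c; rewrite leNgt; apply/negP => /ltr_add_invr[j hj].
  have [c' hc'] := h K c j.
  have := zmax _ (@box_point_in R (far_box t n M sg) c' (ltW (l0 M))).
  move: hj hc'; move: (j.+1%:R^-1) => e; lra.
have [n hn] := ltr_add_invr tz.
pose M := Num.truncn (Num.max `|z.1| `|z.2|).
have hM := ltW (truncnS_gt (Num.max `|z.1| `|z.2|)); rewrite ge_max in hM; case/andP: hM => k1 k2.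
exists n, M, (z.1 < 0) => K c j; apply: contrapT => /forallNP h.
have zA : in_box (far_box t n M (z.1 < 0)) z.
  rewrite /in_box /far_box /=; move: k1 k2; rewrite -/M; have := i0 n.
  move: hn; move: (n.+1%:R^-1) => e hn e0; rewrite (ler_norml z.2) => k1 /andP[k2 k3].
  split; last by apply/andP; split; lra.
  move: hn k1; have [z0|z0] := ltP z.1 0.
    by rewrite ltr0_norm// => hn k1; apply/andP; split; lra.
  by rewrite ger0_norm// => hn k1; apply/andP; split; lra.
have : f z <= f z - j.+1%:R^-1.
  apply: (@box_dense R f (far_box t n M (z.1 < 0)) _ z (l0 M) cf _ zA) => c'; rewrite leNgt; apply/negP => h'.
  apply: (h c'); have := hz (box_point (central_box K) c); move: h'; move: (j.+1%:R^-1) => e; lra.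
have := i0 j; move: (j.+1%:R^-1) => e; lra.
Qed.

Lemma measurable_far_reached t : measurable [set f : path_space R (R * R) | far_reached t f].
Proof.
pose E n M sg := \bigcap_K \bigcap_c \bigcap_j \bigcup_c'
  [set f : path_space R (R * R) |
    f (box_point (central_box K) c) < f (box_point (far_box t n M sg) c') + j.+1%:R^-1].
have mE n M sg : measurable (E n M sg).
  apply: bigcapT_measurable => K; apply: bigcapT_measurable => c; apply: bigcapT_measurable => j.
  apply: bigcupT_measurable => c'; apply: measurable_lt_event; first exact: measurable_coord.
  by apply: measurable_funD => //; exact: measurable_coord.
rewrite (_ : [set f | _] = \bigcup_n \bigcup_M (E n M true `|` E n M false)).
  by apply: bigcupT_measurable => n; apply: bigcupT_measurable => M; exact: measurableU.
apply/seteqP; split => f.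
  move=> [n [M [sg h]]]; exists n => //; exists M => //.
  have Ef : E n M sg f by move=> K _ c _ j _; have [c' hc'] := h K c j; exists c'.
  by case: sg {h} Ef => Ef; [left|right].
move=> [n _ [M _ Ef]]; have [sg h] : exists sg, E n M sg f by case: Ef => ?; [exists true|exists false].
exists n, M, sg => K c j.
by have [c' _ hc'] := h K I c I j I; exists c'.
Qed.
End far_maximizers.

Section uniqueness.
Context {R : realType}.
Local Notation point := (R * R * R * R)%type.
Variables (d : measure_display) (T : measurableType d) (P : probability T R).
Variables (B Z : R -> T -> R) (L : T -> point -> R).
Hypothesis BB : two_sided_brownian P B.
Hypothesis ZZ : two_sided_bessel3 P Z.
Hypothesis LL : directed_landscape P L.
Hypothesis ind : indep3 P (process_sigma setT B) (process_sigma setT Z)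
        (process_sigma R4up (fun p w => L w p)).
Local Notation F := (bessel_landscape_sum B Z L).

Let mB t : measurable_fun setT (B t). Proof. exact: brownian_measurable BB t. Qed.
Let mZ t : measurable_fun setT (Z t). Proof. exact: bessel_measurable ZZ. Qed.
Let mL z : measurable_fun setT (fun w => unit_landscape L w z).
Proof. exact: measurable_unit_landscape LL z. Qed.
Let cZ w : continuous (fun t => Z t w). Proof. by move=> t; apply: (bessel_continuous ZZ). Qed.

Let landscape (z : R * R) (w : T) : R := unit_landscape L w z.
Let environment : R + R * R -> T -> R := pair_process Z landscape.

Let measurable_landscape_sigma z :
  measurable_fun setT (landscape z : process_type R4up (fun p w => L w p) -> R).
Proof. by apply: measurable_process_type; exact: R4up_unit. Qed.

Let L_measurable p : R4up p -> measurable_fun setT (fun w => L w p).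
Proof. by move=> hp; apply: (landscape_measurable LL). Qed.

Let m_environment k : measurable_fun setT (environment k).
Proof. exact: measurable_pair_process. Qed.

Let ind_pair : indep2 P (process_sigma setT B) (process_sigma setT environment) /\
  indep2 P (process_sigma setT Z) (process_sigma setT landscape).
Proof. exact: (indep3_pair_process mB mZ L_measurable ind measurable_landscape_sigma). Qed.

Lemma same_sup_maximum (A A' : R * R * R) (f : R * R -> R) z z' : 0 < A.2 -> 0 < A'.2 ->
  continuous f -> (forall t, f t <= f z) -> (forall t, f t <= f z') -> in_box A z -> in_box A' z' ->
  same_sup (fun c => f (box_point A c)) (fun c => f (box_point A' c)).
Proof.
move=> l0 l0' cf hz hz' zA zA'; have e : f z = f z' by apply/eqP; rewrite eq_le hz hz'.
apply: (same_sup_attained (M := f z)) => // b hb; first exact: (box_dense l0 cf hb zA).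
by rewrite e; exact: (box_dense l0' cf hb zA').
Qed.

Let G (z : R * R) (w : T) : R := landscape z w - Z z.1 w - Z z.2 w.

Let FE w z : F w z.1 z.2 = B z.1 w - B z.2 w + G z w.
Proof. by rewrite /bessel_landscape_sum /G /landscape /unit_landscape; ring. Qed.

Let mG z : measurable_fun setT (G z).
Proof.
apply: measurable_funB; last exact: mZ.
by apply: measurable_funB; [exact: mL|exact: mZ].
Qed.

Let cG w : continuous (G ^~ w).
Proof.
move=> z; have h (p : R * R -> R) : continuous p -> Z (p y) w @[y --> z] --> Z (p z) w.
  by move=> cp; apply: (cvg_comp p (fun t => Z t w) (cp z)); exact: cZ.
apply: cvgB; last by apply: (h snd) => y; exact: cvg_snd.
apply: cvgB; last by apply: (h fst) => y; exact: cvg_fst.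
by apply: (unit_landscape_continuous LL).
Qed.

Let tie (p : rat * rat * nat * (bool * bool) * (bool * bool)) : set T :=
  let: (c, e, m, s, s') := p in
  if (ratr c < ratr e :> R) && (gap_weight s != gap_weight s' :> R) then
    [set w | same_sup
    (fun n => let z := box_point (gap_box (ratr c) (ratr e) m.+1%:R s) n in B z.1 w - B z.2 w + G z w)
    (fun n => let z := box_point (gap_box (ratr c) (ratr e) m.+1%:R s') n in B z.1 w - B z.2 w + G z w)]
  else set0.

Let tie_negligible : P.-negligible (\bigcup_p tie p).
Proof.
apply: negligible_countable => -[[[[c e] m] s] s'] /=; case: ifPn => [/andP[ce ss']|_]; last exact: negligible_set0.
apply: null_negligible.
  by apply: measurable_same_sup => n; (apply: measurable_funD; [apply: measurable_funB; exact: mB|exact: mG]).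
apply: brownian_tie_null => //.
apply: (indep2_sub (fun A hA => hA) _ ind_pair.1); apply: process_sigma_sub => z _.
have mk k : measurable_fun setT (environment k : process_type setT environment -> R) by exact: measurable_process_type.
apply: measurable_funB; last exact: (mk (inl z.2)).
by apply: measurable_funB; [exact: (mk (inr z))|exact: (mk (inl z.1))].
Qed.

Let diagonal_tie (Y g : R -> T -> R) (p : rat * rat * nat) : set T :=
  let: (a, e, m) := p in
  if (0 <= ratr a :> R) && (ratr a < ratr e :> R) then
    [set w | same_sup
    (fun c => let x := segment_point (ratr a - m.+1%:R) m.+1%:R c in g x w - 2 * Y x w)
    (fun c => let x := segment_point (ratr e) m.+1%:R c in g x w - 2 * Y x w)]
  else set0.

Let diagonal_tie_negligible (Y g : R -> T -> R) : two_sided_bessel3 P Y ->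
  (forall x, measurable_fun setT (g x)) -> (forall w, continuous (g ^~ w)) ->
  indep2 P (process_sigma setT g) (process_sigma setT Y) -> P.-negligible (\bigcup_p diagonal_tie Y g p).
Proof.
move=> YY mg cg gY; apply: negligible_countable => -[[a e] m] /=.
case: ifPn => [/andP[a0 ae]|_]; last exact: negligible_set0.
apply: null_negligible; last exact: bessel_tie_null.
apply: measurable_same_sup => n; apply: measurable_funB => //; apply: measurable_funM => //.
  exact: bessel_measurable YY.
exact: bessel_measurable YY.
Qed.

Lemma diagonal_maximizers (Y g : R -> T -> R) w u u' : two_sided_bessel3 P Y -> continuous (g ^~ w) ->
  u < u' -> 0 < u' -> (forall x, g x w - 2 * Y x w <= g u w - 2 * Y u w) ->
  (forall x, g x w - 2 * Y x w <= g u' w - 2 * Y u' w) -> (\bigcup_p diagonal_tie Y g p) w.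
Proof.
move=> YY cg uu' u'0 hu hu'; have m0 : Num.max u 0 < u' by rewrite gt_max uu' u'0.
have [a] := rat_in_itvoo m0; rewrite in_itv/= gt_max => /andP[/andP[ua a0] au'].
have [e] := rat_in_itvoo au'; rewrite in_itv/= => /andP[ae eu'].
pose m := Num.truncn (`|u| + `|u'| + `|ratr a : R| + `|ratr e : R|).
have hm := ltW (truncnS_gt (`|u| + `|u'| + `|ratr a : R| + `|ratr e : R|)); rewrite -/m in hm.
exists (a, e, m) => //=; rewrite (ltW a0) ae /=.
have l0 : (0 : R) < m.+1%:R by [].
pose f x := g x w - 2 * Y x w.
have cf : continuous f.
  by move=> x; apply: cvgB; [exact: cg|apply: cvgM; [exact: cvg_cst|apply: (bessel_continuous YY)]].
have n1 := ler_norm (- u); rewrite normrN in n1; have n2 := ler_norm u'.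
have n3 := normr_ge0 (ratr a : R); have n4 := normr_ge0 (ratr e : R).
have n5 := ler_norm (ratr a : R); have n6 := ler_norm (- ratr e : R); rewrite normrN in n6.
have n7 := normr_ge0 u; have n8 := normr_ge0 u'.
apply: (same_sup_attained (M := f u)) => [c|c|b hb|b hb]; first exact: hu.
- exact: hu.
- by apply: (segment_dense l0 cf hb); apply/andP; split; lra.
- apply: le_trans (hu' u) _; apply: (segment_dense l0 cf hb); apply/andP; split; lra.
Qed.

(** Three null sets are removed, each a countable union over rational data: ties across a Brownian
    gap, and diagonal ties for [Z] and for its time reversal. *)
Lemma maximizer_unique : {ae P, forall w, forall x y x' y',
  is_maximizer (F w) x y -> is_maximizer (F w) x' y' -> x = x' /\ y = y'}.
Proof.
pose g x w := landscape (x, x) w.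
have mg x : measurable_fun setT (g x) by exact: mL.
have cd w : continuous (g ^~ w).
  move=> x; apply: (cvg_comp (fun x : R => (x, x)) (unit_landscape L w)); last exact: unit_landscape_continuous LL w _.
  exact: (cvg_pair cvg_id cvg_id).
have indg : indep2 P (process_sigma setT g) (process_sigma setT Z).
  apply: (indep2_sub _ (fun A hA => hA) (indep2C ind_pair.2)); apply: process_sigma_sub => x _.
  exact: measurable_process_type.
pose Z' t := Z (- t); pose g' x := g (- x).
have ZZ' : two_sided_bessel3 P Z' by exact: bessel_reflect.
have cg' w : continuous (g' ^~ w).
  move=> x; have c1 : - y @[y --> x] --> - x by apply: cvgN; exact: cvg_id.
  exact: (cvg_comp (fun y : R => - y) (fun y => g y w) c1 (@cd w (- x))).
have indg' : indep2 P (process_sigma setT g') (process_sigma setT Z').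
  apply: (indep2_sub _ _ indg); apply: process_sigma_sub => x _; exact: measurable_process_type.
have N1 := diagonal_tie_negligible ZZ mg cd indg.
have N2 := diagonal_tie_negligible ZZ' (fun x => mg (- x)) cg' indg'.
have := negligibleU tie_negligible (negligibleU N1 N2); apply: negligibleS => w /= nU.
apply: contrapT => /not_orP[nt /not_orP[nd nd']]; apply: nU => x y x' y' h h'.
have cF : continuous (fun z : R * R => F w z.1 z.2) by exact: sum_continuous BB ZZ LL w.
have diag u u' : is_maximizer (F w) u u -> is_maximizer (F w) u' u' -> u < u' -> False.
  have FgE v : F w v v = g v w - 2 * Z v w.
    by rewrite /bessel_landscape_sum /g /landscape /unit_landscape /=; ring.
  (* Either the right point is positive, or both are nonpositive and the reflection [- u' < - u] has
     a positive right point. *)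
  move=> hu hu' uu'; have [u'0|u'0] := ltP 0 u'.
    by apply: nd; apply: (diagonal_maximizers ZZ (cd w) uu' u'0) => v; rewrite -!FgE; [exact: hu|exact: hu'].
  apply: nd'; apply: (diagonal_maximizers (u := - u') (u' := - u) ZZ' (cg' w)) => [||v|v].
  - by rewrite ltrN2.
  - by rewrite oppr_gt0; exact: lt_le_trans u'0.
  - by rewrite /Z' /g' opprK -!FgE; exact: hu'.
  - by rewrite /Z' /g' opprK -!FgE; exact: hu.
have [[<- <-]//|ne] := pselect ((x, y) = (x', y')).
have [[/= xy xy']|nd2] := pselect ((x, y).1 = (x, y).2 /\ (x', y').1 = (x', y').2).
  exfalso; rewrite -xy -xy' in h h'; have [lt|gt|eq] := ltgtP x x'.
  - exact: (diag x x').
  - exact: (diag x' x).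
  - by apply: ne; rewrite -xy -xy' eq.
exfalso; apply: nt; have [c [e [ce a1 a2 wn]]] := tie_gap ne nd2.
have [M hM] := gap_avoids_box ce a1; have [M' hM'] := gap_avoids_box ce a2.
pose m := maxn M M'.
exists (c, e, m, gap_side (ratr e) (x, y), gap_side (ratr e) (x', y')) => //=; rewrite ce wn /=.
have l0 : (0 : R) < m.+1%:R by [].
have := @same_sup_maximum (gap_box (ratr c) (ratr e) m.+1%:R (gap_side (ratr e) (x, y)))
  (gap_box (ratr c) (ratr e) m.+1%:R (gap_side (ratr e) (x', y'))) _ (x, y) (x', y') l0 l0 cF
  (fun t => h t.1 t.2) (fun t => h' t.1 t.2).
have EE s : (fun n => F w (box_point (gap_box (ratr c) (ratr e) m.+1%:R s) n).1
     (box_point (gap_box (ratr c) (ratr e) m.+1%:R s) n).2) = (fun n =>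
     let z := box_point (gap_box (ratr c) (ratr e) m.+1%:R s) n in B z.1 w - B z.2 w + G z w).
  by apply/funext => n; rewrite FE.
by rewrite !EE; apply; [apply: hM|apply: hM']; rewrite /m leqW// ?leq_maxl ?leq_maxr.
Qed.

(** Each of [- B (- t)], [Z (- t)] and the landscape at [(- y, - x)] has the law of the original; by
    independence the three may be replaced simultaneously. *)
Lemma sum_symmetric_law : same_law P P (fun (z : R * R) w => F w z.1 z.2)
  (fun (z : R * R) w => F w (- z.2) (- z.1)).
Proof.
pose B' (t : R) (w : T) : R := B 0 w - B (0 - t) w.
have BB' : two_sided_brownian P B' by exact: two_sided_brownian_reflect.
pose Z' (t : R) := Z (- t).
have ZZ' : two_sided_bessel3 P Z' by exact: bessel_reflect.
pose landscape' (z : R * R) := landscape (antitranspose z).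
pose environment' : R + R * R -> T -> R := pair_process Z' landscape'.
have mB' t : measurable_fun setT (B' t) by exact: measurable_funB.
have mE' k : measurable_fun setT (environment' k).
  by apply: measurable_pair_process => // t; [exact: mZ|exact: mL].
have mk k : measurable_fun setT (environment k : process_type setT environment -> R) by exact: measurable_process_type.
have lE : same_law P P environment environment'.
  apply: same_law_pair => //; [by move=> t; exact: mZ|by move=> z; exact: mL|exact: ind_pair.2| | |].
  - apply: (indep2_sub _ _ ind_pair.2); apply: process_sigma_sub => t _; exact: measurable_process_type.
  - exact: bessel_law ZZ ZZ'.
  - exact: unit_landscape_symmetry LL.
have lU : same_law P P (pair_process B environment) (pair_process B' environment').
  apply: same_law_pair => //; [exact: ind_pair.1| |exact: brownian_law BB BB'].
  apply: (indep2_sub _ _ ind_pair.1); apply: process_sigma_sub => t _.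
    apply: (measurable_funB (T := process_type setT B)); exact: measurable_process_type.
  by case: t => t; [exact: (mk (inl (- t)))|exact: (mk (inr (antitranspose t)))].
pose f (u : path_space R (R + (R + R * R))) : path_space R (R * R) := fun z =>
  u (inl z.1) - u (inr (inl z.1)) + u (inr (inr z)) - u (inl z.2) - u (inr (inl z.2)).
have mf : measurable_fun setT f.
  apply: measurable_path => z; have mu k := @measurable_coord R (R + (R + R * R))%type k.
  do 2 (apply: measurable_funB; last exact: mu).
  by apply: measurable_funD; [apply: measurable_funB; exact: mu|exact: mu].
have := same_law_comp mf lU.
have -> : (fun (z : R * R) w => F w (- z.2) (- z.1)) =
    (fun z w => f (fun i => pair_process B' environment' i w) z).
  apply/funext => z; apply/funext => w; rewrite /f /= /B' /Z' /landscape' /landscape /unit_landscape /antitranspose /=.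
  by rewrite /bessel_landscape_sum (brownian_zero BB) !sub0r; ring.
by [].
Qed.

Let probability_ae_eq (A A' N : set T) : measurable A -> measurable A' -> P.-negligible N ->
  (forall w, ~ N w -> A w <-> A' w) -> P A = P A'.
Proof.
have half (C C' : set T) : measurable C -> measurable C' -> P.-negligible N ->
    (forall w, ~ N w -> C w -> C' w) -> (P C <= P C')%E.
  move=> mC mC' [M [mM PM NM]] h; rewrite -[leRHS]adde0 -PM.
  apply: le_trans (measureU2 _ _ _) => //; apply: le_measure; rewrite ?inE//; first exact: measurableU.
  by move=> w Cw; have [Nw|nN] := pselect (N w); [right; exact: NM|left; exact: h].
move=> mA mA' nN h; apply/eqP; rewrite eq_le !half// => w nw; first by move/(h w nw).
by move/(h w nw).
Qed.

(** By uniqueness, [t < |X|] is almost surely the event [far_reached t] of the path [F], and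
    [t < |Y|] is the same event of the reflected path, which has the same law. *)
Lemma maximizer_symmetric (X Y : T -> R) (t : R) : 0 <= t ->
  measurable_fun setT X -> measurable_fun setT Y ->
  {ae P, forall w, is_maximizer (F w) (X w) (Y w)} ->
  P [set w | t < `|X w|] = P [set w | t < `|Y w|].
Proof.
move=> t0 mX mY hXY.
have mF z : measurable_fun setT (fun w => F w z.1 z.2).
  by do 2 (apply: measurable_funB => //); apply: measurable_funD => //; [exact: measurable_funB|exact: (mL z)].
have mlt (V : T -> R) : measurable_fun setT V -> measurable [set w | t < `|V w|].
  by move=> mV; apply: measurable_lt_event => //; exact: measurableT_comp.
have mpath (U : R * R -> T -> R) : (forall z, measurable_fun setT (U z)) ->
    measurable [set w | far_reached t (fun z => U z w)].
  move=> mU; have := measurable_path mU measurableT (measurable_far_reached t).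
  by rewrite setTI.
have cF w : continuous (fun z : R * R => F w z.1 z.2) by exact: sum_continuous BB ZZ LL w.
have cF' w : continuous (fun z : R * R => F w (- z.2) (- z.1)).
  move=> z.
  have c1 : - y.2 @[y --> z] --> - z.2 by apply: cvgN; exact: cvg_snd.
  have c2 : - y.1 @[y --> z] --> - z.1 by apply: cvgN; exact: cvg_fst.
  exact: (cvg_comp _ (fun z => F w z.1 z.2) (cvg_pair c1 c2) (@cF w (- z.2, - z.1))).
have nN := negligibleU hXY maximizer_unique.
transitivity (P [set w | far_reached t (fun z => F w z.1 z.2)]).
  apply: (probability_ae_eq (mlt X mX) _ nN); first exact: mpath.
  move=> w /not_orP[/contrapT h /contrapT u]; split => [tX|/(far_reachedP t0 (cF w))[z hz tz]].
    by apply/(far_reachedP t0 (cF w)); exists (X w, Y w) => // z; exact: h.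
  by have [/= -> _] := u _ _ z.1 z.2 h (fun x y => hz (x, y)).
rewrite (sum_symmetric_law (measurable_far_reached t)); apply/esym.
apply: (probability_ae_eq (mlt Y mY) _ nN); first by apply: mpath => z; exact: (mF (- z.2, - z.1)).
move=> w /not_orP[/contrapT h /contrapT u]; split => [tY|/(far_reachedP t0 (cF' w))[z hz tz]].
  apply/(far_reachedP t0 (cF' w)); exists (- Y w, - X w); last by rewrite normrN.
  by move=> z; rewrite /= !opprK; exact: h.
have hz' : is_maximizer (F w) (- z.2) (- z.1).
  by move=> x y; have := hz (- y, - x); rewrite /= !opprK.
by have [_ e] := u _ _ _ _ h hz'; rewrite /= e normrN.
Qed.
End uniqueness.

(** The landscape at hand serves to find the constants; the bounds that they come from depend on
    laws only, hence hold on every space. [ka] is the smaller of the corner rate and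
    [escape_speed]. *)
Lemma escape_rates_exist (R : realType) d (T : measurableType d) (P : probability T R)
    (L : T -> R * R * R * R -> R) : directed_landscape P L ->
  exists K ka : R, [/\ 1 <= K, 0 < ka &
    forall d' (T' : measurableType d') (P' : probability T' R) (B : R -> T' -> R)
      (L' : T' -> R * R * R * R -> R), two_sided_brownian P' B -> directed_landscape P' L' ->
    (forall k r, (P' (landscape_escape L' k r) <= (K * expR (- (ka * r%:R ^+ 3)))%:E)%E) /\
    (forall k r, (P' (brownian_escape B k r) <= (K * expR (- (ka * r%:R ^+ 3)))%:E)%E)].
Proof.
move=> LL; have [La [K [k [tight K0 k0 rate]]]] := corner_rate_exists LL.
pose C2 := 2 * box_rate La / (1 - expR (- escape_speed)).
pose C3 : R := 2 * step_rate / (1 - expR (- escape_speed)).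
have q0 : 0 <= 1 - expR (- escape_speed) :> R.
  by rewrite subr_ge0 -[leRHS]expR0 ler_expR oppr_le0 ltW// escape_speed_gt0.
have C20 : 0 <= C2 by apply: divr_ge0 => //; apply: mulr_ge0 => //; apply: mulr_ge0 => //; exact: expR_ge0.
have C30 : 0 <= C3.
  apply: divr_ge0 => //; apply: mulr_ge0 => //; apply: addr_ge0 => //.
  by apply: mulr_ge0 => //; have := @oscillation_constant_ge1 R; lra.
pose ka := Num.min k escape_speed.
exists (K + C2 + C3 + 1), ka; split; first lra.
  by rewrite /ka lt_min k0 escape_speed_gt0.
move=> d' T' P' B L' BB LL'.
have e1 (r : nat) : expR (- (k * r%:R ^+ 3)) <= expR (- (ka * r%:R ^+ 3)).
  by rewrite ler_expR lerN2 ler_wpM2r ?exprn_ge0// /ka ge_min lexx.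
have e2 (r : nat) : expR (- (escape_speed * r%:R ^+ 3)) <= expR (- (ka * r%:R ^+ 3)).
  by rewrite ler_expR lerN2 ler_wpM2r ?exprn_ge0// /ka ge_min lexx orbT.
split=> x r; have e0 := expR_ge0 (- (ka * r%:R ^+ 3)).
- apply: le_trans (landscape_escape_bound LL' x r tight K0 rate) _; rewrite lee_fin -/C2.
  have h1 := ler_wpM2l K0 (e1 r); have h2 := ler_wpM2l C20 (e2 r); have h3 := mulr_ge0 C30 e0.
  by rewrite !mulrDl mul1r; lra.
- apply: le_trans (brownian_escape_bound BB x r) _; rewrite lee_fin -/C3.
  have h1 := mulr_ge0 K0 e0; have h2 := mulr_ge0 C20 e0; have h3 := ler_wpM2l C30 (e2 r).
  by rewrite !mulrDl mul1r; lra.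
Qed.

Theorem theorem5p1 (R : realType) :
  exists c a : R, [/\ 0 < c, 1 < a &
    forall (d : measure_display) (T : measurableType d) (P : probability T R)
      (B Z : R -> T -> R) (L : T -> R * R * R * R -> R),
      two_sided_brownian P B -> two_sided_bessel3 P Z ->
      directed_landscape P L ->
      indep3 P (process_sigma setT B) (process_sigma setT Z)
        (process_sigma R4up (fun p w => L w p)) ->
      {ae P, forall w, exists x y : R,
         is_maximizer (bessel_landscape_sum B Z L w) x y} /\
      forall X Y : {RV P >-> R},
        {ae P, forall w,
           is_maximizer (bessel_landscape_sum B Z L w) (X w) (Y w)} ->
        [/\ forall t : R, 2 <= t ->
              P [set w | t < `|X w|] = P [set w | t < `|Y w|] /\
              (P [set w | (t < `|X w|)%R] < (c * (ln t / Num.sqrt t))%:E)%E,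
            ('E_P[fun w => (a `^ (`|Y w - X w| ^+ 3))%R] < +oo)%E &
            ('E_P[fun w => (a `^ (`|L w (X w, 0, Y w, 1)| `^ (3 / 2)))%R] < +oo)%E]].
Proof.
(* The constants have to be given before any space: they are read off from some landscape if there
   is one, and are arbitrary otherwise. *)
have [[d0 [T0 [P0 [L0 LL0]]]]|none] := pselect (exists d (T : measurableType d)
    (P : probability T R) (L : T -> R * R * R * R -> R), directed_landscape P L); last first.
  exists 1, 2; split=> // [|d T P B Z L _ _ LL]; first by rewrite ltr1n.
  by exfalso; apply: none; exists d, T, P, L.
have [K [ka [K1 ka0 rates]]] := escape_rates_exist LL0.
have m0 : 0 < moment_rate ka by rewrite /moment_rate !divr_gt0// mulr_gt0.
have c0 : 0 <= far_constant K ka by apply: mulr_ge0 => //; exact: cell_constant_ge0.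
exists (24 * far_constant K ka + 1), (expR (moment_rate ka)); split.
- lra.
- by rewrite -[ltLHS]expR0 ltr_expR.
move=> d T P B Z L BB ZZ LL ind; have [rL rB] := rates d T P B L BB LL.
split; first exact: (maximizer_exists BB ZZ LL ind K1 ka0 rL rB).
move=> X Y hXY; have mX : measurable_fun setT X by [].
have mY : measurable_fun setT Y by [].
have [E1 E2] := moment_bound BB ZZ LL ind K1 ka0 rL rB hXY.
split=> [t t2||].
- split; first by apply: (maximizer_symmetric BB ZZ LL ind) => //; lra.
  exact: (tail_bound BB ZZ LL ind K1 ka0 rL rB mX t2 hXY).
- rewrite unlock; rewrite (eq_integral (fun w => (expR (moment_rate ka * `|Y w - X w| ^+ 3))%:E))//.
  by move=> w _; rewrite expRM.
- rewrite unlock; rewrite (eq_integral (fun w => (expR (moment_rate ka * `|L w (X w, 0, Y w, 1)| `^ (3 / 2)))%:E))//.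
  by move=> w _; rewrite expRM.
Qed.
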